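(* Under assumption (AS), $$\lim_{t\to T}\frac{K-b(t)}{(T-t)^{1/\alpha}|\ln(T-t)|^{1-\frac1\alpha}}=K\Big(\eta_0\frac{\Gamma(2-\alpha)}{\alpha-1}\Big)^{1/\alpha}.$$
   Context: Fix $T>0$, $K>0$, $r>0$, $\delta\ge0$. Assumption (AS): $X$ is a real Lévy process with Lévy measure $\nu$ such that $\mathbb E(e^{iuX_t})=\exp\big(t\int(e^{iuy}-1-iu(e^y-1))\nu(dy)\big)$ for all $u\in\mathbb R$, $t\ge0$; $\int(e^y-1)_+\nu(dy)<r-\delta$; and for some $a_0<0$, $\mathbf 1_{\{a_0<y<0\}}\nu(dy)=\frac{\eta(y)}{|y|^{1+\alpha}}\mathbf 1_{\{a_0<y<0\}}dy$, where $1<\alpha<2$ and $\eta$ is a positive bounded Borel function on $[a_0,0)$ with $\lim_{y\to0}\eta(y)=\eta_0>0$. Let $(\mathcal F_t)$ be the usual augmentation of the natural filtration of $X$. For $x\ge0$ let $S^x_t=xe^{(r-\delta)t+X_t}$; $P(t,x)=\sup_{\tau\in\mathcal T_{0,T-t}}\mathbb E[e^{-r\tau}(K-S^x_\tau)_+]$ (American put, $\mathcal T_{0,s}$ = stopping times in $[0,s]$), and $b(t)=\inf\{x\ge0:P(t,x)>(K-x)_+\}$, $t\in[0,T)$, its critical price. *)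

(* Defs.v *)
From HB Require Import structures.
From mathcomp Require Import all_boot all_order all_algebra.
From mathcomp Require Import all_classical all_reals all_analysis.
Set Implicit Arguments.
Unset Strict Implicit.
Unset Printing Implicit Defensive.
Import Order.TTheory GRing.Theory Num.Theory.
Import numFieldNormedType.Exports.
Local Open Scope classical_set_scope.
Local Open Scope ring_scope.

Section LevyAmericanPut.
Context {R : realType} {d : measure_display} {Omega : measurableType d}.
Variable P : probability Omega R.

Definition cadlag (f : R -> R) : Prop :=
  forall t, 0 <= t ->
    (f s @[s --> t^'+] --> f t) /\ (0 < t -> cvg (f s @[s --> t^'-])).

Definition levy_process (X : R -> Omega -> R) : Prop :=
  [/\ forall t, measurable_fun setT (X t),
      P [set w | X 0 w != 0] = 0%E,
      exists N, [/\ measurable N, P N = 0%E &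
                   forall w, ~ N w -> cadlag (fun t => X t w)],
      (forall s t (B : set R), 0 <= s -> 0 <= t -> measurable B ->
         P [set w | B (X (t + s) w - X s w)] = P [set w | B (X t w)]) &
      (forall (n : nat) (tt : nat -> R) (B : nat -> set R),
         0 <= tt 0%N -> (forall k, tt k <= tt k.+1) ->
         (forall k, measurable (B k)) ->
         P (\bigcap_(k in `I_n) [set w | B k (X (tt k.+1) w - X (tt k) w)]) =
         (\prod_(k < n) P [set w | B k (X (tt k.+1) w - X (tt k) w)%R])%E)].

Definition levy_measure (nu : {measure set R -> \bar R}) : Prop :=
  nu [set 0] = 0%E /\
  (\int[nu]_y (Num.min 1 (y ^+ 2))%:E < +oo)%E.

(* Real and imaginary parts of the exponent
   psi(u) = int (e^{iuy} - 1 - iu(e^y - 1)) nu(dy). *)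
Definition psi_re (nu : {measure set R -> \bar R}) (u : R) : R :=
  fine (\int[nu]_y (cos (u * y) - 1)%:E).
Definition psi_im (nu : {measure set R -> \bar R}) (u : R) : R :=
  fine (\int[nu]_y (sin (u * y) - u * (expR y - 1))%:E).

(* E(e^{iuX_t}) = exp(t psi(u)), split in real and imaginary parts,
   the integral defining psi(u) being (absolutely) convergent. *)
Definition levy_char (X : R -> Omega -> R) (nu : {measure set R -> \bar R}) :
  Prop :=
  forall u : R,
    nu.-integrable setT (fun y => (cos (u * y) - 1)%:E) /\
    nu.-integrable setT (fun y => (sin (u * y) - u * (expR y - 1))%:E) /\
    forall t : R, 0 <= t ->
      (\int[P]_w (cos (u * X t w))%:E =
        (expR (t * psi_re nu u) * cos (t * psi_im nu u))%:E)%E /\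
      (\int[P]_w (sin (u * X t w))%:E =
        (expR (t * psi_re nu u) * sin (t * psi_im nu u))%:E)%E.

Definition natural_sigma (X : R -> Omega -> R) (s : R) : set (set Omega) :=
  <<s [set A | exists u (B : set R),
          [/\ 0 <= u <= s, measurable B & A = X u @^-1` B]] >>.

(* usual augmentation: F_t = intersection over s > t of
   sigma(natural_sigma s, P-null sets) *)
Definition usual_filtration (X : R -> Omega -> R) (t : R) : set (set Omega) :=
  [set A | forall s, t < s ->
     exists B, natural_sigma X s B /\ P.-negligible ((A `\` B) `|` (B `\` A))].

Definition stopping_time (X : R -> Omega -> R) (tau : Omega -> R) : Prop :=
  forall t, 0 <= t -> usual_filtration X t [set w | tau w <= t].

Definition put_payoff (X : R -> Omega -> R) (r delta K x : R)
  (tau : Omega -> R) (w : Omega) : R :=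
  expR (- r * tau w) *
  Num.max (K - x * expR ((r - delta) * tau w + X (tau w) w)) 0.

Definition american_put (X : R -> Omega -> R) (r delta K T t x : R) : R :=
  sup [set v : R | exists tau : Omega -> R,
        [/\ stopping_time X tau, (forall w, 0 <= tau w <= T - t) &
            v = fine (\int[P]_w (put_payoff X r delta K x tau w)%:E)]].

Definition critical_price (X : R -> Omega -> R) (r delta K T t : R) : R :=
  inf [set x : R | 0 <= x /\
        Num.max (K - x) 0 < american_put X r delta K T t x].

End LevyAmericanPut.

Definition Gamma {R : realType} (s : R) : R :=
  fine (\int[@lebesgue_measure R]_(x in `]0, +oo[%classic)
          (x `^ (s - 1) * expR (- x))%:E).

(* Main.v *)
(* Put h = T - t, V = h^(1/alpha) |ln h|^(1 - 1/alpha) and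
   kappa u = int_{a0 < z < 0} (e^(u z) - 1 - u z) nu(dz), which is equivalent to
   c u^alpha with c = eta0 Gamma(2 - alpha) / (alpha (alpha - 1)), and
   lambda = (alpha c)^(1/alpha).
   Both bounds use supermartingale inequalities for smooth bounded functions of
   the log-price.  Only the characteristic function of X is given, so the
   one-step bound E F(y + X_h) = F y + h L F y + o(h), uniform in y, is first read off
   trigonometric sums and then transferred to F by approximation.

   Upper bound on b.  Suitably truncated, E e^(u X_h) is close to e^(h kappa u)
   for u = U h^(-1/alpha), which gives, for small h,
   P(X_h >= (1 - e) c alpha U^(alpha - 1) h^(1/alpha))
     >= e^(- c U^alpha (alpha (1 + e) - 1)) / 2.  Cutting [0, h] into about |ln h| equal pieces and
   multiplying, P(X_h >= (1 - e)^2 lambda V) >= q h^((1 - e) (1 - 1/alpha)), which is much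
   larger than h / V.  Hence at x = K e^(- (1 - e)^3 lambda V) the European put already
   beats K - x, whose waiting cost is of order h.

   Lower bound on b.  From x <= K e^(- (1 + e) lambda V), a holder who waits until a
   stopping time tau pays a carrying cost proportional to E tau.  She is
   compensated only if the log-price rises above - 2 a, where a = h^(1/alpha), and
   then at a rate O(a^(1 - alpha)).  A supersolution of the form 1 - exp (- A e^(beta y)), with
   beta = |ln h|^(1/alpha) h^(-1/alpha) / lambda, bounds the probability of coming so
   close by E tau times a small multiple of h^(-1/alpha), so the
   expected compensation is a small fraction of the cost. *)
Require Import Defs.
From HB Require Import structures.
From mathcomp Require Import all_boot all_order all_algebra.
From mathcomp Require Import all_classical all_reals all_analysis.
From mathcomp Require Import measurable_realfun ring lra.
Set Implicit Arguments.
Unset Strict Implicit.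
Unset Printing Implicit Defensive.
Import Order.TTheory GRing.Theory Num.Theory.
Import numFieldNormedType.Exports.
Local Open Scope classical_set_scope.
Local Open Scope ring_scope.

(** * Approximation by trigonometric sums *)

(** The constant comes from a Legendre transform. With l = |ln h|, the supremum over u of u lambda V
    - c h u^alpha is reached at u = beta, where beta lambda V = l, and equals (1 - 1/alpha) l. So
    P(X_h >= lambda V) is about h^(1 - 1/alpha), and a gain of order V with this probability
    balances a cost of order h up to logarithms. Upward jumps are controlled only through (e^y -
    1)_+, so exponential moments of order u > 1 may be infinite; exponentials therefore occur only
    through bounded smooth substitutes. Optional stopping is carried out on a time grid, where the
    one-step errors add up over all steps; this is why they must be small compared with the mesh,
    uniformly in the position. A stopping time enters only through the events that a grid time is at
    most tau. These lie in the null-set completion at that very grid time, so the right limit in the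
    filtration does no harm. The carrying cost is positive because, well below the strike, the
    payoff 1 - e^y loses per unit of time at least r - delta minus the integral of (e^z - 1)_+. *)

Definition derives {R : realType} (f f' : R -> R) : Prop :=
  forall y : R, is_derive y (1 : R) f (f' y).

Section Calculus.
Context {R : realType}.
Implicit Types (f g F G : R -> R) (x y : R).

(** No order between [x] and [y] is assumed and [s] ranges over the closed interval, so equal points
    are covered and later uses need no case distinction. *)
Lemma mean_value f f' x y : derives f f' ->
  exists2 s, 0 <= s <= 1 & f y - f x = f' (x + s * (y - x)) * (y - x).
Proof.
move=> df.
have cf : forall a b : R, {within `[a, b], continuous f}.
  move=> a b; apply: continuous_subspaceT => z.
  by apply: differentiable_continuous; apply/derivable1_diffP; case: (df z).
have main a b : a < b ->
    exists2 s, 0 <= s <= 1 & f b - f a = f' (a + s * (b - a)) * (b - a).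
  move=> ab; have [c cin ->] := MVT ab (fun z _ => df z) (cf _ _).
  move: cin; rewrite in_itv/= => /andP[ac cb].
  exists ((c - a) / (b - a)); last by congr (f' _ * _); field; lra.
  by rewrite ler_pdivrMr ?ler_pdivlMr ?subr_gt0//; apply/andP; split; lra.
case: (ltrgtP x y) => xy.
- exact: main.
- have [s s01 e] := main _ _ xy.
  exists (1 - s); first by lra.
  have -> : x + (1 - s) * (y - x) = y + s * (x - y) by ring.
  by lra.
- by exists 0; rewrite ?xy ?subrr ?mulr0// lexx ler01.
Qed.

Lemma lipschitz_of_derive f f' C x y : derives f f' ->
  (forall z, `|f' z| <= C) -> `|f y - f x| <= C * `|y - x|.
Proof.
move=> df bf; have [s _ ->] := mean_value x y df.
by rewrite normrM ler_wpM2r.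
Qed.

(** The mean of [g] at a binomial variable with [n] trials of success probability [t], computed by
    conditioning on one trial. In this form no binomial coefficient occurs and each property is a
    short induction. *)
Fixpoint bernstein (n : nat) (g : nat -> R) (t : R) : R :=
  if n is m.+1 then t * bernstein m (fun k => g k.+1) t +
                    (1 - t) * bernstein m g t
  else g 0%N.

Lemma ler_bernstein n (g g' : nat -> R) t : 0 <= t <= 1 -> (forall k, g k <= g' k) ->
  bernstein n g t <= bernstein n g' t.
Proof.
move=> /andP[t0 t1]; elim: n g g' => [|n IH] g g' gg' //=.
by apply: lerD; apply: ler_wpM2l; rewrite ?subr_ge0// IH.
Qed.

Lemma bernstein_affine n (g : nat -> R) a b t :
  bernstein n (fun k => a * g k + b) t = a * bernstein n g t + b.
Proof. by elim: n g => [|n IH] g //=; rewrite !IH; ring. Qed.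

(** The second moment of a binomial variable about [a]. The centre is left free because a success in
    one trial moves it to [a - 1] in the induction. *)
Lemma bernstein_variance n (a t : R) :
  bernstein n (fun k => (k%:R - a) ^+ 2) t =
  n%:R * t * (1 - t) + (n%:R * t - a) ^+ 2.
Proof.
elim: n a => [|n IH] a /=; first by ring.
have -> : (fun k => (k.+1%:R - a) ^+ 2) = (fun k : nat => (k%:R - (a - 1)) ^+ 2 : R).
  by apply/funext => k; rewrite -natr1; congr (_ ^+ 2); ring.
by rewrite !IH -natr1; ring.
Qed.

Fixpoint bernstein_poly (n : nat) (g : nat -> R) : {poly R} :=
  if n is m.+1 then
    (2^-1 *: (1 + 'X)) * bernstein_poly m (fun k => g k.+1) +
    (2^-1 *: (1 - 'X)) * bernstein_poly m g
  else (g 0%N)%:P.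

Lemma horner_bernstein_poly n (g : nat -> R) x :
  (bernstein_poly n g).[x] = bernstein n g ((1 + x) / 2).
Proof.
elim: n g => [|n IH] g /=; first by rewrite hornerC.
rewrite !(hornerE, IH); by congr (_ * _ + _ * _); field.
Qed.

(** Bernstein's argument with the substitution [t = (1 + x) / 2]. The Lipschitz bound is linear in
    the distance; it is first weakened to a quadratic one by 2 |d| eta <= d^2 + eta^2, so that only
    the binomial variance is needed. *)
Lemma bernstein_approx f (C e : R) : 0 <= C -> 0 < e ->
  (forall x y, `|f x - f y| <= C * `|x - y|) ->
  exists p : {poly R}, forall x, -1 <= x <= 1 -> `|f x - p.[x]| <= e.
Proof.
move=> C0 e0 lf.
(* The variance term and the constant term each contribute at most [C * eta / 2], and this [eta]
   brings their sum below [e / 2]; the summand 1 guards against [C = 0]. *)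
pose eta := e / (C + 1) / 2.
have eta0 : 0 < eta by rewrite /eta; apply: divr_gt0 => //; apply: divr_gt0 => //; lra.
pose n := (Num.trunc (eta^-1 ^+ 2)).+1.
have n0 : 0 < n%:R :> R by rewrite ltr0n.
have nlt : eta^-1 ^+ 2 < n%:R by rewrite truncnS_gt.
pose g k := f (2 * k%:R / n%:R - 1).
exists (bernstein_poly n g) => x /andP[x1 x2].
rewrite horner_bernstein_poly; set t := (1 + x) / 2.
have t01 : 0 <= t <= 1 by rewrite /t; apply/andP; split; lra.
have key k : `|g k - f x| <=
    C * 2 / (n%:R ^+ 2 * eta) * (k%:R - n%:R * t) ^+ 2 + C * eta / 2.
  apply: le_trans (lf _ _) _.
  set dd := 2 * k%:R / n%:R - 1 - x.
  have -> : C * 2 / (n%:R ^+ 2 * eta) * (k%:R - n%:R * t) ^+ 2 + C * eta / 2 =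
     C * (dd ^+ 2 / (2 * eta) + eta / 2).
    by rewrite /dd /t; field; rewrite !gt_eqF.
  have eta2 : 0 < 2 * eta by rewrite mulr_gt0.
  rewrite ler_wpM2l// -(ler_pM2r eta2).
  have -> : (dd ^+ 2 / (2 * eta) + eta / 2) * (2 * eta) = dd ^+ 2 + eta ^+ 2.
    by field; rewrite gt_eqF.
  rewrite -(real_normK (num_real dd)).
  have : 0 <= (`|dd| - eta) ^+ 2 by exact: sqr_ge0.
  by rewrite sqrrB -mulr_natl; lra.
have vb : C * 2 / (n%:R ^+ 2 * eta) *
   bernstein n (fun k => (k%:R - n%:R * t) ^+ 2) t + C * eta / 2 <= e.
  rewrite bernstein_variance subrr expr0n addr0.
  have -> : C * 2 / (n%:R ^+ 2 * eta) * (n%:R * t * (1 - t)) =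
     (C * 2 / eta) * (t * (1 - t)) / n%:R by field; rewrite !gt_eqF.
  have tt : t * (1 - t) <= 4^-1.
    have : 0 <= (t - 2^-1) ^+ 2 by exact: sqr_ge0.
    by rewrite expr2; lra.
  have nn : n%:R^-1 <= eta ^+ 2.
    by rewrite -[leRHS]invrK lef_pV2 ?posrE ?invr_gt0 ?exprn_gt0// -exprVn ltW.
  have t0 : 0 <= t * (1 - t) by rewrite mulr_ge0//; move/andP: t01 => []; lra.
  apply: (@le_trans _ _ (C * 2 / eta * 4^-1 * eta ^+ 2 + C * eta / 2)).
    rewrite lerD2r; apply: ler_pM => //; last first.
    - by apply: ler_wpM2l => //; apply: divr_ge0; [exact: mulr_ge0|exact: ltW].
    - by apply: mulr_ge0 => //; apply: divr_ge0; [exact: mulr_ge0|exact: ltW].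
  have -> : C * 2 / eta * 4^-1 * eta ^+ 2 + C * eta / 2 = C * eta.
    by field; rewrite gt_eqF.
  rewrite /eta; have -> : C * (e / (C + 1) / 2) = (C / (C + 1)) * (e / 2) by field; lra.
  have : C / (C + 1) <= 1 by rewrite ler_pdivrMr; lra.
  move=> h; apply: le_trans (_ : 1 * (e / 2) <= _); last lra.
  by rewrite ler_wpM2r//; lra.
rewrite ler_norml; apply/andP; split.
- have := @ler_bernstein n g (fun k => C * 2 / (n%:R ^+ 2 * eta) * (k%:R - n%:R * t) ^+ 2 + (C * eta / 2 + f x)) t t01.
  rewrite bernstein_affine => h; suff: bernstein n g t <= e + f x by lra.
  apply: le_trans (h _) _; last by lra.
  by move=> k; have := key k; rewrite ler_norml => /andP[_]; lra.
- have := @ler_bernstein n (fun k => - (C * 2 / (n%:R ^+ 2 * eta)) * (k%:R - n%:R * t) ^+ 2 + (f x - C * eta / 2)) g t t01.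
  rewrite bernstein_affine => h; suff: f x - e <= bernstein n g t by lra.
  apply: le_trans (h _); first by lra.
  by move=> k; have := key k; rewrite ler_norml => /andP[+ _]; lra.
Qed.

Lemma poly_primitive (p : {poly R}) (c : R) :
  exists2 q : {poly R}, q^`() = p & q.[0] = c.
Proof.
pose q := \poly_(i < (size p).+1) (if i is j.+1 then p`_j / i%:R else c).
exists q.
- apply/polyP => i; rewrite coef_deriv coef_poly ltnS.
  case: ltnP => si; last by rewrite mul0rn nth_default.
  by rewrite -[LHS]mulr_natr -mulrA mulVf ?mulr1// pnatr_eq0.
- by rewrite horner_coef0 coef_poly.
Qed.

End Calculus.

Section SmoothClass.
Context {R : realType}.

(** One constant bounds everything. The Lipschitz condition on [f2] gives a rate in the polynomial
    approximation and makes the image of [F] under the generator Lipschitz as well. *)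
Definition C2_lip (C : R) (F f1 f2 : R -> R) : Prop :=
  [/\ derives F f1, derives f1 f2,
      forall y, [/\ `|F y| <= C, `|f1 y| <= C & `|f2 y| <= C] &
      forall x y, `|f2 x - f2 y| <= C * `|x - y|].

(** The second derivative is approximated and then integrated back twice with the exact initial
    values at 0. On [-1, 1] an integration from 0 does not increase the error, so the same [e]
    serves at all three orders. The factor [M] prepares for the substitution of a sine. *)
Lemma poly_approx_C2 C (F f1 f2 : R -> R) (M e : R) : 0 < e -> 0 <= M ->
  C2_lip C F f1 f2 ->
  exists p : {poly R}, forall x, -1 <= x <= 1 ->
   [/\ `|F (M * x) - p.[x]| <= e, `|M * f1 (M * x) - (p^`()).[x]| <= e &
       `|M ^+ 2 * f2 (M * x) - (p^`()^`()).[x]| <= e].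
Proof.
move=> e0 M0 [dF d1 bd lip].
have C0 : 0 <= C by case: (bd 0) => /(le_trans (normr_ge0 _)).
have [|x y|p2 hp2] := @bernstein_approx R (fun x => M ^+ 2 * f2 (M * x)) (M ^+ 3 * C) e _ e0.
- by rewrite mulr_ge0// exprn_ge0.
- rewrite -mulrBr normrM (ger0_norm (exprn_ge0 _ M0)).
  have -> : M ^+ 3 * C * `|x - y| = M ^+ 2 * (M * C * `|x - y|) by ring.
  rewrite ler_wpM2l ?exprn_ge0//.
  apply: le_trans (lip _ _) _.
  by rewrite -mulrBr normrM ger0_norm// mulrCA mulrA.
have [p1 dp1 p10] := poly_primitive p2 (M * f1 0).
have [p dp p0] := poly_primitive p1 (F 0).
have dM : derives (fun x => M * x) (fun=> M).
  move=> x.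
  have h := is_deriveZ M (is_derive_id x (1 : R)).
  by apply: is_derive_eq h _; rewrite /GRing.scale/= mulr1.
have step (f f' : R -> R) (q q' : {poly R}) : derives f f' ->
   q^`() = q' -> q.[0] = f 0 ->
   (forall x : R, -1 <= x <= 1 -> `|f' x - q'.[x]| <= e) ->
   (forall x : R, -1 <= x <= 1 -> `|f x - q.[x]| <= e).
  move=> df dq q0 h x /andP[x1 x2].
  have dfq : derives (fun z => f z - q.[z]) (fun z => f' z - q'.[z]).
    move=> z;  rewrite -dq; exact: (is_deriveB (df z) (is_derive_poly q z)).
  have [s s01] := mean_value 0 x dfq.
  rewrite !subr0 q0 subrr subr0 add0r => e1.
  set c := s * x in e1.
  have cx : `|c| <= `|x|.
    by move/andP: s01 => [s0 s1]; rewrite /c normrM ger0_norm// ler_piMl.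
  have x1' : `|x| <= 1 by rewrite ler_norml x1 x2.
  have c1 : -1 <= c <= 1 by rewrite -ler_norml (le_trans cx).
  rewrite e1 normrM -[leRHS]mulr1.
  by apply: ler_pM => //; exact: h.
have d1' : derives (fun x => M * f1 (M * x)) (fun z => M ^+ 2 * f2 (M * z)).
  move=> z.
  have h := @is_derive1_comp R f1 (fun x => M * x) z _ _ (d1 (M * z)) (dM z).
  have := @is_deriveZ R R R (f1 \o (fun x => M * x)) M z 1 _ h.
  by move=> h'; apply: is_derive_eq h' _; rewrite /GRing.scale/= expr2 -mulrA; congr (_ * _); rewrite mulrC.
have d0' : derives (fun x => F (M * x)) (fun z => M * f1 (M * z)).
  move=> z.
  have h := @is_derive1_comp R F (fun x => M * x) z _ _ (dF (M * z)) (dM z).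
  by apply: is_derive_eq h _; rewrite mulrC.
exists p => x x1; have h2 := hp2 x x1.
have p1f : p1.[0] = M * f1 (M * 0) by rewrite p10 mulr0.
have h1 := step _ _ _ _ d1' dp1 p1f hp2.
have h0 := step _ _ _ _ d0' dp (etrans p0 (congr1 F (esym (mulr0 _)))) h1.
by rewrite dp dp1; split; [exact: h0|exact: h1|].
Qed.

End SmoothClass.

Section TrigSums.
Context {R : realType}.

(** A triple is an amplitude, a frequency and a phase. With phases, cosines alone suffice: a
    derivative is a phase shift by [pi / 2], and a translation in [y] only changes phases. *)
Definition trig_sum (s : seq (R * R * R)) (y : R) : R :=
  \sum_(i <- s) i.1.1 * cos (i.1.2 * y + i.2).

Definition trig_deriv (s : seq (R * R * R)) : seq (R * R * R) :=
  [seq (i.1.1 * i.1.2, i.1.2, i.2 + pi / 2) | i <- s].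

Lemma derives_mul_add (u c : R) : derives (fun y => u * y + c) (fun=> u).
Proof.
move=> y; have h := is_deriveZ u (is_derive_id y (1 : R)).
have := is_deriveD h (is_derive_cst c y (1 : R)).
by move=> h'; apply: is_derive_eq h' _; rewrite /GRing.scale/= mulr1 addr0.
Qed.

Lemma cosDpihalf_neg_sin (x : R) : cos (x + pi / 2) = - sin x.
Proof. by rewrite cosD cos_pihalf sin_pihalf mulr0 sub0r mulr1. Qed.

Lemma derives_trig_sum s : derives (trig_sum s) (trig_sum (trig_deriv s)).
Proof.
elim: s => [|[[a u] c] s IH] y.
  have -> : trig_sum [::] = cst 0.
    by apply/funext => z; rewrite /trig_sum big_nil.
  by exact: is_derive_cst.
have -> : trig_sum ((a, u, c) :: s) =
    (a *: (fun y => cos (u * y + c))) + trig_sum s.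
  by apply/funext => z; rewrite /trig_sum big_cons.
have h1 := @is_derive1_comp R cos (fun y => u * y + c) y _ _
  (is_derive_cos _) (derives_mul_add u c y).
have h2 := is_deriveD (is_deriveZ a h1) (IH y).
apply: is_derive_eq h2 _.
rewrite /trig_sum /trig_deriv/= big_cons/= /GRing.scale/=; congr (_ + _).
by rewrite addrA cosDpihalf_neg_sin; ring.
Qed.

Definition is_trig (f : R -> R) : Prop := exists s, f =1 trig_sum s.

Lemma is_trig_cst (a : R) : is_trig (fun=> a).
Proof.
by exists [:: (a, 0, 0)] => y; rewrite /trig_sum big_seq1/= mul0r addr0 cos0 mulr1.
Qed.

Lemma is_trigD f g : is_trig f -> is_trig g -> is_trig (fun y => f y + g y).
Proof.
by move=> [s hs] [t ht]; exists (s ++ t) => y; rewrite /trig_sum big_cat/= hs ht.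
Qed.

Lemma is_trigM_sin f (v : R) : is_trig f -> is_trig (fun y => f y * sin (v * y)).
Proof.
move=> [s hs].
exists ([seq (i.1.1 / 2, i.1.2 + v, i.2 - pi / 2) | i <- s] ++
        [seq (- i.1.1 / 2, i.1.2 - v, i.2 - pi / 2) | i <- s]) => y.
rewrite hs /trig_sum big_cat/= !big_map big_distrl/= -big_split/=.
apply: eq_bigr => [[[a u] c] _] /=.
have -> : (u + v) * y + (c - pi / 2) = (u * y + c + v * y) - pi / 2 by ring.
have -> : (u - v) * y + (c - pi / 2) = (u * y + c - v * y) - pi / 2 by ring.
have cs (x : R) : cos (x - pi / 2) = sin x.
  by rewrite cosB cos_pihalf sin_pihalf mulr0 add0r mulr1.
by rewrite !cs sinD sinB; field.
Qed.

Lemma is_trig_poly_sin (p : {poly R}) (v : R) :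
  is_trig (fun y => p.[sin (v * y)]).
Proof.
elim/poly_ind: p => [|p c IH].
  have [s hs] := is_trig_cst 0; exists s => y; rewrite horner0 -hs//.
have [s hs] := is_trigD (is_trigM_sin v IH) (is_trig_cst c).
by exists s => y; rewrite !hornerE -hs.
Qed.

End TrigSums.

(** * Integrals of real-valued functions *)

Definition summ {R : realType} {d} {T : measurableType d}
  (mu : {measure set T -> \bar R}) (f : T -> R) : Prop :=
  mu.-integrable setT (EFin \o f).

Section RealIntegral.
Context {R : realType} {d : measure_display} {T : measurableType d}.
Variable mu : {measure set T -> \bar R}.
Implicit Types f g : T -> R.

Lemma summ_le f g : measurable_fun setT f -> (forall x, `|f x| <= g x) ->
  summ mu g -> summ mu f.
Proof.
move=> mf fg ig; apply: le_integrable ig => //; first exact/measurable_EFinP.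
by move=> x _ /=; rewrite lee_fin (le_trans (fg x))// ler_norm.
Qed.

Lemma summD f g : summ mu f -> summ mu g -> summ mu (fun x => f x + g x).
Proof. by move=> hf hg; exact: (integrableD measurableT hf hg). Qed.

Lemma summB f g : summ mu f -> summ mu g -> summ mu (fun x => f x - g x).
Proof. by move=> hf hg; exact: (integrableB measurableT hf hg). Qed.

Lemma summZ k f : summ mu f -> summ mu (fun x => k * f x).
Proof. by move=> hf; exact: (@integrableZl _ _ _ mu setT measurableT k _ hf). Qed.

Lemma summ0 : summ mu (fun=> 0).
Proof. exact: (@integrable0 _ _ _ mu). Qed.

Lemma summ_norm f : summ mu f -> summ mu (fun x => `|f x|).
Proof. by move=> h; exact: (@integrable_norm _ _ _ mu setT). Qed.

Lemma RintD f g : summ mu f -> summ mu g ->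
  \int[mu]_x (f x + g x) = \int[mu]_x f x + \int[mu]_x g x.
Proof. exact: (@RintegralD _ _ _ mu). Qed.

Lemma RintB f g : summ mu f -> summ mu g ->
  \int[mu]_x (f x - g x) = \int[mu]_x f x - \int[mu]_x g x.
Proof. exact: (@RintegralB _ _ _ mu). Qed.

Lemma RintZ k f : summ mu f -> \int[mu]_x (k * f x) = k * \int[mu]_x f x.
Proof. exact: (@RintegralZl _ _ _ mu). Qed.

Lemma Rint_le f g : summ mu f -> summ mu g -> (forall x, f x <= g x) ->
  \int[mu]_x f x <= \int[mu]_x g x.
Proof. by move=> hf hg fg; apply: le_Rintegral => //. Qed.

Lemma Rint_abs_le f g : measurable_fun setT f -> (forall x, `|f x| <= g x) ->
  summ mu g -> `|\int[mu]_x f x| <= \int[mu]_x g x.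
Proof.
move=> mf fg ig; have hf := summ_le mf fg ig.
apply: le_trans (le_normr_Rintegral _ hf) _ => //.
by apply: Rint_le => //; exact: summ_norm.
Qed.

Lemma eq_Rint f g : f =1 g -> \int[mu]_x f x = \int[mu]_x g x.
Proof. by move=> fg; apply: eq_Rintegral => x _. Qed.

Lemma EFin_Rint f : summ mu f -> (\int[mu]_x f x)%:E = (\int[mu]_x (f x)%:E)%E.
Proof. by move=> hf; rewrite fineK//; exact: integrable_fin_num. Qed.

Lemma summ_sum (I : Type) (s : seq I) (F : I -> T -> R) :
  (forall i, summ mu (F i)) -> summ mu (fun x => \sum_(i <- s) F i x).
Proof.
move=> h; elim: s => [|i s IH].
  by under [X in summ _ X]funext do rewrite big_nil; exact: summ0.
by under [X in summ _ X]funext do rewrite big_cons; exact: summD.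
Qed.

Lemma Rint_sum (I : Type) (s : seq I) (F : I -> T -> R) :
  (forall i, summ mu (F i)) ->
  \int[mu]_x (\sum_(i <- s) F i x) = \sum_(i <- s) \int[mu]_x F i x.
Proof.
move=> h; elim: s => [|i s IH].
  rewrite big_nil; under eq_Rint do rewrite big_nil.
  by rewrite /Rintegral integral0.
rewrite big_cons -IH -RintD//; last exact: summ_sum.
by apply: eq_Rint => x; rewrite big_cons.
Qed.

Lemma Rint_dominated_ae (f : nat -> T -> R) (f0 g : T -> R) :
  (forall n, measurable_fun setT (f n)) -> measurable_fun setT f0 ->
  {ae mu, forall x, (fun n => f n x) @ \oo --> f0 x} ->
  (forall n x, `|f n x| <= g x) -> summ mu g ->
  (fun n => \int[mu]_x f n x) @ \oo --> \int[mu]_x f0 x.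
Proof.
move=> mf mf0 cf fg ig.
have [|||||i0 _ c0] := @dominated_convergence _ T R mu setT measurableT
  (fun n => EFin \o f n) (EFin \o f0) (EFin \o g).
- by move=> n; exact/measurable_EFinP.
- exact/measurable_EFinP.
- apply: filterS cf => x cf _; apply: cvg_EFin; [exact: nearW|exact: cf].
- exact: ig.
- by apply: aeW => x n _ /=; rewrite lee_fin.
apply: fine_cvg; rewrite fineK; first exact: c0.
exact: integrable_fin_num.
Qed.

Lemma Rint_dominated (f : nat -> T -> R) (f0 g : T -> R) :
  (forall n, measurable_fun setT (f n)) -> measurable_fun setT f0 ->
  (forall x, (fun n => f n x) @ \oo --> f0 x) ->
  (forall n x, `|f n x| <= g x) -> summ mu g ->
  (fun n => \int[mu]_x f n x) @ \oo --> \int[mu]_x f0 x.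
Proof. by move=> mf mf0 cf; apply: Rint_dominated_ae => //; exact: aeW. Qed.

End RealIntegral.

Section Prob.
Context {R : realType} {d : measure_display} {T : measurableType d}.
Variable P : probability T R.
Implicit Types f g : T -> R.

Lemma summ_bounded f C : measurable_fun setT f -> (forall x, `|f x| <= C) ->
  summ P f.
Proof.
move=> mf bf; apply: summ_le (_ : summ P (fun=> C)) => //.
exact: finite_measure_integrable_cst.
Qed.

Lemma Rint_cst C : \int[P]_x C = C.
Proof. by rewrite Rintegral_cst//; have /= -> := @probability_setT _ _ _ P; rewrite mulr1. Qed.

Lemma Rint_bounded f C : measurable_fun setT f -> (forall x, `|f x| <= C) ->
  `|\int[P]_x f x| <= C.
Proof.
move=> mf bf; rewrite -[leRHS](Rint_cst C); apply: Rint_abs_le => //.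
exact: finite_measure_integrable_cst.
Qed.

End Prob.

(** * Bounded functions with bounded derivatives *)

Section SmoothBounded.
Context {R : realType}.
Implicit Types F G f g : R -> R.

Definition C2_bd (C : R) F f1 f2 : Prop :=
  [/\ derives F f1, derives f1 f2 &
      forall y, [/\ `|F y| <= C, `|f1 y| <= C & `|f2 y| <= C]].

Lemma C2_lip_bd C F f1 f2 : C2_lip C F f1 f2 -> C2_bd C F f1 f2.
Proof. by case. Qed.

Lemma C2_bd_ge0 C F f1 f2 : C2_bd C F f1 f2 -> 0 <= C.
Proof. by case=> _ _ /(_ 0) [+ _ _]; apply: le_trans; exact: normr_ge0. Qed.

Lemma derives_continuous F f1 : derives F f1 -> continuous F.
Proof.
move=> dF z.
by apply: differentiable_continuous; apply/derivable1_diffP; case: (dF z).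
Qed.

Lemma derives_measurable F f1 : derives F f1 -> measurable_fun setT F.
Proof. by move=> dF; apply: continuous_measurable_fun; exact: derives_continuous dF. Qed.

Lemma derives_uniq F f1 g1 : derives F f1 -> derives F g1 -> f1 =1 g1.
Proof. by move=> h1 h2 y; have <- := @derive_val _ _ _ _ _ _ _ (h1 y); have <- := @derive_val _ _ _ _ _ _ _ (h2 y). Qed.

Lemma derivesB F f1 G g1 : derives F f1 -> derives G g1 ->
  derives (fun y => F y - G y) (fun y => f1 y - g1 y).
Proof. by move=> h1 h2 y; exact: is_deriveB. Qed.

Lemma derivesD F f1 G g1 : derives F f1 -> derives G g1 ->
  derives (fun y => F y + G y) (fun y => f1 y + g1 y).
Proof. by move=> h1 h2 y; exact: is_deriveD. Qed.

Lemma derivesZ k F f1 : derives F f1 -> derives (fun y => k * F y) (fun y => k * f1 y).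
Proof. by move=> h1 y; exact: (is_deriveZ k (h1 y)). Qed.

Lemma derivesM F f1 G g1 : derives F f1 -> derives G g1 ->
  derives (fun y => F y * G y) (fun y => F y * g1 y + f1 y * G y).
Proof.
move=> h1 h2 y; apply: is_derive_eq (is_deriveM (h1 y) (h2 y)) _.
by rewrite /GRing.scale/= [G y * _]mulrC.
Qed.

Lemma derives_comp F f1 G g1 : derives F f1 -> derives G g1 ->
  derives (fun y => F (G y)) (fun y => f1 (G y) * g1 y).
Proof. by move=> h1 h2 y; exact: (@is_derive1_comp R F G y _ _ (h1 _) (h2 _)). Qed.

Lemma derives_eq F f1 g1 : derives F f1 -> f1 =1 g1 -> derives F g1.
Proof. by move=> h e y; apply: is_derive_eq (h y) (e y). Qed.

Lemma derives_ext F f1 G g1 : derives F f1 -> F =1 G -> f1 =1 g1 -> derives G g1.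
Proof. by move=> h /funext <- /funext <-. Qed.

Lemma derives_sin : derives (@sin R) cos.
Proof. by move=> y; exact: is_derive_sin. Qed.

Lemma derives_cos : derives (@cos R) (fun y => - sin y).
Proof. by move=> y; exact: is_derive_cos. Qed.

Lemma derives_expR : derives (@expR R) expR.
Proof. by move=> y; exact: is_derive_expR. Qed.

Lemma derives_addl (a : R) : derives (fun y => a + y) (fun=> 1).
Proof.
have h := @derives_mul_add R 1 a; move=> y.
by have := h y; congr (is_derive _ _ _ _); apply/funext => z; ring.
Qed.

Lemma derives_shift F f1 (a : R) : derives F f1 ->
  derives (fun y => F (a + y)) (fun y => f1 (a + y)).
Proof.
move=> dF; apply: derives_eq (derives_comp dF (derives_addl a)) _ => y.
by rewrite mulr1.
Qed.

Lemma C2_bd_shift C F f1 f2 (a : R) : C2_bd C F f1 f2 ->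
  C2_bd C (fun y => F (a + y)) (fun y => f1 (a + y)) (fun y => f2 (a + y)).
Proof.
by move=> [d1 d2 b]; split; [exact: derives_shift|exact: derives_shift|move=> y].
Qed.

(** The factor [Num.min 2 |a|] is small for small shifts and bounded for all, so that its mean at
    [a = X r w] tends to 0 with [r] without any moment of [X]. *)
Lemma C2_lip_increment C F f1 f2 (a : R) : C2_lip C F f1 f2 ->
  C2_bd (C * Num.min 2 `|a|) (fun y => F (a + y) - F y)
    (fun y => f1 (a + y) - f1 y) (fun y => f2 (a + y) - f2 y).
Proof.
move=> [d1 d2 b lip]; split.
- by apply: derivesB => //; exact: derives_shift.
- by apply: derivesB => //; exact: derives_shift.
have C0 : 0 <= C by case: (b 0) => /(le_trans (normr_ge0 _)).
have two (g : R -> R) x y : (forall z, `|g z| <= C) -> `|g x - g y| <= C * 2.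
  by move=> h; rewrite (le_trans (ler_normB _ _))// mulr_natr mulr2n lerD.
have lm (g : R -> R) y : (forall z, `|g z| <= C) ->
    (forall x y, `|g x - g y| <= C * `|x - y|) ->
    `|g (a + y) - g y| <= C * Num.min 2 `|a|.
  move=> h1 h2; rewrite /Num.min; case: ifPn => _; first exact: two.
  by apply: le_trans (h2 _ _) _; rewrite addrK.
move=> y; split.
- apply: lm => [z|u v]; first by case: (b z).
  by apply: lipschitz_of_derive d1 _ => z; case: (b z).
- apply: lm => [z|u v]; first by case: (b z).
  by apply: lipschitz_of_derive d2 _ => z; case: (b z).
- by apply: lm => [z|u v//]; case: (b z).
Qed.

Lemma taylor1 C F f1 f2 (y z : R) : derives F f1 -> derives f1 f2 ->
  (forall y, `|f2 y| <= C) -> `|F (y + z) - F y - f1 y * z| <= C * z ^+ 2.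
Proof.
move=> d1 d2 b.
have [s /andP[s0 s1]] := mean_value y (y + z) d1.
have -> : y + z - y = z by ring.
move=> ->; rewrite -mulrBl normrM.
have h := lipschitz_of_derive y (y + s * z) d2 b.
have C0 : 0 <= C by apply: le_trans (normr_ge0 _) (b 0).
rewrite -real_normK ?num_real// expr2 mulrA ler_wpM2r//.
apply: le_trans h _; rewrite ler_wpM2l//.
have -> : y + s * z - y = s * z by ring.
by rewrite normrM ger0_norm// ler_piMl.
Qed.

Lemma expR_taylor1 (z : R) : `|z| <= 1 -> `|expR z - 1 - z| <= expR 1 * z ^+ 2.
Proof.
move=> z1.
have [s /andP[s0 s1]] := mean_value 0 z derives_expR.
rewrite expR0 subr0 add0r => ->.
have -> : expR (s * z) * z - z = (expR (s * z) - 1) * z by ring.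
rewrite normrM.
have [t /andP[t0 t1]] := mean_value 0 (s * z) derives_expR.
rewrite expR0 subr0 add0r => ->.
have -> : z ^+ 2 = `|z| * `|z| by rewrite -normrM -expr2 ger0_norm ?sqr_ge0.
rewrite [leRHS]mulrA ler_wpM2r// normrM.
rewrite (ger0_norm (expR_ge0 _)); apply: ler_pM => //.
  rewrite ler_expR (le_trans (ler_norm _))// mulrA normrM mulr_ile1//.
  by rewrite ger0_norm ?mulr_ge0// mulr_ile1.
by rewrite normrM ger0_norm// ler_piMl.
Qed.

Lemma expR1Dx_le (z : R) : 0 <= expR z - 1 - z.
Proof. by have := expR_ge1Dx z; lra. Qed.

End SmoothBounded.

(** * The integro-differential operator of the process *)

Section Generator.
Context {R : realType}.
Variable nu : {measure set R -> \bar R}.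
Implicit Types F G f g : R -> R.

(** The common majorant of all jump integrands below. Its first term is integrable for every Lévy
    measure, its second by the assumption on upward jumps. *)
Definition jump_weight (z : R) : R :=
  Num.min 1 (z ^+ 2) + Num.max (expR z - 1) 0.

(** The generator of [X]. The compensator [expR z - 1], instead of a truncated jump, is the one in
    the exponent of [levy_char]; it makes the image of [expR] vanish, in line with [expR X] being a
    martingale. *)
Definition gen F f1 (y : R) : R :=
  \int[nu]_z (F (y + z) - F y - f1 y * (expR z - 1)).

Lemma jump_weight_ge0 z : 0 <= jump_weight z.
Proof.
by rewrite addr_ge0// /Num.min /Num.max; case: ifPn => // _; rewrite ?sqr_ge0// leNgt.
Qed.

Definition gen_const : R := 3 + expR 1.

Lemma gen_const_ge0 : 0 <= gen_const.
Proof. by rewrite addr_ge0// expR_ge0. Qed.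

(** For [|z| <= 1] the first-order Taylor terms cancel and both remainders are quadratic. For larger
    jumps the weight is at least 1, and the only unbounded term, the compensator, is dominated by
    its upward part. *)
Lemma gen_integrand_le C F f1 f2 y z : C2_bd C F f1 f2 ->
  `|F (y + z) - F y - f1 y * (expR z - 1)| <= gen_const * C * jump_weight z.
Proof.
move=> bd; have C0 := C2_bd_ge0 bd; case: bd => d1 d2 b.
have e0 : 0 <= expR 1 :> R by exact: expR_ge0.
have bF u : `|F u| <= C by case: (b u).
have [_ b1 _] := b y.
have Ce : 0 <= C * expR 1 by exact: mulr_ge0.
have [z1|z1] := leP `|z| 1.
  have -> : F (y + z) - F y - f1 y * (expR z - 1) =
    (F (y + z) - F y - f1 y * z) - f1 y * (expR z - 1 - z) by ring.
  have h1 := @taylor1 R C F f1 f2 y z d1 d2 (fun u => let: And3 _ _ h := b u in h).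
  have h2 := expR_taylor1 z1.
  have zz : z ^+ 2 <= 1 by rewrite -real_normK ?num_real// exprn_ile1.
  have w : z ^+ 2 <= jump_weight z.
    rewrite /jump_weight /Num.min; case: ifPn => h; last by rewrite lerDl le_max lexx orbT.
    by move: h zz; rewrite ltNge => /negP.
  apply: (@le_trans _ _ (C * z ^+ 2 + C * (expR 1 * z ^+ 2))).
    rewrite (le_trans (ler_normB _ _))// lerD// normrM; exact: ler_pM.
  have -> : C * z ^+ 2 + C * (expR 1 * z ^+ 2) = (1 + expR 1) * C * z ^+ 2 by ring.
  apply: (@le_trans _ _ (gen_const * C * z ^+ 2)).
    by rewrite ler_wpM2r ?sqr_ge0// ler_wpM2r// /gen_const; lra.
  by rewrite ler_wpM2l// mulr_ge0// gen_const_ge0.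
have w1 : Num.min 1 (z ^+ 2) = 1.
  apply/min_idPl; rewrite -real_normK ?num_real//.
  by rewrite exprn_ege1// ltW.
have E0 : 0 <= Num.max (expR z - 1) 0 :> R by rewrite le_max lexx orbT.
have E1 : `|expR z - 1| <= 1 + Num.max (expR z - 1) 0.
  have := expR_gt0 z; rewrite /Num.max; case: ifPn; rewrite -?leNgt => h h'.
    by rewrite ltr0_norm//; lra.
  by rewrite ger0_norm//; lra.
rewrite /jump_weight w1; set E := Num.max _ _ in E0 E1 *.
apply: (@le_trans _ _ (C + C + C * (1 + E))).
  rewrite (le_trans (ler_normB _ _))// lerD//.
    by rewrite (le_trans (ler_normB _ _))// lerD.
  by rewrite normrM; apply: ler_pM.
have -> : C + C + C * (1 + E) = 3 * C + C * E by ring.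
rewrite /gen_const mulrDr mulr1 lerD//; last first.
  by rewrite ler_wpM2r// ler_peMl//; lra.
by rewrite ler_wpM2r//; lra.
Qed.

Hypothesis hW : summ nu jump_weight.

Definition jump_mass : R := \int[nu]_z jump_weight z.

Lemma jump_mass_ge0 : 0 <= jump_mass.
Proof. by apply: Rintegral_ge0 => z _; exact: jump_weight_ge0. Qed.

Lemma measurable_gen_integrand F f1 y : measurable_fun setT F ->
  measurable_fun setT (fun z : R => F (y + z) - F y - f1 y * (expR z - 1)).
Proof.
move=> mF; apply: measurable_funB.
  apply: measurable_funB => //; apply: measurableT_comp => //.
  by apply: measurable_funD.
by apply: measurable_funM => //; apply: measurable_funB => //; exact: measurable_expR.
Qed.

Lemma summ_gen C F f1 f2 y : C2_bd C F f1 f2 ->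
  summ nu (fun z => F (y + z) - F y - f1 y * (expR z - 1)).
Proof.
move=> bd; apply: summ_le (summZ (gen_const * C) hW); last first.
  by move=> z; exact: gen_integrand_le bd.
by apply: measurable_gen_integrand; case: bd => /derives_measurable.
Qed.

Lemma gen_bound C F f1 f2 y : C2_bd C F f1 f2 ->
  `|gen F f1 y| <= gen_const * C * jump_mass.
Proof.
move=> bd; rewrite -RintZ//; apply: Rint_abs_le (summZ (gen_const * C) hW); last first.
  by move=> z; exact: gen_integrand_le bd.
by apply: measurable_gen_integrand; case: bd => /derives_measurable.
Qed.

Lemma genB C D F f1 f2 G g1 g2 y : C2_bd C F f1 f2 -> C2_bd D G g1 g2 ->
  gen (fun y => F y - G y) (fun y => f1 y - g1 y) y = gen F f1 y - gen G g1 y.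
Proof.
move=> bF bG; rewrite /gen -RintB; [|exact: summ_gen bF|exact: summ_gen bG].
by apply: eq_Rint => z; ring.
Qed.

Lemma gen_shift F f1 (a y : R) :
  gen (fun y => F (a + y)) (fun y => f1 (a + y)) y = gen F f1 (a + y).
Proof. by apply: eq_Rint => z; rewrite addrA. Qed.

Lemma gen_increment C F f1 f2 (a y : R) : C2_lip C F f1 f2 ->
  `|gen F f1 (a + y) - gen F f1 y| <=
  gen_const * (C * Num.min 2 `|a|) * jump_mass.
Proof.
move=> lF; have bF := C2_lip_bd lF.
rewrite -gen_shift -(genB _ (C2_bd_shift a bF) bF).
exact: gen_bound (C2_lip_increment a lF).
Qed.

End Generator.

(** * The generator *)

Section TrigBounds.
Context {R : realType}.

Lemma trig_sum_le (s : seq (R * R * R)) y :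
  `|trig_sum s y| <= \sum_(i <- s) `|i.1.1|.
Proof.
rewrite /trig_sum (le_trans (ler_norm_sum _ _ _))//.
apply: ler_sum => i _; rewrite normrM ler_piMr// ler_norml cos_geN1 cos_le1//.
Qed.

Lemma C2_bd_trig_sum (s : seq (R * R * R)) : exists C,
  C2_bd C (trig_sum s) (trig_sum (trig_deriv s))
    (trig_sum (trig_deriv (trig_deriv s))).
Proof.
pose n (s : seq (R * R * R)) := \sum_(i <- s) `|i.1.1|.
have n0 t : 0 <= n t by apply: sumr_ge0.
exists (n s + n (trig_deriv s) + n (trig_deriv (trig_deriv s))).
split; [exact: derives_trig_sum|exact: derives_trig_sum|move=> y].
have := n0 s; have := n0 (trig_deriv s); have := n0 (trig_deriv (trig_deriv s)).
by split; (apply: le_trans (trig_sum_le _ _) _); rewrite -/(n _); lra.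
Qed.

End TrigBounds.

Section TrigDynkin.
Context {R : realType} {d : measure_display} {Omega : measurableType d}.
Variable P : probability Omega R.
Variable X : R -> Omega -> R.
Variable nu : {measure set R -> \bar R}.
Hypothesis mX : forall t, measurable_fun setT (X t).
Hypothesis hchar : levy_char P X nu.
Hypothesis hW : summ nu (@jump_weight R).

(** The generator multiplies e^(i u y) by psi(u). On a cosine the real part of psi keeps the phase,
    and the imaginary part produces minus a sine, encoded by the shift [pi / 2]. *)
Definition trig_gen (s : seq (R * R * R)) : seq (R * R * R) :=
  [seq (i.1.1 * psi_re nu i.1.2, i.1.2, i.2) | i <- s] ++
  [seq (i.1.1 * psi_im nu i.1.2, i.1.2, i.2 + pi / 2) | i <- s].

Lemma trig_sum_gen s y : trig_sum (trig_gen s) y =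
  \sum_(i <- s) (i.1.1 * (psi_re nu i.1.2 * cos (i.1.2 * y + i.2) -
                          psi_im nu i.1.2 * sin (i.1.2 * y + i.2))).
Proof.
rewrite /trig_sum big_cat/= !big_map -big_split/=.
by apply: eq_bigr => i _ /=; rewrite addrA cosDpihalf_neg_sin; ring.
Qed.

(** This is where the exponent of the characteristic function is identified with an integral
    operator against [nu]; all later analysis of the law of [X] rests on it. *)
Lemma gen_trig_sum s y :
  gen nu (trig_sum s) (trig_sum (trig_deriv s)) y = trig_sum (trig_gen s) y.
Proof.
rewrite trig_sum_gen /gen.
have e z : trig_sum s (y + z) - trig_sum s y -
      trig_sum (trig_deriv s) y * (expR z - 1) =
    \sum_(i <- s) (i.1.1 * (cos (i.1.2 * y + i.2) * (cos (i.1.2 * z) - 1) -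
      sin (i.1.2 * y + i.2) * (sin (i.1.2 * z) - i.1.2 * (expR z - 1)))).
  rewrite /trig_sum /trig_deriv big_map mulr_suml -!sumrB.
  apply: eq_bigr => [[[a u] c] _] /=.
  rewrite addrA cosDpihalf_neg_sin.
  have -> : u * (y + z) + c = (u * y + c) + u * z by ring.
  by rewrite cosD; ring.
rewrite (eq_Rint _ e).
have hc u : summ nu (fun z => cos (u * z) - 1) by case: (hchar u).
have hs u : summ nu (fun z => sin (u * z) - u * (expR z - 1)).
  by case: (hchar u) => _ [].
rewrite Rint_sum; last first.
  by move=> i; apply: summZ; apply: summB; apply: summZ.
apply: eq_bigr => i _.
rewrite RintZ; last by apply: summB; apply: summZ.
by rewrite RintB ?RintZ//; [rewrite mulrC [_ * psi_im _ _]mulrC mulrC; congr (_ * (_ - _)); rewrite mulrC|apply: summZ..].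
Qed.

Lemma measurable_cosX u c t : measurable_fun setT (fun w => cos (u * X t w + c)).
Proof.
apply: measurableT_comp; first exact: derives_measurable derives_cos.
by apply: measurable_funD => //; apply: measurable_funM.
Qed.

Lemma expect_cos u c t : 0 <= t ->
  \int[P]_w cos (u * X t w + c) =
  expR (t * psi_re nu u) * cos (c + t * psi_im nu u).
Proof.
move=> t0; have [_ [_ /(_ t t0) [hc hs]]] := hchar u.
have mc : measurable_fun setT (fun w => cos (u * X t w)).
  apply: measurableT_comp; first exact: derives_measurable derives_cos.
  by apply: measurable_funM.
have ms : measurable_fun setT (fun w => sin (u * X t w)).
  apply: measurableT_comp; first exact: derives_measurable derives_sin.
  by apply: measurable_funM.
have ic : summ P (fun w => cos (u * X t w)).
  by apply: (@summ_bounded _ _ _ P _ 1) => // w; rewrite ler_norml cos_geN1 cos_le1.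
have is_ : summ P (fun w => sin (u * X t w)).
  by apply: (@summ_bounded _ _ _ P _ 1) => // w; rewrite ler_norml sin_geN1 sin_le1.
have -> : \int[P]_w cos (u * X t w + c) =
    \int[P]_w (cos c * cos (u * X t w) - sin c * sin (u * X t w)).
  by apply: eq_Rint => w; rewrite cosD; ring.
rewrite RintB ?RintZ//; [|exact: summZ|exact: summZ].
by rewrite /Rintegral hc hs /= cosD; ring.
Qed.

(** The explicit value of the mean of [trig_sum s (y + X t w)]. As a formula it makes sense for
    every real [t], so it can be differentiated everywhere in time, including at 0. *)
Definition trig_flow (s : seq (R * R * R)) (y t : R) : R :=
  \sum_(i <- s) i.1.1 * (expR (t * psi_re nu i.1.2) *
     cos (i.1.2 * y + i.2 + t * psi_im nu i.1.2)).

Lemma expect_trig_sum s y t : 0 <= t ->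
  \int[P]_w trig_sum s (y + X t w) = trig_flow s y t.
Proof.
move=> t0; rewrite /trig_sum Rint_sum; last first.
  move=> i; apply: summZ.
  under [X in summ _ X]funext do rewrite mulrDr addrAC addrC.
  apply: (@summ_bounded _ _ _ P _ 1); last by move=> w; rewrite ler_norml cos_geN1 cos_le1.
  exact: measurable_cosX.
apply: eq_bigr => i _.
have e w : i.1.1 * cos (i.1.2 * (y + X t w) + i.2) =
    i.1.1 * cos (i.1.2 * X t w + (i.1.2 * y + i.2)).
  by congr (_ * cos _); ring.
rewrite (eq_Rint _ e) RintZ ?expect_cos//.
apply: (@summ_bounded _ _ _ P _ 1); last by move=> w; rewrite ler_norml cos_geN1 cos_le1.
exact: measurable_cosX.
Qed.

Lemma derives_trig_flow s y :
  derives (trig_flow s y) (trig_flow (trig_gen s) y).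
Proof.
elim: s => [|[[a u] c] s IH].
  move=> t; have -> : trig_flow [::] y = cst 0.
    by apply/funext => z; rewrite /trig_flow big_nil.
  exact: is_derive_cst.
have -> : trig_flow ((a, u, c) :: s) y = (fun t =>
   a * (expR (t * psi_re nu u) * cos (u * y + c + t * psi_im nu u)) + trig_flow s y t).
  by apply/funext => z; rewrite /trig_flow big_cons.
set p := psi_re nu u; set q := psi_im nu u.
have d1 : derives (fun t => expR (t * p)) (fun t => expR (t * p) * p).
  by apply: derives_ext (derives_comp derives_expR (@derives_mul_add R p 0)) _ _ => t;
    rewrite addr0 [p * t]mulrC.
have d2 : derives (fun t => cos (u * y + c + t * q)) (fun t => - sin (u * y + c + t * q) * q).
  by apply: derives_ext (derives_comp derives_cos (@derives_mul_add R q (u * y + c))) _ _ => t;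
    rewrite addrC [q * t]mulrC.
apply: derives_eq (derivesD (derivesZ a (derivesM d1 d2)) IH) _ => t.
rewrite /trig_flow !big_cat/= !big_cons/= !big_map -/p -/q.
have -> : u * y + (c + pi / 2) + t * q = (u * y + c + t * q) + pi / 2 by ring.
rewrite cosDpihalf_neg_sin; ring.
Qed.

Lemma trig_step s y h : 0 <= h -> exists2 r, 0 <= r <= h &
  \int[P]_w trig_sum s (y + X h w) - trig_sum s y =
  h * \int[P]_w trig_sum (trig_gen s) (y + X r w).
Proof.
move=> h0; have [r /andP[r0 r1]] := mean_value 0 h (derives_trig_flow s y).
rewrite add0r subr0 => e; exists (r * h).
  by rewrite mulr_ge0//= ler_piMl.
rewrite !expect_trig_sum ?mulr_ge0// mulrC -e; congr (_ - _).
by apply: eq_bigr => i _; rewrite !mul0r addr0 expR0 mul1r.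
Qed.

End TrigDynkin.

(** * From trigonometric sums to bounded smooth functions *)

Section Periodize.
Context {R : realType}.
Implicit Types F G f g : R -> R.

(* [F \o wrap M] is a function of [sin (M^-1 * y)], hence a limit of trigonometric sums,
   and it tends to [F] as [M] grows. *)
Definition wrap (M y : R) : R := M * sin (M^-1 * y).

Lemma derives_scale (a : R) : derives (fun y => a * y) (fun=> a).
Proof.
by apply: derives_ext (@derives_mul_add R a 0) _ _ => // y; rewrite addr0.
Qed.

Lemma derives_wrap M : M != 0 -> derives (wrap M) (fun y => cos (M^-1 * y)).
Proof.
move=> M0; apply: derives_eq (derivesZ M (derives_comp (@derives_sin R) (derives_scale M^-1))) _.
by move=> y; rewrite mulrCA mulfV// mulr1.
Qed.

Lemma normr_cos_le1 (x : R) : `|cos x| <= 1.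
Proof. by rewrite ler_norml cos_geN1 cos_le1. Qed.

Lemma normr_sin_le1 (x : R) : `|sin x| <= 1.
Proof. by rewrite ler_norml sin_geN1 sin_le1. Qed.

Lemma lipschitzM (A B La Lb a a' b b' t : R) :
  `|a'| <= A -> `|b| <= B -> 0 <= t ->
  `|a - a'| <= La * t -> `|b - b'| <= Lb * t ->
  `|a * b - a' * b'| <= (La * B + A * Lb) * t.
Proof.
move=> ha hb t0 da db.
have -> : a * b - a' * b' = (a - a') * b + a' * (b - b') by ring.
have -> : (La * B + A * Lb) * t = (La * t) * B + A * (Lb * t) by ring.
by rewrite (le_trans (ler_normD _ _))// !normrM lerD// ler_pM.
Qed.

(** The constant [6 * C] does not depend on [M >= 1]; this uniformity is what survives when [M]
    tends to infinity. *)
Lemma C2_lip_wrap C F f1 f2 M : 1 <= M -> C2_lip C F f1 f2 ->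
  C2_lip (6 * C) (fun y => F (wrap M y))
    (fun y => f1 (wrap M y) * cos (M^-1 * y))
    (fun y => f2 (wrap M y) * (cos (M^-1 * y) * cos (M^-1 * y)) -
              f1 (wrap M y) * (M^-1 * sin (M^-1 * y))).
Proof.
move=> M1 [d1 d2 b lip].
have M0 : 0 < M by apply: lt_le_trans M1.
have Mn0 : M != 0 by rewrite gt_eqF.
have v0 : 0 <= M^-1 by rewrite invr_ge0 ltW.
have v1 : M^-1 <= 1 by rewrite invf_le1.
have C0 : 0 <= C by case: (b 0) => /(le_trans (normr_ge0 _)).
have dc : derives (fun y => cos (M^-1 * y)) (fun y => - sin (M^-1 * y) * M^-1).
  exact: derives_comp derives_cos (derives_scale _).
have dw := derives_wrap Mn0.
have wl x y : `|wrap M x - wrap M y| <= `|x - y|.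
  by rewrite -[leRHS]mul1r; apply: lipschitz_of_derive dw _ => z; exact: normr_cos_le1.
have cl x y : `|cos (M^-1 * x) - cos (M^-1 * y)| <= 1 * `|x - y|.
  apply: lipschitz_of_derive dc _ => z.
  by rewrite normrM normrN mulr_ile1// ?normr_sin_le1// ger0_norm.
have sl x y : `|M^-1 * sin (M^-1 * x) - M^-1 * sin (M^-1 * y)| <= 1 * `|x - y|.
  apply: lipschitz_of_derive (derivesZ _ (derives_comp derives_sin (derives_scale _))) _ => z.
  by rewrite !normrM (ger0_norm v0) mulr_ile1 ?mulr_ge0// mulr_ile1// normr_cos_le1.
have msl x : `|M^-1 * sin (M^-1 * x)| <= 1.
  by rewrite normrM (ger0_norm v0) mulr_ile1// normr_sin_le1.
have ccl x : `|cos (M^-1 * x) * cos (M^-1 * x)| <= 1.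
  by rewrite normrM mulr_ile1// normr_cos_le1.
split.
- exact: derives_comp.
- apply: derives_eq (derivesM (derives_comp d2 dw) dc) _ => y; ring.
- move=> y; have [b0 b1 b2] := b (wrap M y); split.
  + by apply: le_trans b0 _; lra.
  + apply: (@le_trans _ _ (C * 1)); last by lra.
    by rewrite normrM ler_pM// normr_cos_le1.
  + apply: (@le_trans _ _ (C * 1 + C * 1)); last by lra.
    by rewrite (le_trans (ler_normB _ _))// lerD// normrM ler_pM.
- move=> x y; have [_ b1y b2y] := b (wrap M y).
  have l2 : `|f2 (wrap M x) - f2 (wrap M y)| <= C * `|x - y|.
    by apply: le_trans (lip _ _) _; rewrite ler_wpM2l.
  have l1 : `|f1 (wrap M x) - f1 (wrap M y)| <= C * `|x - y|.
    apply: (@le_trans _ _ (C * `|wrap M x - wrap M y|)); last by rewrite ler_wpM2l.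
    by apply: lipschitz_of_derive d2 _ => z; case: (b z).
  have lcc := lipschitzM (normr_cos_le1 (M^-1 * y)) (normr_cos_le1 (M^-1 * x))
    (normr_ge0 _) (cl x y) (cl x y).
  have h1 := lipschitzM b2y (ccl x) (normr_ge0 _) l2 lcc.
  have h2 := lipschitzM b1y (msl x) (normr_ge0 _) l1 (sl x y).
  set A := f2 (wrap M x) * _ in h1 *; set A' := f2 (wrap M y) * _ in h1 *.
  set B := f1 (wrap M x) * _ in h2 *; set B' := f1 (wrap M y) * _ in h2 *.
  have -> : A - B - (A' - B') = (A - A') - (B - B') by ring.
  rewrite (le_trans (ler_normB _ _))// (le_trans (lerD h1 h2))// -mulrDl.
  by rewrite ler_wpM2r//; lra.
Qed.

(** A polynomial in the sine is a trigonometric sum. The powers of [M] in the polynomial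
    approximation cancel the powers of [M^-1] from the chain rule, which leaves an error [e] for the
    function and both derivatives. *)
Lemma wrap_trig_approx C F f1 f2 M e : 1 <= M -> C2_lip C F f1 f2 -> 0 < e ->
  exists s, C2_bd e (fun y => F (wrap M y) - trig_sum s y)
    (fun y => f1 (wrap M y) * cos (M^-1 * y) - trig_sum (trig_deriv s) y)
    (fun y => f2 (wrap M y) * (cos (M^-1 * y) * cos (M^-1 * y)) -
              f1 (wrap M y) * (M^-1 * sin (M^-1 * y)) -
              trig_sum (trig_deriv (trig_deriv s)) y).
Proof.
move=> M1 lF e0.
have M0 : 0 < M by apply: lt_le_trans M1.
have v0 : 0 <= M^-1 by rewrite invr_ge0 ltW.
have v1 : M^-1 <= 1 by rewrite invf_le1.
have e20 : 0 < e / 2 by lra.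
have [p hp] := poly_approx_C2 e20 (ltW M0) lF.
have [s hs] := is_trig_poly_sin p M^-1.
have [dF1 dF2 _ _] := C2_lip_wrap M1 lF.
exists s; split.
- by apply: derivesB => //; exact: derives_trig_sum.
- by apply: derivesB => //; exact: derives_trig_sum.
have dq (q : {poly R}) : derives (horner q) (horner q^`()).
  by move=> y; exact: is_derive_poly.
have ds : derives (fun y => sin (M^-1 * y)) (fun y => cos (M^-1 * y) * M^-1).
  exact: derives_comp derives_sin (derives_scale _).
have dc : derives (fun y => cos (M^-1 * y)) (fun y => - sin (M^-1 * y) * M^-1).
  exact: derives_comp derives_cos (derives_scale _).
have dp1 := derives_comp (dq p) ds.
(* Uniqueness of derivatives identifies the formal derivative of the sum [s] with the chain-rule
   expression in [p], whose coefficients are under control. *)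
have e1 := derives_uniq (derives_ext dp1 hs (fun _ => erefl)) (derives_trig_sum s).
have dp2 := derivesM (derives_comp (dq p^`()) ds) (derivesZ M^-1 dc).
have e2 := derives_uniq (derives_ext dp2 (fun y => etrans (congr1 _ (mulrC _ _)) (e1 y)) (fun _ => erefl))
  (derives_trig_sum _).
move=> y; set S := sin (M^-1 * y); set K := cos (M^-1 * y).
have [|h0 h1 h2] := hp S; first by rewrite /S sin_geN1 sin_le1.
have K1 : `|K| <= 1 by exact: normr_cos_le1.
have S1 : `|S| <= 1 by exact: normr_sin_le1.
split.
- by rewrite -hs; apply: le_trans h0 _; lra.
- rewrite -e1 -/S -/K /wrap -/S.
  have -> : f1 (M * S) * K - p^`().[S] * (K * M^-1) =
    (M * f1 (M * S) - p^`().[S]) * (K * M^-1) by field; rewrite gt_eqF.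
  rewrite normrM -[e]mulr1; apply: ler_pM => //; first by lra.
  by rewrite normrM mulr_ile1// ger0_norm.
- rewrite -e2 -/S -/K /wrap -/S.
  have -> : f2 (M * S) * (K * K) - f1 (M * S) * (M^-1 * S) -
     (p^`().[S] * (M^-1 * (- S * M^-1)) + p^`()^`().[S] * (K * M^-1) * (M^-1 * K)) =
     (M ^+ 2 * f2 (M * S) - p^`()^`().[S]) * ((K * M^-1) * (K * M^-1)) -
     (M * f1 (M * S) - p^`().[S]) * (S * (M^-1 * M^-1)).
    by field; rewrite gt_eqF.
  have -> : e = (e / 2) * 1 + (e / 2) * 1 by lra.
  rewrite (le_trans (ler_normB _ _))// lerD// normrM ler_pM//.
    by rewrite !normrM (ger0_norm v0) !mulr_ile1// ?mulr_ge0.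
  by rewrite !normrM (ger0_norm v0) !mulr_ile1// ?mulr_ge0.
Qed.

Lemma cvg_wrap (y : R) : (fun n : nat => wrap n.+1%:R y) @ \oo --> y.
Proof.
have hn : (@harmonic R) @ \oo --> (0 : R) by exact: cvg_harmonic.
have h1 : (fun n : nat => y - y ^+ 2 * @harmonic R n) @ \oo --> y.
  have := cvgB (@cvg_cst _ y _ _ _) (cvgM (@cvg_cst _ (y ^+ 2) _ _ _) hn).
  by rewrite mulr0 subr0; apply.
have h2 : (fun n : nat => y + y ^+ 2 * @harmonic R n) @ \oo --> y.
  have := cvgD (@cvg_cst _ y _ _ _) (cvgM (@cvg_cst _ (y ^+ 2) _ _ _) hn).
  by rewrite mulr0 addr0; apply.
apply: squeeze_cvgr h1 h2; apply: nearW => n.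
have n0 : 0 < n.+1%:R :> R by rewrite ltr0n.
have h := @taylor1 R 1 sin cos (fun x => - sin x) 0 (n.+1%:R^-1 * y) (@derives_sin R) (@derives_cos R).
have : `|sin (n.+1%:R^-1 * y) - n.+1%:R^-1 * y| <= (n.+1%:R^-1 * y) ^+ 2.
  move: h; rewrite add0r sin0 cos0 subr0 !mul1r; apply => x.
  by rewrite normrN normr_sin_le1.
rewrite -(ler_pM2l n0) -[X in X * `|_|]gtr0_norm// -normrM mulrBr mulrA mulfV ?gt_eqF// mul1r.
rewrite -/(wrap _ _).
have -> : n.+1%:R * (n.+1%:R^-1 * y) ^+ 2 = y ^+ 2 * n.+1%:R^-1 by field; rewrite addrC natr1 gt_eqF.
have -> : harmonic n = n.+1%:R^-1 :> R by [].
by rewrite ler_norml; set q := y ^+ 2 / _ => /andP[? ?]; apply/andP; split; lra.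
Qed.

Lemma cvg_cos_wrap (y : R) : (fun n : nat => cos (n.+1%:R^-1 * y)) @ \oo --> (1 : R).
Proof.
have hn : (@harmonic R) @ \oo --> (0 : R) by exact: cvg_harmonic.
have : (fun n : nat => @harmonic R n * y) @ \oo --> (0 : R).
  by have := cvgM hn (@cvg_cst _ y _ _ _); rewrite mul0r; apply.
move=> /(continuous_cvg _ (@derives_continuous R _ _ (@derives_cos R) 0)).
by rewrite cos0.
Qed.

End Periodize.

Section UniformGenerator.
Context {R : realType} {d : measure_display} {Omega : measurableType d}.
Variable P : probability Omega R.
Variable X : R -> Omega -> R.
Variable nu : {measure set R -> \bar R}.
Hypothesis hX : levy_process P X.
Hypothesis hchar : levy_char P X nu.
Hypothesis hW : summ nu (@jump_weight R).
Implicit Types F G f g : R -> R.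

Lemma levy_measurable t : measurable_fun setT (X t).
Proof. by case: hX. Qed.

Let mX := levy_measurable.

Lemma levy_X0 : {ae P, forall w, X 0 w = 0}.
Proof.
case: hX => _ h0 _ _ _; exists [set w | X 0 w != 0]; split => //.
- have -> : [set w | X 0 w != 0] = ~` (X 0 @^-1` [set 0]).
    by apply/seteqP; split => w /= => [/eqP|?]; [|apply/eqP].
  by apply: measurableC; rewrite -[X in measurable X]setTI; exact: mX.
- by move=> w /= /eqP.
Qed.

Lemma levy_cadlag : {ae P, forall w, cadlag (fun t => X t w)}.
Proof.
by case: hX => _ _ [N [mN N0 hN]] _ _; exists N; split => // w /= h; apply: contrapT => /hN.
Qed.

Lemma measurable_min_norm t : measurable_fun setT (fun w => Num.min 2 `|X t w|).
Proof. by apply: measurable_minr => //; apply: measurableT_comp. Qed.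

(** If it failed there would be times tending to 0 with large means; right-continuity of the paths
    at 0, [X 0 = 0] almost surely and dominated convergence exclude this. *)
Lemma small_time_continuity (e : R) : 0 < e -> exists2 h0, 0 < h0 &
  forall r, 0 <= r <= h0 -> \int[P]_w Num.min 2 `|X r w| <= e.
Proof.
move=> e0; apply: contrapT => hn.
have bad (n : nat) : exists r, [/\ 0 <= r, r <= n.+1%:R^-1 &
    e < \int[P]_w Num.min 2 `|X r w|].
  apply: contrapT => hr; apply: hn; exists n.+1%:R^-1; first by rewrite invr_gt0.
  move=> r /andP[r0 r1]; rewrite leNgt; apply/negP => er; apply: hr.
  by exists r; split.
have [r hr] := choice bad.
have c : (fun n => \int[P]_w Num.min 2 `|X (r n) w|) @ \oo --> \int[P]_w 0.
  apply: (@Rint_dominated_ae _ _ _ P _ _ (fun=> 2)).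
  - by move=> n; exact: measurable_min_norm.
  - exact: measurable_cst.
  - apply: filterS2 levy_X0 levy_cadlag => w w0 cw.
    have [c0 _] := cw 0 (lexx _); rewrite w0 in c0.
    apply/cvgrPdist_le => /= eps eps0.
    have /cvgrPdist_le/(_ eps eps0) := c0.
    rewrite near_withinE => -[del /= del0 hdel].
    have : \forall n \near \oo, n.+1%:R^-1 < del.
      have /cvgrPdist_lt/(_ del del0) := @cvg_harmonic R.
      apply: filterS => n; rewrite sub0r normrN ger0_norm//; by rewrite invr_ge0.
    apply: filterS => n nd; rewrite sub0r normrN.
    have [r0 r1 _] := hr n.
    have Xe : `|X (r n) w| <= eps.
      move: r0; rewrite le_eqVlt => /orP[/eqP <-|r0]; first by rewrite w0 normr0 ltW.
      have hb : ball_ Num.norm 0 del (r n).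
        by rewrite /ball_/= sub0r normrN gtr0_norm// (le_lt_trans r1).
      by have := hdel _ hb r0; rewrite sub0r normrN.
    rewrite ger0_norm; last by rewrite le_min normr_ge0 andbT.
    by rewrite ge_min Xe orbT.
  - move=> n w; rewrite ger0_norm; last by rewrite le_min normr_ge0 andbT.
    by rewrite ge_min lexx.
  - exact: finite_measure_integrable_cst.
rewrite Rint_cst in c.
have : e <= 0.
  apply: ler_cvg_to (@cvg_cst _ e _ _ _) c _.
  by apply: nearW => n; have [_ _ /ltW] := hr n.
by rewrite leNgt e0.
Qed.

Let K : R := @gen_const R * jump_mass nu.

Lemma K_ge0 : 0 <= K.
Proof. by rewrite mulr_ge0// ?gen_const_ge0 ?jump_mass_ge0. Qed.

Lemma measurable_shiftX F f1 y t : derives F f1 ->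
  measurable_fun setT (fun w => F (y + X t w)).
Proof.
move=> dF; apply: measurableT_comp; first exact: derives_measurable dF.
by apply: measurable_funD.
Qed.

Lemma summ_shiftX C F f1 f2 y t : C2_bd C F f1 f2 ->
  summ P (fun w => F (y + X t w)).
Proof.
move=> [dF _ b]; apply: (@summ_bounded _ _ _ P _ C).
  exact: measurable_shiftX dF.
by move=> w; case: (b (y + X t w)).
Qed.

Lemma measurable_gen_trig s y t :
  measurable_fun setT (fun w => trig_sum (trig_gen nu s) (y + X t w)).
Proof. exact: measurable_shiftX (derives_trig_sum _). Qed.

(** The mean value form evaluates the generator at [y + X r w] instead of [y], which costs
    [K * C * D]. The approximation errors are removed at fixed [h] by letting [e] tend to 0, so they
    need not be small compared with [h]. *)
Lemma gen_step_trig C F f1 f2 y h D : C2_lip C F f1 f2 ->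
  (forall e, 0 < e -> exists s, C2_bd e (fun y => F y - trig_sum s y)
     (fun y => f1 y - trig_sum (trig_deriv s) y)
     (fun y => f2 y - trig_sum (trig_deriv (trig_deriv s)) y)) ->
  0 <= h -> (forall r, 0 <= r <= h -> \int[P]_w Num.min 2 `|X r w| <= D) ->
  `|\int[P]_w F (y + X h w) - F y - h * gen nu F f1 y| <= h * (K * C * D).
Proof.
move=> lF approx h0 hD.
have bF := C2_lip_bd lF; have C0 := C2_bd_ge0 bF.
have K0 := K_ge0.
apply/ler_addgt0Pr => e e0.
(* Two errors come from replacing [F] by the sum in the mean and at [y]. Of the three multiplied by
   [h * K], two come from the generator along the path and one from the generator at [y]. *)
pose e' := e / (2 + 3 * h * K).
have den : 0 < 2 + 3 * h * K by have := mulr_ge0 h0 K0; lra.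
have e'0 : 0 < e' by exact: divr_gt0.
have -> : e = (2 + 3 * h * K) * e' by rewrite /e' mulrC divfK// gt_eqF.
have [s bs] := approx e' e'0.
have [Cp bp] := C2_bd_trig_sum s.
set p := trig_sum s in bs bp *.
set p1 := trig_sum (trig_deriv s) in bs bp *.
have [r r0h stp] := trig_step mX hchar s y h0.
have gp u : trig_sum (trig_gen nu s) u = gen nu p p1 u.
  by rewrite (gen_trig_sum hchar).
have E1 : `|\int[P]_w F (y + X h w) - \int[P]_w p (y + X h w)| <= e'.
  rewrite -RintB; [|exact: summ_shiftX bF|exact: summ_shiftX bp].
  apply: Rint_bounded => [|w]; last by case: bs => _ _ /(_ (y + X h w)) [].
  by case: bs => + _ _; exact: measurable_shiftX.
have E2 : `|F y - p y| <= e' by case: bs => _ _ /(_ y) [].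
have gpF u : gen nu p p1 u = gen nu F f1 u -
    gen nu (fun y => F y - p y) (fun y => f1 y - p1 y) u.
  by rewrite (genB hW _ bF bp); ring.
have bg u : `|gen nu (fun y => F y - p y) (fun y => f1 y - p1 y) u| <= K * e'.
  by have := gen_bound hW u bs; rewrite /K; lra.
have E3 : `|gen nu F f1 y - gen nu p p1 y| <= K * e'.
  by rewrite gpF opprB addrC subrK; exact: bg.
have E4 : `|\int[P]_w trig_sum (trig_gen nu s) (y + X r w) - gen nu p p1 y| <=
    K * C * D + 2 * K * e'.
  have ist : summ P (fun w => trig_sum (trig_gen nu s) (y + X r w)).
    have [C' bC'] := C2_bd_trig_sum (trig_gen nu s).
    exact: summ_shiftX bC'.
  have ic c : summ P (fun=> c) by exact: finite_measure_integrable_cst.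
  have imin : summ P (fun w => Num.min 2 `|X r w|).
    apply: (@summ_bounded _ _ _ P _ 2); first exact: measurable_min_norm.
    by move=> w; rewrite ger0_norm ?ge_min ?lexx// le_min normr_ge0 andbT.
  rewrite -[gen nu p p1 y](Rint_cst P) -RintB//.
  apply: (@le_trans _ _ (\int[P]_w (K * C * Num.min 2 `|X r w| + 2 * K * e'))).
    apply: Rint_abs_le; last by apply: summD => //; exact: summZ.
    - by apply: measurable_funB => //; exact: measurable_gen_trig.
    - move=> w; rewrite gp !gpF.
      set A := gen nu F f1 (y + _); set B := gen nu F f1 y.
      set A' := gen nu _ _ (y + _); set B' := gen nu _ _ y.
      have -> : A - A' - (B - B') = (A - B) - A' + B' by ring.
      have hA : `|A - B| <= K * C * Num.min 2 `|X r w|.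
        rewrite /A [y + _]addrC; apply: le_trans (gen_increment hW _ _ lF) _.
        by rewrite /K; lra.
      have hA' : `|A'| <= K * e' by exact: bg.
      have hB' : `|B'| <= K * e' by exact: bg.
      have := ler_normD (A - B - A') B'; have := ler_normB (A - B) A'; lra.
  rewrite RintD//; last exact: summZ.
  rewrite Rint_cst lerD2r RintZ//; apply: ler_wpM2l; first exact: mulr_ge0.
  exact: hD.
rewrite -/p in stp.
set EF := \int[P]_w F _ in E1 *; set Ep := \int[P]_w p _ in E1 stp *.
set B := \int[P]_w trig_sum _ _ in stp E4 *.
set gF := gen nu F f1 y in E3 *; set gP := gen nu p p1 y in E3 E4 *.
have -> : EF - F y - h * gF =
  (EF - Ep) - (F y - p y) + h * (B - gP) - h * (gF - gP) by lra.
have t1 : `|h * (B - gP)| <= h * (K * C * D + 2 * K * e').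
  by rewrite normrM (ger0_norm h0) ler_wpM2l.
have t2 : `|h * (gF - gP)| <= h * (K * e').
  by rewrite normrM (ger0_norm h0) ler_wpM2l.
have := ler_normB (EF - Ep) (F y - p y).
have := ler_normD (EF - Ep - (F y - p y)) (h * (B - gP)).
have := ler_normB (EF - Ep - (F y - p y) + h * (B - gP)) (h * (gF - gP)).
by lra.
Qed.

(** Limit of the previous estimate along the wrapped functions; the bound is the same for every [n],
    and dominated convergence applies under [P] as well as under [nu]. *)
Lemma gen_step C F f1 f2 y h D : C2_lip C F f1 f2 -> 0 <= h ->
  (forall r, 0 <= r <= h -> \int[P]_w Num.min 2 `|X r w| <= D) ->
  `|\int[P]_w F (y + X h w) - F y - h * gen nu F f1 y| <= h * (K * (6 * C) * D).
Proof.
move=> lF h0 hD; have bF := C2_lip_bd lF.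
have n1 (n : nat) : 1 <= n.+1%:R :> R by rewrite ler1n.
have lW (n : nat) := C2_lip_wrap (n1 n) lF.
pose Fn (n : nat) y := F (wrap n.+1%:R y).
pose gn (n : nat) y := f1 (wrap n.+1%:R y) * cos (n.+1%:R^-1 * y).
have bnd (n : nat) : `|\int[P]_w Fn n (y + X h w) - Fn n y - h * gen nu (Fn n) (gn n) y| <=
    h * (K * (6 * C) * D).
  by apply: gen_step_trig (lW n) _ h0 hD => e e0; exact: wrap_trig_approx (n1 n) lF e0.
have [dF d1 bb _] := lF.
have cF u : (fun n => Fn n u) @ \oo --> F u.
  exact: (cvg_comp _ _ (@cvg_wrap R u) (@derives_continuous R _ _ dF u)).
have cg u : (fun n => gn n u) @ \oo --> f1 u.
  rewrite -[f1 u]mulr1; apply: cvgM; last exact: cvg_cos_wrap.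
  exact: (cvg_comp _ _ (@cvg_wrap R u) (@derives_continuous R _ _ d1 u)).
have c1 : (fun n => \int[P]_w Fn n (y + X h w)) @ \oo --> \int[P]_w F (y + X h w).
  apply: (@Rint_dominated _ _ _ P _ _ (fun=> 6 * C)).
  - by move=> n; case: (lW n) => + _ _ _; exact: measurable_shiftX.
  - exact: measurable_shiftX dF.
  - by move=> w; exact: cF.
  - by move=> n w; case: (lW n) => _ _ /(_ (y + X h w)) [].
  - exact: finite_measure_integrable_cst.
have c2 : (fun n => gen nu (Fn n) (gn n) y) @ \oo --> gen nu F f1 y.
  apply: (@Rint_dominated _ _ _ nu _ _ (fun z => @gen_const R * (6 * C) * jump_weight z)).
  - by move=> n; apply: measurable_gen_integrand; case: (lW n) => /derives_measurable.
  - by apply: measurable_gen_integrand; exact: derives_measurable dF.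
  - move=> z; apply: cvgB; first by apply: cvgB; exact: cF.
    by apply: cvgM; [exact: cg|exact: cvg_cst].
  - by move=> n z; exact: gen_integrand_le (C2_lip_bd (lW n)).
  - exact: summZ.
have c3 := cvgB (cvgB c1 (cF y)) (cvgM (@cvg_cst _ h _ _ _) c2).
have c4 : (fun n => `|\int[P]_w Fn n (y + X h w) - Fn n y - h * gen nu (Fn n) (gn n) y|)
    @ \oo --> `|\int[P]_w F (y + X h w) - F y - h * gen nu F f1 y|.
  exact: cvg_norm (c3 _ _ _ _).
have c5 : (fun=> h * (K * (6 * C) * D)) @ \oo --> h * (K * (6 * C) * D).
  exact: cvg_cst.
by apply: ler_cvg_to c4 c5 _; apply: nearW => n; exact: bnd.
Qed.

Lemma generator_uniform C F f1 f2 e : C2_lip C F f1 f2 -> 0 < e ->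
  exists2 h0, 0 < h0 & forall h y, 0 < h <= h0 ->
  `|\int[P]_w F (y + X h w) - F y - h * gen nu F f1 y| <= e * h.
Proof.
move=> lF e0; have C0 := C2_bd_ge0 (C2_lip_bd lF); have K0 := K_ge0.
pose D := e / (K * (6 * C) + 1).
have den : 0 < K * (6 * C) + 1 by have := mulr_ge0 K0 C0; lra.
have D0 : 0 < D by exact: divr_gt0.
have [h0 h00 hh] := small_time_continuity D0.
exists h0 => // h y /andP[hp hle].
apply: le_trans (gen_step y lF (ltW hp) (D := D) _) _.
  by move=> r /andP[r0 rh]; apply: hh; rewrite r0 (le_trans rh).
rewrite [e * h]mulrC; apply: ler_wpM2l; first exact: ltW.
rewrite /D; set q := K * (6 * C) in den *.
rewrite mulrA ler_pdivrMr//.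
by rewrite mulrDr mulr1 [e * _]mulrC; lra.
Qed.

(** Adds a deterministic drift [v] and a discount rate [rho]. All second-order terms in [h] are
    collected in [B * h ^+ 2], and [h0] is chosen without reference to [y]. *)
Lemma generator_drift C F f1 f2 v rho e : C2_lip C F f1 f2 -> 0 < e ->
  exists2 h0, 0 < h0 & forall h y, 0 < h <= h0 ->
  `|expR (- rho * h) * \int[P]_w F (y + v * h + X h w) - F y -
    h * (gen nu F f1 y + v * f1 y - rho * F y)| <= e * h.
Proof.
have arith_A (n1 n2 n3 s1 s2 h x y z : R) : n1 <= x * h -> n2 <= h * y -> n3 <= z * h ->
  s1 <= n1 + n2 -> s2 <= s1 + n3 -> s2 <= (x + y + z) * h by lra.
have arith_T (n1 n2 n3 n4 n5 s1 s2 s3 s4 b1 b3 b4 b5 f : R) : n1 <= b1 -> n2 <= e / 2 * f -> n3 <= b3 ->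
  n4 <= b4 -> n5 <= b5 -> b1 + b3 + b4 + b5 <= e / 2 * f -> s1 <= n1 + n2 -> s2 <= s1 + n3 ->
  s3 <= s2 + n4 -> s4 <= s3 + n5 -> s4 <= e * f by lra.
move=> lF e0; have bF := C2_lip_bd lF; have C0 := C2_bd_ge0 bF; have K0 := K_ge0.
have e20 : 0 < e / 2 by lra.
have [h1 h10 gu] := generator_uniform lF e20.
have E0 : 0 <= expR 1 :> R := expR_ge0 _.
pose A := e / 2 + K * C + C * `|v|.
pose B := expR 1 * rho ^+ 2 * C + C * v ^+ 2 + K * C * `|v| + `|rho| * A.
have A0 : 0 <= A by rewrite /A; have := mulr_ge0 K0 C0; have := mulr_ge0 C0 (normr_ge0 v); lra.
have B0 : 0 <= B.
  have b1 := mulr_ge0 (mulr_ge0 E0 (sqr_ge0 rho)) C0.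
  have b2 := mulr_ge0 C0 (sqr_ge0 v).
  have b3 := mulr_ge0 (mulr_ge0 K0 C0) (normr_ge0 v).
  have b4 := mulr_ge0 (normr_ge0 rho) A0.
  by rewrite /B; lra.
pose h0 := Num.min h1 (Num.min (`|rho| + 1)^-1 (e / 2 / (B + 1))).
have B1 : 0 < B + 1 by lra.
have rho1 : 0 < `|rho| + 1 by rewrite ltr_wpDl.
have h00 : 0 < h0 by rewrite !lt_min h10 invr_gt0 rho1 divr_gt0.
exists h0 => // h y /andP[hp]; rewrite !le_min => /and3P[hh1 hrho hB].
have hge0 := ltW hp.
set a := \int[P]_w _.
have st : `|a - F (y + v * h) - h * gen nu F f1 (y + v * h)| <= e / 2 * h.
  by apply: gu; rewrite hp.
have ga : `|a| <= C.
  apply: Rint_bounded; first by case: bF => + _ _; exact: measurable_shiftX.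
  by move=> w; case: bF => _ _ /(_ (y + v * h + X h w)) [].
have [d1 d2 bb] := bF.
have tF : `|F (y + v * h) - F y - f1 y * (v * h)| <= C * (v * h) ^+ 2.
  by apply: taylor1 d1 d2 _ => u; case: (bb u).
have lFv : `|F (y + v * h) - F y| <= C * `|v| * h.
  apply: le_trans (@lipschitz_of_derive R F f1 C y (y + v * h) d1 _) _.
    by move=> u; case: (bb u).
  by rewrite addrC addKr normrM (ger0_norm hge0) mulrA.
have gv : `|gen nu F f1 (y + v * h) - gen nu F f1 y| <= K * C * `|v| * h.
  rewrite [y + _]addrC; apply: le_trans (gen_increment hW _ _ lF) _.
  rewrite /K; have -> : @gen_const R * (C * Num.min 2 `|v * h|) * jump_mass nu =
    @gen_const R * jump_mass nu * C * Num.min 2 `|v * h| by ring.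
  rewrite -[X in _ <= X]mulrA ler_wpM2l ?mulr_ge0 ?gen_const_ge0 ?jump_mass_ge0//.
  by rewrite ge_min normrM (ger0_norm hge0) lexx orbT.
have gb : `|gen nu F f1 (y + v * h)| <= K * C.
  by apply: le_trans (gen_bound hW _ bF) _; rewrite /K mulrAC.
have rh : `|- rho * h| <= 1.
  rewrite normrM normrN (ger0_norm hge0).
  apply: (@le_trans _ _ ((`|rho| + 1) * (`|rho| + 1)^-1)).
    by apply: ler_pM => //; rewrite lerDl.
  by rewrite mulfV// gt_eqF.
have ex := expR_taylor1 rh.
set E := expR (- rho * h) in ex *.
set g := gen nu F f1 y in gv *; set g' := gen nu F f1 (y + v * h) in st gv gb *.
set F' := F (y + v * h) in st tF lFv *.
have aF : `|a - F y| <= A * h.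
  have -> : a - F y = (a - F' - h * g') + h * g' + (F' - F y) by ring.
  have h2 : `|h * g'| <= h * (K * C) by rewrite normrM (ger0_norm hge0) ler_wpM2l.
  exact: arith_A st h2 lFv (ler_normD (a - F' - h * g') (h * g'))
    (ler_normD (a - F' - h * g' + h * g') (F' - F y)).
have -> : E * a - F y - h * (g + v * f1 y - rho * F y) =
  (E - 1 - - rho * h) * a + (a - F' - h * g') + (F' - F y - f1 y * (v * h)) +
  h * (g' - g) - rho * h * (a - F y) by ring.
have T1 : `|(E - 1 - - rho * h) * a| <= expR 1 * rho ^+ 2 * C * h ^+ 2.
  rewrite normrM; apply: (@le_trans _ _ (expR 1 * (- rho * h) ^+ 2 * C)).
    exact: ler_pM.
  by rewrite exprMn sqrrN le_eqVlt; apply/orP; left; apply/eqP; ring.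
have T2 : `|h * (g' - g)| <= K * C * `|v| * h ^+ 2.
  rewrite normrM (ger0_norm hge0).
  by apply: le_trans (ler_wpM2l hge0 gv) _; rewrite le_eqVlt; apply/orP; left; apply/eqP; ring.
have T3 : `|rho * h * (a - F y)| <= `|rho| * A * h ^+ 2.
  rewrite !normrM (ger0_norm hge0).
  have -> : `|rho| * A * h ^+ 2 = `|rho| * h * (A * h) by ring.
  by rewrite ler_wpM2l// mulr_ge0.
have T4 : `|F' - F y - f1 y * (v * h)| <= C * v ^+ 2 * h ^+ 2.
  by apply: le_trans tF _; rewrite exprMn mulrA.
have Bh : B * h ^+ 2 <= e / 2 * h.
  rewrite expr2 mulrA ler_wpM2r//.
  apply: (@le_trans _ _ ((B + 1) * (e / 2 / (B + 1)))).
    by apply: ler_pM => //; rewrite lerDl.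
  by rewrite mulrC divfK// gt_eqF.
have Be : B * h ^+ 2 = expR 1 * rho ^+ 2 * C * h ^+ 2 + C * v ^+ 2 * h ^+ 2 +
   K * C * `|v| * h ^+ 2 + `|rho| * A * h ^+ 2 by rewrite /B; ring.
set q1 := (E - 1 - - rho * h) * a in T1 *.
set q2 := a - F' - h * g' in st *.
set q3 := F' - F y - f1 y * (v * h) in T4 *.
set q4 := h * (g' - g) in T2 *; set q5 := rho * h * (a - F y) in T3 *.
rewrite Be in Bh.
exact: arith_T T1 st T4 T2 T3 Bh (ler_normD q1 q2) (ler_normD (q1 + q2) q3)
  (ler_normD (q1 + q2 + q3) q4) (ler_normB (q1 + q2 + q3 + q4) q5).
Qed.

End UniformGenerator.

(** * Increments and the augmented filtration *)

Section PiIndependence.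
Context {R : realType} {d : measure_display} {Omega : measurableType d}.
Variable P : probability Omega R.

Lemma pr_fin (A : set Omega) : measurable A -> P A = (fine (P A))%:E.
Proof. by move=> mA; rewrite fineK// fin_num_measure. Qed.

Definition indep (A E : set Omega) : Prop := P (A `&` E) = (P A * P E)%E.

(** The Dynkin argument: for a fixed event [E], the measurable sets independent of [E] form a
    lambda-system. *)
Lemma indep_sigma (C : set (set Omega)) (E : set Omega) :
  measurable E -> setI_closed C ->
  (forall A, C A -> measurable A /\ indep A E) ->
  forall A, <<s C >> A -> measurable A /\ indep A E.
Proof.
move=> mE CI hC A CA.
suff : <<s C >> `<=` [set A | measurable A /\ indep A E] by apply.
apply: lambda_system_subset => //.
apply/dynkin_lambda_system; split.
- by split => //; rewrite /indep setTI probability_setT mul1e.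
- move=> B [mB iB]; split; first exact: measurableC.
  have mBE : measurable (B `&` E) by exact: measurableI.
  have mCE : measurable (~` B `&` E) by apply: measurableI => //; exact: measurableC.
  have e1 : P E = (P (B `&` E) + P (~` B `&` E))%E.
    have dis : (B `&` E) `&` (~` B `&` E) = set0.
      by rewrite setIACA setICr set0I.
    have <- := @measureU _ _ _ P _ _ mBE mCE dis.
    by rewrite -setIUl setUv setTI.
  move: e1; rewrite /indep iB probability_setC// (pr_fin mE) (pr_fin mB) (pr_fin mCE).
  rewrite (_ : (1 - (fine (P B))%:E)%E = (1 - fine (P B))%:E)//.
  by rewrite -!EFinM -!EFinD => -[e1]; congr EFin; lra.
- move=> F tF hF; split; first by apply: bigcupT_measurable => k; case: (hF k).
  have mF k : measurable (F k) by case: (hF k).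
  rewrite /indep setI_bigcupl !measure_bigcup//.
  + rewrite (pr_fin mE) muleC -nneseriesZl//.
    by apply: eq_eseriesr => k _ /=; have [_ iF] := hF k; rewrite iF (pr_fin mE) muleC.
  + by move=> k _; exact: measurableI.
  + exact: trivIset_setIr.
Qed.

Lemma measure_eq_modulo (N A B : set Omega) : measurable N -> P N = 0%E ->
  measurable A -> measurable B -> A `&` ~` N = B `&` ~` N -> P A = P B.
Proof.
move=> mN N0 mA mB AB.
have key (C : set Omega) : measurable C -> P C = P (C `&` ~` N).
  move=> mC; rewrite -[in LHS](setIT C) -(setvU N) setIUr.
  rewrite measureU//.
  - rewrite [X in (_ + X)%E](_ : _ = 0%E) ?adde0//.
    apply/eqP; rewrite eq_le measure_ge0 andbT -N0 le_measure// ?inE//.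
    exact: measurableI.
  - by apply: measurableI => //; exact: measurableC.
  - exact: measurableI.
  - by rewrite setIACA setICl setI0.
by rewrite key// AB -key.
Qed.

End PiIndependence.

Section Increments.
Context {R : realType} {d : measure_display} {Omega : measurableType d}.
Variable P : probability Omega R.
Variable X : R -> Omega -> R.
Hypothesis hX : levy_process P X.
Hypothesis hc : measure_is_complete P.

Let mX t : measurable_fun setT (X t).
Proof. by case: hX. Qed.

Definition incr (s t : R) (w : Omega) : R := X t w - X s w.

Lemma measurable_incr s t : measurable_fun setT (incr s t).
Proof. exact: measurable_funB. Qed.

Lemma preim_measurable (f : Omega -> R) (B : set R) :
  measurable_fun setT f -> measurable B -> measurable (f @^-1` B).
Proof. by move=> mf mB; rewrite -[X in measurable X]setTI; exact: mf. Qed.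

Definition rectangles (tt : nat -> R) (n : nat) : set (set Omega) :=
  [set A | exists2 B : nat -> set R, (forall k, measurable (B k)) &
     A = \bigcap_(k in `I_n) (incr (tt k) (tt k.+1) @^-1` B k)].

Lemma rectanglesI tt n : setI_closed (rectangles tt n).
Proof.
move=> _ _ [B mB ->] [C mC ->]; exists (fun k => B k `&` C k).
  by move=> k; exact: measurableI.
apply/seteqP; split => [w [h1 h2] k kn|w h]; first by split; [exact: h1|exact: h2].
by split => k kn; case: (h k kn).
Qed.

(** The product formula is used twice, for [n] increments and for [n.+1] increments with [E] imposed
    on the last one; the two products differ by exactly one factor. *)
Lemma rectangles_indep tt n (E : set R) : 0 <= tt 0%N ->
  (forall k, tt k <= tt k.+1) -> measurable E ->
  forall A, rectangles tt n A ->
  measurable A /\ indep P A (incr (tt n) (tt n.+1) @^-1` E).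
Proof.
move=> t0 tS mE _ [B mB ->]; split.
  apply: bigcap_measurableType => k _.
  by apply: preim_measurable => //; exact: measurable_incr.
have [_ _ _ _ prod] := hX.
have p1 := prod n tt B t0 tS mB.
pose B' k := if (k < n)%N then B k else E.
have mB' k : measurable (B' k) by rewrite /B'; case: ifP.
have p2 := prod n.+1 tt B' t0 tS mB'.
rewrite /indep.
have -> : \bigcap_(k in `I_n) (incr (tt k) (tt k.+1) @^-1` B k) `&`
     (incr (tt n) (tt n.+1) @^-1` E) =
   \bigcap_(k in `I_n.+1) [set w | B' k (X (tt k.+1) w - X (tt k) w)].
  apply/seteqP; split => [w [h1 h2] k /=|w h].
    rewrite ltnS leq_eqVlt => /orP[/eqP ->|kn]; first by rewrite /B' ltnn.
    by rewrite /B' kn; exact: h1.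
  split => [k /= kn|].
    have := h k (leqW kn : (k < n.+1)%N); by rewrite /= /B' kn.
  by have := h n (ltnSn n); rewrite /= /B' ltnn.
rewrite p2 big_ord_recr/= {2}/B' ltnn; congr (_ * _)%E.
rewrite p1; apply: eq_bigr => i _; by rewrite /B' ltn_ord.
Qed.

Lemma measurable_rect_incr tt n k : (k <= n)%N ->
  measurable_fun setT
    ((fun w => X (tt k) w - X (tt 0%N) w) : g_sigma_algebraType (rectangles tt n) -> R).
Proof.
elim: k => [|k IH] kn.
  have -> : (fun w => X (tt 0%N) w - X (tt 0%N) w) = cst 0 :> (Omega -> R).
    by apply/funext => w; rewrite subrr.
  exact: measurable_cst.
have -> : (fun w => X (tt k.+1) w - X (tt 0%N) w) =
   (fun w => incr (tt k) (tt k.+1) w + (X (tt k) w - X (tt 0%N) w)).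
  by apply/funext => w; rewrite /incr; ring.
apply: measurable_funD; last exact: IH (ltnW kn).
move=> _ E mE; rewrite setTI; apply: sub_sigma_algebra.
exists (fun j => if j == k then E else setT).
  by move=> j; case: ifP.
apply/seteqP; split => [w h j jn|w h]; first by case: ifP => // /eqP ->.
by have := h k kn; rewrite /= eqxx.
Qed.

Definition cyl (l : seq (R * set R)) : set Omega :=
  \big[setI/setT]_(i <- l) (X i.1 @^-1` i.2).

Definition cyls (s : R) : set (set Omega) :=
  [set A | exists2 l : seq (R * set R),
     (forall i, List.In i l -> 0 <= i.1 <= s /\ measurable i.2) & A = cyl l].

Lemma cyls_setI s : setI_closed (cyls s).
Proof.
move=> _ _ [l1 h1 ->] [l2 h2 ->]; exists (l1 ++ l2); last by rewrite /cyl big_cat.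
by move=> i hi; case: (List.in_app_or _ _ _ hi); [exact: h1|exact: h2].
Qed.

Lemma cyls_measurable s A : cyls s A -> measurable A.
Proof.
move=> [l hl ->]; elim: l hl => [|i l IH] hl; first by rewrite /cyl big_nil.
rewrite /cyl big_cons; apply: measurableI.
  by apply: preim_measurable => //; have [|] := hl i; [left|].
by apply: IH => j jl; apply: hl; right.
Qed.

(** The assumption concerns increments, while the filtration is generated by values. Off the null
    set where [X 0] is not 0, a value is the increment from time 0, that is, a sum of increments
    along the sorted times of the cylinder. *)
Lemma cyls_indep s h (E : set R) : 0 <= s -> 0 <= h -> measurable E ->
  forall A, cyls s A -> indep P A (incr s (s + h) @^-1` E).
Proof.
move=> s0 h0 mE A cA; have mA := cyls_measurable cA; case: cA => l hl Al.
pose us := sort <=%R [seq i.1 | i <- l].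
have us_mem u : u \in us -> exists2 i, List.In i l & u = i.1.
  rewrite mem_sort; elim: (l) => //= i l' IH.
  rewrite inE => /orP[/eqP ->|/IH[j jl ->]]; first by exists i => //; left.
  by exists j => //; right.
have us_le u : u \in us -> 0 <= u <= s.
  by move=> /us_mem[i /hl[+ _] ->].
pose n := (size us).+1.
(* Index 0 is time 0, then come the sorted times of the cylinder. At index [n] the sequence
   [0 :: us] is exhausted and the default value of [nth] supplies [s]; later indices give
   [s + h]. *)
pose tt k := if (k <= n)%N then nth s (0 :: us) k else s + h.
have ttn : tt n = s by rewrite /tt leqnn /= nth_default.
have ttn1 : tt n.+1 = s + h by rewrite /tt ltnn.
have srt : sorted <=%R (0 :: us).
  have s1 : sorted <=%R us by apply: sort_sorted; exact: le_total.
  by rewrite /= path_min_sorted//; apply/allP => u /us_le/andP[].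
have tS k : tt k <= tt k.+1.
  rewrite /tt; case: (ltngtP k n) => kn.
  - case: (ltngtP k.+1 n) => kn1; [|by move: kn1; rewrite ltnNge kn|].
      have := sorted_leq_nth le_trans (@lexx _ R) s srt; apply => //; rewrite ?inE//=.
    rewrite kn1 [X in _ <= X]nth_default//.
    have : nth s (0 :: us) k \in 0 :: us by apply: mem_nth; rewrite /= -/n.
    by rewrite inE => /orP[/eqP ->//|/us_le/andP[]].
  - by rewrite ?ltnNge ?(ltnW kn) ?lexx.
  - by rewrite kn nth_default// lerDl.
have tt0 : tt 0%N = 0 by [].
have tk i : List.In i l -> exists2 k, (k <= n)%N & tt k = i.1.
  move=> il; have : i.1 \in us.
    rewrite mem_sort; elim: (l) il => //= j l' IH [->|/IH h1]; rewrite inE ?eqxx//.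
    by rewrite h1 orbT.
  move=> iu; exists (index i.1 us).+1; first by rewrite ltnS ltnW// index_mem.
  by rewrite /tt ltnS ltnW ?index_mem//= nth_index.
(* [A] with each [X i.1] replaced by its increment from time 0; the two events agree off the null
   set and [A'] belongs to the sigma-algebra of the increments. *)
pose A' : set Omega := \big[setI/setT]_(i <- l) ((fun w => X i.1 w - X 0 w) @^-1` i.2).
have sA' : <<s rectangles tt n >> A'.
  rewrite /A'.
  suff : forall l', (forall i, List.In i l' -> List.In i l) ->
     (measurable : set (set (g_sigma_algebraType (rectangles tt n))))
       (\big[setI/setT]_(i <- l') ((fun w => X i.1 w - X 0 w) @^-1` i.2)).
    by apply.
  elim => [|i l' IH] sub; first by rewrite big_nil; exact: measurableT.
  rewrite big_cons; apply: measurableI; last by apply: IH => j jl; apply: sub; right.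
  have il : List.In i l by apply: sub; left.
  have [k kn ek] := tk i il; have [_ mi] := hl i il.
  have := measurable_rect_incr (tt := tt) kn measurableT mi.
  by rewrite setTI ek tt0.
have tt0' : 0 <= tt 0%N by rewrite tt0.
have mY : measurable (incr s (s + h) @^-1` E).
  by apply: preim_measurable => //; exact: measurable_incr.
have rI := rectangles_indep (n := n) tt0' tS mE.
rewrite ttn ttn1 in rI.
have [mA' iA'] := indep_sigma mY (@rectanglesI tt n) rI sA'.
have [_ X0 _ _ _] := hX.
have mN : measurable [set w | X 0 w != 0].
  have -> : [set w | X 0 w != 0] = ~` (X 0 @^-1` [set 0]).
    by apply/seteqP; split => w /= => [/eqP|?]; [|apply/eqP].
  by apply: measurableC; apply: preim_measurable.
have AA' : A `&` ~` [set w | X 0 w != 0] = A' `&` ~` [set w | X 0 w != 0].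
  rewrite Al /A' /cyl; elim: (l) => [|i l' IH]; first by rewrite !big_nil.
  rewrite !big_cons -!setIA IH; apply/seteqP; split => w /= [h1 [h2 /negP/negPn/eqP h3]];
    by split; [move: h1; rewrite h3 subr0|split => //; rewrite h3 eqxx].
rewrite /indep (measure_eq_modulo mN X0 mA mA' AA') -iA'.
apply: measure_eq_modulo mN X0 _ _ _; [exact: measurableI..|].
by rewrite setIAC AA' setIAC.
Qed.

(** Null-set completion at the single time [s]. [usual_filtration] at [t] is the intersection of
    these over [s > t]; independence of the future is proved at this level, without right limits. *)
Definition aug_sigma (s : R) : set (set Omega) :=
  [set A | exists B, natural_sigma X s B /\
     P.-negligible ((A `\` B) `|` (B `\` A))].

Lemma natural_sigma_indep s h (E : set R) : 0 <= s -> 0 <= h -> measurable E ->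
  forall A, natural_sigma X s A ->
    measurable A /\ indep P A (incr s (s + h) @^-1` E).
Proof.
move=> s0 h0 mE A nA.
have mY : measurable (incr s (s + h) @^-1` E).
  by apply: preim_measurable => //; exact: measurable_incr.
apply: (indep_sigma mY (@cyls_setI s)).
  by move=> B cB; split; [exact: cyls_measurable cB|exact: cyls_indep].
suff : natural_sigma X s `<=` <<s cyls s >> by apply.
apply: smallest_sub; first exact: smallest_sigma_algebra.
move=> _ [u [B [us mB ->]]]; apply: sub_sigma_algebra.
exists [:: (u, B)]; last by rewrite /cyl big_seq1.
by move=> i [<-|[]].
Qed.

Lemma natural_sigma_measurable s A : 0 <= s -> natural_sigma X s A -> measurable A.
Proof.
by move=> s0 nA; have [] := natural_sigma_indep s0 (lexx 0) measurableT nA.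
Qed.

(** Completeness of [P] turns the negligible differences into measurable sets. *)
Lemma aug_sigma_measurable s A : 0 <= s -> aug_sigma s A -> measurable A.
Proof.
move=> s0 [B [/(natural_sigma_measurable s0) mB neg]].
have m1 : measurable (A `\` B) by apply: hc; apply: negligibleS neg; exact: subsetUl.
have m2 : measurable (B `\` A) by apply: hc; apply: negligibleS neg; exact: subsetUr.
have -> : A = (B `|` (A `\` B)) `\` (B `\` A).
  apply/seteqP; split => [w Aw|w [[Bw|[Aw _]//] /= h]].
    by split; [case: (pselect (B w)) => h; [left|right]|case].
  by apply: contrapT => nA; apply: h.
by apply: measurableD => //; exact: measurableU.
Qed.

Lemma natural_sigma_aug s A : natural_sigma X s A -> aug_sigma s A.
Proof.
by move=> nA; exists A; split => //; rewrite setDv setU0; exact: negligible_set0.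
Qed.

Lemma natural_sigma_setI s : setI_closed (natural_sigma X s).
Proof.
move=> A B nA nB.
exact: (@measurableI _ (g_sigma_algebraType _) A B nA nB).
Qed.

Lemma aug_sigma_setI s : setI_closed (aug_sigma s).
Proof.
move=> A1 A2 [B1 [n1 g1]] [B2 [n2 g2]]; exists (B1 `&` B2); split.
  exact: natural_sigma_setI.
apply: negligibleS (negligibleU g1 g2) => w /= [[[a1 a2] h]|[[b1 b2] h]].
  case: (pselect (B1 w)) => b1; last by left; left.
  by right; left; split => // b2; apply: h.
case: (pselect (A1 w)) => a1; last by left; right.
by right; right; split => // a2; apply: h.
Qed.

Lemma aug_sigma_indep s h (E : set R) : 0 <= s -> 0 <= h -> measurable E ->
  forall A, aug_sigma s A -> measurable A /\ indep P A (incr s (s + h) @^-1` E).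
Proof.
move=> s0 h0 mE A sA; have mA := aug_sigma_measurable s0 sA.
split => //; case: sA => B [nB [N [mN N0 sub]]].
have [mB iB] := natural_sigma_indep s0 h0 mE nB.
have mY : measurable (incr s (s + h) @^-1` E).
  by apply: preim_measurable => //; exact: measurable_incr.
have AB : A `&` ~` N = B `&` ~` N.
  apply/seteqP; split => w [h1 nN]; split => //; apply: contrapT => h2;
    apply: nN; apply: sub; [by left|by right].
rewrite /indep (measure_eq_modulo mN N0 mA mB AB) -iB.
apply: measure_eq_modulo mN N0 _ _ _; [exact: measurableI..|].
by rewrite setIAC AB setIAC.
Qed.

Lemma levy_stationary s h (B : set R) : 0 <= s -> 0 <= h -> measurable B ->
  P (incr s (s + h) @^-1` B) = P (X h @^-1` B).
Proof. by move=> s0 h0 mB; rewrite /incr [s + h]addrC; have [_ _ _ st _] := hX; exact: st. Qed.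

End Increments.

(** * The Markov property at a fixed time *)

Section Markov.
Context {R : realType} {d : measure_display} {Omega : measurableType d}.
Variable P : probability Omega R.
Variable X : R -> Omega -> R.
Hypothesis hX : levy_process P X.
Hypothesis hc : measure_is_complete P.

Let mX t : measurable_fun setT (X t).
Proof. by case: hX. Qed.

Lemma aug_sigma_gen_indep s h (E : set R) : 0 <= s -> 0 <= h -> measurable E ->
  forall A, <<s aug_sigma P X s >> A ->
    measurable A /\ indep P A (incr X s (s + h) @^-1` E).
Proof.
move=> s0 h0 mE; apply: indep_sigma.
- by apply: preim_measurable => //; apply: measurable_incr hX _ _.
- exact: aug_sigma_setI.
- exact: aug_sigma_indep.
Qed.

Lemma Rint_pushforward (d1 : measure_display) (T1 : measurableType d1)
  (phi : Omega -> T1) (f : T1 -> R) : measurable_fun setT phi ->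
  measurable_fun setT f -> (exists C : R, forall x, `|f x| <= C) ->
  (\int[pushforward P phi]_y (f y)%:E = \int[P]_w (f (phi w))%:E)%E.
Proof.
move=> mphi mf [C fC].
have mF : measurable_fun setT (EFin \o f) by exact/measurable_EFinP.
rewrite (integral_pushforward mphi mF)//.
rewrite preimage_setT.
apply: (@summ_bounded _ _ _ P (f \o phi) C) => [|x]; last exact: fC.
exact: measurableT_comp.
Qed.

Lemma law_increment s h (f : R -> R) : 0 <= s -> 0 <= h ->
  measurable_fun setT f -> (exists C : R, forall x, `|f x| <= C) ->
  \int[P]_w f (incr X s (s + h) w) = \int[P]_w f (X h w).
Proof.
move=> s0 h0 mf bf; rewrite /Rintegral; congr fine.
rewrite -(@Rint_pushforward _ R (incr X s (s + h)) f)//; last exact: measurable_incr hX _ _.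
rewrite -(@Rint_pushforward _ R (X h) f)//.
apply: eq_measure_integral => [|mi B mB _]; first exact: measurable_incr hX _ _.
exact: (levy_stationary hX s0 h0 mB).
Qed.

(** The Lipschitz bound on [F] passes to the mean, so measurability follows from continuity. *)
Lemma measurable_expect_shift h (F : R -> R) (C L : R) : (forall y, `|F y| <= C) ->
  (forall x y, `|F x - F y| <= L * `|x - y|) -> measurable_fun setT F ->
  measurable_fun setT (fun y : R => \int[P]_w F (y + X h w)).
Proof.
move=> bF lF mF.
  apply: continuous_measurable_fun => y.
  have L0 : 0 <= L.
    by have := lF 1 0; rewrite subr0 normr1 mulr1; apply: le_trans.
  apply/cvgrPdist_le => /= e e0.
  exists (e / (L + 1)); first by rewrite /= divr_gt0// ltr_wpDl.
  move=> z /= yz.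
  have sm u : summ P (fun w' => F (u + X h w')).
    apply: (@summ_bounded _ _ _ P _ C) => //.
    by apply: measurableT_comp mF _; apply: measurable_funD.
  rewrite -RintB//; apply: Rint_bounded.
    by apply: measurable_funB; apply: measurableT_comp mF _; apply: measurable_funD.
  move=> w; apply: le_trans (lF _ _) _.
  have -> : y + X h w - (z + X h w) = y - z by ring.
  apply: (@le_trans _ _ ((L + 1) * (e / (L + 1)))).
    by apply: ler_pM => //; [rewrite lerDl|exact: ltW].
  by rewrite mulrC divfK// gt_eqF// ltr_wpDl.
Qed.

(** The past is modelled by [Omega] itself with the sigma-algebra generated by [aug_sigma].
    Independence says that the joint law of the outcome [w] and the increment is a product measure;
    Fubini then integrates out the increment, which has the law of [X h]. *)
Lemma markov_step s h (A : set Omega) (F : R -> R) (C L : R) : 0 <= s -> 0 <= h ->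
  aug_sigma P X s A -> (forall y, `|F y| <= C) ->
  (forall x y, `|F x - F y| <= L * `|x - y|) -> measurable_fun setT F ->
  \int[P]_w (\1_A w * F (X (s + h) w)) =
  \int[P]_w (\1_A w * \int[P]_w' F (X s w + X h w')).
Proof.
move=> s0 h0 sA bF lF mF.
pose G := <<s aug_sigma P X s >>.
(* The same set [Omega] with the coarser sigma-algebra of the past; the identity map to it is the
   random variable that records the past. *)
pose T1 : measurableType _ := g_sigma_algebraType (aug_sigma P X s).
pose Y := incr X s (s + h).
have mY : measurable_fun setT Y by exact: measurable_incr hX _ _.
have mid : measurable_fun setT (id : Omega -> T1).
  move=> _ B mB; rewrite setTI.
  by have [] := aug_sigma_gen_indep s0 (lexx 0) measurableT mB.
pose idf : {mfun Omega >-> T1} := HB.pack (id : Omega -> T1) (isMeasurableFun.Build _ _ _ _ _ mid).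
pose Yf : {mfun Omega >-> R} := HB.pack Y (isMeasurableFun.Build _ _ _ _ _ mY).
pose m1 : probability T1 R := distribution P idf.
pose m2 : probability R R := distribution P Yf.
have mpair : measurable_fun setT ((fun w => (w, Y w)) : Omega -> T1 * R).
  by apply/measurable_fun_pairP; split; [exact: mid|exact: mY].
pose f (z : T1 * R) : R := \1_A z.1 * F (X s z.1 + z.2).
have mXs : measurable_fun setT (X s : T1 -> R).
  move=> _ B mB; rewrite setTI; apply: sub_sigma_algebra.
  apply: natural_sigma_aug; apply: sub_sigma_algebra; exists s, B.
  by rewrite s0 lexx.
have mA1 : measurable_fun setT (\1_A : T1 -> R).
  by apply: measurable_indic; exact: sub_sigma_algebra.
have mf : measurable_fun setT f.
  apply: measurable_funM; first exact: measurableT_comp mA1 _.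
  apply: measurableT_comp mF _; apply: measurable_funD => //.
  exact: measurableT_comp mXs _.
have i01 (w : Omega) : 0 <= (\1_A w : R) <= 1 by rewrite indicE; case: (_ \in _); rewrite ?lexx ?ler01.
have C0 : 0 <= C by apply: le_trans (bF 0).
have bf z : `|f z| <= C.
  rewrite /f normrM; have /andP[i0 i1] := i01 z.1.
  by rewrite (ger0_norm i0) -[C]mul1r ler_pM.
have L1 : (\int[P]_w (\1_A w * F (X (s + h) w))%:E = \int[P]_w (f (w, Y w))%:E)%E.
  apply: eq_integral => w _; rewrite /f /Y /incr/=; congr (_ * F _)%:E; ring.
have L2 := @Rint_pushforward _ (T1 * R)%type (fun w => (w, Y w)) f mpair mf (ex_intro _ C bf).
have L3 : (\int[pushforward P ((fun w => (w, Y w)) : Omega -> T1 * R)]_z (f z)%:E =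
   \int[(m1 \x m2)%E]_z (f z)%:E)%E.
  apply: eq_measure_integral => B mB _; apply/esym.
  apply: (@product_measure_unique _ _ T1 R R m1 m2
    (pushforward P ((fun w => (w, Y w)) : Omega -> T1 * R))) => // A1 B1 mA1' mB1.
  have [_] := aug_sigma_gen_indep s0 h0 mB1 mA1'.
  by rewrite /indep => <-; congr (P _).
have if12 : (m1 \x m2)%E.-integrable setT (EFin \o f).
  apply: (@measurable_bounded_integrable _ _ _ (m1 \x m2)%E) => //.
    have e : ((m1 \x m2) (setT `*` setT) = m1 setT * m2 setT)%E by exact: product_measure1E.
    rewrite setXTT in e; apply: (@le_lt_trans _ _ (m1 [set: T1] * m2 [set: R])%E).
      by rewrite -e.
    by rewrite !probability_setT mule1 ltry.
  exists C; split; first exact: num_real.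
  by move=> M CM z _ /=; apply: le_trans (bf z) (ltW CM).
have L4 := @integral12_prod_meas1 _ _ T1 R R m1 m2 _ if12.
rewrite /Rintegral; congr fine; rewrite L1 -L2 L3 -L4.
have inner (w : T1) : (\int[m2]_y (EFin \o f) (w, y) =
    (\1_A w * \int[P]_w' F (X s w + X h w'))%:E)%E.
  have mg' : measurable_fun setT (fun y => F (X s w + y)).
    by apply: measurableT_comp mF _; apply: measurable_funD.
  have mg : measurable_fun setT (fun y => f (w, y)).
    rewrite /f/=.
    by apply: measurable_funM => //; exact: mg'.
  have := @Rint_pushforward _ R Y (fun y => f (w, y)) mY mg (ex_intro _ C (fun y => bf (w, y))).
  rewrite /m2 /distribution/= => ->.
  have bg' : exists C, forall y, `|F (X s w + y)| <= C by exists C => y.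
  have mgY : measurable_fun setT (fun w' => F (X s w + Y w')) by exact: measurableT_comp mg' mY.
  have sg : summ P (fun w' => F (X s w + Y w')) by apply: (@summ_bounded _ _ _ P _ C).
  rewrite -(@law_increment s h (fun y => F (X s w + y)))// -RintZ// EFin_Rint//.
  exact: summZ.
have mI := measurable_expect_shift h bF lF mF.
pose g (w : T1) := \1_A w * \int[P]_w' F (X s w + X h w').
have mg : measurable_fun setT g.
  by apply: measurable_funM => //; exact: measurableT_comp mI mXs.
transitivity (\int[m1]_w (g w)%:E)%E.
  by apply: eq_integral => w _; exact: inner.
rewrite /m1 /distribution (@Rint_pushforward _ T1 idf g)//.
exists C => w; rewrite /g normrM; have /andP[i0 i1] := i01 w.
rewrite (ger0_norm i0) -[C]mul1r; apply: ler_pM => //.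
apply: Rint_bounded => //.
by apply: measurableT_comp mF _; apply: measurable_funD.
Qed.

End Markov.

(** * Dynkin inequality along a grid *)

Section AugSigma.
Context {R : realType} {d : measure_display} {Omega : measurableType d}.
Variable P : probability Omega R.
Variable X : R -> Omega -> R.

Lemma aug_sigma_setC s A : aug_sigma P X s A -> aug_sigma P X s (~` A).
Proof.
move=> [B [nB gB]]; exists (~` B); split.
  exact: (@measurableC _ (g_sigma_algebraType _) B nB).
apply: negligibleS gB => w /= [[h1 h2]|[h1 h2]].
  by right; split => //; apply: contrapT.
by left; split => //; apply: contrapT.
Qed.

Lemma aug_sigma_bigcup s (A : nat -> set Omega) :
  (forall n, aug_sigma P X s (A n)) -> aug_sigma P X s (\bigcup_n A n).
Proof.
move=> /choice[B hB]; exists (\bigcup_n B n); split.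
  by apply: (@bigcupT_measurable _ (g_sigma_algebraType _)) => n; case: (hB n).
have := negligible_bigcup (fun n => (hB n).2).
apply: negligibleS => w [[[n _ An] h]|[[n _ Bn] h]]; exists n => //.
  by left; split => // Bn; apply: h; exists n.
by right; split => // An; apply: h; exists n.
Qed.

Lemma natural_sigma_mono s t : s <= t -> natural_sigma X s `<=` natural_sigma X t.
Proof.
move=> st; apply: smallest_sub; first exact: smallest_sigma_algebra.
move=> A [u [B [/andP[u0 us] mB ->]]]; apply: sub_sigma_algebra.
by exists u, B; split => //; rewrite u0 (le_trans us).
Qed.

Lemma aug_sigma_mono s t : s <= t -> aug_sigma P X s `<=` aug_sigma P X t.
Proof.
by move=> st A [B [nB g]]; exists B; split => //; exact: natural_sigma_mono nB.
Qed.

Lemma aug_sigma_preimage s u (B : set R) : 0 <= u <= s -> measurable B ->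
  aug_sigma P X s (X u @^-1` B).
Proof.
by move=> us mB; apply: natural_sigma_aug; apply: sub_sigma_algebra; exists u, B.
Qed.

Lemma aug_sigma_set0 s : aug_sigma P X s set0.
Proof. by apply: natural_sigma_aug; exact: (@measurable0 _ (g_sigma_algebraType _)). Qed.

(** The event that [tau] is at least [s] is the complement of a countable union of events about
    times strictly before [s], each known by time [s]. This is how the right limit in the filtration
    is absorbed. *)
Lemma stopping_time_aug (tau : Omega -> R) s : stopping_time P X tau ->
  (forall w, 0 <= tau w) -> aug_sigma P X s [set w | s <= tau w].
Proof.
move=> st t0.
have -> : [set w | s <= tau w] = ~` \bigcup_n [set w | tau w <= s - n.+1%:R^-1].
  apply/seteqP; split => [w /= h [n _ /=]|w /= h].
    by apply/negP; rewrite -ltNge; apply: lt_le_trans h; rewrite ltrBlDr ltrDl invr_gt0.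
  rewrite leNgt; apply/negP => ts; apply: h.
  have d0 : 0 < s - tau w by rewrite subr_gt0.
  exists (Num.trunc (s - tau w)^-1) => //=.
  rewrite lerBrDr -lerBrDl -[leRHS]invrK lef_pV2 ?posrE ?invr_gt0// ltW//.
  by rewrite truncnS_gt.
apply: aug_sigma_setC; apply: aug_sigma_bigcup => n.
have [h|h] := leP 0 (s - n.+1%:R^-1).
  by have := st _ h s; apply; rewrite ltrBlDr ltrDl invr_gt0.
have -> : [set w | tau w <= s - n.+1%:R^-1] = set0.
  by apply/seteqP; split => // w /= h'; have := t0 w; rewrite leNgt (le_lt_trans h' h).
exact: aug_sigma_set0.
Qed.

End AugSigma.

Section DiscreteDynkin.
Context {R : realType} {d : measure_display} {Omega : measurableType d}.
Variable P : probability Omega R.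
Variable X : R -> Omega -> R.
Hypothesis hX : levy_process P X.
Hypothesis hc : measure_is_complete P.

Let mX t : measurable_fun setT (X t).
Proof. by case: hX. Qed.

Variables (C : R) (F f1 f2 : R -> R) (h v rho y0 : R) (q : R -> R) (Q : R).
Hypothesis lF : C2_lip C F f1 f2.
Hypothesis h0 : 0 < h.
Hypothesis mq : measurable_fun setT q.
Hypothesis bq : forall y, `|q y| <= Q.
Hypothesis one_step : forall y,
  expR (- rho * h) * \int[P]_w F (y + v * h + X h w) <= F y + h * q y.

Definition grid_pos (k : nat) (w : Omega) : R :=
  y0 + v * (h * k%:R) + X (h * k%:R) w.

Definition grid_mart (k : nat) (w : Omega) : R :=
  expR (- rho * (h * k%:R)) * F (grid_pos k w).

Lemma measurable_grid_pos k : measurable_fun setT (grid_pos k).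
Proof. by apply: measurable_funD. Qed.

Lemma measurable_grid_F k : measurable_fun setT (fun w => F (grid_pos k w)).
Proof.
apply: measurableT_comp; last exact: measurable_grid_pos.
by case: lF => /derives_measurable.
Qed.

Lemma measurable_grid_mart k : measurable_fun setT (grid_mart k).
Proof. by apply: measurable_funM => //; exact: measurable_grid_F. Qed.

Lemma grid_mart_bound k w : `|grid_mart k w| <= expR (- rho * (h * k%:R)) * C.
Proof.
rewrite normrM (ger0_norm (expR_ge0 _)) ler_wpM2l ?expR_ge0//.
by case: lF => _ _ /(_ (grid_pos k w)) [].
Qed.

Lemma summ_grid_mart k : summ P (grid_mart k).
Proof.
by apply: (@summ_bounded _ _ _ P _ (expR (- rho * (h * k%:R)) * C));
  [exact: measurable_grid_mart|exact: grid_mart_bound].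
Qed.

Lemma summ_indic (A : set Omega) (f : Omega -> R) (B : R) : measurable A ->
  measurable_fun setT f -> (forall w, `|f w| <= B) -> summ P (fun w => \1_A w * f w).
Proof.
move=> mA mf bf; apply: (@summ_bounded _ _ _ P _ B).
  by apply: measurable_funM => //; exact: measurable_indic.
move=> w; have B0 : 0 <= B by apply: le_trans (bf w).
rewrite normrM -[B]mul1r; apply: ler_pM => //.
by rewrite indicE; case: (_ \in _); rewrite ?normr1 ?normr0.
Qed.

Lemma indic_ge0 (A : set Omega) (w : Omega) : 0 <= (\1_A w : R).
Proof. by rewrite indicE; case: (_ \in _). Qed.

(** The Markov property reduces the mean over one grid step to the deterministic inequality
    [one_step], taken at the current position. *)
Lemma dynkin_step k (A : set Omega) : aug_sigma P X (h * k%:R) A ->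
  \int[P]_w (\1_A w * (grid_mart k.+1 w - grid_mart k w)) <=
  h * expR (- rho * (h * k%:R)) * \int[P]_w (\1_A w * q (grid_pos k w)).
Proof.
move=> sA; set s := h * k%:R; set E := expR (- rho * s).
have s0 : 0 <= s by rewrite mulr_ge0// ltW.
have h0' := ltW h0.
have mA : measurable A by apply: (aug_sigma_measurable hX hc s0 sA).
have [dF d1 bF _] := lF.
have mF := derives_measurable dF.
have bF0 u : `|F u| <= C by case: (bF u).
have lipF a b : `|F a - F b| <= C * `|a - b|.
  by apply: lipschitz_of_derive dF _ => u; case: (bF u).
pose c := y0 + v * (s + h).
have sh : h * k.+1%:R = s + h by rewrite /s -natr1 mulrDr mulr1.
have mFc (e : R) : measurable_fun setT (fun x => F (e + x)).
  by apply: measurableT_comp mF _; apply: measurable_funD.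
have mark := @markov_step _ _ _ P X hX hc s h A (fun x => F (c + x)) C C s0 h0' sA
  (fun x => bF0 _) (fun a b => _ : _) (mFc c).
have mg : measurable_fun setT (fun w => q (grid_pos k w)).
  by apply: measurableT_comp mq _; exact: measurable_grid_pos.
have e1 : \int[P]_w (\1_A w * grid_mart k.+1 w) =
    E * (expR (- rho * h) * \int[P]_w (\1_A w * F (c + X (s + h) w))).
  rewrite mulrA -RintZ; last first.
    by apply: (@summ_indic A _ C) => //; exact: measurableT_comp (mFc c) (mX _).
  apply: eq_Rint => w; rewrite /grid_mart /grid_pos sh /E -expRD -/c.
  by rewrite [in RHS]mulrCA; congr (_ * (expR _ * _)); ring.
have sI : summ P (fun w => \1_A w * grid_mart k w).
  by apply: (@summ_indic A _ (E * C)) => //; [exact: measurable_grid_mart|exact: grid_mart_bound].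
have sI1 : summ P (fun w => \1_A w * grid_mart k.+1 w).
  by apply: (@summ_indic A _ (expR (- rho * (h * k.+1%:R)) * C)) => //; [exact: measurable_grid_mart|exact: grid_mart_bound].
have sq : summ P (fun w => \1_A w * q (grid_pos k w)) by apply: (@summ_indic A _ Q).
have -> : \int[P]_w (\1_A w * (grid_mart k.+1 w - grid_mart k w)) =
   \int[P]_w (\1_A w * grid_mart k.+1 w) - \int[P]_w (\1_A w * grid_mart k w).
  by rewrite -RintB//; apply: eq_Rint => w; ring.
rewrite e1 mark; last by move=> a b; rewrite (le_trans (lipF _ _))// opprD addrACA subrr add0r.
have meas_in : measurable_fun setT (fun y : R => \int[P]_w F (c + (y + X h w))).
  apply: (@measurable_expect_shift _ _ _ P X hX h (fun x => F (c + x)) C C) => //.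
  by move=> a b; rewrite (le_trans (lipF _ _))// opprD addrACA subrr add0r.
have sin : summ P (fun w => \1_A w * \int[P]_w' F (c + (X s w + X h w'))).
  apply: (@summ_indic A _ C) => //; first exact: measurableT_comp meas_in (mX s).
  move=> w; apply: Rint_bounded => //.
  by apply: measurableT_comp mF _; apply: measurable_funD => //; apply: measurable_funD.
rewrite -RintZ//.
have le1 w : expR (- rho * h) * (\1_A w * \int[P]_w' F (c + (X s w + X h w'))) <=
     \1_A w * (F (grid_pos k w) + h * q (grid_pos k w)).
  rewrite mulrCA ler_wpM2l ?indic_ge0//.
  apply: le_trans (one_step (grid_pos k w)).
  rewrite ler_wpM2l ?expR_ge0//.
  rewrite le_eqVlt; apply/orP; left; apply/eqP; apply: eq_Rint => w'.
  by rewrite /grid_pos /c -/s; congr F; ring.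
have sF : summ P (fun w => \1_A w * F (grid_pos k w)).
  by apply: (@summ_indic A _ C) => //; exact: measurable_grid_F.
have sFq : summ P (fun w => \1_A w * (F (grid_pos k w) + h * q (grid_pos k w))).
  have -> : (fun w => \1_A w * (F (grid_pos k w) + h * q (grid_pos k w))) =
     (fun w => \1_A w * F (grid_pos k w) + h * (\1_A w * q (grid_pos k w))).
    by apply/funext => w; ring.
  by apply: summD => //; exact: summZ.
have I1 := Rint_le (summZ _ sin) sFq le1.
have I2 : \int[P]_w (\1_A w * (F (grid_pos k w) + h * q (grid_pos k w))) =
   \int[P]_w (\1_A w * F (grid_pos k w)) + h * \int[P]_w (\1_A w * q (grid_pos k w)).
  rewrite -RintZ// -RintD//; last exact: summZ.
  by apply: eq_Rint => w; ring.
have I3 : \int[P]_w (\1_A w * grid_mart k w) = E * \int[P]_w (\1_A w * F (grid_pos k w)).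
  by rewrite -RintZ//; apply: eq_Rint => w; rewrite /grid_mart -/s -/E; ring.
rewrite I3 lerBlDr.
apply: le_trans (ler_wpM2l (expR_ge0 _) (le_trans I1 _)) _; first by rewrite I2.
rewrite -/E; lra.
Qed.

Lemma grid_mart0 : \int[P]_w grid_mart 0 w = F y0.
Proof.
have -> : \int[P]_w grid_mart 0 w = \int[P]_w F y0; last exact: Rint_cst.
rewrite /Rintegral; congr fine.
apply: ae_eq_integral => //.
- by apply/measurable_EFinP; exact: measurable_grid_mart.
- apply: filterS (levy_X0 hX) => w w0 _.
  by rewrite /grid_mart /grid_pos !mulr0 w0 expR0 mul1r !addr0.
Qed.

(** The events [A k] may be any events known at the grid times. A stopping time, a first passage or
    their minimum is encoded by a decreasing family, for which the sum telescopes to the stopped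
    value. *)
Lemma dynkin_sum n (A : nat -> set Omega) :
  (forall k, aug_sigma P X (h * k%:R) (A k)) ->
  \int[P]_w (grid_mart 0 w + \sum_(k < n) \1_(A k) w * (grid_mart k.+1 w - grid_mart k w)) <=
  F y0 + h * \sum_(k < n) expR (- rho * (h * k%:R)) * \int[P]_w (\1_(A k) w * q (grid_pos k w)).
Proof.
move=> sA.
have mA k : measurable (A k).
  by apply: (aug_sigma_measurable hX hc _ (sA k)); rewrite mulr_ge0// ltW.
have si (k : 'I_n) : summ P (fun w => \1_(A k) w * (grid_mart k.+1 w - grid_mart k w)).
  apply: (@summ_indic _ _ (expR (- rho * (h * k.+1%:R)) * C + expR (- rho * (h * k%:R)) * C)) => //.
    by apply: measurable_funB; exact: measurable_grid_mart.
  by move=> w; rewrite (le_trans (ler_normB _ _))// lerD// grid_mart_bound.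
rewrite RintD//; [|exact: summ_grid_mart|exact: summ_sum].
rewrite grid_mart0 lerD2l Rint_sum// mulr_sumr; apply: ler_sum => k _.
by rewrite mulrA; exact: dynkin_step.
Qed.

End DiscreteDynkin.

(** * Growth of kappa *)

Section DensityIntegral.
Context {R : realType} {d : measure_display} {T : measurableType d}.
Variables (nu mu : {measure set T -> \bar R}) (D : set T) (g : T -> R).
Hypothesis mD : measurable D.
Hypothesis mg : measurable_fun D g.
Hypothesis g0 : forall x, D x -> 0 <= g x.
Hypothesis dens : forall A, measurable A -> A `<=` D ->
  (nu A = \int[mu]_(x in A) (g x)%:E)%E.
Import HBNNSimple.

(** A density identity known on sets is extended to functions through simple functions and monotone
    convergence on both sides. *)
Lemma ge0_integral_density (f : T -> R) : measurable_fun D f ->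
  (forall x, D x -> 0 <= f x) ->
  (\int[nu]_(x in D) (f x)%:E = \int[mu]_(x in D) (f x * g x)%:E)%E.
Proof.
move=> mf f0.
have mf' : measurable_fun D (EFin \o f) by exact/measurable_EFinP.
have f0' x : D x -> (0 <= (EFin \o f) x)%E by move=> Dx; rewrite lee_fin f0.
pose f_ := nnsfun_approx mD mf'.
have mfn n : measurable_fun D (f_ n) by exact: measurable_funTS.
have cf x : D x -> (fun n => (f_ n x)%:E) @ \oo --> (f x)%:E.
  by move=> Dx; have := cvg_nnsfun_approx mD mf' f0' Dx.
have nd x : nondecreasing_seq (fun n => f_ n x).
  by move=> m n mn; exact/lefP/nd_nnsfun_approx.
transitivity (limn (fun n => \int[nu]_(x in D) (f_ n x)%:E)%E).
  rewrite -monotone_convergence//.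
  - by apply: eq_integral => x /[!inE] Dx; apply/esym/cvg_lim => //; exact: cf.
  - by move=> n; exact/measurable_EFinP.
  - by move=> n x _; rewrite lee_fin.
  - by move=> x _ m n mn; rewrite lee_fin; exact: nd.
transitivity (limn (fun n => \int[mu]_(x in D) (f_ n x * g x)%:E)%E); last first.
  rewrite -monotone_convergence//.
  - apply: eq_integral => x /[!inE] Dx; apply/cvg_lim => //.
    rewrite EFinM; under eq_fun do rewrite EFinM.
    by apply: cvgeZr => //; exact: cf.
  - by move=> n; apply/measurable_EFinP; exact: measurable_funM.
  - by move=> n x Dx; rewrite lee_fin mulr_ge0// g0.
  - by move=> x Dx m n mn; rewrite lee_fin ler_wpM2r ?g0//; exact: nd.
congr (limn _); apply/funext => n.
transitivity (\sum_(k \in range (f_ n)) (k%:E * nu (D `&` (f_ n @^-1` [set k]))))%E.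
  under eq_integral do rewrite fimfunE -fsumEFin//.
  rewrite ge0_integral_fsum//; last 2 first.
  - by move=> y; exact/measurable_EFinP/measurable_funTS/measurable_funM.
  - by move=> y x _; rewrite nnfun_muleindic_ge0.
  apply: eq_fsbigr => r _.
  by rewrite integralZl_indic_nnsfun// integral_indic//= setIC.
transitivity (\sum_(k \in range (f_ n))
    \int[mu]_(x in D) (k * \1_(f_ n @^-1` [set k]) x * g x)%:E)%E.
  apply: eq_fsbigr => r rn.
  have r0 : 0 <= r by move: rn; rewrite inE => -[x _ <-].
  have mr : measurable (f_ n @^-1` [set r]) by exact: measurable_sfunP.
  rewrite dens; [|exact: measurableI|exact: subIsetl].
  rewrite -ge0_integralZl//.
  - rewrite integral_mkcondr; apply: eq_integral => x _; rewrite patchE indicE.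
    have [xr|xr] := boolP (x \in _); first by rewrite mulr1 EFinM.
    by rewrite mulr0 mul0r.
  - apply: (@measurable_funS _ _ _ _ D) => //; exact/measurable_EFinP.
  - by move=> x [Dx _]; rewrite lee_fin g0.
rewrite -ge0_integral_fsum//.
- apply: eq_integral => x _; rewrite fsumEFin//; congr EFin.
  by rewrite [in RHS]fimfunE mulr_fsuml.
- move=> r; apply/measurable_EFinP; apply: measurable_funM => //.
  by apply: measurable_funTS; exact: measurable_funM.
- move=> r x Dx; have := nnfun_muleindic_ge0 (f_ n) r x; rewrite -EFinM !lee_fin => h.
  by apply: mulr_ge0 => //; exact: g0.
Qed.

End DensityIntegral.

Section LebesgueScale.
Context {R : realType}.
Local Notation leb := (@lebesgue_measure R).

(** The image of the Lebesgue measure under multiplication by [u], multiplied by [u], agrees with it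
    on half-open intervals, hence everywhere. *)
Lemma ge0_integral_scale (u : R) (f : R -> R) : 0 < u ->
  measurable_fun setT f -> (forall x, 0 <= f x) ->
  (\int[leb]_x (f (u * x))%:E = (u^-1)%:E * \int[leb]_x (f x)%:E)%E.
Proof.
move=> u0 mf f0.
have ui0 : 0 <= u^-1 by rewrite invr_ge0 ltW.
have ms : measurable_fun setT (fun x : R => u * x) by exact: measurable_funM.
have mF : measurable_fun setT (EFin \o f) by exact/measurable_EFinP.
have pre (a b : R) : (fun x : R => u * x) @^-1` `]a, b] = `](a / u), (b / u)]%classic.
  apply/seteqP; split => x /=; rewrite !in_itv/=.
    by rewrite ltr_pdivrMr// ler_pdivlMr// ![x * u]mulrC.
  by rewrite ltr_pdivrMr// ler_pdivlMr// ![x * u]mulrC.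
pose ph : measurableTypeR R -> measurableTypeR R := fun x => u * x.
have mph : measurable_fun setT ph by [].
pose pm0 : {measure set (measurableTypeR R) -> \bar R} := pushforward leb ph.
pose pm := pm0 mph.
have un0 : 0 <= u by exact: ltW.
pose sm : {measure set (measurableTypeR R) -> \bar R} := mscale (NngNum un0) pm.
have key A : measurable A -> leb A = sm A.
  apply: lebesgue_measure_unique => _ [[a b] _ <-] /=.
  have -> : sm `]a, b]%classic = (u%:E * leb (ph @^-1` `]a, b]%classic))%E by [].
  rewrite /ph pre !lebesgue_measure_itv/=.
  rewrite !lte_fin ltr_pM2r ?invr_gt0//; case: ifPn => ab; last by rewrite mule0.
  by rewrite -!EFinB -EFinM; congr EFin; field; rewrite gt_eqF.
have h1 : (\int[pm]_x (f x)%:E = \int[leb]_x (f (u * x))%:E)%E.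
  rewrite /pm /pm0 (@ge0_integral_pushforward _ _ _ _ R ph mph leb setT (EFin \o f))//.
  by move=> x _; rewrite lee_fin.
rewrite -h1.
have h2 : (\int[leb]_x (f x)%:E = u%:E * \int[pm]_x (f x)%:E)%E.
  rewrite -(@ge0_integral_mscale _ _ R pm setT measurableT (NngNum un0) (EFin \o f) mF)//; last first.
    by move=> x _; rewrite lee_fin.
  by apply: eq_measure_integral => A mA _; exact: key.
by rewrite h2 muleA -EFinM mulVf ?gt_eqF// mul1e.
Qed.

Lemma ge0_integral_reflect (f : R -> R) (a : R) :
  measurable_fun setT f -> (forall x, 0 <= f x) ->
  (\int[leb]_(x in `]a, 0%R[%classic) (f (- x)%R)%:E = \int[leb]_(x in `]0%R, (- a)%R[%classic) (f x)%:E)%E.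
Proof.
move=> mf f0.
have mF : measurable_fun setT (EFin \o f) by exact/measurable_EFinP.
pose ph : measurableTypeR R -> measurableTypeR R := -%R.
have mph : measurable_fun setT ph by apply: continuous_measurable_fun; exact: opp_continuous.
rewrite (_ : `]a, 0%R[%classic = ph @^-1` `]0%R, (- a)%R[%classic); last first.
  by rewrite opp_preimage_itvbndbnd opprK oppr0.
transitivity (\int[pushforward leb ph]_(x in `]0%R, (- a)%R[%classic) (f x)%:E)%E.
  rewrite (@ge0_integral_pushforward _ _ _ _ R ph mph leb `]0%R, (- a)%R[%classic (EFin \o f))//.
    exact: measurable_funTS.
  by move=> x _; rewrite lee_fin.
by apply: eq_measure_integral => A mA _; exact: lebesgue_measureN.
Qed.

End LebesgueScale.

(** * The Gamma integral behind the constant *)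

Section GammaConstant.
Context {R : realType}.
Local Notation leb := (@lebesgue_measure R).

(** Taylor's formula with integral remainder for the exponential, one half of the Fubini argument
    below; [F] is an explicit antiderivative of the integrand on ]0, x]. *)
Lemma integral_expR_tail (x : R) : 0 < x ->
  (\int[leb]_(t in `]0%R, +oo[%classic) (Num.max (x - t) 0 * expR (- t))%:E =
   (expR (- x) - 1 + x)%:E)%E.
Proof.
move=> x0.
rewrite integral_mkcond.
rewrite (_ : restrict _ _ = (fun t => ((x - t) * expR (- t))%:E) \_ `]0, x]%classic); last first.
  apply/funext => t; rewrite /restrict.
  have [t1|t1] := boolP (t \in `]0, x]%classic).
    move: (t1); rewrite inE/= in_itv/= => /andP[t2 t3].
    by rewrite ifT ?inE/= ?in_itv/= ?t2// max_l// subr_ge0.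
  case: ifPn => //; rewrite inE/= in_itv/= andbT => t2.
  move: t1; rewrite notin_setE/= in_itv/= t2/= => /negP; rewrite -ltNge => xt.
  by rewrite max_r ?mul0r// subr_le0 ltW.
pose f1 (t : R) := (x - t) * expR (- t).
pose F (t : R) := (t + (1 - x)) * expR (- t).
have dN : derives (fun t : R => expR (- t)) (fun t => - expR (- t)).
  have h := derives_comp (@derives_expR R) (@derives_mul_add R (- 1) 0).
  apply: derives_ext h _ _ => t /=; rewrite ?mulrN1 ?mulN1r ?addr0//.
have dF : derives F f1.
  have h1 : derives (fun t : R => t + (1 - x)) (fun=> 1).
    have h := @derives_mul_add R 1 (1 - x).
    by apply: derives_ext h _ _ => t; rewrite ?mul1r.
  by apply: derives_eq (derivesM h1 dN) _ => t; rewrite /f1/=; ring.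
have df1 : derives f1 (fun t => (x - t) * - expR (- t) - 1 * expR (- t)).
  have h1 : derives (fun t : R => x - t) (fun=> - 1).
    have h := @derives_mul_add R (- 1) x.
    by apply: derives_ext h _ _ => t; rewrite ?mulN1r 1?addrC.
  by apply: derives_eq (derivesM h1 dN) _ => t /=; ring.
rewrite -integral_mkcond (_ : (fun t => _) = EFin \o f1)//.
rewrite integral_itv_obnd_cbnd; last first.
  by apply/measurable_EFinP/measurable_funTS; exact: derives_measurable df1.
rewrite (@continuous_FTC2 _ f1 F)//.
- by rewrite /F -EFinB; congr EFin; rewrite oppr0 expR0; ring.
- by apply: continuous_subspaceT; exact: derives_continuous df1.
- split.
  + by move=> t _; case: (dF t).
  + by apply: cvg_at_right_filter; exact: (@derives_continuous R _ _ dF 0).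
  + by apply: cvg_at_left_filter; exact: (@derives_continuous R _ _ dF x).
- by move=> t _; rewrite derive1E; exact: (@derive_val _ _ _ _ _ _ _ (dF t)).
Qed.

Variable alpha : R.
Hypothesis alpha1 : 1 < alpha.

Lemma powR_cvgy (p : R) : 0 < p -> (x `^ (- p)) @[x --> +oo] --> (0 : R).
Proof.
move=> p0; apply/cvgrPdist_le => e e0.
have a0 : 0 < e `^ (- p^-1) by exact: powR_gt0.
near=> x.
have xa : e `^ (- p^-1) <= x by near: x; exact: nbhs_pinfty_ge.
rewrite sub0r normrN ger0_norm ?powR_ge0// powRN.
have x0 : 0 < x by exact: lt_le_trans xa.
rewrite -[leRHS]invrK lef_pV2 ?posrE ?powR_gt0// ?invr_gt0//.
have := @ge0_ler_powR _ p (ltW p0) (e `^ (- p^-1)) x.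
rewrite !nnegrE (ltW a0) (ltW x0) => /(_ isT isT xa).
by rewrite -powRrM mulNr mulVf ?gt_eqF// powR_inv1 ?(ltW e0).
Unshelve. all: by end_near. Qed.

Lemma powR_mul_base (x p : R) : 0 < x -> x * x `^ p = x `^ (1 + p).
Proof.
by move=> x0; rewrite -{1}[x]powRr1 ?ltW// -powRD// (gt_eqF x0) implybT.
Qed.

Lemma is_derive_powR (p x : R) : 0 < x ->
  is_derive x (1 : R) (fun y => y `^ p) (p * x `^ (p - 1)).
Proof. by move=> x0; exact: is_derive1_powR. Qed.

Lemma integral_powR_tail (t : R) : 0 < t ->
  (\int[leb]_(x in `]0%R, +oo[%classic) (Num.max (x - t) 0 * x `^ (- (1 + alpha)))%:E =
   (t `^ (1 - alpha) / (alpha * (alpha - 1)))%:E)%E.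
Proof.
move=> t0.
pose f1 (x : R) := x `^ (- alpha) - t * x `^ (- (1 + alpha)).
rewrite integral_mkcond.
rewrite (_ : restrict _ _ = (fun x => (f1 x)%:E) \_ `[t, +oo[%classic); last first.
  apply/funext => x; rewrite /restrict.
  have [t1|t1] := boolP (x \in `[t, +oo[%classic).
    move: (t1); rewrite inE/= in_itv/= andbT => t2.
    have x0 : 0 < x by exact: lt_le_trans t2.
    rewrite ifT ?inE/= ?in_itv/= ?andbT// max_l ?subr_ge0// /f1 mulrBl.
    congr (_ - _)%:E; rewrite powR_mul_base//.
    by congr (_ `^ _); ring.
  case: ifPn => //; rewrite inE/= in_itv/= andbT => t2.
  move: t1; rewrite notin_setE/= in_itv/= andbT => /negP; rewrite -ltNge => xt.
  by rewrite max_r ?mul0r// subr_le0 ltW.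
rewrite -integral_mkcond.
pose F (x : R) := (1 - alpha)^-1 * x `^ (1 - alpha) + (t / alpha) * x `^ (- alpha).
have alpha1' := alpha1; have a1 : 1 - alpha != 0 by lra.
have an0 : alpha != 0 by lra.
have dF (x : R) : 0 < x -> is_derive x (1 : R) F (f1 x).
  move=> x0.
  have h1 := is_deriveZ (1 - alpha)^-1 (is_derive_powR (1 - alpha) x0).
  have h2 := is_deriveZ (t / alpha) (is_derive_powR (- alpha) x0).
  apply: is_derive_eq (is_deriveD h1 h2) _.
  rewrite /GRing.scale/= /f1 !mulrA mulVf// mul1r.
  have -> : t / alpha * - alpha = - t by field.
  rewrite mulNr; congr (_ `^ _ - _ * _ `^ _); ring.
have cf1 (x : R) : 0 < x -> {for x, continuous f1}.
  move=> x0.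
  have h1 := is_derive_powR (- alpha) x0.
  have h2 := is_deriveZ t (is_derive_powR (- (1 + alpha)) x0).
  have := is_deriveB h1 h2.
  by case=> h _; apply: differentiable_continuous; exact/derivable1_diffP.
rewrite (_ : (fun x => _) = EFin \o f1)//.
rewrite (@ge0_continuous_FTC2y _ f1 F t 0).
- rewrite /F sub0e -EFinN; congr EFin.
  have -> : t `^ (1 - alpha) = t * t `^ (- alpha).
    by rewrite powR_mul_base.
  by field; rewrite an0 a1; lra.
- move=> x tx; have x0 : 0 < x by exact: lt_le_trans tx.
  rewrite /f1 subr_ge0.
  have -> : x `^ (- alpha) = x * x `^ (- (1 + alpha)).
    rewrite powR_mul_base//.
    by congr (_ `^ _); ring.
  by rewrite ler_wpM2r ?powR_ge0.
- apply/continuous_within_itvcyP; split.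
    by move=> x; rewrite in_itv/= andbT => tx; apply: cf1; exact: lt_trans tx.
  by apply: cvg_at_right_filter; exact: cf1.
- rewrite -[X in _ --> X]addr0 -[X in _ --> X + _](mulr0 (1 - alpha)^-1) -[X in _ --> _ + X](mulr0 (t / alpha)).
  apply: cvgD; apply: cvgMr => //.
    have -> : 1 - alpha = - (alpha - 1) by ring.
    by apply: powR_cvgy; lra.
  by apply: powR_cvgy; lra.
- by move=> x tx; case: (dF x (lt_trans t0 tx)).
- apply: cvg_at_right_filter; case: (dF t t0) => h _.
  by apply: differentiable_continuous; exact/derivable1_diffP.
- move=> x; rewrite in_itv/= andbT => tx; rewrite derive1E.
  exact: (@derive_val _ _ _ _ _ _ _ (dF x (lt_trans t0 tx))).
Qed.

(** The double integral of (x - t)_+ e^(-t) x^(-1 - alpha) is computed in both orders. Tonelli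
    applies without knowing that either side is finite. *)
Lemma integral_exp2_powR :
  (\int[leb]_(x in `]0%R, +oo[%classic) ((expR (- x) - 1 + x) * x `^ (- (1 + alpha)))%:E =
   ((alpha * (alpha - 1))^-1)%:E *
   \int[leb]_(t in `]0%R, +oo[%classic) (t `^ (2 - alpha - 1) * expR (- t))%:E)%E.
Proof.
set D := `]0%R, +oo[%classic.
have mD : measurable D by exact: measurable_itv.
have h1 := alpha1; have c0 : 0 <= (alpha * (alpha - 1))^-1 by rewrite invr_ge0 mulr_ge0//; lra.
have mpow (p : R) : measurable_fun setT (fun x : R => x `^ p) by exact: measurable_powR.
have mexpN : measurable_fun setT (fun x : R => expR (- x)).
  by apply: measurableT_comp => //; exact: measurable_funN.
pose g (z : R * R) := \1_D z.1 * \1_D z.2 *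
   (Num.max (z.1 - z.2) 0 * expR (- z.2) * z.1 `^ (- (1 + alpha))).
have mg : measurable_fun setT g.
  apply: measurable_funM.
    by apply: measurable_funM; apply: measurableT_comp => //; exact: measurable_indic.
  apply: measurable_funM; last exact: (measurableT_comp (mpow _)).
  apply: measurable_funM; last exact: (measurableT_comp mexpN).
  by apply: measurable_maxr => //; exact: measurable_funB.
have g0 z : 0 <= g z.
  by rewrite /g !mulr_ge0 ?powR_ge0 ?expR_ge0// ?le_max ?lexx ?orbT// indicE.
have mEg : measurable_fun setT (EFin \o g) by exact/measurable_EFinP.
have g0' z : (0 <= (EFin \o g) z)%E by rewrite lee_fin.
have E1 : (\int[leb]_x \int[leb]_y (EFin \o g) (x, y) =
   \int[leb]_(x in D) ((expR (- x) - 1 + x) * x `^ (- (1 + alpha)))%:E)%E.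
  rewrite [RHS]integral_mkcond; apply: eq_integral => x _.
  rewrite /restrict; case: ifPn => xD; last first.
    apply: integral0_eq => y _ /=; rewrite /g/= indicE (negbTE xD) !mul0r//.
  have x0 : 0 < x by move: xD; rewrite inE /D/= in_itv/= andbT.
  transitivity (\int[leb]_(y in D) ((x `^ (- (1 + alpha)))%:E * (Num.max (x - y) 0 * expR (- y))%:E))%E.
    rewrite [RHS]integral_mkcond; apply: eq_integral => y _.
    rewrite /restrict /g/= !indicE xD; case: ifPn => yD; last by rewrite mulr0 !mul0r.
    by rewrite -EFinM (_ : true%:R = 1 :> R)// !mul1r mulrC.
  rewrite ge0_integralZl//.
  - by rewrite integral_expR_tail// -EFinM mulrC.
  - apply/measurable_EFinP/measurable_funTS; apply: measurable_funM => //.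
    by apply: measurable_maxr => //; exact: measurable_funB.
  - by move=> y _; rewrite lee_fin mulr_ge0 ?expR_ge0// le_max lexx orbT.
  - by rewrite lee_fin powR_ge0.
apply: etrans (esym E1) (etrans (@fubini_tonelli _ _ _ _ R leb leb (EFin \o g) mEg g0') _).
rewrite -ge0_integralZl//.
- rewrite [RHS]integral_mkcond; apply: eq_integral => t _.
  rewrite /restrict; case: ifPn => tD; last first.
    by apply: integral0_eq => y _ /=; rewrite /g/= !indicE (negbTE tD) mulr0 !mul0r.
  have t0 : 0 < t by move: tD; rewrite inE /D/= in_itv/= andbT.
  transitivity (\int[leb]_(y in D) ((expR (- t))%:E * (Num.max (y - t) 0 * y `^ (- (1 + alpha)))%:E))%E.
    rewrite [RHS]integral_mkcond; apply: eq_integral => y _.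
    rewrite /restrict /g/= !indicE tD; case: ifPn => yD; last by rewrite !mul0r.
    by rewrite -EFinM (_ : true%:R = 1 :> R)// !mul1r mulrCA mulrA.
  rewrite ge0_integralZl//.
  - rewrite integral_powR_tail// -!EFinM; congr EFin.
    have -> : 2 - alpha - 1 = 1 - alpha by ring.
    by ring.
  - apply/measurable_EFinP/measurable_funTS; apply: measurable_funM => //.
    by apply: measurable_maxr => //; exact: measurable_funB.
  - by move=> y _; rewrite lee_fin mulr_ge0 ?powR_ge0// le_max lexx orbT.
- by apply/measurable_EFinP/measurable_funTS; exact: measurable_funM.
- by move=> y _; rewrite lee_fin mulr_ge0 ?powR_ge0 ?expR_ge0.
Qed.

End GammaConstant.

Definition exp2 {R : realType} (x : R) : R := expR x - 1 - x.

Section Exp2.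
Context {R : realType}.

Lemma exp2_ge0 (x : R) : 0 <= exp2 x.
Proof. exact: expR1Dx_le. Qed.

Lemma exp2_le_lin (x : R) : x <= 0 -> exp2 x <= - x.
Proof. by move=> x0; have : expR x <= 1 by [rewrite -expR0 ler_expR]; rewrite /exp2; lra. Qed.

Lemma exp2_le_sqr (x : R) : x <= 0 -> exp2 x <= expR 1 * x ^+ 2.
Proof.
move=> x0; have e1 : 1 <= expR 1 :> R by have := expR_ge1Dx (1 : R); lra.
have [x1|x1] := lerP `|x| 1.
  by apply: le_trans (expR_taylor1 x1); exact: ler_norm.
apply: le_trans (exp2_le_lin x0) _.
move: x1; rewrite ler0_norm// => x1; nra.
Qed.

Lemma derives_exp2 : derives (@exp2 R) (fun x => expR x - 1).
Proof.
have h1 := @derives_expR R.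
have h2 := @derives_mul_add R 1 1.
by apply: derives_ext (derivesB h1 h2) _ _ => x; rewrite /exp2 ?mul1r//; ring.
Qed.

Lemma measurable_exp2 : measurable_fun setT (@exp2 R).
Proof. exact: derives_measurable derives_exp2. Qed.

Lemma powR_small (p e : R) : 0 < p -> 0 < e ->
  exists2 u0, 1 <= u0 & forall u : R, u0 <= u -> u `^ (- p) <= e.
Proof.
move=> p0 e0; have := @powR_cvgy R p p0.
move/cvgrPdist_le => /(_ _ e0) [M [_ hM]].
exists (Num.max 1 (M + 1)); first by rewrite le_max lexx.
move=> u; rewrite ge_max => /andP[u1 Mu].
have := hM u; rewrite sub0r normrN ger0_norm ?powR_ge0//; apply.
by apply: lt_le_trans Mu; lra.
Qed.

End Exp2.

Section KappaAsymptotics.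
Context {R : realType}.
Local Notation leb := (@lebesgue_measure R).
Variables (nu : {measure set R -> \bar R}) (eta : R -> R) (a0 alpha eta0 : R).
Hypothesis hW : summ nu (@jump_weight R).
Hypotheses (a0_lt0 : a0 < 0) (alpha_gt1 : 1 < alpha) (alpha_lt2 : alpha < 2).
Hypothesis meta : measurable_fun `[a0, 0[%classic eta.
Hypothesis eta_pos : forall y, a0 <= y -> y < 0 -> 0 < eta y.
Hypothesis eta_cvg : eta y @[y --> 0^'-] --> eta0.
Hypothesis eta0_gt0 : 0 < eta0.
Hypothesis dens : forall A : set R, measurable A -> A `<=` `]a0, 0[%classic ->
  (nu A = \int[leb]_(y in A) (eta y / `|y| `^ (1 + alpha))%:E)%E.

Definition kappa (u : R) : R := \int[nu]_z (\1_(`]a0, 0[%classic) z * exp2 (u * z)).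
Definition kappa_const : R := eta0 * Gamma (2 - alpha) / (alpha * (alpha - 1)).

(** The integral defining [kappa] with the pure power density, reflected to the positive axis. It
    stays in the extended reals because its finiteness is only derived later. *)
Definition stable_moment (D : set R) (u : R) : \bar R :=
  (\int[leb]_(x in D) (exp2 (- (u * x)) * x `^ (- (1 + alpha)))%:E)%E.

Lemma measurable_powRl (p : R) : measurable_fun setT (fun x : R => x `^ p).
Proof. exact: measurable_powR. Qed.

Lemma measurable_stable_integrand (u : R) : measurable_fun setT (fun x : R => exp2 (- (u * x)) * x `^ (- (1 + alpha))).
Proof.
apply: measurable_funM => //; apply: measurableT_comp; first exact: measurable_exp2.
by apply: measurableT_comp => //; exact: measurable_funM.
Qed.

Lemma stable_integrand_ge0 (u x : R) : 0 <= exp2 (- (u * x)) * x `^ (- (1 + alpha)).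
Proof. by rewrite mulr_ge0 ?exp2_ge0 ?powR_ge0. Qed.

(** Beyond [M] the integrand [exp2] is at most [u * x], which is at most [2 * u * (x - M / 2)]; the
    truncated power integral at [M / 2] then applies. The growth in [u] is only linear. *)
Lemma stable_moment_tail (u M : R) : 0 <= u -> 0 < M ->
  (stable_moment `[M, +oo[%classic u <= (2 * u * ((M / 2) `^ (1 - alpha) / (alpha * (alpha - 1))))%:E)%E.
Proof.
move=> u0 M0.
have M20 : 0 < M / 2 by lra.
rewrite EFinM -(integral_powR_tail alpha_gt1 M20).
have mg : measurable_fun setT (fun x : R => Num.max (x - M / 2) 0 * x `^ (- (1 + alpha))).
  by apply: measurable_funM => //; apply: measurable_maxr => //; exact: measurable_funB.
have g0 (x : R) : 0 <= Num.max (x - M / 2) 0 * x `^ (- (1 + alpha)).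
  by rewrite mulr_ge0 ?powR_ge0// le_max lexx orbT.
rewrite -ge0_integralZl//; last 3 first.
- exact/measurable_EFinP/measurable_funTS.
- by move=> x _; rewrite lee_fin.
- by rewrite lee_fin mulr_ge0.
rewrite /stable_moment.
apply: (@le_trans _ _ (\int[leb]_(x in `[M, +oo[%classic) ((2 * u)%:E * (Num.max (x - M / 2) 0 * x `^ (- (1 + alpha)))%:E))%E).
  apply: ge0_le_integral => //.
  - by move=> x _; rewrite lee_fin stable_integrand_ge0.
  - by apply/measurable_EFinP/measurable_funTS; exact: measurable_stable_integrand.
  - by apply/measurable_EFinP/measurable_funTS; exact: measurable_funM.
  move=> x; rewrite /= in_itv/= andbT => Mx.
  rewrite -EFinM lee_fin mulrA ler_wpM2r ?powR_ge0//.
  have ux : - (u * x) <= 0 by rewrite oppr_le0 mulr_ge0//; lra.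
  apply: le_trans (exp2_le_lin ux) _; rewrite opprK -mulrA mulrCA ler_wpM2l//.
  by rewrite max_l; lra.
apply: ge0_subset_integral => //.
- by apply/measurable_EFinP/measurable_funTS; exact: measurable_funM.
- by move=> x _; rewrite -EFinM lee_fin mulr_ge0// mulr_ge0.
- by move=> x; rewrite /= !in_itv/= !andbT; exact: lt_le_trans.
Qed.

Lemma stable_moment_split (u M : R) : 0 < M ->
  (stable_moment `]0%R, +oo[%classic u = stable_moment `]0%R, M[%classic u + stable_moment `[M, +oo[%classic u)%E.
Proof.
move=> M0; rewrite /stable_moment -ge0_integral_setU//=.
- congr (integral _ _ _); apply/seteqP; split => x /=; rewrite !in_itv/= !andbT.
    by move=> x0; case: (ltP x M) => xM; [left|right]; rewrite ?x0.
  by case=> [/andP[]//|]; exact: lt_le_trans.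
- by apply/measurable_EFinP/measurable_funTS; exact: measurable_stable_integrand.
- by move=> x _; rewrite lee_fin stable_integrand_ge0.
- apply/disj_setPS => x [] /=; rewrite !in_itv/= andbT => /andP[_ xM] Mx.
  by move: xM; rewrite ltNge Mx.
Qed.

Lemma stable_moment_scale (u : R) : 0 < u ->
  (stable_moment `]0%R, +oo[%classic u = (u `^ alpha)%:E * stable_moment `]0%R, +oo[%classic 1)%E.
Proof.
move=> u0.
pose D : set R := `]0%R, +oo[%classic.
have mD : measurable D by exact: measurable_itv.
pose f (x : R) : R := \1_D x * (exp2 (- (1 * x)) * x `^ (- (1 + alpha))).
have mf : measurable_fun setT f.
  by apply: measurable_funM; [exact: measurable_indic|exact: measurable_stable_integrand].
have f0 x : 0 <= f x by rewrite /f mulr_ge0 ?stable_integrand_ge0// indicE.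
have := ge0_integral_scale u0 mf f0.
have -> : (\int[leb]_x (f x)%:E = stable_moment D 1)%E.
  rewrite /stable_moment [RHS]integral_mkcond; apply: eq_integral => x _.
  by rewrite /restrict /f indicE; case: (x \in D); rewrite ?mul1r ?mul0r.
have -> : (\int[leb]_x (f (u * x))%:E = (u `^ (- (1 + alpha)))%:E * stable_moment D u)%E.
  transitivity (\int[leb]_(x in D) ((u `^ (- (1 + alpha)))%:E *
      (exp2 (- (u * x)) * x `^ (- (1 + alpha)))%:E))%E; last first.
    rewrite ge0_integralZl//.
    - by apply/measurable_EFinP/measurable_funTS; exact: measurable_stable_integrand.
    - by move=> x _; rewrite lee_fin stable_integrand_ge0.
    - by rewrite lee_fin powR_ge0.
  rewrite [RHS]integral_mkcond; apply: eq_integral => x _.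
  rewrite /restrict /f indicE.
  have -> : (u * x \in D) = (x \in D).
    by apply/idP/idP; rewrite !inE /D/= !in_itv/= !andbT pmulr_rgt0.
  case: ifPn => xD; last by rewrite mul0r.
  have x0 : 0 < x by move: xD; rewrite inE /D/= in_itv/= andbT.
  rewrite -EFinM powRM ?ltW// !mul1r; congr EFin.
  by rewrite [RHS]mulrCA [in RHS]mulrA -mulrA.
move=> h.
have : ((u `^ (1 + alpha))%:E * ((u `^ (- (1 + alpha)))%:E * stable_moment D u) =
        (u `^ (1 + alpha))%:E * ((u^-1)%:E * stable_moment D 1))%E by rewrite h.
rewrite !muleA -!EFinM -powRD; last by rewrite (gt_eqF u0) implybT.
rewrite subrr powRr0 mul1e => ->; congr (EFin _ * _)%E.
have -> : u^-1 = u `^ (- 1) by rewrite powR_inv1// ltW.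
by rewrite -powRD ?(gt_eqF u0) ?implybT//; congr (_ `^ _); ring.
Qed.

Lemma kappa_near0 (e dl : R) : 0 < e < 1 -> 0 < dl -> dl <= - a0 ->
  (forall y, - dl < y -> y < 0 -> `|eta y - eta0| <= e * eta0) ->
  forall u, 0 <= u ->
  (((1 - e) * eta0)%:E * stable_moment `]0%R, dl[%classic u <=
   \int[nu]_(z in `](- dl)%R, 0%R[%classic) (exp2 (u * z))%:E)%E /\
  (\int[nu]_(z in `](- dl)%R, 0%R[%classic) (exp2 (u * z))%:E <=
    ((1 + e) * eta0)%:E * stable_moment `]0%R, dl[%classic u)%E.
Proof.
move=> /andP[e0 e1] d0 da he u u0.
set D := `](- dl)%R, 0%R[%classic.
have mD : measurable D by exact: measurable_itv.
have DA : D `<=` `]a0, 0[%classic.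
  by move=> z; rewrite /D/= !in_itv/= => /andP[z1 ->]; rewrite andbT; lra.
pose g (y : R) := eta y / `|y| `^ (1 + alpha).
have mg : measurable_fun D g.
  apply: measurable_funM.
    apply: measurable_funS meta => //.
    move=> z; rewrite /D/= !in_itv/= => /andP[z1 ->]; rewrite andbT; lra.
  have -> : (fun y : R => (`|y| `^ (1 + alpha))^-1) = (fun y => `|y| `^ (- (1 + alpha))).
    by apply/funext => y; rewrite powRN.
  apply: measurable_funTS; apply: (measurableT_comp (measurable_powRl _)).
  exact: normr_measurable.
have g0 y : D y -> 0 <= g y.
  move=> Dy; rewrite /g mulr_ge0 ?invr_ge0 ?powR_ge0// ltW// eta_pos//.
    by move: (DA _ Dy); rewrite /= in_itv/= => /andP[/ltW].
  by move: Dy; rewrite /D/= in_itv/= => /andP[].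
have dens' A : measurable A -> A `<=` D -> (nu A = \int[leb]_(x in A) (g x)%:E)%E.
  by move=> mA AD; apply: dens => //; exact: subset_trans DA.
have mF : measurable_fun setT (fun z => exp2 (u * z)).
  by apply: measurableT_comp; [exact: measurable_exp2|exact: measurable_funM].
have mF' : measurable_fun D (fun z => exp2 (u * z)) by exact: measurable_funTS.
have F0 y : D y -> 0 <= exp2 (u * y) by move=> _; exact: exp2_ge0.
(* Transports [nu] along the identity to the version of the line that carries the Lebesgue measure,
   so that both measures live on the same measurable type. *)
pose ph : R -> measurableTypeR R := id.
have mph : measurable_fun setT ph by move=> _ B mB; rewrite setTI.
have mFE : measurable_fun D (EFin \o (fun z => exp2 (u * z))) by exact/measurable_EFinP.
have nuE : (\int[nu]_(z in D) (exp2 (u * z))%:E = \int[pushforward nu ph]_(z in D) (exp2 (u * z))%:E)%E.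
  rewrite (@ge0_integral_pushforward _ _ _ _ R ph mph nu D (EFin \o (fun z => exp2 (u * z))))//.
  by move=> x _; rewrite lee_fin exp2_ge0.
have nuD : (\int[pushforward nu ph]_(z in D) (exp2 (u * z))%:E = \int[leb]_(z in D) (exp2 (u * z) * g z)%:E)%E.
  by apply: ge0_integral_density.
rewrite nuE nuD {nuE nuD mFE mph ph dens'}.
pose f (x : R) := exp2 (- (u * x)) * `|x| `^ (- (1 + alpha)).
have mf : measurable_fun setT f.
  apply: measurable_funM.
    apply: measurableT_comp; first exact: measurable_exp2.
    by apply: measurableT_comp => //; exact: measurable_funM.
  by apply: (measurableT_comp (measurable_powRl _)); exact: normr_measurable.
have f0 x : 0 <= f x by rewrite /f mulr_ge0 ?exp2_ge0 ?powR_ge0.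
have JE : (stable_moment `]0%R, dl[%classic u = \int[leb]_(x in D) (f (- x)%R)%:E)%E.
  transitivity (\int[leb]_(x in `]0%R, (- - dl)%R[%classic) (f x)%:E)%E; last first.
    exact/esym/(ge0_integral_reflect (- dl) mf f0).
  rewrite opprK /stable_moment; apply: eq_integral => x.
  rewrite inE/= in_itv/= => /andP[x0 _]; by rewrite /f gtr0_norm.
rewrite JE {JE}; split.
  rewrite -ge0_integralZl//; last 3 first.
  - by apply/measurable_EFinP/measurable_funTS; apply: measurableT_comp => //; exact: measurable_funN.
  - by move=> x _; rewrite lee_fin.
  - by rewrite lee_fin mulr_ge0//; [lra|exact: ltW].
  apply: ge0_le_integral => //.
  - by move=> x _; rewrite -EFinM lee_fin mulr_ge0// mulr_ge0//; [lra|exact: ltW].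
  - apply/measurable_EFinP/measurable_funTS; apply: measurable_funM => //.
    by apply: measurableT_comp => //; exact: measurable_funN.
  - by apply/measurable_EFinP; exact: measurable_funM.
  move=> y Dy; rewrite -EFinM lee_fin /f /g mulrN opprK normrN powRN mulrCA.
  rewrite ler_wpM2l ?exp2_ge0// ler_wpM2r ?invr_ge0 ?powR_ge0//.
  move: Dy; rewrite /D/= in_itv/= => /andP[y1 y2].
  by have := he y y1 y2; rewrite ler_norml; lra.
rewrite -ge0_integralZl//; last 3 first.
- by apply/measurable_EFinP/measurable_funTS; apply: measurableT_comp => //; exact: measurable_funN.
- by move=> x _; rewrite lee_fin.
- by rewrite lee_fin mulr_ge0//; [lra|exact: ltW].
apply: ge0_le_integral => //.
- by move=> x Dx; rewrite lee_fin mulr_ge0// ?g0// exp2_ge0.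
- by apply/measurable_EFinP; exact: measurable_funM.
- apply/measurable_EFinP/measurable_funTS; apply: measurable_funM => //.
  by apply: measurableT_comp => //; exact: measurable_funN.
move=> y Dy; rewrite -EFinM lee_fin /f /g mulrN opprK normrN powRN [leRHS]mulrCA.
rewrite ler_wpM2l ?exp2_ge0// ler_wpM2r ?invr_ge0 ?powR_ge0//.
move: Dy; rewrite /D/= in_itv/= => /andP[y1 y2].
by have := he y y1 y2; rewrite ler_norml; lra.
Qed.

Lemma summ_exp2 (A : set R) (u : R) : measurable A -> A `<=` `]a0, 0[%classic ->
  0 <= u -> summ nu (fun z => \1_A z * exp2 (u * z)).
Proof.
move=> mA AD u0.
apply: (summ_le _ _ (summZ (expR 1 * u ^+ 2 * (1 + a0 ^+ 2)) hW)).
  apply: measurable_funM; first exact: measurable_indic.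
  by apply: measurableT_comp; [exact: measurable_exp2|exact: measurable_funM].
move=> z; have e0 : 0 < expR 1 :> R by exact: expR_gt0.
have W0 := jump_weight_ge0 z.
have c0 : 0 <= expR 1 * u ^+ 2 by rewrite mulr_ge0 ?sqr_ge0// ltW.
rewrite indicE; case: (boolP (z \in A)) => zA; last first.
  by rewrite mul0r normr0 mulr_ge0// mulr_ge0// addr_ge0// sqr_ge0.
rewrite mul1r ger0_norm ?exp2_ge0//.
move: zA; rewrite inE => /AD; rewrite /= in_itv/= => /andP[z1 z2].
have uz : u * z <= 0 by rewrite mulr_ge0_le0// ltW.
apply: le_trans (exp2_le_sqr uz) _.
rewrite exprMn mulrA -[leRHS]mulrA ler_wpM2l//.
have h1 : Num.min 1 (z ^+ 2) <= jump_weight z.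
  by rewrite /jump_weight lerDl le_max lexx orbT.
have h2 : z ^+ 2 <= (1 + a0 ^+ 2) * Num.min 1 (z ^+ 2).
  have zz : z ^+ 2 <= a0 ^+ 2.
    by rewrite -[z ^+ 2]sqrrN -[a0 ^+ 2]sqrrN lerXn2r ?nnegrE//; move: (a0_lt0); lra.
  rewrite /Num.min; case: ifPn => h; first by rewrite mulr1; lra.
  by rewrite mulrDl mul1r lerDl mulr_ge0 ?sqr_ge0.
apply: le_trans h2 _; by rewrite ler_wpM2l// addr_ge0// sqr_ge0.
Qed.

Lemma kappa_away0 (dl : R) : 0 < dl ->
  exists2 C : R, 0 <= C & forall u, 0 <= u ->
    \int[nu]_z (\1_(`]a0, (- dl)%R]%classic) z * exp2 (u * z)) <= C * u.
Proof.
move=> d0.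
set A : set R := `]a0, (- dl)%R]%classic.
have mA : measurable A by exact: measurable_itv.
have AD : A `<=` `]a0, 0[%classic.
  by move=> z; rewrite /A/= !in_itv/= => /andP[->]; move: (d0) => d0' ? /=; lra.
pose k := (- a0) / Num.min 1 (dl ^+ 2).
have m0 : 0 < Num.min 1 (dl ^+ 2) by rewrite lt_min ltr01 exprn_gt0.
have k0 : 0 <= k by rewrite divr_ge0// ?ltW//; rewrite oppr_gt0.
exists (k * jump_mass nu); first by rewrite mulr_ge0// jump_mass_ge0.
move=> u u0; have -> : k * jump_mass nu * u = \int[nu]_z (u * k * jump_weight z).
  by rewrite RintZ; [rewrite /jump_mass; ring|exact: hW].
apply: Rint_le; [exact: summ_exp2|exact: summZ|move=> z].
have W0 := jump_weight_ge0 z.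
rewrite indicE; case: (boolP (z \in A)) => zA; last first.
  by rewrite mul0r mulr_ge0// mulr_ge0.
rewrite mul1r.
move: (zA); rewrite inE => /AD; rewrite /= in_itv/= => /andP[z1 z2].
move: zA; rewrite inE /A/= in_itv/= => /andP[_ z3].
have uz : u * z <= 0 by rewrite mulr_ge0_le0// ltW.
apply: le_trans (exp2_le_lin uz) _.
have h1 : Num.min 1 (dl ^+ 2) <= jump_weight z.
  apply: (@le_trans _ _ (Num.min 1 (z ^+ 2))).
    by rewrite le_min ge_min lexx/= ge_min; apply/orP; right; rewrite -[z ^+ 2]sqrrN lerXn2r ?nnegrE//; lra.
  by rewrite /jump_weight lerDl le_max lexx orbT.
have h2 : - a0 <= k * jump_weight z.
  rewrite /k mulrAC ler_pdivlMr// ler_wpM2l//; first by rewrite oppr_ge0 ltW.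
by rewrite -mulrN -mulrA ler_wpM2l//; lra.
Qed.

Lemma eta_near0 (e : R) : 0 < e -> exists2 dl, 0 < dl <= - a0 &
  forall y, - dl < y -> y < 0 -> `|eta y - eta0| <= e * eta0.
Proof.
move=> e0; have a00 := a0_lt0.
have ee : 0 < e * eta0 by rewrite mulr_gt0.
have /cvgrPdist_le /(_ _ ee) := eta_cvg.
rewrite near_withinE => /nbhs_ballP [dl /= d0 h].
exists (Num.min dl (- a0)).
  by rewrite lt_min d0 ge_min lexx orbT andbT/= oppr_gt0.
move=> y; rewrite ltrNl lt_min => /andP[y1 y2] y0; rewrite distrC; apply: h => //.
by rewrite /ball/= sub0r normrN ltr0_norm.
Qed.

Lemma EFin_Rint_indic (A : set R) (f : R -> R) : summ nu (fun z => \1_A z * f z) ->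
  ((\int[nu]_z (\1_A z * f z))%:E = \int[nu]_(z in A) (f z)%:E)%E.
Proof.
move=> h; rewrite EFin_Rint// [RHS]integral_mkcond; apply: eq_integral => z _.
by rewrite /restrict indicE; case: (z \in A); rewrite ?mul1r ?mul0r.
Qed.

Lemma stable_moment_ge0 (D : set R) u : (0 <= stable_moment D u)%E.
Proof. by apply: integral_ge0 => x _; rewrite lee_fin stable_integrand_ge0. Qed.

Lemma stable_moment_gamma : (stable_moment `]0%R, +oo[%classic 1 =
  ((alpha * (alpha - 1))^-1)%:E *
   \int[leb]_(t in `]0%R, +oo[%classic) (t `^ (2 - alpha - 1) * expR (- t))%:E)%E.
Proof.
rewrite -(integral_exp2_powR alpha_gt1); apply: eq_integral => x _.
by rewrite mul1r /exp2 opprK.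
Qed.

Lemma stable_moment_near0_fin (e dl : R) u : 0 < e < 1 -> 0 < dl -> dl <= - a0 ->
  (forall y, - dl < y -> y < 0 -> `|eta y - eta0| <= e * eta0) -> 0 <= u ->
  (stable_moment `]0%R, dl[%classic u < +oo)%E.
Proof.
move=> e01 d0 da he u0.
have [h _] := kappa_near0 e01 d0 da he u0.
have k0 : 0 < (1 - e) * eta0 by rewrite mulr_gt0//; move: e01; lra.
have mD : measurable (`](- dl)%R, 0%R[%classic : set R) by exact: measurable_itv.
have DA : `](- dl)%R, 0%R[%classic `<=` `]a0, 0[%classic.
  by move=> z; rewrite /= !in_itv/= => /andP[z1 ->]; rewrite andbT; lra.
have := EFin_Rint_indic (summ_exp2 mD DA u0) => E.
move: h; rewrite -E; have := stable_moment_ge0 `]0%R, dl[%classic u.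
case: (stable_moment _ _) => [x _ _|_|]//; first by rewrite ltry.
by rewrite mulry gtr0_sg// mul1e.
Qed.

(** Finiteness is inherited from [nu]: near 0 the integral is controlled by one against the Lévy
    measure, and the rest by the tail bound. Positivity is read off the Gamma integrand on ]0,
    1]. *)
Lemma stable_moment_fin_gt0 : exists2 k : R, 0 < k & stable_moment `]0%R, +oo[%classic 1 = k%:E.
Proof.
have [dl /andP[d0 da] he] : exists2 dl, 0 < dl <= - a0 &
  forall y, - dl < y -> y < 0 -> `|eta y - eta0| <= 2^-1 * eta0 by apply: eta_near0; lra.
have e01 : 0 < (2^-1 : R) < 1 by lra.
have hf := stable_moment_near0_fin e01 d0 da he ler01.
have ht := stable_moment_tail ler01 d0.
have ltK : (stable_moment `]0%R, +oo[%classic 1 < +oo)%E.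
  by rewrite (stable_moment_split _ d0) lte_add_pinfty// (le_lt_trans ht)// ltry.
have g0 : (0 < stable_moment `]0%R, +oo[%classic 1)%E.
  rewrite stable_moment_gamma mule_gt0//.
    by rewrite lte_fin invr_gt0 mulr_gt0//; move: (alpha_gt1); lra.
  apply: (@lt_le_trans _ _ (expR (- 1))%:E); first by rewrite lte_fin expR_gt0.
  apply: (@le_trans _ _ (\int[leb]_(t in `]0%R, 1%R]%classic) (expR (- 1))%:E)%E).
    by rewrite integral_cst// /= lebesgue_measure_itv/= lte_fin ltr01 -EFinB subr0 mule1.
  have mf : measurable_fun setT (fun t : R => t `^ (2 - alpha - 1) * expR (- t)).
    apply: measurable_funM => //; apply: measurableT_comp => //; exact: measurable_funN.
  apply: (@le_trans _ _ (\int[leb]_(t in `]0%R, 1%R]%classic) (t `^ (2 - alpha - 1) * expR (- t))%:E)%E).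
    apply: ge0_le_integral => //.
    - by apply/measurable_EFinP/measurable_funTS.
    move=> t; rewrite /= in_itv/= => /andP[t0 t1]; rewrite lee_fin.
    rewrite -[leLHS]mul1r ler_pM ?expR_ge0//; last by rewrite ler_expR; lra.
    have -> : 2 - alpha - 1 = - (alpha - 1) by ring.
    rewrite powRN invf_ge1 ?powR_gt0//.
    have [h1 h2] : 0 <= alpha - 1 /\ 0 <= t by split; [move: (alpha_gt1); lra|exact: ltW].
    have := @ge0_ler_powR R (alpha - 1) h1 t 1; rewrite powR1 !nnegrE; exact.
  apply: ge0_subset_integral => //.
  - exact/measurable_EFinP/measurable_funTS.
  - by move=> x _; rewrite lee_fin mulr_ge0 ?powR_ge0 ?expR_ge0.
  - by move=> x; rewrite /= !in_itv/= andbT => /andP[].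
move: ltK g0; case: (stable_moment _ _) => [k _|//|//].
by rewrite lte_fin => k0; exists k.
Qed.

Lemma kappa_split (dl u : R) : 0 < dl <= - a0 -> 0 <= u ->
  kappa u = \int[nu]_z (\1_(`](- dl)%R, 0%R[%classic) z * exp2 (u * z)) +
            \int[nu]_z (\1_(`]a0, (- dl)%R]%classic) z * exp2 (u * z)).
Proof.
move=> /andP[d0 da] u0.
rewrite -RintD; last 2 first.
- apply: summ_exp2 => // z; rewrite /= !in_itv/= => /andP[z1 ->]; rewrite andbT; lra.
- apply: summ_exp2 => // z; rewrite /= !in_itv/= => /andP[-> z1]/=; lra.
apply: eq_Rint => z; rewrite -mulrDl !indicE; congr (_ * _).
rewrite !mem_setE !in_itv/=.
case: (ltP a0 z) => h1; case: (ltP z 0) => h2; case: (ltP (- dl) z) => h3 //=; rewrite ?addr0 ?add0r//; exfalso; lra.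
Qed.

(** Half of the tolerance [e] goes to the oscillation of [eta] near 0. The other half covers two
    terms of linear growth, the jumps away from 0 and the tail missing from the exact scaling. *)
Lemma kappa_asymp : 0 < kappa_const /\
  forall e, 0 < e < 1 -> exists2 u0, 1 <= u0 & forall u, u0 <= u ->
  (1 - e) * kappa_const * u `^ alpha <= kappa u <= (1 + e) * kappa_const * u `^ alpha.
Proof.
have arith_bounds (E e j t x A B Cu Tu k : R) : 0 <= E -> 0 < e -> e < 1 -> j + t = x * k ->
    (1 - e / 2) * E * j <= A -> A <= (1 + e / 2) * E * j -> 0 <= B -> B <= Cu -> 0 <= t -> t <= Tu ->
    Cu + E * Tu <= e / 2 * (E * k) * x -> (1 - e) * (E * k) * x <= A + B <= (1 + e) * (E * k) * x.
  move=> E0 e0 e1 jt n1 n2 B0 B1 t0 t1 small.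
  have h1 : (1 - e / 2) * E * j + (1 - e / 2) * (E * t) = (1 - e / 2) * (E * k) * x.
    by rewrite -mulrA -mulrDr -mulrDr jt; ring.
  have h2 : (1 + e / 2) * E * j + (1 + e / 2) * (E * t) = (1 + e / 2) * (E * k) * x.
    by rewrite -mulrA -mulrDr -mulrDr jt; ring.
  have h3 := ler_wpM2l E0 t1; have h4 := mulr_ge0 E0 t0; have h5 := mulr_ge0 (ltW e0) h4.
  by apply/andP; split; lra.
have a1 := alpha_gt1.
have [k k0 hk] := stable_moment_fin_gt0.
have aa : 0 < alpha * (alpha - 1) by rewrite mulr_gt0//; lra.
have kE : kappa_const = eta0 * k.
  rewrite /kappa_const /Gamma.
  have -> : (\int[leb]_(t in `]0%R, +oo[%classic) (t `^ (2 - alpha - 1) * expR (- t))%:E =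
    (alpha * (alpha - 1) * k)%:E)%E.
    by rewrite EFinM -hk stable_moment_gamma muleA -EFinM mulfV ?mul1e// gt_eqF.
  by rewrite /= mulrCA mulrC mulKf// gt_eqF.
have c0 : 0 < kappa_const by rewrite kE mulr_gt0.
split=> // e /andP[e0 e1].
have [dl /andP[d0 da] he] : exists2 dl, 0 < dl <= - a0 &
  forall y, - dl < y -> y < 0 -> `|eta y - eta0| <= (e / 2) * eta0 by apply: eta_near0; lra.
have e01 : 0 < e / 2 < 1 by lra.
have [C C0 hC] := kappa_away0 d0.
pose Tl := 2 * ((dl / 2) `^ (1 - alpha) / (alpha * (alpha - 1))).
have T0 : 0 <= Tl by rewrite /Tl mulr_ge0// divr_ge0 ?powR_ge0// ltW.
have ap : 0 < alpha - 1 by lra.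
have pp : 0 < e / 2 * kappa_const / (C + eta0 * Tl + 1).
  have h1 : 0 <= eta0 * Tl by rewrite mulr_ge0// ltW.
  by apply: divr_gt0; [apply: mulr_gt0 => //; lra|lra].
have [u0 u01 hu] := powR_small ap pp.
exists u0 => // u uu; have u1 : 1 <= u by exact: le_trans uu.
have ugt0 : 0 < u by lra.
have ua : 0 <= u `^ alpha by exact: powR_ge0.
have small : (C + eta0 * Tl) * u <= e / 2 * kappa_const * u `^ alpha.
  have {1}-> : u = u `^ alpha * u `^ (- (alpha - 1)).
    rewrite -powRD ?(gt_eqF ugt0) ?implybT//; have -> : alpha - (alpha - 1) = 1 by ring.
    by rewrite powRr1// ltW.
  rewrite mulrCA mulrC ler_wpM2r//.
  have h0 : 0 <= C + eta0 * Tl by rewrite addr_ge0// mulr_ge0// ltW.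
  apply: le_trans (ler_wpM2l h0 (hu u uu)) _.
  have h1 : 0 <= e / 2 * kappa_const by apply: mulr_ge0; [lra|exact: ltW].
  rewrite mulrCA -[leRHS]mulr1 ler_wpM2l//.
  by rewrite ler_pdivrMr; lra.
have uge0 := ltW ugt0.
have [n1 n2] := kappa_near0 e01 d0 da he uge0.
have jf := stable_moment_near0_fin e01 d0 da he uge0.
have j0 := stable_moment_ge0 `]0%R, dl[%classic u.
have hs := stable_moment_split u d0.
rewrite stable_moment_scale// hk -EFinM in hs.
have ht := stable_moment_tail uge0 d0.
have t0 := stable_moment_ge0 `[dl, +oo[%classic u.
have mD : measurable (`](- dl)%R, 0%R[%classic : set R) by exact: measurable_itv.
have DA : `](- dl)%R, 0%R[%classic `<=` `]a0, 0[%classic.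
  by move=> z; rewrite /= !in_itv/= => /andP[z1 ->]; rewrite andbT; lra.
rewrite -(EFin_Rint_indic (summ_exp2 mD DA uge0)) in n1 n2.
rewrite (@kappa_split dl u) ?d0//.
have B1 := hC u uge0.
have B0 : 0 <= \int[nu]_z (\1_(`]a0, (- dl)%R]%classic) z * exp2 (u * z)).
  by apply: Rintegral_ge0 => z _; rewrite mulr_ge0 ?exp2_ge0// indicE.
move: (\int[nu]_z (\1_(`]a0, (- dl)%R]%classic) z * exp2 (u * z))) B0 B1 => B B0 B1.
move: (\int[nu]_z _) n1 n2 => A n1 n2.
move: (stable_moment `[dl, +oo[%classic u) ht t0 hs => [t||]; last 2 first.
- by rewrite leye_eq.
- by rewrite leeNy_eq.
rewrite !lee_fin => t1 t0.
move: (stable_moment `]0%R, dl[%classic u) jf j0 n1 n2 => [j||//]; last first.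
  by rewrite ltxx.
rewrite -!EFinM !lee_fin => _ j0 n1 n2 [hs].
have hT : 2 * u * ((dl / 2) `^ (1 - alpha) / (alpha * (alpha - 1))) = Tl * u by rewrite /Tl; ring.
rewrite hT {hT} in t1; clearbody Tl.
rewrite kE in small *.
rewrite [(C + eta0 * Tl) * u]mulrDl -mulrA in small.
exact: arith_bounds (ltW eta0_gt0) e0 e1 (esym hs) n1 n2 B0 B1 t0 t1 small.
Qed.

End KappaAsymptotics.

(** * Small-time lower tail *)

Section FixedTimeDynkin.
Context {R : realType} {d : measure_display} {Omega : measurableType d}.
Variable P : probability Omega R.
Variable X : R -> Omega -> R.
Variable nu : {measure set R -> \bar R}.
Hypothesis hX : levy_process P X.
Hypothesis hc : measure_is_complete P.
Hypothesis hchar : levy_char P X nu.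
Hypothesis hW : summ nu (@jump_weight R).

(** A bound on the generator is turned into a bound at time [T]. The one-step error is at most
    [e / T] per unit of time, so it totals at most [e] on [0, T], and [e] is arbitrary. Only a bound
    on the mean of [q] along the path is required. *)
Lemma dynkin_fixed C (F f1 f2 q : R -> R) (v rho Q D T y0 : R) :
  C2_lip C F f1 f2 -> measurable_fun setT q -> (forall y, `|q y| <= Q) ->
  (forall y, gen nu F f1 y + v * f1 y - rho * F y <= q y) ->
  0 <= rho -> 0 < T -> 0 <= D ->
  (forall t, 0 <= t <= T -> \int[P]_w q (y0 + v * t + X t w) <= D) ->
  expR (- rho * T) * \int[P]_w F (y0 + v * T + X T w) <= F y0 + T * D.
Proof.
move=> lF mq bq hq r0 T0 D0 hD; apply/ler_addgt0Pr => e e0.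
have e'0 : 0 < e / T by rewrite divr_gt0.
have [h0 h00 hg] := generator_drift hX hchar hW v rho lF e'0.
pose n := (Num.truncn (T / h0)).
have nT : T / h0 < n.+1%:R by rewrite truncnS_gt.
pose h := T / n.+1%:R.
have n0 : (0 : R) < n.+1%:R by rewrite ltr0n.
have hp : 0 < h by rewrite divr_gt0.
have hh : h <= h0 by rewrite /h ler_pdivrMr// mulrC -ler_pdivrMr// ltW.
have hn : h * n.+1%:R = T by rewrite /h divfK// gt_eqF.
have one y : expR (- rho * h) * \int[P]_w F (y + v * h + X h w) <= F y + h * (q y + e / T).
  have := hg h y; rewrite hp hh => /(_ isT); rewrite ler_norml => /andP[_ h1].
  have h2 : h * (gen nu F f1 y + v * f1 y - rho * F y) <= h * q y by rewrite ler_wpM2l// ltW.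
  by lra.
have mq' : measurable_fun setT (fun y => q y + e / T) by exact: measurable_funD.
have bq' y : `|q y + e / T| <= Q + e / T.
  by rewrite (le_trans (ler_normD _ _))// lerD// ger0_norm// ltW.
have sT k : aug_sigma P X (h * k%:R) setT.
  by rewrite -setC0; apply: aug_sigma_setC; exact: aug_sigma_set0.
have := @dynkin_sum _ _ _ P X hX hc C F f1 f2 h v rho y0 _ _ lF hp mq' bq' one n.+1 (fun=> setT) sT.
have -> : \int[P]_w (grid_mart X F h v rho y0 0 w +
   \sum_(k < n.+1) \1_setT w * (grid_mart X F h v rho y0 k.+1 w - grid_mart X F h v rho y0 k w)) =
   expR (- rho * T) * \int[P]_w F (y0 + v * T + X T w).
  rewrite -RintZ; last first.
    case: (lF) => dF _ bF _.
    apply: (@summ_bounded _ _ _ P _ C); last by move=> w; case: (bF (y0 + v * T + X T w)).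
    apply: measurableT_comp; first exact: derives_measurable dF.
    by apply: measurable_funD => //; exact: (levy_measurable hX).
  apply: eq_Rint => w.
  under eq_bigr do rewrite indicT mul1r.
  rewrite -(big_mkord xpredT (fun k => grid_mart X F h v rho y0 k.+1 w - grid_mart X F h v rho y0 k w)).
  by rewrite telescope_sumr// addrC subrK /grid_mart /grid_pos hn.
move/le_trans; apply; rewrite -addrA lerD2l.
apply: (@le_trans _ _ (h * \sum_(k < n.+1) (D + e / T))); last first.
  rewrite sumr_const card_ord -mulr_natr.
  have -> : h * ((D + e / T) * n.+1%:R) = (h * n.+1%:R) * (D + e / T) by ring.
  by rewrite hn mulrDr mulrCA mulfV ?gt_eqF// mulr1.
rewrite ler_wpM2l ?(ltW hp)//; apply: ler_sum => k _.
have D'0 : 0 <= D + e / T by rewrite addr_ge0// ltW.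
have kT : 0 <= h * k%:R <= T.
  rewrite mulr_ge0 ?(ltW hp)//= -hn ler_wpM2l ?(ltW hp)// ler_nat ltnW//.
have mqg : measurable_fun setT (fun w => q (y0 + v * (h * k%:R) + X (h * k%:R) w)).
  by apply: measurableT_comp mq _; apply: measurable_funD => //; exact: (levy_measurable hX).
have -> : \int[P]_w (\1_setT w * (q (grid_pos X h v y0 k w) + e / T)) =
   \int[P]_w q (y0 + v * (h * k%:R) + X (h * k%:R) w) + e / T.
  rewrite -[X in _ + X](Rint_cst P) -RintD.
  - by apply: eq_Rint => w; rewrite indicT mul1r.
  - exact: (summ_bounded _ _ (fun w => bq _)).
  - by apply: (@summ_bounded _ _ _ P _ (e / T)) => // w; rewrite ger0_norm// ltW.
apply: (@le_trans _ _ (expR (- rho * (h * k%:R)) * (D + e / T))).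
  by rewrite ler_wpM2l ?expR_ge0// lerD2r hD.
rewrite ler_piMl// -[X in _ <= X]expR0 ler_expR mulNr oppr_le0 mulr_ge0//.
by case/andP: kT.
Qed.

End FixedTimeDynkin.

(** * Smooth truncations of the exponential *)

Section Logistic.
Context {R : realType}.
Implicit Types B u y : R.

Definition logistic (x : R) : R := (1 + expR (- x))^-1.

Lemma logistic01 x : 0 < logistic x < 1.
Proof.
have e0 : 0 < expR (- x) by exact: expR_gt0.
rewrite /logistic invr_gt0 addr_gt0//= invf_lt1; lra.
Qed.

Lemma derives_logistic : derives logistic (fun x => logistic x * (1 - logistic x)).
Proof.
move=> x; have e0 : 0 < expR (- x) by exact: expR_gt0.
have nz : 1 + expR (- x) != 0 by rewrite gt_eqF//; lra.
have dN : derives (fun t : R => 1 + expR (- t)) (fun t => - expR (- t)).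
  have h := derives_comp (@derives_expR R) (@derives_mul_add R (- 1) 0).
  have h' := derives_comp (@derives_addl R 1) h.
  by apply: derives_ext h' _ _ => t /=; rewrite ?mulrN1 ?mulN1r ?addr0 ?mul1r.
have := is_deriveV (f := fun t : R => 1 + expR (- t)) nz (dN x).
move=> h; apply: is_derive_eq h _; rewrite /GRing.scale/= /logistic; field.
exact: nz.
Qed.

Lemma C2_lip_logistic : C2_lip 1 logistic (fun x => logistic x * (1 - logistic x))
  (fun x => logistic x * (1 - logistic x) * (1 - 2 * logistic x)).
Proof.
have d1 := derives_logistic.
have d1m : derives (fun x => 1 - logistic x) (fun x => 0 - logistic x * (1 - logistic x)).
  by apply: derivesB => // x; exact: is_derive_cst.
have d2 : derives (fun x => logistic x * (1 - logistic x))
    (fun x => logistic x * (1 - logistic x) * (1 - 2 * logistic x)).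
  by apply: derives_eq (derivesM d1 d1m) _ => x /=; ring.
have d2m : derives (fun x => 1 - 2 * logistic x) (fun x => 0 - 2 * (logistic x * (1 - logistic x))).
  by apply: derivesB; [move=> x; exact: is_derive_cst|exact: derivesZ].
have d3 := derivesM d2 d2m.
have b x : 0 < logistic x < 1 := logistic01 x.
split => //.
  move=> x; have /andP[p0 p1] := b x; split; rewrite ler_norml; apply/andP; split; nra.
move=> x y; rewrite -[x - y]opprB -[_ * _ - _]opprB !normrN.
apply: lipschitz_of_derive d3 _ => z.
have /andP[p0 p1] := b z; move: (logistic z) p0 p1 => p p0 p1.
have q1 : 0 <= p * (1 - p) by rewrite mulr_ge0//; lra.
have q2 : p * (1 - p) <= 1 / 4 by have := sqr_ge0 (p - 1/2); rewrite expr2; lra.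
have -> : p * (1 - p) * (0 - 2 * (p * (1 - p))) + p * (1 - p) * (1 - 2 * p) * (1 - 2 * p)
   = (p * (1 - p)) * (1 - 6 * (p * (1 - p))) by ring.
move: (p * (1 - p)) q1 q2 => q q1 q2.
by rewrite ler_norml; apply/andP; split; nra.
Qed.

(** A smooth version of the minimum of e^(u y) and [B]: a rescaled logistic function shifted by ln B
    / u, hence bounded with bounded derivatives of all orders that are used. *)
Definition trunc_exp B u y : R := expR (u * y) / (1 + expR (u * y) / B).

Lemma trunc_expE B u y : 0 < B -> trunc_exp B u y = B * logistic (- ln B + u * y).
Proof.
move=> B0; rewrite /trunc_exp /logistic opprD opprK expRD lnK ?posrE// expRN.
have := expR_gt0 (u * y); move: (expR _) => w w0; field.
by rewrite !gt_eqF//; lra.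
Qed.

Definition trunc_exp' B u y : R := u * expR (u * y) / (1 + expR (u * y) / B) ^+ 2.

Lemma trunc_exp'E B u y : 0 < B -> trunc_exp' B u y =
  B * u * (logistic (- ln B + u * y) * (1 - logistic (- ln B + u * y))).
Proof.
move=> B0; rewrite /trunc_exp' /logistic opprD opprK expRD lnK ?posrE// expRN.
have := expR_gt0 (u * y); move: (expR _) => w w0; field.
by rewrite !gt_eqF//; lra.
Qed.

Lemma C2_lip_trunc_exp B u : 0 < B -> 1 <= u -> exists f2,
  C2_lip (B * u ^+ 3) (trunc_exp B u) (trunc_exp' B u) f2.
Proof.
move=> B0 u1; have [d1 d2 b lip] := C2_lip_logistic.
have da : derives (fun y => - ln B + u * y) (fun=> u).
  by apply: derives_ext (@derives_mul_add R u (- ln B)) _ _ => y; ring.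
have e1 := derivesZ B (derives_comp d1 da).
have e2 := derivesZ (B * u) (derives_comp d2 da).
pose s y := logistic (- ln B + u * y).
exists (fun y => B * u * (s y * (1 - s y) * (1 - 2 * s y) * u)).
have u0 : 0 <= u by lra.
have u2 : u <= u ^+ 2 by rewrite expr2; nra.
have u3 : u ^+ 2 <= u ^+ 3 by rewrite exprS ler_peMl ?sqr_ge0.
split.
- by apply: derives_ext e1 _ _ => y; rewrite ?trunc_expE// trunc_exp'E//; ring.
- by apply: derives_ext e2 _ _ => y; rewrite ?trunc_exp'E.
- move=> y; have [b0 b1 b2] := b (- ln B + u * y).
  rewrite trunc_expE// trunc_exp'E// -/(s y) in b0 b1 b2 *; split.
  + by rewrite normrM gtr0_norm// ler_wpM2l ?(ltW B0)//; lra.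
  + rewrite normrM ger0_norm ?mulr_ge0 ?(ltW B0)// -mulrA ler_wpM2l ?(ltW B0)//.
    apply: le_trans (ler_wpM2l u0 b1) _; lra.
  + apply: (@le_trans _ _ (B * u * (1 * u))).
      rewrite normrM ger0_norm ?mulr_ge0 ?(ltW B0)// ler_wpM2l ?mulr_ge0 ?(ltW B0)//.
      by rewrite normrM (ger0_norm u0) ler_wpM2r.
    by rewrite mul1r -mulrA -expr2 ler_wpM2l ?(ltW B0).
- move=> x y; rewrite -mulrBr -mulrBl normrM ger0_norm ?mulr_ge0 ?(ltW B0)//.
  rewrite normrM (ger0_norm u0).
  have -> : B * u ^+ 3 * `|x - y| = B * u * (`|u * x - u * y| * u).
    by rewrite -mulrBr normrM (ger0_norm u0); ring.
  rewrite ler_wpM2l ?mulr_ge0 ?(ltW B0)// ler_wpM2r//.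
  by apply: le_trans (lip _ _) _; rewrite mul1r opprD addrACA subrr add0r.
Qed.

End Logistic.

Section TruncExpGenerator.
Context {R : realType}.
Implicit Types B u y z : R.

Lemma trunc_exp_ge0 B u y : 0 < B -> 0 <= trunc_exp B u y.
Proof. by move=> B0; rewrite divr_ge0 ?expR_ge0// addr_ge0// divr_ge0 ?expR_ge0// ltW. Qed.

Lemma trunc_exp_leB B u y : 0 < B -> trunc_exp B u y <= B.
Proof.
move=> B0; rewrite /trunc_exp; have e0 := expR_gt0 (u * y).
have q0 : 0 < expR (u * y) / B by rewrite divr_gt0.
rewrite ler_pdivrMr; last lra.
by rewrite mulrDr mulr1 mulrCA mulfV ?gt_eqF// mulr1; lra.
Qed.

Lemma trunc_exp_le_exp B u y : 0 < B -> trunc_exp B u y <= expR (u * y).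
Proof.
move=> B0; rewrite /trunc_exp; have e0 := expR_gt0 (u * y).
have q0 : 0 < expR (u * y) / B by rewrite divr_gt0.
by rewrite ler_pdivrMr ?ler_peMr//; lra.
Qed.

Lemma trunc_exp'01 B u y : 0 < B -> 0 <= u -> 0 <= trunc_exp' B u y <= u * B.
Proof.
move=> B0 u0; rewrite /trunc_exp'; have e0 := expR_gt0 (u * y).
have q0 : 0 < expR (u * y) / B by rewrite divr_gt0.
apply/andP; split.
  by rewrite divr_ge0 ?sqr_ge0// mulr_ge0 ?expR_ge0.
have := trunc_exp_leB u y B0; rewrite /trunc_exp => h.
have -> : u * expR (u * y) / (1 + expR (u * y) / B) ^+ 2 =
   u * (expR (u * y) / (1 + expR (u * y) / B) * (1 + expR (u * y) / B)^-1).
  by rewrite expr2 invfM; ring.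
rewrite ler_wpM2l//; apply: le_trans h; rewrite ler_piMr//.
  by rewrite divr_ge0 ?expR_ge0//; lra.
by rewrite invf_le1; lra.
Qed.

Lemma trunc_exp_mono B u : 0 < B -> 1 <= u -> {homo trunc_exp B u : x y / x <= y}.
Proof.
move=> B0 u1 x y xy; have [f2 [dF _ _ _]] := C2_lip_trunc_exp B0 u1.
have [s _] := mean_value x y dF.
have /andP[h _] := @trunc_exp'01 B u (x + s * (y - x)) B0 (le_trans ler01 u1).
move=> e; rewrite -subr_ge0 e mulr_ge0// subr_ge0//.
Qed.

(** The difference of the two sides has derivative -2 (1 - e^x)^2, so it decreases to its value 0 at
    0. *)
Lemma expR1_sqr_le (x : R) : x <= 0 -> (1 - expR x) ^+ 2 <= 2 * exp2 x.
Proof.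
move=> x0.
pose g t := 2 * exp2 t - (1 - expR t) ^+ 2 : R.
have d1 : derives (fun t : R => 1 - expR t) (fun t => 0 - expR t).
  by apply: derivesB; [move=> t; exact: is_derive_cst|exact: derives_expR].
have dg : derives g (fun t => 2 * (expR t - 1) - ((1 - expR t) * (0 - expR t) + (0 - expR t) * (1 - expR t))).
  have := derivesB (derivesZ 2 (@derives_exp2 R)) (derivesM d1 d1).
  by move=> h; apply: derives_ext h _ _ => t; rewrite /g ?expr2.
have [s /andP[s0 s1]] := mean_value x 0 dg.
have g0 : g 0 = 0 by rewrite /g /exp2 expR0; ring.
rewrite g0; set t := x + _.
have t0 : t <= 0 by rewrite /t sub0r mulrN -{1}[x]mul1r -mulrBl mulr_ge0_le0//; lra.
have e1 : expR t <= 1 by rewrite -expR0 ler_expR.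
have e0 := expR_gt0 t.
have h : 2 * (expR t - 1) - ((1 - expR t) * (0 - expR t) + (0 - expR t) * (1 - expR t)) <= 0 by nra.
move=> e; have : 0 - g x <= 0 by rewrite e mulr_le0_ge0//; lra.
by rewrite /g; lra.
Qed.

(* With [w = expR (u * y)], [x = expR (u * z)] and [s = (1 + w / B)^-1], the
   increment is [w * (x - 1) * s * s'], where [s' = (1 + w * x / B)^-1]. *)
Lemma trunc_exp_small_jump B u y z : 0 < B -> 1 <= u -> z <= 0 ->
  let I := trunc_exp B u (y + z) - trunc_exp B u y - trunc_exp' B u y * (expR z - 1) in
  I <= trunc_exp B u y * exp2 (u * z) /\
  (trunc_exp B u y - 3 / B * trunc_exp (B ^+ 2) (2 * u) y) * exp2 (u * z)
    - u * B * exp2 z <= I.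
Proof.
move=> B0 u1 z0 /=.
have uz : u * z <= 0 by rewrite mulr_ge0_le0//; lra.
have p0 := exp2_ge0 (u * z); have sq := expR1_sqr_le uz.
have pz := exp2_ge0 z.
have Ez : expR z - 1 = exp2 z + z by rewrite /exp2; ring.
have Ex : expR (u * z) = 1 + exp2 (u * z) + u * z by rewrite /exp2; ring.
have x1 : expR (u * z) <= 1 by rewrite -expR0 ler_expR.
have x0 := expR_gt0 (u * z).
have B' := trunc_exp_leB u y B0.
rewrite /trunc_exp /trunc_exp' -mulrA mulrDr expRD.
have -> : expR (2 * u * y) = expR (u * y) ^+ 2.
  by rewrite -mulrA -expRM_natl//.
rewrite /trunc_exp in B'.
move: (expR (u * y)) (expR_gt0 (u * y)) B' => w w0 B'.
rewrite Ez; move: (expR (u * z)) Ex x1 x0 sq => x Ex x1 x0 sq.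
move: (exp2 (u * z)) p0 Ex sq => p p0 Ex sq; move: (exp2 z) pz => pz pz0.
have Bw : 0 < B + w by exact: addr_gt0.
have Bwx : 0 < B + w * x by apply: addr_gt0 => //; exact: mulr_gt0.
have q0 : 0 < w / B by rewrite divr_gt0.
have q1 : 0 < w * x / B by rewrite divr_gt0// mulr_gt0.
have qq : w * x / B <= w / B by rewrite ler_pM2r ?invr_gt0// ler_piMr// ltW.
set s := (1 + w / B)^-1; set s' := (1 + w * x / B)^-1.
have s0 : 0 < s by rewrite invr_gt0 addr_gt0.
have s'0 : 0 < s' by rewrite invr_gt0 addr_gt0.
have s'1 : s' <= 1 by rewrite invf_le1 ?addr_gt0// lerDl ltW.
have s1 : s <= 1 by rewrite invf_le1 ?addr_gt0// lerDl ltW.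
have ss' : s <= s' by rewrite lef_pV2 ?posrE ?addr_gt0// lerD2l.
have E2 : (1 + w / B) ^- 2 = s ^+ 2 by rewrite exprVn.
rewrite E2.
have inc : w * x * s' - w * s = w * (x - 1) * s * s'.
  by rewrite /s /s'; field; rewrite (gt_eqF B0) (gt_eqF Bw) (gt_eqF Bwx).
have dif : s' - s = s * s' * (w / B) * (1 - x).
  by rewrite /s /s'; field; rewrite (gt_eqF B0) (gt_eqF Bw) (gt_eqF Bwx).
rewrite inc; split.
  have h1 : w * (x - 1) * s * s' <= w * (x - 1) * s * s.
    by apply: ler_wnM2l => //; rewrite mulr_le0_ge0 ?(ltW s0)// mulr_ge0_le0 ?(ltW w0)//; lra.
  have h2 : w * s ^+ 2 * p <= w * s * p.
    by rewrite ler_wpM2r// ler_wpM2l ?(ltW w0)// expr2 ler_piMl// ltW.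
  have h3 : 0 <= u * (w * s ^+ 2) * pz.
    apply: mulr_ge0 => //; apply: mulr_ge0; first exact: le_trans ler01 u1.
    exact: mulr_ge0 (ltW w0) (sqr_ge0 s).
  have -> : x - 1 = p + u * z by lra.
  move: h1; have -> : x - 1 = p + u * z by lra.
  rewrite expr2 in h2 h3 *; lra.
have e1 : w * (x - 1) * s * s' = w * s ^+ 2 * (x - 1) - w ^+ 2 / B * s ^+ 2 * s' * (1 - x) ^+ 2.
  have -> : w * (x - 1) * s * s' = w * s ^+ 2 * (x - 1) + w * (x - 1) * s * (s' - s) by ring.
  by rewrite dif; ring.
have W0 : 0 <= w ^+ 2 / B * s ^+ 2 by rewrite mulr_ge0 ?sqr_ge0// divr_ge0 ?sqr_ge0// ltW.
have h1 : w ^+ 2 / B * s ^+ 2 * s' * (1 - x) ^+ 2 <= w ^+ 2 / B * s ^+ 2 * (2 * p).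
  by rewrite -mulrA; apply: ler_wpM2l => //; apply: le_trans sq; apply: ler_piMl => //; exact: sqr_ge0.
have h2 : w * s ^+ 2 = w * s - w ^+ 2 / B * s ^+ 2.
  by rewrite /s; field; rewrite (gt_eqF B0) (gt_eqF Bw).
have h3 : w ^+ 2 / B * s ^+ 2 <= B^-1 * (w ^+ 2 / (1 + w ^+ 2 / B ^+ 2)).
  have -> : w ^+ 2 / B * s ^+ 2 = B^-1 * (w ^+ 2 * s ^+ 2) by ring.
  rewrite ler_pM2l ?invr_gt0// ler_pM2l ?exprn_gt0// /s exprVn lef_pV2 ?posrE.
  - by rewrite -expr_div_n; have := ltW q0; rewrite !expr2; nra.
  - by rewrite exprn_gt0//; lra.
  - by rewrite addr_gt0// divr_gt0 ?exprn_gt0.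
have h4 : u * (w * s ^+ 2) * pz <= u * B * pz.
  apply: ler_wpM2r => //; apply: ler_wpM2l; first lra.
  apply: le_trans B'; rewrite expr2 mulrA; apply: ler_piMr => //.
  by rewrite mulr_ge0 ?(ltW w0) ?(ltW s0).
have h5 := ler_wpM2r p0 h3.
have E3 : x - 1 = p + u * z by lra.
rewrite e1 {1}E3.
move: h1 h2 h3 h4 h5; set G := B^-1 * _; set Q := w ^+ 2 / B * s ^+ 2; set M := w * s ^+ 2 => h1 h2 h3 h4 h5.
have -> : 3 / B * (w ^+ 2 / (1 + w ^+ 2 / B ^+ 2)) = 3 * G by rewrite /G; ring.
have E4 : M * p = (w * s) * p - Q * p by rewrite h2; ring.
have -> : u * w * (s ^+ 2 * (pz + z)) = u * M * pz + u * M * z by rewrite /M; ring.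
have -> : M * (p + u * z) = M * p + u * M * z by ring.
have h6 : u * M * pz <= u * B * pz by [].
rewrite E4; move: h1 h5 h6; lra.
Qed.

End TruncExpGenerator.

Section TruncExpExpectation.
Context {R : realType} {d : measure_display} {Omega : measurableType d}.
Variable P : probability Omega R.
Variable X : R -> Omega -> R.
Variable nu : {measure set R -> \bar R}.
Hypothesis hX : levy_process P X.
Hypothesis hc : measure_is_complete P.
Hypothesis hchar : levy_char P X nu.
Hypothesis hW : summ nu (@jump_weight R).
Variable a0 : R.
Hypothesis a0_lt0 : a0 < 0.

Lemma kappa_ge0 u : 0 <= kappa nu a0 u.
Proof. by apply: Rintegral_ge0 => z _; rewrite mulr_ge0 ?exp2_ge0// indicE. Qed.

(** Collects what [kappa] ignores: jumps outside ]a0, 0[, and the gap between the compensators z and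
    e^z - 1. After multiplication by [u * B], a bound on the derivative of the truncated
    exponential, it is linear in [u], hence negligible at the scale in use. *)
Definition kappa_slack : R :=
  (expR 1 * (1 + a0 ^+ 2) + (Num.min 1 (a0 ^+ 2))^-1 + 1) * jump_mass nu.

Lemma min1_sqr_gt0 : 0 < Num.min 1 (a0 ^+ 2).
Proof. by rewrite lt_min ltr01 exprn_even_gt0//= lt_eqF. Qed.

Lemma kappa_slack_ge0 : 0 <= kappa_slack.
Proof.
apply: mulr_ge0; last exact: jump_mass_ge0.
have := min1_sqr_gt0; rewrite -invr_gt0 => h.
have e0 := expR_gt0 (1 : R); have := sqr_ge0 a0 => s0.
have : 0 <= expR 1 * (1 + a0 ^+ 2) by apply: mulr_ge0; lra.
lra.
Qed.

Lemma slack_ge0 (u B : R) : 0 <= u -> 0 <= B -> 0 <= u * B * kappa_slack.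
Proof. by move=> u0 B0; exact: mulr_ge0 (mulr_ge0 u0 B0) kappa_slack_ge0. Qed.

Lemma jump_weight_ge_min (z : R) : Num.min 1 (z ^+ 2) <= jump_weight z.
Proof. by rewrite /jump_weight lerDl le_max lexx orbT. Qed.

Lemma jump_weight_ge_exp (z : R) : expR z - 1 <= jump_weight z.
Proof.
rewrite /jump_weight; have : 0 <= Num.min 1 (z ^+ 2) by rewrite le_min ler01 sqr_ge0.
have : expR z - 1 <= Num.max (expR z - 1) 0 by rewrite le_max lexx.
lra.
Qed.

Lemma jump_weight_away z : z <= a0 -> 1 <= (Num.min 1 (a0 ^+ 2))^-1 * jump_weight z.
Proof.
move=> za; have m0 := min1_sqr_gt0.
rewrite mulrC -ler_pdivrMr ?invr_gt0// invrK mul1r.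
apply: le_trans (jump_weight_ge_min z).
rewrite le_min ge_min lexx/= ge_min; apply/orP; right.
by rewrite -[a0 ^+ 2]sqrrN -[z ^+ 2]sqrrN lerXn2r ?nnegrE; move: (a0_lt0); lra.
Qed.

Lemma exp2_le_jump_weight z : a0 < z -> z < 0 ->
  exp2 z <= expR 1 * (1 + a0 ^+ 2) * jump_weight z.
Proof.
move=> z1 z2; apply: le_trans (exp2_le_sqr (ltW z2)) _.
rewrite -mulrA ler_wpM2l ?expR_ge0//.
apply: (@le_trans _ _ ((1 + a0 ^+ 2) * Num.min 1 (z ^+ 2))); last first.
  by rewrite ler_wpM2l ?jump_weight_ge_min// addr_ge0// sqr_ge0.
have zz : z ^+ 2 <= a0 ^+ 2.
  by rewrite -[z ^+ 2]sqrrN -[a0 ^+ 2]sqrrN lerXn2r ?nnegrE//; move: (a0_lt0); lra.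
rewrite /Num.min; case: ifPn => h; first by rewrite mulr1; lra.
by rewrite mulrDl mul1r lerDl mulr_ge0 ?sqr_ge0.
Qed.

(** The three summands of [k] belong to the three ranges of the jump: [a0 < z < 0], where only the
    compensator gap remains, [z <= a0], and [0 <= z], where monotonicity and the bound on the
    derivative are enough. *)
Lemma trunc_exp_jump B u y z : 0 < B -> 1 <= u ->
  let I := trunc_exp B u (y + z) - trunc_exp B u y - trunc_exp' B u y * (expR z - 1) in
  let k := expR 1 * (1 + a0 ^+ 2) + (Num.min 1 (a0 ^+ 2))^-1 + 1 in
  I <= trunc_exp B u y * (\1_(`]a0, 0[%classic) z * exp2 (u * z)) + u * B * k * jump_weight z /\
  (trunc_exp B u y - 3 / B * trunc_exp (B ^+ 2) (2 * u) y) * (\1_(`]a0, 0[%classic) z * exp2 (u * z))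
    - u * B * k * jump_weight z <= I.
Proof.
move=> B0 u1 I k.
have m0 : 0 < (Num.min 1 (a0 ^+ 2))^-1 by rewrite invr_gt0 min1_sqr_gt0.
have e1 : 0 <= expR 1 * (1 + a0 ^+ 2) :> R.
  by rewrite mulr_ge0 ?expR_ge0// addr_ge0// sqr_ge0.
have W0 := jump_weight_ge0 z.
have uB : 0 <= u * B by rewrite mulr_ge0//; [lra|exact: ltW].
have t1 : 0 <= expR 1 * (1 + a0 ^+ 2) * jump_weight z by rewrite mulr_ge0.
have t2 : 0 <= (Num.min 1 (a0 ^+ 2))^-1 * jump_weight z by rewrite mulr_ge0// ltW.
have kE : u * B * k * jump_weight z = u * B * (expR 1 * (1 + a0 ^+ 2) * jump_weight z +
   (Num.min 1 (a0 ^+ 2))^-1 * jump_weight z + jump_weight z) by rewrite /k; ring.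
have ub (c : R) : c <= expR 1 * (1 + a0 ^+ 2) * jump_weight z +
   (Num.min 1 (a0 ^+ 2))^-1 * jump_weight z + jump_weight z -> u * B * c <= u * B * k * jump_weight z.
  by move=> h; rewrite kE ler_wpM2l.
have u0 : 0 <= u by lra.
have /andP[f0 f1] := @trunc_exp'01 R B u y B0 u0.
have [z0|z0] := ltP z 0; last first.
  have -> : \1_(`]a0, 0[%classic) z = 0 :> R.
    by rewrite indicE memNset//= in_itv/= => /andP[_ h]; lra.
  rewrite !mul0r !mulr0 add0r sub0r.
  have zE : 0 <= z <= expR z - 1 by have := expR1Dx_le z; lra.
  have mono : trunc_exp B u y <= trunc_exp B u (y + z) by apply: trunc_exp_mono => //; lra.
  have lipF : trunc_exp B u (y + z) - trunc_exp B u y <= u * B * z.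
    have [f2 [dF _ _ _]] := C2_lip_trunc_exp B0 u1.
    have bd t : `|trunc_exp' B u t| <= u * B.
      by have /andP[h1 h2] := @trunc_exp'01 R B u t B0 u0; rewrite ger0_norm.
    have := lipschitz_of_derive y (y + z) dF bd.
    have -> : y + z - y = z by ring.
    rewrite (ger0_norm z0); apply: le_trans; exact: ler_norm.
  have b1 : u * B * (expR z - 1) <= u * B * k * jump_weight z.
    by apply: ub; have := jump_weight_ge_exp z; lra.
  have b2 : u * B * z <= u * B * (expR z - 1) by rewrite ler_wpM2l//; lra.
  have b3 : trunc_exp' B u y * (expR z - 1) <= u * B * (expR z - 1) by rewrite ler_wpM2r//; lra.
  have b4 : 0 <= trunc_exp' B u y * (expR z - 1) by rewrite mulr_ge0//; lra.
  by rewrite /I; split; lra.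
have ez : 0 <= 1 - expR z <= 1.
  by have := expR_gt0 z; have : expR z <= 1 by [rewrite -expR0 ler_expR ltW]; lra.
have [za|za] := ltP a0 z; last first.
  have -> : \1_(`]a0, 0[%classic) z = 0 :> R.
    by rewrite indicE memNset//= in_itv/= => /andP[h _]; lra.
  rewrite !mul0r !mulr0 add0r sub0r.
  have mono : trunc_exp B u (y + z) <= trunc_exp B u y by apply: trunc_exp_mono => //; lra.
  have p0 := @trunc_exp_ge0 R B u (y + z) B0.
  have p1 := @trunc_exp_leB R B u y B0.
  have b1 : u * B * 1 <= u * B * k * jump_weight z.
    by apply: ub; have := jump_weight_away za; lra.
  have b2 : B <= u * B by rewrite ler_peMl// ltW.
  have b3 : 0 <= trunc_exp' B u y * (1 - expR z) by rewrite mulr_ge0//; lra.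
  have b4 : trunc_exp' B u y * (1 - expR z) <= trunc_exp' B u y by rewrite ler_piMr//; lra.
  have IE : I = trunc_exp B u (y + z) - trunc_exp B u y + trunc_exp' B u y * (1 - expR z).
    by rewrite /I; ring.
  by rewrite IE; split; lra.
have -> : \1_(`]a0, 0[%classic) z = 1 :> R.
  by rewrite indicE mem_set//= in_itv/= za z0.
rewrite mul1r; have [h1 h2] := @trunc_exp_small_jump R B u y z B0 u1 (ltW z0).
have b1 : u * B * exp2 z <= u * B * k * jump_weight z.
  by apply: ub; have := exp2_le_jump_weight za z0; lra.
have b0 : 0 <= u * B * exp2 z by rewrite mulr_ge0// exp2_ge0.
by split; [apply: le_trans h1 _|apply: le_trans h2]; lra.
Qed.

Lemma gen_trunc_exp B u y : 0 < B -> 1 <= u ->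
  gen nu (trunc_exp B u) (trunc_exp' B u) y <= kappa nu a0 u * trunc_exp B u y + u * B * kappa_slack /\
  kappa nu a0 u * (trunc_exp B u y - 3 / B * trunc_exp (B ^+ 2) (2 * u) y) - u * B * kappa_slack
    <= gen nu (trunc_exp B u) (trunc_exp' B u) y.
Proof.
move=> B0 u1.
have [f2 lF] := C2_lip_trunc_exp B0 u1.
have sI := @summ_gen R nu hW _ _ _ _ y (C2_lip_bd lF).
have u0 : 0 <= u by lra.
have mD : measurable (`]a0, 0[%classic : set R) by exact: measurable_itv.
have sk := @summ_exp2 R nu a0 hW a0_lt0 _ u mD (fun x h => h) u0.
set k := expR 1 * (1 + a0 ^+ 2) + (Num.min 1 (a0 ^+ 2))^-1 + 1 : R.
split.
  have -> : kappa nu a0 u * trunc_exp B u y + u * B * kappa_slack =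
    \int[nu]_z (trunc_exp B u y * (\1_(`]a0, 0[%classic) z * exp2 (u * z)) + u * B * k * jump_weight z).
    rewrite RintD; [|exact: summZ|exact: summZ].
    by rewrite !RintZ// /kappa_slack /kappa /jump_mass -/k; ring.
  apply: Rint_le => //.
    by apply: summD; exact: summZ.
  by move=> z; have [] := @trunc_exp_jump B u y z B0 u1.
have -> : kappa nu a0 u * (trunc_exp B u y - 3 / B * trunc_exp (B ^+ 2) (2 * u) y) - u * B * kappa_slack =
  \int[nu]_z ((trunc_exp B u y - 3 / B * trunc_exp (B ^+ 2) (2 * u) y) *
     (\1_(`]a0, 0[%classic) z * exp2 (u * z)) - u * B * k * jump_weight z).
  rewrite RintB; [|exact: summZ|exact: summZ].
  by rewrite !RintZ// /kappa_slack /kappa /jump_mass -/k; ring.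
apply: Rint_le => //.
  by apply: summB; exact: summZ.
by move=> z; have [] := @trunc_exp_jump B u y z B0 u1.
Qed.

Lemma trunc_exp0_le1 (B u : R) : 0 < B -> trunc_exp B u 0 <= 1.
Proof. by move=> B0; have := @trunc_exp_le_exp R B u 0 B0; rewrite mulr0 expR0. Qed.

Lemma measurable_trunc_expX B u t : 0 < B -> 1 <= u ->
  measurable_fun setT (fun w => trunc_exp B u (X t w)).
Proof.
move=> B0 u1; have [f2 [dF _ _ _]] := C2_lip_trunc_exp B0 u1.
by apply: measurableT_comp; [exact: derives_measurable dF|exact: (levy_measurable hX)].
Qed.

Lemma summ_trunc_expX B u t : 0 < B -> 1 <= u ->
  summ P (fun w => trunc_exp B u (X t w)).
Proof.
move=> B0 u1; apply: (@summ_bounded _ _ _ P _ B); first exact: measurable_trunc_expX.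
by move=> w; rewrite ger0_norm ?trunc_exp_ge0// trunc_exp_leB.
Qed.

(** Discounting at the rate [kappa nu a0 u] leaves only the slack on the right-hand side. *)
Lemma trunc_exp_upper B u T : 0 < B -> 1 <= u -> 0 <= T ->
  \int[P]_w trunc_exp B u (X T w) <=
  expR (kappa nu a0 u * T) * (1 + T * (u * B * kappa_slack)).
Proof.
move=> B0 u1; have u0 : 0 <= u by lra.
have D0 := slack_ge0 u0 (ltW B0).
rewrite le_eqVlt => /orP[/eqP <-|T0].
  rewrite mulr0 expR0 mul0r addr0 mul1r.
  have -> : \int[P]_w trunc_exp B u (X 0 w) = \int[P]_w trunc_exp B u 0.
    congr fine; apply: ae_eq_integral.
    - exact: measurableT.
    - by apply/measurable_EFinP; exact: measurable_trunc_expX.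
    - exact: measurable_cst.
    - by case: (levy_X0 hX) => N [mN N0 hN]; exists N; split => // w /= h; apply: hN => /= e;
        apply: h => _; rewrite e.
  by rewrite Rint_cst trunc_exp0_le1.
have [f2 lF] := C2_lip_trunc_exp B0 u1.
have := @dynkin_fixed _ _ _ P X nu hX hc hchar hW _ _ _ _ (fun=> u * B * kappa_slack) 0 (kappa nu a0 u)
  (u * B * kappa_slack) (u * B * kappa_slack) T 0 lF.
have m1 : measurable_fun setT (fun _ : R => u * B * kappa_slack) by exact: measurable_cst.
move=> /(_ m1) h.
have {h} := h _ _ (kappa_ge0 u) T0 D0 _.
rewrite mul0r !add0r => h.
have {h} h : expR (- kappa nu a0 u * T) * \int[P]_w trunc_exp B u (X T w) <= 1 + T * (u * B * kappa_slack).
  have e : (fun w => trunc_exp B u (X T w)) = (fun w => trunc_exp B u (0 + X T w)).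
    by apply/funext => w; rewrite add0r.
  rewrite e; apply: le_trans (h _ _ _) _.
  - by move=> y; rewrite ger0_norm.
  - by move=> y; rewrite mul0r addr0 lerBlDl; have [] := @gen_trunc_exp B u y B0 u1.
  - by move=> t _; rewrite Rint_cst.
  by rewrite lerD2r trunc_exp0_le1.
have E0 := expR_gt0 (kappa nu a0 u * T).
move: (\int[P]_w _) h => I h.
have -> : I = expR (kappa nu a0 u * T) * (expR (- kappa nu a0 u * T) * I).
  by rewrite mulrA -expRD mulNr subrr expR0 mul1r.
by rewrite ler_wpM2l ?(ltW E0).
Qed.

(** The discounted inequality is applied to the negative of the function. The loss due to truncation
    is a truncated exponential at the doubled exponent and level [B ^+ 2], whose mean the upper
    bound controls; it carries a factor [B^-1]. *)
Lemma trunc_exp_lower B u T : 0 < B -> 1 <= u -> 0 < T ->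
  expR (kappa nu a0 u * T) * (trunc_exp B u 0 - T * (3 * kappa nu a0 u / B *
     (expR (kappa nu a0 (2 * u) * T) * (1 + T * (2 * u * B ^+ 2 * kappa_slack))) +
     u * B * kappa_slack)) <=
  \int[P]_w trunc_exp B u (X T w).
Proof.
move=> B0 u1 T0; have u0 : 0 <= u by lra.
have u2 : 1 <= 2 * u by lra.
have B2 : 0 < B ^+ 2 by rewrite exprn_gt0.
have D0 := slack_ge0 u0 (ltW B0).
have [f2 lF] := C2_lip_trunc_exp B0 u1.
have lN : C2_lip (B * u ^+ 3) (fun y => - 1 * trunc_exp B u y) (fun y => - 1 * trunc_exp' B u y) (fun y => - 1 * f2 y).
  case: lF => d1 d2 b l; split; [exact: derivesZ|exact: derivesZ| |].
    by move=> y; have [] := b y; rewrite !mulN1r !normrN.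
  by move=> x y; rewrite !mulN1r -opprD normrN.
pose q y := 3 * kappa nu a0 u / B * trunc_exp (B ^+ 2) (2 * u) y + u * B * kappa_slack.
pose M := expR (kappa nu a0 (2 * u) * T) * (1 + T * (2 * u * B ^+ 2 * kappa_slack)).
have k0 : 0 <= 3 * kappa nu a0 u / B by rewrite divr_ge0 ?(ltW B0)// mulr_ge0// kappa_ge0.
have [g2 [dH _ _ _]] := C2_lip_trunc_exp B2 u2.
have mH := derives_measurable dH.
have mq : measurable_fun setT q by apply: measurable_funD => //; exact: measurable_funM.
have bq y : `|q y| <= 3 * kappa nu a0 u / B * B ^+ 2 + u * B * kappa_slack.
  rewrite ger0_norm; first by rewrite lerD2r ler_wpM2l ?trunc_exp_leB.
  by rewrite addr_ge0// mulr_ge0// trunc_exp_ge0.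
have D'0 : 0 <= 3 * kappa nu a0 u / B * M + u * B * kappa_slack.
  rewrite addr_ge0// mulr_ge0// /M mulr_ge0 ?expR_ge0// addr_ge0// mulr_ge0 ?(ltW T0)//.
  by apply: slack_ge0; [rewrite mulr_ge0|exact: ltW].
have gN y : gen nu (fun y => - 1 * trunc_exp B u y) (fun y => - 1 * trunc_exp' B u y) y =
   - gen nu (trunc_exp B u) (trunc_exp' B u) y.
  rewrite -[RHS]mulN1r /gen -RintZ; last exact: (@summ_gen R nu hW _ _ _ _ y (C2_lip_bd lF)).
  by apply: eq_Rint => z; ring.
have hq y : gen nu (fun y => - 1 * trunc_exp B u y) (fun y => - 1 * trunc_exp' B u y) y +
    0 * (- 1 * trunc_exp' B u y) - kappa nu a0 u * (- 1 * trunc_exp B u y) <= q y.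
  rewrite gN /q; have [_] := @gen_trunc_exp B u y B0 u1.
  have -> : 3 * kappa nu a0 u / B * trunc_exp (B ^+ 2) (2 * u) y =
    kappa nu a0 u * (3 / B * trunc_exp (B ^+ 2) (2 * u) y) by ring.
  lra.
have hE t : 0 <= t <= T -> \int[P]_w q (0 + 0 * t + X t w) <= 3 * kappa nu a0 u / B * M + u * B * kappa_slack.
  move=> /andP[t0 tT].
  rewrite (@eq_Rint _ _ _ P _ (fun w => 3 * kappa nu a0 u / B * trunc_exp (B ^+ 2) (2 * u) (X t w) + u * B * kappa_slack)); last first.
    by move=> w; rewrite mul0r !add0r.
  have sH := @summ_trunc_expX (B ^+ 2) (2 * u) t B2 u2.
  rewrite RintD; [|exact: summZ|by apply: (@summ_bounded _ _ _ P _ (u * B * kappa_slack)) => // w; rewrite ger0_norm].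
  rewrite RintZ// Rint_cst lerD2r ler_wpM2l//.
  apply: le_trans (@trunc_exp_upper (B ^+ 2) (2 * u) t B2 u2 t0) _.
  have s0 : 0 <= 2 * u * B ^+ 2 * kappa_slack by apply: slack_ge0; [rewrite mulr_ge0|exact: ltW].
  apply: ler_pM; rewrite ?expR_ge0//.
  - by rewrite addr_ge0// mulr_ge0.
  - by rewrite ler_expR ler_wpM2l// kappa_ge0.
  - by rewrite lerD2l ler_wpM2r.
have := @dynkin_fixed _ _ _ P X nu hX hc hchar hW _ _ _ _ q 0 (kappa nu a0 u) _ _ T 0
   lN mq bq hq (kappa_ge0 u) T0 D'0 hE.
rewrite (@eq_Rint _ _ _ P _ (fun w => - 1 * trunc_exp B u (X T w))); last first.
  by move=> w; rewrite mul0r !add0r.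
rewrite RintZ; last exact: summ_trunc_expX.
rewrite -/M; move: (\int[P]_w _) => I h.
have E0 := expR_gt0 (kappa nu a0 u * T).
have -> : I = expR (kappa nu a0 u * T) * (expR (- kappa nu a0 u * T) * I).
  by rewrite mulrA -expRD mulNr subrr expR0 mul1r.
by rewrite ler_wpM2l ?(ltW E0)//; lra.
Qed.

End TruncExpExpectation.

Section ThreeExponents.
Context {R : realType}.
Implicit Types B t s : R.

Lemma trunc_exp_cut_low B eta s t : 0 < B -> 0 <= eta -> 0 <= s -> t < s ->
  trunc_exp B 1 t <= expR (eta * s) * trunc_exp B 1 ((1 - eta) * t).
Proof.
move=> B0 e0 s0 ts; rewrite /trunc_exp !mul1r.
have a0 := expR_gt0 t; have b0 := expR_gt0 ((1 - eta) * t).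
have ab : expR t <= expR (eta * s) * expR ((1 - eta) * t).
  have : eta * t <= eta * s by rewrite ler_wpM2l// ltW.
  by rewrite -expRD ler_expR; lra.
have k1 : 1 <= expR (eta * s) by rewrite -[X in X <= _]expR0 ler_expR mulr_ge0.
move: (expR t) (expR ((1 - eta) * t)) (expR (eta * s)) a0 b0 ab k1 => a b k a0 b0 ab k1.
have q1 : 0 < 1 + a / B by rewrite addr_gt0// divr_gt0.
have q2 : 0 < 1 + b / B by rewrite addr_gt0// divr_gt0.
rewrite ler_pdivrMr//.
have -> : k * (b / (1 + b / B)) * (1 + a / B) = k * b * (1 + a / B) / (1 + b / B) by ring.
rewrite ler_pdivlMr//.
have h1 : a * (b / B) <= k * (a * (b / B)).
  by rewrite ler_peMl// mulr_ge0 ?(ltW a0)// divr_ge0 ?ltW.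
have -> : k * b * (1 + a / B) = k * b + k * (a * (b / B)) by ring.
by rewrite mulrDr mulr1 lerD.
Qed.

Lemma trunc_exp_cut_high B B2 eta s t : 0 < B -> 0 <= eta -> s < t ->
  B * expR (eta * s) <= B2 ->
  trunc_exp B 1 t <= 2 * expR (- (eta * s)) * trunc_exp B2 1 ((1 + eta) * t).
Proof.
move=> B0 e0 st BB.
have B'0 : 0 < B2 by apply: lt_le_trans BB; rewrite mulr_gt0 ?expR_gt0.
have leB := @trunc_exp_leB R B 1 t B0.
have leE := @trunc_exp_le_exp R B 1 t B0; rewrite mul1r in leE.
rewrite [X in _ <= _ * X]/trunc_exp !mul1r.
have d0 := expR_gt0 ((1 + eta) * t).
have m0 := expR_gt0 (- (eta * s)).
have ad : expR t <= expR (- (eta * s)) * expR ((1 + eta) * t).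
  have : eta * s <= eta * t by rewrite ler_wpM2l// ltW.
  by rewrite -expRD ler_expR; lra.
have Bm : B <= expR (- (eta * s)) * B2.
  by rewrite expRN mulrC ler_pdivlMr ?expR_gt0.
move: (expR ((1 + eta) * t)) (expR (- (eta * s))) d0 m0 ad Bm => D m d0 m0 ad Bm.
have q : 0 < 1 + D / B2 by rewrite addr_gt0// divr_gt0.
have [dB|dB] := lerP D B2.
  apply: le_trans leE _; apply: le_trans ad _.
  rewrite [2 * m]mulrC -mulrA ler_wpM2l ?(ltW m0)// mulrA ler_pdivlMr//.
  have : D / B2 <= 1 by rewrite ler_pdivrMr// mul1r.
  by move: (D / B2) q => x q x1; nra.
apply: le_trans leB _; apply: le_trans Bm _.
rewrite [2 * m]mulrC -mulrA ler_wpM2l ?(ltW m0)// mulrA ler_pdivlMr//.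
by rewrite mulrDr mulr1 mulrCA mulfV ?gt_eqF// mulr1; lra.
Qed.

Lemma trunc_exp_scale B u x : trunc_exp B u x = trunc_exp B 1 (u * x).
Proof. by rewrite /trunc_exp !mul1r. Qed.

Lemma trunc_exp_split B B2 eta s1 s2 u x : 0 < B -> 0 <= eta -> 0 <= s1 ->
  B * expR (eta * s2) <= B2 ->
  trunc_exp B u x <= expR (eta * s1) * trunc_exp B ((1 - eta) * u) x +
    2 * expR (- (eta * s2)) * trunc_exp B2 ((1 + eta) * u) x +
    expR s2 * \1_[set t | s1 <= u * t] x.
Proof.
move=> B0 e0 s10 BB; rewrite (trunc_exp_scale B u) (trunc_exp_scale B (_ * u)) (trunc_exp_scale B2 (_ * u)) -!mulrA.
have B'0 : 0 < B2 by apply: lt_le_trans BB; rewrite mulr_gt0 ?expR_gt0.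
have h1 : 0 <= expR (eta * s1) * trunc_exp B 1 ((1 - eta) * (u * x)).
  by rewrite mulr_ge0 ?expR_ge0// trunc_exp_ge0.
have h2 : 0 <= 2 * (expR (- (eta * s2)) * trunc_exp B2 1 ((1 + eta) * (u * x))).
  by rewrite mulr_ge0// mulr_ge0 ?expR_ge0// trunc_exp_ge0.
have h3 : 0 <= expR s2 * \1_[set t | s1 <= u * t] x :> R.
  by rewrite mulr_ge0 ?expR_ge0// indicE.
have [c1|c1] := ltP (u * x) s1.
  by have := trunc_exp_cut_low B0 e0 s10 c1; lra.
have [c2|c2] := ltP s2 (u * x).
  by have := trunc_exp_cut_high B0 e0 c2 BB; lra.
move: h3; rewrite indicE mem_set// mulr1 => h3.
have := @trunc_exp_le_exp R B 1 (u * x) B0; rewrite mul1r => h4.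
have : expR (u * x) <= expR s2 by rewrite ler_expR.
lra.
Qed.

Lemma bernoulli_powR (x p : R) : -1 < x -> 0 < p -> p < 1 ->
  (1 + x) `^ p <= 1 + p * x.
Proof.
move=> x1 p0 p1.
have x0 : 0 <= 1 + x by lra.
have := @conjugate_powR R ((1 + x) `^ p) 1 p^-1 (1 - p)^-1 (powR_ge0 _ _) ler01.
rewrite !invr_gt0 !invrK => /(_ p0); have h : 0 < 1 - p by lra.
move=> /(_ h); have h2 : p + (1 - p) = 1 by lra.
move=> /(_ h2); rewrite mulr1 powR1 -powRrM mulfV ?gt_eqF// powRr1//; lra.
Qed.

(** One factor [1 + x] is split off and the concave bound applied to the power [a - 1]. A
    second-order bound is needed because the first-order terms nearly cancel where it is used. *)
Lemma bernoulli2_powR (x a : R) : -1 < x -> 1 < a -> a < 2 ->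
  (1 + x) `^ a <= 1 + a * x + (a - 1) * x ^+ 2.
Proof.
move=> x1 a1 a2.
have x0 : 0 < 1 + x by lra.
have -> : (1 + x) `^ a = (1 + x) * (1 + x) `^ (a - 1).
  by rewrite powR_mul_base//; congr (_ `^ _); ring.
have p0 : 0 < a - 1 by lra.
have p1 : a - 1 < 1 by lra.
have := ler_wpM2l (ltW x0) (bernoulli_powR x1 p0 p1); rewrite expr2; lra.
Qed.

End ThreeExponents.

(** * Tail of X at the scale h^(1/alpha) *)

Section SmallTimeTail.
Context {R : realType} {d : measure_display} {Omega : measurableType d}.
Variable P : probability Omega R.
Variable X : R -> Omega -> R.
Variable nu : {measure set R -> \bar R}.
Hypothesis hX : levy_process P X.
Hypothesis hc : measure_is_complete P.
Hypothesis hchar : levy_char P X nu.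
Hypothesis hW : summ nu (@jump_weight R).
Variables (a0 alpha c : R).
Hypotheses (a0_lt0 : a0 < 0) (alpha_gt1 : 1 < alpha) (alpha_lt2 : alpha < 2) (c_gt0 : 0 < c).
Hypothesis hk : forall e, 0 < e < 1 -> exists2 u0, 1 <= u0 & forall u, u0 <= u ->
  (1 - e) * c * u `^ alpha <= kappa nu a0 u <= (1 + e) * c * u `^ alpha.

Lemma near0_powR_ge (U M : R) : 0 < U ->
  \forall h \near 0^'+, M <= U * h `^ (- alpha^-1).
Proof.
move=> U0; have ai : 0 < alpha^-1 by rewrite invr_gt0; move: (alpha_gt1); lra.
pose M' := Num.max 1 M.
have M'0 : 0 < M' by rewrite lt_max ltr01.
have e0 : 0 < U / M' by rewrite divr_gt0.
have /cvgrPdist_le /(_ _ e0) := @powR_cvg0 R _ ai => H.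
near=> h; have h0 : 0 < h by near: h; exact: nbhs_right_gt.
have : `|0 - h `^ alpha^-1| <= U / M' by near: h.
rewrite sub0r normrN ger0_norm ?powR_ge0// ler_pdivlMr// => h1.
apply: (@le_trans _ _ M'); first by rewrite le_max lexx orbT.
by rewrite powRN ler_pdivlMr ?powR_gt0// mulrC.
Unshelve. all: by end_near. Qed.

(** At the exponent U h^(-1/alpha) the product of [kappa] and time has a finite limit, as for an
    exactly stable law, whereas time multiplied by a linear term in the exponent tends to 0. *)
Lemma kappa_scaled_cvg (U : R) : 0 < U ->
  kappa nu a0 (U * h `^ (- alpha^-1)) * h @[h --> 0^'+] --> c * U `^ alpha.
Proof.
move=> U0; apply/cvgrPdist_le => e e0.
have an0 : alpha != 0 by rewrite gt_eqF//; move: (alpha_gt1); lra.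
have C0 : 0 < c * U `^ alpha by rewrite mulr_gt0// powR_gt0.
pose e' := Num.min (2^-1) (e / (c * U `^ alpha)).
have e'0 : 0 < e' < 1 by rewrite /e' lt_min invr_gt0 divr_gt0// gt_min; apply/andP; split => //; apply/orP; left; lra.
have [u0 u01 hu] := hk e'0.
near=> h; have h0 : 0 < h by near: h; exact: nbhs_right_gt.
have hh : u0 <= U * h `^ (- alpha^-1) by near: h; exact: near0_powR_ge.
have := hu _ hh.
have -> : (U * h `^ (- alpha^-1)) `^ alpha = U `^ alpha / h.
  rewrite powRM ?powR_ge0 ?(ltW U0)// -powRrM mulNr mulVf// powR_inv1// ltW.
move=> /andP[h1 h2].
have h1' := ler_wpM2r (ltW h0) h1; have h2' := ler_wpM2r (ltW h0) h2.
have hn : h != 0 by rewrite gt_eqF.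
rewrite -!mulrA mulVf// mulr1 in h1' h2'.
have e'e : e' * (c * U `^ alpha) <= e.
  by rewrite -ler_pdivlMr// ge_min lexx orbT.
by rewrite ler_norml; apply/andP; split; lra.
Unshelve. all: by end_near. Qed.

Lemma time_scaled_cvg (U k : R) : 0 < U -> h * (U * h `^ (- alpha^-1) * k) @[h --> 0^'+] --> (0 : R).
Proof.
move=> U0; have ai : 0 < 1 - alpha^-1.
  by rewrite subr_gt0 invf_lt1//; move: (alpha_gt1); lra.
have : (U * k) * h `^ (1 - alpha^-1) @[h --> 0^'+] --> U * k * 0.
  by apply: cvgMr; exact: powR_cvg0.
rewrite mulr0; apply: cvg_trans; apply: near_eq_cvg; near=> h.
have h0 : 0 < h by near: h; exact: nbhs_right_gt.
by rewrite -(powR_mul_base _ h0); ring.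
Unshelve. all: by end_near. Qed.

Lemma norm_bounds (x e : R) : `|x| <= e -> - e <= x /\ x <= e.
Proof. by rewrite ler_norml => /andP. Qed.

(** The order of limits matters: the level [B] is fixed first and costs [k / B], then [h] tends to 0
    and removes the slack, whose size depends on [B]. *)
Lemma trunc_exp_limit (U e : R) : 0 < U -> 0 < e ->
  exists2 B0, 0 < B0 & forall B, B0 <= B -> \forall h \near 0^'+,
    `|\int[P]_w trunc_exp B (U * h `^ (- alpha^-1)) (X h w) - expR (c * U `^ alpha)| <= e.
Proof.
have arith1 (E I v l m L f : R) : L - l <= f / 2 -> - (f / 2) <= E - v -> I <= v -> l <= I ->
    m <= f / 2 -> E - m <= L -> - f <= I - E <= f by move=> *; apply/andP; split; lra.
have arith2 (b : R) : 0 < b -> 1 - b <= (1 + b)^-1.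
  move=> b0; rewrite -[leRHS]mul1r ler_pdivlMr; last lra.
  by have := sqr_ge0 b; rewrite expr2; lra.
have arith3 (k f B : R) : 2 * k <= B * f -> k <= f / 2 * B by lra.
have arith4 (E B C D : R) : E - E * (1 + 3 * C * D) / B = E * (1 - B^-1 - 3 / B * C * D) by ring.
move=> U0 e0.
set C1 := c * U `^ alpha; set C2 := c * (2 * U) `^ alpha.
have C10 : 0 <= C1 by rewrite mulr_ge0 ?powR_ge0// ltW.
have E1 := expR_gt0 C1; have E2 := expR_gt0 C2.
(* The summand 1 accounts for the truncated exponential at 0 being [(1 + B^-1)^-1] instead of 1, the
   other summand for the truncation loss at the doubled exponent. *)
pose k := expR C1 * (1 + 3 * C1 * expR C2).
have k0 : 0 < k.
  have t0 : 0 <= 3 * C1 * expR C2 by apply: mulr_ge0 (ltW E2); exact: mulr_ge0.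
  have t1 : 0 < 1 + 3 * C1 * expR C2 by lra.
  exact: mulr_gt0 E1 t1.
have ke0 : 0 < 2 * k / e by apply: divr_gt0 => //; apply: mulr_gt0.
exists (2 * k / e) => //.
move=> B BB; have B0 : 0 < B by exact: lt_le_trans BB.
have U20 : 0 < 2 * U by rewrite mulr_gt0.
have ck1 := kappa_scaled_cvg U0; have ck2 := kappa_scaled_cvg U20.
rewrite -/C1 in ck1; rewrite -/C2 in ck2.
have cE1 : expR (kappa nu a0 (U * h `^ (- alpha^-1)) * h) @[h --> 0^'+] --> expR C1.
  exact: (continuous_cvg _ (@continuous_expR R C1) ck1).
have cE2 : expR (kappa nu a0 (2 * U * h `^ (- alpha^-1)) * h) @[h --> 0^'+] --> expR C2.
  exact: (continuous_cvg _ (@continuous_expR R C2) ck2).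
have ct1 := time_scaled_cvg (B * kappa_slack nu a0) U0.
have ct2 := time_scaled_cvg (B ^+ 2 * kappa_slack nu a0) U20.
pose up (h : R) := expR (kappa nu a0 (U * h `^ (- alpha^-1)) * h) *
   (1 + h * (U * h `^ (- alpha^-1) * (B * kappa_slack nu a0))).
have cup : up h @[h --> 0^'+] --> expR C1 * (1 + 0).
  by apply: (cvgM cE1); apply: (cvgD _ ct1); exact: cvg_cst.
pose lo (h : R) := expR (kappa nu a0 (U * h `^ (- alpha^-1)) * h) *
   ((1 + B^-1)^-1 - (3 / B * (kappa nu a0 (U * h `^ (- alpha^-1)) * h) *
     (expR (kappa nu a0 (2 * U * h `^ (- alpha^-1)) * h) *
       (1 + h * (2 * U * h `^ (- alpha^-1) * (B ^+ 2 * kappa_slack nu a0)))) +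
     h * (U * h `^ (- alpha^-1) * (B * kappa_slack nu a0)))).
have clo : lo h @[h --> 0^'+] --> expR C1 * ((1 + B^-1)^-1 - (3 / B * C1 * (expR C2 * (1 + 0)) + 0)).
  apply: (cvgM cE1); apply: cvgB; first exact: cvg_cst.
  apply: (cvgD _ ct1); apply: cvgM; first exact: cvgMr.
  by apply: (cvgM cE2); apply: (cvgD _ ct2); exact: cvg_cst.
rewrite addr0 mulr1 in cup; rewrite !addr0 mulr1 in clo.
have e20 : 0 < e / 2 by rewrite divr_gt0.
move/cvgrPdist_le : cup => /(_ _ e20) nup.
move/cvgrPdist_le : clo => /(_ _ e20) nlo.
near=> h; have h0 : 0 < h by near: h; exact: nbhs_right_gt.
have u1 : 1 <= U * h `^ (- alpha^-1) by near: h; exact: near0_powR_ge.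
have : `|expR C1 - up h| <= e / 2 by near: h.
have : `|expR C1 * ((1 + B^-1)^-1 - 3 / B * C1 * expR C2) - lo h| <= e / 2 by near: h.
move=> /norm_bounds[l1 l2] /norm_bounds[l3 l4].
have hup := @trunc_exp_upper _ _ _ P X nu hX hc hchar hW a0 a0_lt0 B _ h B0 u1 (ltW h0).
have hlo := @trunc_exp_lower _ _ _ P X nu hX hc hchar hW a0 a0_lt0 B _ h B0 u1 h0.
have hup' : \int[P]_w trunc_exp B (U * h `^ (- alpha^-1)) (X h w) <= up h.
  by move: hup; rewrite /up -!mulrA.
have hlo' : lo h <= \int[P]_w trunc_exp B (U * h `^ (- alpha^-1)) (X h w).
  apply: le_trans hlo; rewrite le_eqVlt /lo; apply/orP; left; apply/eqP.
  rewrite [in RHS]/trunc_exp mulr0 expR0 div1r mul1r; congr (_ * (_ - _)).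
  by rewrite -!mulrA; ring.
have kB : k / B <= e / 2.
  by rewrite ler_pdivrMr//; apply: arith3; rewrite -ler_pdivrMr.
have lim : expR C1 - k / B <= expR C1 * ((1 + B^-1)^-1 - 3 / B * C1 * expR C2).
  have -> : expR C1 - k / B = expR C1 * (1 - B^-1 - 3 / B * C1 * expR C2) by exact: arith4.
  rewrite ler_wpM2l ?(ltW E1)// lerD2r.
  have Bi : 0 < B^-1 by rewrite invr_gt0.
  exact: arith2.
by rewrite ler_norml; exact: arith1 l2 l3 hup' hlo' kB lim.
Unshelve. all: by end_near. Qed.

(* The mean of [expR (u * X h)] comes from [s1 <= u * X h <= s2]: below [s1] it is
   controlled by the exponent [(1 - eta) * u], above [s2] by [(1 + eta) * u], and in
   between the integrand is at most [expR s2]. *)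
Lemma small_time_tail (e : R) : 0 < e < 1 -> exists2 M, 0 < M &
  forall U, 0 < U -> M <= U `^ alpha -> \forall h \near 0^'+,
  ((expR (- (c * U `^ alpha * (alpha * (1 + e) - 1))) / 2)%:E <=
   P [set w | ((1 - e) * c * alpha * U `^ (alpha - 1) * h `^ alpha^-1 <= X h w)%R])%E.
Proof.
have arith1 (k I E Q : R) : 0 < k -> I - E <= 1 -> 1 <= E -> k * E <= Q -> k * I <= 2 * Q.
  by move=> k0 h1 h2 h3; have : k * I <= k * (2 * E) by [rewrite ler_pM2l//; lra]; lra.
have arith2 (E I x y p Q : R) : - 1 <= I - E -> I <= x + y + p -> x <= 2 * Q ->
    y <= 4 * Q -> 14 * Q <= E -> 1 <= Q -> E / 2 <= p by lra.
move=> /andP[e0 e1]; have a1 := alpha_gt1; have a2 := alpha_lt2; have c0 := c_gt0.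
pose k0 := alpha * e ^+ 2 / 4.
have k00 : 0 < k0 by rewrite divr_gt0// mulr_gt0 ?exprn_gt0//; lra.
(* Then [k0 * C0 >= 13], so e^(k0 C0) >= 14. The outer parts contribute at most 2 Q and 4 Q and the
   limit error at most 1 <= Q; removing 7 Q from [expR C0] leaves at least its half. *)
exists (13 / (c * k0)); first by rewrite divr_gt0// mulr_gt0.
move=> U U0 MU; set eta := e / 2.
have ck0 : 0 < c * k0 by rewrite mulr_gt0.
have MU' : 13 <= k0 * (c * U `^ alpha) by move: MU; rewrite ler_pdivrMr//; lra.
have Ua : U * U `^ (alpha - 1) = U `^ alpha by rewrite powR_mul_base//; congr (_ `^ _); ring.
set s1 := (1 - e) * c * alpha * U `^ alpha; set s2 := (1 + e) * c * alpha * U `^ alpha.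
have UUa0 : 0 < U `^ alpha by exact: powR_gt0.
set C0 := c * U `^ alpha; rewrite -/C0 in MU'.
have C00 : 0 < C0 by rewrite mulr_gt0.
have s1E : s1 = (1 - e) * alpha * C0 by rewrite /s1 /C0; ring.
have s2E : s2 = (1 + e) * alpha * C0 by rewrite /s2 /C0; ring.
have s10 : 0 <= s1 by rewrite s1E; have := mulr_ge0 (_ : 0 <= (1 - e) * alpha) (ltW C00); apply; apply: mulr_ge0; lra.
have et0 : 0 <= eta by rewrite /eta; lra.
have Um0 : 0 < (1 - eta) * U by rewrite mulr_gt0//; rewrite /eta; lra.
have Up0 : 0 < (1 + eta) * U by rewrite mulr_gt0//; rewrite /eta; lra.
have bm : c * ((1 - eta) * U) `^ alpha <= C0 * (1 - alpha * eta + (alpha - 1) * eta ^+ 2).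
  rewrite powRM ?(ltW U0)//; last by rewrite /eta; lra.
  have h1 : -1 < - eta by rewrite /eta; lra.
  have := bernoulli2_powR h1 a1 a2; rewrite sqrrN mulrN => h2.
  by have := ler_wpM2l (ltW C00) h2; rewrite /C0; lra.
have bp : c * ((1 + eta) * U) `^ alpha <= C0 * (1 + alpha * eta + (alpha - 1) * eta ^+ 2).
  rewrite powRM ?(ltW U0)//; last by rewrite /eta; lra.
  have h1 : -1 < eta by rewrite /eta; lra.
  have h2 := bernoulli2_powR h1 a1 a2.
  by have := ler_wpM2l (ltW C00) h2; rewrite /C0; lra.
have small : (alpha - 1) * eta ^+ 2 <= k0.
  have -> : k0 = alpha * eta ^+ 2 by rewrite /k0 /eta; field.
  by rewrite ler_wpM2r ?sqr_ge0//; lra.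
have k0E : k0 + k0 = alpha * eta * e by rewrite /k0 /eta; field.
(* The first-order terms cancel except for alpha eta e C0, which is 2 k0 C0 since [eta = e / 2]; the
   second-order term takes back at most k0 C0. The same computation applies on the other side. *)
have xm : eta * s1 + c * ((1 - eta) * U) `^ alpha <= C0 - k0 * C0.
  have : C0 * ((alpha - 1) * eta ^+ 2) <= C0 * k0 by rewrite ler_pM2l.
  have : C0 * (k0 + k0) = C0 * (alpha * eta * e) by rewrite k0E.
  rewrite s1E; lra.
have xp : - (eta * s2) + c * ((1 + eta) * U) `^ alpha <= C0 - k0 * C0.
  have : C0 * ((alpha - 1) * eta ^+ 2) <= C0 * k0 by rewrite ler_pM2l.
  have : C0 * (k0 + k0) = C0 * (alpha * eta * e) by rewrite k0E.
  rewrite s2E; lra.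
clear bm bp small k0E.
have [B1 B10 hB1] := trunc_exp_limit U0 ltr01.
have [B2 B20 hB2] := trunc_exp_limit Um0 ltr01.
have [B3 B30 hB3] := trunc_exp_limit Up0 ltr01.
pose B := Num.max B1 B2; pose B' := Num.max B3 (B * expR (eta * s2)).
have BB1 : B1 <= B by rewrite le_max lexx.
have BB2 : B2 <= B by rewrite le_max lexx orbT.
have BB3 : B3 <= B' by rewrite le_max lexx.
have BB' : B * expR (eta * s2) <= B' by rewrite le_max lexx orbT.
have B0 : 0 < B by exact: lt_le_trans BB1.
have B'0 : 0 < B' by exact: lt_le_trans BB3.
have n1 := hB1 _ BB1; have n2 := hB2 _ BB2; have n3 := hB3 _ BB3.
clear hB1 hB2 hB3 BB1 BB2 BB3 B10 B20 B30.
have n4 := near0_powR_ge 1 U0; have n5 := near0_powR_ge 1 Um0; have n6 := near0_powR_ge 1 Up0.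
have n7 : \forall h \near 0^'+, (0 : R) < h by exact: nbhs_right_gt.
apply: filterS (filterI n1 (filterI n2 (filterI n3 (filterI n4 (filterI n5 (filterI n6 n7)))))).
move=> h [m1 [m2 [m3 [u1 [um1 [up1 h0]]]]]]; rewrite -/C0 in m1.
clear n1 n2 n3 n4 n5 n6 n7.
pose u := U * h `^ (- alpha^-1); rewrite -/u in u1 m1; rewrite -mulrA -/u in um1 m2; rewrite -mulrA -/u in up1 m3.
have ugt0 : 0 < u by exact: lt_le_trans ltr01 u1.
have mX := levy_measurable hX h.
set A := [set w | _ <= X h w].
have mA : measurable A.
  rewrite (_ : A = X h @^-1` `[(1 - e) * c * alpha * U `^ (alpha - 1) * h `^ alpha^-1, +oo[%classic); last first.
    by apply/seteqP; split => w /=; rewrite /A/= in_itv/= andbT.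
  by rewrite -[X in measurable X]setTI; exact: mX.
have AE w : (s1 <= u * X h w) = (\1_A w == 1 :> R).
  have -> : s1 = u * ((1 - e) * c * alpha * U `^ (alpha - 1) * h `^ alpha^-1).
    rewrite /u /s1 -Ua powRN; have := powR_gt0 alpha^-1 h0 => hp.
    by field; rewrite gt_eqF.
  rewrite ler_pM2l//.
  rewrite indicE; case: (boolP (w \in A)); rewrite ?inE ?notin_setE /A/= => hA.
    by rewrite hA eqxx.
  by move/negP/negbTE : hA => ->; rewrite eq_sym oner_eq0.
have split w : trunc_exp B u (X h w) <= expR (eta * s1) * trunc_exp B ((1 - eta) * u) (X h w) +
    2 * expR (- (eta * s2)) * trunc_exp B' ((1 + eta) * u) (X h w) + expR s2 * \1_A w.
  apply: le_trans (trunc_exp_split u (X h w) B0 et0 s10 BB') _.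
  rewrite lerD2l ler_wpM2l ?expR_ge0// indicE.
  case: (boolP (_ \in _)) => [|_]; last by rewrite indicE.
  by rewrite inE/= AE => /eqP ->.
have sA : summ P (\1_A : Omega -> R).
  apply: (@summ_bounded _ _ _ P _ 1); first exact: measurable_indic.
  by move=> w; rewrite indicE; case: (_ \in _); rewrite ?normr1 ?normr0.
have sm := @summ_trunc_expX _ _ _ P X hX B _ h B0 um1.
have sp := @summ_trunc_expX _ _ _ P X hX B' _ h B'0 up1.
have := Rint_le (@summ_trunc_expX _ _ _ P X hX B _ h B0 u1)
  (summD (summD (summZ _ sm) (summZ _ sp)) (summZ _ sA)) split.
rewrite RintD; [|by apply: summD; exact: summZ|exact: summZ].
rewrite RintD; [|exact: summZ|exact: summZ].
rewrite !RintZ//.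
have PA : P A = (\int[P]_w \1_A w)%:E.
  by rewrite EFin_Rint// integral_indic// setIT.
rewrite PA lee_fin.
move: (\int[P]_w \1_A w) => p.
move: m1 m2 m3.
move: (\int[P]_w trunc_exp B u (X h w)) (\int[P]_w trunc_exp B ((1 - eta) * u) (X h w))
  (\int[P]_w trunc_exp B' ((1 + eta) * u) (X h w)) => I1 I2 I3.
move=> /norm_bounds[m1 _] /norm_bounds[_ m2] /norm_bounds[_ m3] main.
set Em := expR (c * ((1 - eta) * U) `^ alpha) in m2.
set Ep := expR (c * ((1 + eta) * U) `^ alpha) in m3.
have Em1 : 1 <= Em by rewrite /Em -[X in X <= _]expR0 ler_expR mulr_ge0 ?powR_ge0// ltW.
have Ep1 : 1 <= Ep by rewrite /Ep -[X in X <= _]expR0 ler_expR mulr_ge0 ?powR_ge0// ltW.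
pose Q := expR (C0 - k0 * C0).
have Qm : expR (eta * s1) * Em <= Q by rewrite /Em -expRD ler_expR.
have Qp : expR (- (eta * s2)) * Ep <= Q by rewrite /Ep -expRD ler_expR.
have em0 := expR_gt0 (eta * s1); have ep0 := expR_gt0 (- (eta * s2)).
have t1 : expR (eta * s1) * I2 <= 2 * Q by exact: arith1 em0 m2 Em1 Qm.
have t2 : 2 * expR (- (eta * s2)) * I3 <= 4 * Q.
  have := arith1 _ _ _ _ ep0 m3 Ep1 Qp; rewrite -mulrA.
  by rewrite -(ler_pM2l (ltr0Sn R 1)) => /le_trans; apply; rewrite mulrA -natrM.
have QC : 14 * Q <= expR C0.
  have -> : expR C0 = expR (k0 * C0) * Q by rewrite /Q -expRD; congr expR; ring.
  rewrite ler_wpM2r ?expR_ge0//; apply: le_trans (expR_ge1Dx _).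
  by rewrite -[14]/((1 + 13)%:R) natrD lerD2l.
have Q1 : 1 <= Q by apply: le_trans Qm; rewrite -[X in X <= _]mul1r ler_pM//; rewrite -[X in X <= _]expR0 ler_expR mulr_ge0.
have pE : expR C0 / 2 <= expR s2 * p by exact: arith2 m1 main t1 t2 QC Q1.
have -> : - (C0 * (alpha * (1 + e) - 1)) = - s2 + C0 by rewrite s2E; ring.
rewrite expRD -mulrA.
have s0 := expR_gt0 (- s2).
have -> : p = expR (- s2) * (expR s2 * p) by rewrite mulrA -expRD addNr expR0 mul1r.
by rewrite ler_wpM2l ?(ltW s0).
Qed.

End SmallTimeTail.

(** * Large moves as sums of moderate ones *)

Section LargeMoves.
Context {R : realType} {d : measure_display} {Omega : measurableType d}.
Variable P : probability Omega R.
Variable X : R -> Omega -> R.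
Hypothesis hX : levy_process P X.

Lemma levy_power (a q h : R) (n : nat) : 0 <= q -> 0 < h ->
  (q%:E <= P [set w | (a <= X h w)%R])%E ->
  ((q ^+ n)%:E <= P [set w | (a * n%:R <= X (h * n%:R) w)%R])%E.
Proof.
move=> q0 h0 hq.
have [mX X0 _ stat ind] := hX.
have h0' := ltW h0.
pose B : set R := `[a, +oo[%classic.
have mB : measurable B by exact: measurable_itv.
pose tt (k : nat) : R := h * k%:R.
have tt0 : 0 <= tt 0%N by rewrite /tt mulr0.
have tti k : tt k <= tt k.+1 by rewrite /tt ler_wpM2l// ler_nat.
have PB k : P [set w | B (X (tt k.+1) w - X (tt k) w)] = P [set w | (a <= X h w)%R].
  have := stat (tt k) h B _ h0' mB.
  have -> : h + tt k = tt k.+1 by rewrite /tt -natr1 mulrDr mulr1 addrC.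
  rewrite mulr_ge0// => /(_ isT) ->; congr (P _).
  by apply/seteqP; split => w; rewrite /B/= in_itv/= andbT.
have mle t (b : R) : measurable [set w | b <= X t w].
  have -> : [set w | b <= X t w] = X t @^-1` `[b, +oo[%classic.
    by apply/seteqP; split => w; rewrite /= in_itv/= andbT.
  by rewrite -[X in measurable X]setTI; exact: mX.
have low : ((q ^+ n)%:E <= \prod_(k < n) P [set w | B (X (tt k.+1) w - X (tt k) w)%R])%E.
  elim: n => [|n IH]; first by rewrite big_ord0 expr0.
  rewrite big_ord_recr/= exprSr EFinM lee_pmul ?lee_fin ?exprn_ge0//.
  by rewrite PB.
apply: le_trans low _; rewrite -(ind n tt (fun=> B) tt0 tti (fun=> mB)).
have mN : measurable [set w | X 0 w != 0].
  have -> : [set w | X 0 w != 0] = ~` (X 0 @^-1` [set 0]).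
    by apply/seteqP; split => w /= => [/eqP|?]; [|apply/eqP].
  by apply: measurableC; rewrite -[X in measurable X]setTI; exact: mX.
(* The increments add up to X at the end minus X at 0, and the latter vanishes only almost surely;
   hence the extra null set. *)
apply: (@le_trans _ _ (P ([set w | a * n%:R <= X (h * n%:R) w] `|` [set w | X 0 w != 0]))).
  apply: le_measure; rewrite ?inE.
  - apply: fin_bigcap_measurable => [|k _]; first exact: finite_II.
    have -> : [set w | B (X (tt k.+1) w - X (tt k) w)] = [set w | a <= X (tt k.+1) w - X (tt k) w].
      by apply/seteqP; split => w; rewrite /B/= in_itv/= andbT.
    have -> : [set w | a <= X (tt k.+1) w - X (tt k) w] = (fun w => X (tt k.+1) w - X (tt k) w) @^-1` `[a, +oo[%classic.
      by apply/seteqP; split => w; rewrite /= in_itv/= andbT.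
    by rewrite -[X in measurable X]setTI; apply: (measurable_funB (mX _) (mX _)).
  - exact: measurableU.
  move=> w hw; have [w0|w0] := eqVneq (X 0 w) 0; [left|by right].
  rewrite /=; have step k : (k <= n)%N -> a * k%:R <= X (tt k) w.
    elim: k => [|k IH] kn; first by rewrite mulr0 /tt mulr0 w0.
    have := hw k kn; rewrite /B/= in_itv/= andbT => h1.
    by have := IH (ltnW kn); rewrite -natr1 mulrDr mulr1; lra.
  exact: step.
apply: le_trans (measureU2 _ _ _) _ => //.
by rewrite [X in (_ + X)%E]X0 adde0.
Qed.

Variables (alpha c : R).
Hypotheses (alpha_gt1 : 1 < alpha) (alpha_lt2 : alpha < 2) (c_gt0 : 0 < c).
Hypothesis tail : forall e, 0 < e < 1 -> exists2 M, 0 < M &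
  forall U, 0 < U -> M <= U `^ alpha -> \forall h \near 0^'+,
  ((expR (- (c * U `^ alpha * (alpha * (1 + e) - 1))) / 2)%:E <=
   P [set w | ((1 - e) * c * alpha * U `^ (alpha - 1) * h `^ alpha^-1 <= X h w)%R])%E.

Definition front (t : R) : R := t `^ alpha^-1 * `|ln t| `^ (1 - alpha^-1).
Definition front_const : R := (alpha * c) `^ alpha^-1.

Lemma powR_invr (x p : R) : 0 < x -> (x^-1) `^ p = (x `^ p)^-1.
Proof. by move=> x0; rewrite -[x^-1]powR_inv1 ?ltW// -powRrM mulN1r powRN. Qed.

(** The level reached by N |ln t| blocks. The powers of [U] cancel because alpha (1 - 1/alpha) =
    alpha - 1, so [U] stays free. One factor [1 - e] absorbs [1 - e1]; the other suffices for the
    power of [(1 - e) ^+ 2], since 2 (1 - 1/alpha) <= 1 for alpha < 2. *)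
Lemma front_level (e e1 U : R) : 0 < e < 1 -> 0 < e1 -> e1 <= e -> 0 < U ->
  (1 - e) ^+ 2 * front_const <=
  (1 - e1) * c * alpha * U `^ (alpha - 1) * ((1 - e) ^+ 2 / (c * alpha * U `^ alpha)) `^ (1 - alpha^-1).
Proof.
move=> /andP[e0 e1'] e10 e1e U0; have a1 := alpha_gt1; have a2 := alpha_lt2; have c0 := c_gt0.
have ca : 0 < c * alpha by rewrite mulr_gt0//; lra.
have an0 : alpha != 0 by rewrite gt_eqF//; lra.
have Ua : 0 < U `^ alpha by exact: powR_gt0.
set p := 1 - alpha^-1.
have ai : 1 / 2 < alpha^-1 by rewrite div1r ltf_pV2 ?posrE//; lra.
have ai1 : alpha^-1 < 1 by rewrite invf_lt1//; lra.
have E0 : 0 < (1 - e) ^+ 2 by rewrite exprn_gt0//; lra.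
rewrite powRM ?(ltW E0)//; last by rewrite invr_ge0 ltW// mulr_gt0.
rewrite powR_invr; last by rewrite mulr_gt0.
rewrite [(c * alpha * _) `^ p]powRM ?(ltW ca) ?(ltW Ua)//.
have -> : (U `^ alpha) `^ p = U `^ (alpha - 1).
  by rewrite -powRrM; congr (_ `^ _); rewrite /p mulrBr mulr1 mulfV.
have Ub : 0 < U `^ (alpha - 1) by exact: powR_gt0.
have cap : 0 < (c * alpha) `^ p by exact: powR_gt0.
have caE : c * alpha = (c * alpha) `^ p * front_const.
  rewrite /front_const [alpha * c]mulrC -powRD; last by rewrite (gt_eqF ca) implybT.
  by rewrite /p subrK powRr1// ltW.
have -> : (1 - e1) * c * alpha * U `^ (alpha - 1) *
   (((1 - e) ^+ 2) `^ p * ((c * alpha) `^ p * U `^ (alpha - 1))^-1) =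
   (1 - e1) * ((1 - e) ^+ 2) `^ p * front_const.
  rewrite -[(1 - e1) * c * alpha]mulrA {1}caE; field.
  by rewrite !gt_eqF.
have fc : 0 < front_const by rewrite powR_gt0// mulr_gt0//; lra.
rewrite ler_pM2r//; apply: (@le_trans _ _ ((1 - e) * (1 - e))); first by rewrite expr2.
apply: ler_pM; [lra|lra|lra|].
have -> : (1 - e) ^+ 2 = (1 - e) `^ 2 by rewrite powR_mulrn//; lra.
rewrite -powRrM -[X in X <= _](@powRr1 _ (1 - e)); last lra.
by apply: ger_powR; [lra|rewrite /p; lra].
Qed.

Lemma large_move_lower (e : R) : 0 < e < 1 -> exists2 q, 0 < q &
  \forall t \near 0^'+, ((q * t `^ ((1 - e) * (1 - alpha^-1)))%:E <=
    P [set w | ((1 - e) ^+ 2 * front_const * front t <= X t w)%R])%E.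
Proof.
have arith_pow (m x n y k : R) : m * x <= (n * y + 1) * x -> n * x * y <= k * y ->
  - x + k * - y <= m * - x by lra.
move=> e01; have /andP[e0 e1'] := e01.
have a1 := alpha_gt1; have a2 := alpha_lt2; have c0 := c_gt0.
have an0 : alpha != 0 by rewrite gt_eqF//; lra.
have ai : 0 < alpha^-1 by rewrite invr_gt0; lra.
have ai1 : alpha^-1 < 1 by rewrite invf_lt1//; lra.
(* Chosen so that alpha (1 + e1) - 1 = (alpha - 1)(1 + e / 2): the rate in the tail bound is then
   close to its ideal value. *)
pose e1 := e * (alpha - 1) / (2 * alpha).
have e10 : 0 < e1 by rewrite /e1 divr_gt0// mulr_gt0//; lra.
have e1E : alpha * e1 = e * (alpha - 1) / 2 by rewrite /e1; field.
have e1e : e1 <= e.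
  rewrite /e1 ler_pdivrMr; last by rewrite mulr_gt0//; lra.
  by rewrite ler_pM2l//; lra.
have e1_01 : 0 < e1 < 1 by rewrite e10; apply: le_lt_trans e1e _.
have [M M0 hM] := tail e1_01.
have ea : 0 < e * (alpha - 1) by rewrite mulr_gt0//; lra.
have l2 : 0 < ln 2 :> R by rewrite ln_gt0//; lra.
(* A large [U] makes the factor 1/2 in the tail bound, raised to the number of blocks, cost only a
   small share of the exponent. *)
pose M' := Num.max M (4 * ln 2 / (c * (e * (alpha - 1)))).
have M'0 : 0 < M' by rewrite lt_max M0.
pose U := M' `^ alpha^-1.
have U0 : 0 < U by exact: powR_gt0.
have Ua : U `^ alpha = M' by rewrite /U -powRrM mulVf// powRr1// ltW.
have MU : M <= U `^ alpha by rewrite Ua le_max lexx.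
have lU : ln 2 / (c * U `^ alpha) <= e * (alpha - 1) / 4.
  rewrite ler_pdivrMr ?mulr_gt0 ?powR_gt0// Ua.
  have : 4 * ln 2 / (c * (e * (alpha - 1))) <= M' by rewrite le_max lexx orbT.
  by rewrite ler_pdivrMr ?mulr_gt0//; lra.
set W := c * U `^ alpha in lU.
have W0 : 0 < W by rewrite mulr_gt0// powR_gt0.
pose L := W * (alpha * (1 + e1) - 1) + ln 2.
have L0 : 0 < L by rewrite addr_gt0// mulr_gt0//; rewrite mulrDr e1E; lra.
pose N := (1 - e) ^+ 2 / (c * alpha * U `^ alpha).
have NE : N = (1 - e) ^+ 2 / (alpha * W) by rewrite /N /W; congr (_ / _); ring.
have N0 : 0 < N.
  rewrite NE; apply: divr_gt0; first by rewrite exprn_gt0// subr_gt0.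
  exact: mulr_gt0 (lt_trans ltr01 a1) W0.
have NL : N * L <= (1 - e) * (1 - alpha^-1).
  have -> : N * L = (1 - e) ^+ 2 * ((alpha * (1 + e1) - 1 + ln 2 / W) / alpha).
    by rewrite NE /L; field; rewrite an0 gt_eqF.
  have -> : 1 - alpha^-1 = (alpha - 1) / alpha by field.
  rewrite expr2 -mulrA; apply: ler_wpM2l; first lra.
  rewrite mulrA ler_pM2r//.
  apply: le_trans (_ : (1 - e) * ((1 + e) * (alpha - 1)) <= _).
    by apply: ler_wpM2l; [lra|rewrite mulrDr e1E; lra].
  have : 0 <= e * e * (alpha - 1) by rewrite mulr_ge0// ?mulr_ge0 ?(ltW e0)//; lra.
  lra.
have lev := front_level e01 e10 e1e U0.
exists (expR (- L)); first exact: expR_gt0.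
have := hM _ U0 MU.
rewrite near_withinE => /nbhs_ballP [h0 /= h00 hh].
rewrite near_withinE; apply/nbhs_ballP; exists (Num.min h0 1) => /=; first by rewrite lt_min h00 ltr01.
move=> t; rewrite /ball/= sub0r normrN => + t0; rewrite gtr0_norm// lt_min => /andP[th t1].
set l := `|ln t|.
have lE : ln t = - l by rewrite /l ler0_norm ?opprK// ln_le0// ltW.
have l0 : 0 <= l by exact: normr_ge0.
(* At least [N * l] blocks are needed to reach the level; rounding up adds at most one block, whose
   factor [expR (- L)] is the constant [q]. *)
pose n := (Num.truncn (N * l)).+1.
have n0 : (0 : R) < n%:R by rewrite ltr0n.
have Nl0 : 0 <= N * l by rewrite mulr_ge0// ltW.
have nN : N * l <= n%:R by rewrite ltW// /n truncnS_gt.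
have nN1 : n%:R <= N * l + 1.
  by rewrite /n -natr1 lerD2r truncn_le.
have h1 : 0 < t / n%:R by rewrite divr_gt0.
have hlt : t / n%:R < h0.
  by apply: le_lt_trans th; rewrite ler_pdivrMr// ler_peMr ?(ltW t0)// ler1n.
have := hh (t / n%:R); rewrite /ball/= sub0r normrN gtr0_norm// => /(_ hlt h1) tl.
have q0 : 0 <= expR (- (W * (alpha * (1 + e1) - 1))) / 2 by rewrite divr_ge0 ?expR_ge0.
have := levy_power n q0 h1 tl.
have -> : expR (- (W * (alpha * (1 + e1) - 1))) / 2 = expR (- L).
  by rewrite /L opprD expRD [expR (- ln 2)]expRN lnK ?posrE.
rewrite divfK ?gt_eqF// => Ptail.
apply: (@le_trans _ _ (expR (- L) ^+ n)%:E).
  rewrite lee_fin -expRM_natl /powR (gt_eqF t0) -expRD ler_expR lE.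
  have nL : n%:R * L <= (N * l + 1) * L by rewrite ler_wpM2r// ltW.
  have NLl : N * L * l <= (1 - e) * (1 - alpha^-1) * l by rewrite ler_wpM2r.
  exact: arith_pow nL NLl.
apply: le_trans Ptail _.
have mle s (b : R) : measurable [set w | b <= X s w].
  have [mX _ _ _ _] := hX.
  have -> : [set w | b <= X s w] = X s @^-1` `[b, +oo[%classic.
    by apply/seteqP; split => w; rewrite /= in_itv/= andbT.
  by rewrite -[X in measurable X]setTI; exact: mX.
apply: le_measure; rewrite ?inE//.
move=> w /=; apply: le_trans.
have E : (t / n%:R) `^ alpha^-1 * n%:R = t `^ alpha^-1 * n%:R `^ (1 - alpha^-1).
  rewrite powRM ?invr_ge0 ?(ltW n0) ?(ltW t0)// powR_invr// -mulrA; congr (_ * _).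
  by rewrite powRD ?(gt_eqF n0) ?implybT// powRr1 ?(ltW n0)// powRN mulrC.
rewrite -[leRHS]mulrA E /front -/l [leLHS]mulrCA [leRHS]mulrCA.
rewrite ler_wpM2l ?powR_ge0//.
apply: (@le_trans _ _ ((1 - e1) * c * alpha * U `^ (alpha - 1) * (N * l) `^ (1 - alpha^-1))).
  rewrite powRM// ?(ltW N0)// mulrA ler_wpM2r ?powR_ge0//.
rewrite ler_wpM2l//.
  have e1c : 0 <= 1 - e1 by case/andP: e1_01 => _ /ltW; rewrite subr_ge0.
  apply: mulr_ge0 (powR_ge0 _ _); apply: mulr_ge0 (ltW (lt_trans ltr01 a1)).
  exact: mulr_ge0 e1c (ltW c0).
have ai1' : 0 <= 1 - alpha^-1 by rewrite subr_ge0 ltW.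
by apply: ge0_ler_powR; rewrite ?nnegrE ?ler0n.
Qed.

End LargeMoves.

(** * Stopping times on a grid *)

Section GridTime.
Context {R : realType}.
Implicit Types h t : R.

(** The first grid point strictly after [t]. Strictness makes the approximation approach from the
    right, where paths are continuous, and turns the index condition into the event [h * k <= tau],
    known at time [h * k]. *)
Definition grid_time (h t : R) : R := h * (Num.truncn (t / h)).+1%:R.

Lemma grid_time_bounds h t : 0 < h -> 0 <= t -> t < grid_time h t <= t + h.
Proof.
move=> h0 t0; rewrite /grid_time; apply/andP; split.
  by rewrite mulrC -ltr_pdivrMr// truncnS_gt.
by rewrite -natr1 mulrDr mulr1 lerD2r mulrC -ler_pdivlMr// truncn_le// divr_ge0// ltW.
Qed.

Lemma grid_time_index h t k : 0 < h -> 0 <= t -> (k < (Num.truncn (t / h)).+1)%N = (h * k%:R <= t).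
Proof.
move=> h0 t0; rewrite ltnS truncn_ge_nat ?divr_ge0 ?(ltW h0)//.
by rewrite ler_pdivlMr// mulrC.
Qed.

(** Writes the value at the rounded-up time as a sum of increments with known indicators, the form
    required by the Dynkin inequality. Since [t <= h * n] the index is at most [n.+1], hence that
    many terms. *)
Lemma grid_time_sum (M : nat -> R) h t n : 0 < h -> 0 <= t <= h * n%:R ->
  M (Num.truncn (t / h)).+1 =
  M 0%N + \sum_(k < n.+1) (h * k%:R <= t)%R%:R * (M k.+1 - M k).
Proof.
move=> h0 /andP[t0 tn]; set m := (Num.truncn (t / h)).+1.
have mn : (m <= n.+1)%N.
  rewrite /m ltnS -(ler_nat R); apply: le_trans (_ : t / h <= _).
    by rewrite truncn_le// divr_ge0// ltW.
  by rewrite ler_pdivrMr// mulrC.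
rewrite (eq_bigr (fun k : 'I_n.+1 => (k < m)%:R * (M k.+1 - M k))); last first.
  by move=> k _; rewrite grid_time_index.
rewrite -(big_mkord xpredT (fun k => (k < m)%:R * (M k.+1 - M k))) (big_cat_nat (leq0n m) mn)//=.
have -> : \sum_(m <= k < n.+1) (k < m)%N%:R * (M k.+1 - M k) = 0.
  by rewrite big_nat big1// => k /andP[mk _]; rewrite ltnNge mk mul0r.
rewrite addr0.
rewrite (@eq_big_nat _ _ _ 0%N m _ (fun k => M k.+1 - M k)); last first.
  by move=> k /andP[_ km]; rewrite km mul1r.
by rewrite telescope_sumr// addrC subrK.
Qed.

End GridTime.

Section StoppedPayoff.
Context {R : realType} {d : measure_display} {Omega : measurableType d}.
Variable P : probability Omega R.
Variable X : R -> Omega -> R.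
Hypothesis hX : levy_process P X.
Hypothesis hc : measure_is_complete P.
Variables (tau : Omega -> R) (T : R).
Hypothesis T_gt0 : 0 < T.
Hypothesis st : stopping_time P X tau.
Hypothesis tau_bd : forall w, 0 <= tau w <= T.

Implicit Type h : R.

Let tau0 w : 0 <= tau w.
Proof. by case/andP: (tau_bd w). Qed.

Lemma measurable_tau_ge h k : 0 < h -> measurable [set w | h * k%:R <= tau w].
Proof.
move=> h0; apply: (aug_sigma_measurable hX hc (s := h * k%:R)).
  by rewrite mulr_ge0// ltW.
exact: stopping_time_aug.
Qed.

Lemma indic_tau_ge h k w : \1_[set w | h * k%:R <= tau w] w = (h * k%:R <= tau w)%R%:R :> R.
Proof. rewrite indicE; case: (boolP (w \in _)) => [|/negP]; rewrite inE/= => hw; first by rewrite hw.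
by move/negP/negbTE : hw => ->. Qed.

Lemma measurable_at_grid (f : nat -> Omega -> R) h : 0 < h ->
  (forall k, measurable_fun setT (f k)) ->
  measurable_fun setT (fun w => f (Num.truncn (tau w / h)).+1 w).
Proof.
move=> h0 mf; pose n := Num.truncn (T / h).
have hn : T <= h * n.+1%:R by rewrite mulrC -ler_pdivrMr// ltW// truncnS_gt.
have -> : (fun w => f (Num.truncn (tau w / h)).+1 w) =
   (fun w => f 0%N w + \sum_(k < n.+2) \1_[set w | h * k%:R <= tau w] w * (f k.+1 w - f k w)).
  apply/funext => w; rewrite (grid_time_sum (f^~ w) (n := n.+1) h0); last first.
    by have /andP[-> h2] := tau_bd w; exact: le_trans hn.
  by congr (_ + _); apply: eq_bigr => k _; rewrite indic_tau_ge.
apply: measurable_funD => //; apply: measurable_sum => k.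
apply: measurable_funM; last exact: measurable_funB.
by apply: measurable_indic; exact: measurable_tau_ge.
Qed.

Lemma grid_time_cvg w : (fun n => grid_time (T / n.+1%:R) (tau w)) @ \oo --> (tau w)^'+.
Proof.
have t0 := tau0 w; have T0 := T_gt0.
have hn n : 0 < T / n.+1%:R by rewrite divr_gt0.
have cv : (fun n => grid_time (T / n.+1%:R) (tau w)) @ \oo --> tau w.
  apply: (@squeeze_cvgr _ _ _ _ (fun=> tau w) (fun n => tau w + T * n.+1%:R^-1)).
  - by near=> n; have /andP[h1 ->] := grid_time_bounds (hn n) t0; rewrite andbT ltW.
  - exact: cvg_cst.
  - rewrite -[X in _ --> X]addr0 -[X in _ --> _ + X](mulr0 T).
    apply: cvgD; first exact: cvg_cst.
    by apply: cvgMr; exact: cvg_harmonic.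
move=> A [e /= e0 hA]; have /cvgrPdist_lt /(_ _ e0) := cv.
apply: filterS => n hd; apply: hA => //.
by have /andP[h1 _] := grid_time_bounds (hn n) t0.
Unshelve. all: by end_near. Qed.

Variables (r delta K x : R).
Hypotheses (r_gt0 : 0 < r) (K_ge0 : 0 <= K) (x_ge0 : 0 <= x).

Lemma put_payoff_bound s w : (forall w, 0 <= s w) -> `|put_payoff X r delta K x s w| <= K.
Proof.
move=> s0; rewrite /put_payoff normrM ger0_norm ?expR_ge0// ger0_norm; last by rewrite le_max lexx orbT.
rewrite -[leRHS]mul1r; apply: ler_pM; rewrite ?expR_ge0//.
- by rewrite le_max lexx orbT.
- by rewrite -[X in _ <= X]expR0 ler_expR mulNr oppr_le0 mulr_ge0// ltW.
- by rewrite ge_max K_ge0 andbT lerBlDr lerDl mulr_ge0 ?expR_ge0.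
Qed.

Definition grid_payoff (h : R) (w : Omega) : R :=
  put_payoff X r delta K x (fun w => grid_time h (tau w)) w.

Lemma measurable_grid_payoff h : 0 < h -> measurable_fun setT (grid_payoff h).
Proof.
move=> h0; apply: (measurable_at_grid (f := fun k w =>
   expR (- r * (h * k%:R)) * Num.max (K - x * expR ((r - delta) * (h * k%:R) + X (h * k%:R) w)) 0)) => // k.
have [mX _ _ _ _] := hX.
apply: measurable_funM => //; apply: measurable_maxr => //.
apply: measurable_funB => //; apply: measurable_funM => //.
by apply: measurableT_comp => //; exact: measurable_funD.
Qed.

(** Right-continuity of the paths is used here, and only outside the null set on which it may
    fail. *)
Lemma payoff_cvg_ae : {ae P, forall w,
  (fun n => grid_payoff (T / n.+1%:R) w) @ \oo --> put_payoff X r delta K x tau w}.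
Proof.
case: (levy_cadlag hX) => N [mN N0 sub]; exists N; split => // w hw; apply: sub => /= cad; apply: hw => /=.
have c1 := @grid_time_cvg w.
have ct : (fun n => grid_time (T / n.+1%:R) (tau w)) @ \oo --> tau w.
  exact: cvg_trans c1 (cvg_within _).
have [cX _] := cad _ (tau0 w).
have cXn : (fun n => X (grid_time (T / n.+1%:R) (tau w)) w) @ \oo --> X (tau w) w.
  exact: cvg_comp c1 cX.
have cr (a : R) : (fun n => a * grid_time (T / n.+1%:R) (tau w)) @ \oo --> a * tau w.
  exact: cvgMr.
have e1 : (fun n => expR (- r * grid_time (T / n.+1%:R) (tau w))) @ \oo --> expR (- r * tau w).
  exact: (continuous_cvg _ (@continuous_expR R _) (cr (- r))).
have e2 : (fun n => expR ((r - delta) * grid_time (T / n.+1%:R) (tau w) + X (grid_time (T / n.+1%:R) (tau w)) w))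
   @ \oo --> expR ((r - delta) * tau w + X (tau w) w).
  exact: (continuous_cvg _ (@continuous_expR R _) (cvgD (cr (r - delta)) cXn)).
rewrite /grid_payoff /put_payoff; apply: cvgM => //.
have e3 : (fun n => K - x * expR ((r - delta) * grid_time (T / n.+1%:R) (tau w) + X (grid_time (T / n.+1%:R) (tau w)) w))
   @ \oo --> K - x * expR ((r - delta) * tau w + X (tau w) w).
  by apply: cvgB; [exact: cvg_cst|exact: cvgMr].
under eq_fun do rewrite maxr_absE.
rewrite maxr_absE; apply: cvgMl; apply: cvgD; first by apply: cvgD => //; exact: cvg_cst.
by apply: cvg_norm; apply: cvgB => //; exact: cvg_cst.
Qed.

(** Measurability of [X] at a random time is not assumed. It comes from the almost sure limit of
    grid payoffs, with completeness of [P] covering the exceptional null set. *)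
Lemma measurable_put_payoff : measurable_fun setT (put_payoff X r delta K x tau).
Proof.
have hn n : 0 < T / n.+1%:R by rewrite divr_gt0.
have [N [mN N0 sub]] := payoff_cvg_ae.
pose g w := \1_(~` N) w * put_payoff X r delta K x tau w.
have mg : measurable_fun setT g.
  apply: (@measurable_fun_cvg _ _ _ setT (fun n w => \1_(~` N) w * grid_payoff (T / n.+1%:R) w)).
    move=> n; apply: measurable_funM; last exact: measurable_grid_payoff.
    by apply: measurable_indic; exact: measurableC.
  move=> w _; rewrite /g indicE.
  have [wN|wN] := boolP (w \in ~` N).
    apply: cvgMr; apply: contrapT => h; move: wN; rewrite inE; apply; exact: sub.
  by rewrite mul0r; under eq_fun do rewrite mul0r; exact: cvg_cst.
apply/measurable_EFinP; apply: (ae_measurable_fun hc (f := EFin \o g)) => //; last exact/measurable_EFinP.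
exists N; split => // w /= h; apply: contrapT => wN; apply: h => _.
by rewrite /= /g indicE mem_set// mul1r.
Qed.

Lemma payoff_expectation_cvg : (fun n => \int[P]_w grid_payoff (T / n.+1%:R) w) @ \oo -->
  \int[P]_w put_payoff X r delta K x tau w.
Proof.
have hn n : 0 < T / n.+1%:R by rewrite divr_gt0.
apply: (@Rint_dominated_ae _ _ _ P _ _ (fun=> K)).
- by move=> n; exact: measurable_grid_payoff.
- exact: measurable_put_payoff.
- exact: payoff_cvg_ae.
- move=> n w; apply: put_payoff_bound => w'.
  by have /andP[h _] := grid_time_bounds (hn n) (tau0 w'); rewrite ltW// (le_lt_trans _ h).
- exact: finite_measure_integrable_cst.
Qed.

Lemma payoff_expectation_le : \int[P]_w put_payoff X r delta K x tau w <= K.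
Proof.
apply: le_trans (ler_norm _) _; apply: Rint_bounded; first exact: measurable_put_payoff.
by move=> w; exact: put_payoff_bound.
Qed.

End StoppedPayoff.

(** * European put *)

Section EuropeanBound.
Context {R : realType} {d : measure_display} {Omega : measurableType d}.
Variable P : probability Omega R.
Variable X : R -> Omega -> R.
Variable nu : {measure set R -> \bar R}.
Hypothesis hX : levy_process P X.
Hypothesis hc : measure_is_complete P.
Hypothesis hchar : levy_char P X nu.
Hypothesis hW : summ nu (@jump_weight R).

(* The function is concave in [expR y], and the compensator makes [expR X] a martingale. *)
Lemma trunc_exp1_jump_le0 (B y z : R) : 0 < B ->
  trunc_exp B 1 (y + z) - trunc_exp B 1 y - trunc_exp' B 1 y * (expR z - 1) <= 0.
Proof.
move=> B0; rewrite /trunc_exp /trunc_exp' !mul1r expRD.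
move: (expR y) (expR_gt0 y) (expR z) (expR_gt0 z) => w w0 x x0.
have q0 : 0 < w / B by rewrite divr_gt0.
have q1 : 0 < w * x / B by rewrite divr_gt0// mulr_gt0.
set s := (1 + w / B)^-1; set s' := (1 + w * x / B)^-1.
have s0 : 0 < s by rewrite invr_gt0; lra.
have s'0 : 0 < s' by rewrite invr_gt0; lra.
have -> : w * x * s' - w * s - w / (1 + w / B) ^+ 2 * (x - 1) =
    - (w * s * (w * s * s' / B) * (x - 1) ^+ 2).
  rewrite /s /s'; field; rewrite !gt_eqF//; first lra.
  by move: q1; rewrite pmulr_lgt0 ?invr_gt0// => h; lra.
rewrite oppr_le0; apply: mulr_ge0; last exact: sqr_ge0.
exact: ltW (mulr_gt0 (mulr_gt0 w0 s0) (divr_gt0 (mulr_gt0 (mulr_gt0 w0 s0) s'0) B0)).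
Qed.

(** Half of the martingale property of [expR X], enough for a lower bound on a put. The truncated
    exponential of order 1 is a supersolution starting below 1, and [1 + e] times it dominates the
    minimum when [B = M / e]. *)
Lemma exp_min_le1 (T M : R) : 0 < T -> 0 < M -> \int[P]_w Num.min (expR (X T w)) M <= 1.
Proof.
move=> T0 M0; apply/ler_addgt0Pr => e e0.
pose B := M / e; have B0 : 0 < B by rewrite divr_gt0.
have MB : M / B = e by rewrite /B invf_div mulrCA mulfV ?mulr1// gt_eqF.
have [f2 lF] := C2_lip_trunc_exp B0 (lexx 1).
have g0 y : gen nu (trunc_exp B 1) (trunc_exp' B 1) y + 0 * trunc_exp' B 1 y - 0 * trunc_exp B 1 y <= 0.
  rewrite !mul0r subr0 addr0.
  have s0 := @summ_gen R nu hW _ _ _ _ y (C2_lip_bd lF).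
  have := Rint_le s0 (@summ0 R _ _ nu) (fun z => @trunc_exp1_jump_le0 B y z B0).
  by have -> : \int[nu]__ (0 : R) = 0 by rewrite /Rintegral integral0.
have ub : \int[P]_w trunc_exp B 1 (X T w) <= 1.
  have := @dynkin_fixed _ _ _ P X nu hX hc hchar hW _ _ _ _ (fun=> 0) 0 0 0 0 T 0 lF.
  have m0 : measurable_fun setT (fun _ : R => 0 : R) by exact: measurable_cst.
  move=> /(_ m0 (fun=> _) g0 (lexx 0) T0 (lexx 0)) h.
  have {h} := h _ _.
  rewrite oppr0 !mul0r expR0 mul1r mulr0 addr0 => h.
  rewrite (@eq_Rint _ _ _ P _ (fun w => trunc_exp B 1 (0 + X T w))); last first.
    by move=> w; rewrite add0r.
  have h1 : `|0 : R| <= 0 by rewrite normr0.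
  have h2 (t : R) : 0 <= t <= T -> \int[P]__ (0 : R) <= 0 by rewrite Rint_cst.
  by apply: le_trans (h h1 h2) _; rewrite addr0; exact: trunc_exp0_le1.
have mX := levy_measurable hX T.
have sm : summ P (fun w => Num.min (expR (X T w)) M).
  apply: (@summ_bounded _ _ _ P _ M).
    by apply: measurable_minr => //; exact: measurableT_comp.
  by move=> w; rewrite ger0_norm ?ge_min ?lexx ?orbT// le_min expR_ge0 ltW.
have st := @summ_trunc_expX _ _ _ P X hX B 1 T B0 (lexx 1).
apply: (@le_trans _ _ (\int[P]_w ((1 + e) * trunc_exp B 1 (X T w)))).
  apply: Rint_le => //; first exact: summZ.
  move=> w; rewrite /trunc_exp mul1r; move: (expR _) (expR_gt0 (X T w)) => a a0.
  have q : 0 < 1 + a / B by rewrite addr_gt0// divr_gt0.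
  rewrite mulrA ler_pdivlMr//.
  rewrite -MB mulrDl mul1r mulrDr mulr1.
  have [aM|aM] := leP a M.
    by rewrite lerD2l mulrC ler_pM2r// ler_pM2r ?invr_gt0.
  by apply: lerD; [exact: ltW|rewrite mulrA mulrAC].
rewrite RintZ//; apply: le_trans (ler_wpM2l _ ub) _; lra.
Qed.

Lemma stopping_time_cst (s : R) : stopping_time P X (fun=> s).
Proof.
move=> t t0 u tu; exists [set w : Omega | s <= t]; split; last first.
  by rewrite setDv setU0; exact: negligible_set0.
have [h|h] := boolP (s <= t).
  have -> : [set _ : Omega | true] = setT by apply/seteqP; split => w /=.
  exact: (@measurableT _ (g_sigma_algebraType _)).
have -> : [set _ : Omega | false] = set0 by apply/seteqP; split => w.
exact: (@measurable0 _ (g_sigma_algebraType _)).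
Qed.

Variables (r delta K : R).
Hypotheses (r_gt0 : 0 < r) (delta_ge0 : 0 <= delta) (rd_gt0 : 0 < r - delta) (K_gt0 : 0 < K).

(** Pointwise the payoff dominates an expression that equals K - S below [m] and 0 above: capping
    [expR X] at [expR m] overshoots by a constant on the event [m <= X], which the indicator term
    corrects. Only the capped mean then has to be bounded. *)
Lemma european_put_ge (T x m : R) : 0 < T -> 0 <= x ->
  expR (- r * T) * (K - x * expR ((r - delta) * T) +
    fine (P [set w | m <= X T w]) * (x * expR ((r - delta) * T) * expR m - K)) <=
  \int[P]_w put_payoff X r delta K x (fun=> T) w.
Proof.
move=> T0 x0; set E := expR ((r - delta) * T); set A := [set w | m <= X T w].
have mX := levy_measurable hX T.
have mA : measurable A.
  have -> : A = X T @^-1` `[m, +oo[%classic.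
    by apply/seteqP; split => w; rewrite /A/= in_itv/= andbT.
  by rewrite -[X in measurable X]setTI; exact: mX.
have M0 := expR_gt0 m.
have sm : summ P (fun w => Num.min (expR (X T w)) (expR m)).
  apply: (@summ_bounded _ _ _ P _ (expR m)).
    by apply: measurable_minr => //; exact: measurableT_comp.
  by move=> w; rewrite ger0_norm ?ge_min ?lexx ?orbT// le_min expR_ge0 ltW.
have sA : summ P (\1_A : Omega -> R).
  apply: (@summ_bounded _ _ _ P _ 1); first exact: measurable_indic.
  by move=> w; rewrite indicE; case: (_ \in _); rewrite ?normr1 ?normr0.
have PA : fine (P A) = \int[P]_w \1_A w.
  by rewrite /Rintegral integral_indic// setIT.
pose g w := K + (- (x * E)) * Num.min (expR (X T w)) (expR m) + (x * E * expR m - K) * \1_A w.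
have sK : summ P (fun=> K) by exact: finite_measure_integrable_cst.
have sg : summ P g by apply: summD; [apply: summD => //|]; exact: summZ.
have payoff_meas : measurable_fun setT (put_payoff X r delta K x (fun=> T)).
  apply: measurable_funM => //; apply: measurable_maxr => //.
  apply: measurable_funB => //; apply: measurable_funM => //.
  by apply: measurableT_comp => //; exact: measurable_funD.
have sp : summ P (put_payoff X r delta K x (fun=> T)).
  by apply: (@summ_bounded _ _ _ P _ K) => // w; apply: put_payoff_bound => //; [exact: ltW|move=> _; exact: ltW].
apply: (@le_trans _ _ (\int[P]_w (expR (- r * T) * g w))); last first.
  apply: Rint_le => //; first exact: summZ.
  move=> w; rewrite /put_payoff ler_wpM2l ?expR_ge0// /g indicE expRD -/E.
  have [mw|mw] := leP m (X T w).
    rewrite mem_set// mulr1.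
    have -> : Num.min (expR (X T w)) (expR m) = expR m by rewrite min_r// ler_expR.
    by rewrite le_max; apply/orP; right; lra.
  rewrite memNset/=; last by move=> h; move: mw; rewrite ltNge h.
  have -> : Num.min (expR (X T w)) (expR m) = expR (X T w) by rewrite min_l// ler_expR ltW.
  by rewrite le_max; apply/orP; left; rewrite mulr0 addr0 mulNr mulrA.
rewrite RintZ// ler_wpM2l ?expR_ge0// /g.
rewrite RintD; [|by apply: summD => //; exact: summZ|exact: summZ].
rewrite RintD//; last exact: summZ.
rewrite !RintZ// (Rint_cst P K) PA.
have := exp_min_le1 T0 M0; have xE : 0 <= x * E by rewrite mulr_ge0// expR_ge0.
move=> /(ler_wpM2l xE); lra.
Qed.

(** The supremum is a genuine one because all payoffs have mean at most [K]. *)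
Lemma american_put_ge (T t x : R) (tau : Omega -> R) : t < T -> 0 <= x ->
  stopping_time P X tau -> (forall w, 0 <= tau w <= T - t) ->
  \int[P]_w put_payoff X r delta K x tau w <= american_put P X r delta K T t x.
Proof.
move=> tT x0 st bd; apply: ub_le_sup; last by exists tau.
exists K => _ [s [ss sb ->]].
by apply: (payoff_expectation_le hX hc (T := T - t)) => //; [rewrite subr_gt0|exact: ltW].
Qed.

Variables (alpha c : R).
Hypotheses (alpha_gt1 : 1 < alpha) (alpha_lt2 : alpha < 2) (c_gt0 : 0 < c).
Hypothesis large : forall e, 0 < e < 1 -> exists2 q, 0 < q &
  \forall t \near 0^'+, ((q * t `^ ((1 - e) * (1 - alpha^-1)))%:E <=
    P [set w | ((1 - e) ^+ 2 * front_const alpha c * front alpha t <= X t w)%R])%E.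

Lemma front_ge (t : R) : 0 < t -> t <= expR (- 1) -> t `^ alpha^-1 <= front alpha t.
Proof.
move=> t0 te; rewrite /front ler_peMr ?powR_ge0//.
have lt : ln t <= - 1 by rewrite -[X in _ <= X]expRK ler_ln ?posrE ?expR_gt0.
have l1 : 1 <= `|ln t| by rewrite ler0_norm; lra.
have p0 : 0 <= 1 - alpha^-1 by rewrite subr_ge0 invf_le1; move: (alpha_gt1); lra.
by have := @ler_powR R `|ln t| l1 0 _ p0; rewrite powRr0.
Qed.

Lemma continuation_point (e : R) : 0 < e < 1 -> \forall h \near 0^'+,
  forall T t, T - t = h ->
  let x := K * expR (- ((1 - e) ^+ 3 * front_const alpha c * front alpha h)) in
  0 <= x /\ Num.max (K - x) 0 < american_put P X r delta K T t x.
Proof.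
have arith1 (x k w : R) : 1 + - x <= w -> 0 < k -> k - k * x <= w * k.
  by move=> h k0; have := ler_wpM2r (ltW k0) h; rewrite mulrDl mul1r mulNr [x * k]mulrC.
have arith2 (k x w1 w2 w3 a1 a2 a3 : R) : a1 <= w1 -> w2 <= x -> a3 <= w3 -> k - a2 <= a1 ->
  a2 < a3 -> k - x < w1 - w2 + w3 by lra.
move=> e01; have /andP[e0 e1] := e01; have a1 := alpha_gt1; have c0 := c_gt0.
have ai1 : alpha^-1 < 1 by rewrite invf_lt1//; lra.
have [q q0 Hq] := large e01.
set fc := front_const alpha c in Hq *.
have fc0 : 0 < fc by rewrite powR_gt0// mulr_gt0//; lra.
(* Probability times gain is at least a multiple of h^((1 - e)(1 - 1/alpha) + 1/alpha) = h^(1 - p),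
   with the logarithm in V simply dropped. As p > 0 this exceeds the interest r h for small h. *)
pose C := expR (- r) * q * (e * ((1 - e) ^+ 2 * fc)).
have C0 : 0 < C.
  by rewrite mulr_gt0// ?mulr_gt0 ?expR_gt0 ?exprn_gt0//; lra.
pose p := e * (1 - alpha^-1).
have p0 : 0 < p by rewrite mulr_gt0// subr_gt0.
have Cr : 0 < C / (2 * r) by rewrite divr_gt0// mulr_gt0.
have n1 : \forall h \near 0^'+, h `^ p <= C / (2 * r).
  have /cvgrPdist_le /(_ _ Cr) := @powR_cvg0 R _ p0; apply: filterS => h.
  by rewrite sub0r normrN ger0_norm ?powR_ge0.
have n2 : \forall h \near 0^'+, h <= expR (- 1) :> R by exact: nbhs_right_le (expR_gt0 _).
have n3 : \forall h \near 0^'+, (0 : R) < h by exact: nbhs_right_gt.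
apply: filterS (filterI Hq (filterI n1 (filterI n2 n3))) => h [Pm [hp [he h0]]] T t Tt.
clear n1 n2 n3 Hq.
have h1 : h <= 1 by apply: le_trans he _; rewrite -[leRHS]expR0 ler_expR; lra.
set V := front alpha h in Pm *.
have V0 : h `^ alpha^-1 <= V by exact: front_ge.
have Vp : 0 < V by apply: lt_le_trans V0; exact: powR_gt0.
set m := (1 - e) ^+ 2 * fc * V in Pm *.
have E2 : 0 < (1 - e) ^+ 2 by rewrite exprn_gt0//; lra.
have m0 : 0 < m by exact: mulr_gt0 (mulr_gt0 E2 fc0) Vp.
have -> : (1 - e) ^+ 3 * fc * V = (1 - e) * m by rewrite /m exprS; ring.
set x := K * expR (- ((1 - e) * m)).
have x0 : 0 < x by rewrite mulr_gt0// expR_gt0.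
have xK : x <= K.
  by rewrite ler_piMr ?(ltW K_gt0)// -[leRHS]expR0 ler_expR oppr_le0 mulr_ge0 ?(ltW m0)//; lra.
move=> /=; split; first exact: ltW.
have tT : t < T by rewrite -subr_gt0 Tt.
apply: lt_le_trans (american_put_ge tT (ltW x0) (@stopping_time_cst h) _); last first.
  by move=> _; rewrite Tt lexx ltW.
apply: lt_le_trans (european_put_ge m h0 (ltW x0)).
rewrite max_l ?subr_ge0//.
set pr := fine _.
have prge : q * h `^ ((1 - e) * (1 - alpha^-1)) <= pr.
  rewrite /pr -lee_fin fineK//.
  have mA : measurable [set w | m <= X h w].
    have -> : [set w | m <= X h w] = X h @^-1` `[m, +oo[%classic.
      by apply/seteqP; split => w; rewrite /= in_itv/= andbT.
    by rewrite -[X in measurable X]setTI; exact: (levy_measurable hX).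
  exact: fin_num_measure.
have pr0 : 0 <= pr by apply: le_trans prge; rewrite mulr_ge0 ?powR_ge0// ltW.
have rh : 0 <= r * h by rewrite mulr_ge0// ltW.
have dh : 0 <= delta * h by rewrite mulr_ge0// ltW.
have rdh : 0 <= (r - delta) * h by rewrite mulr_ge0// ltW.
have E1 : 1 <= expR ((r - delta) * h) by rewrite -[leLHS]expR0 ler_expR.
(* At the starting price K e^(-(1 - e) m), a move of size [m] leads to K e^(e m) at least, so the
   holder avoids a loss of at least K e m. *)
have jump : K * (e * m) <= x * expR ((r - delta) * h) * expR m - K.
  have -> : x * expR ((r - delta) * h) * expR m = K * (expR (e * m) * expR ((r - delta) * h)).
    have -> : expR (e * m) = expR (- ((1 - e) * m)) * expR m by rewrite -expRD; congr expR; ring.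
    by rewrite /x; ring.
  rewrite -[X in _ - X]mulr1 -mulrBr ler_wpM2l ?(ltW K_gt0)//.
  have h3 : 1 + e * m <= expR (e * m) by exact: expR_ge1Dx.
  have h4 : expR (e * m) <= expR (e * m) * expR ((r - delta) * h) by rewrite ler_peMr ?expR_ge0.
  lra.
have em0 : 0 <= e * m by rewrite mulr_ge0// ltW.
have t1 : K - K * (r * h) <= expR (- r * h) * K.
  by apply: arith1 K_gt0; rewrite -mulNr; exact: expR_ge1Dx.
have t2 : expR (- r * h) * (x * expR ((r - delta) * h)) <= x.
  rewrite mulrCA -expRD ler_piMr ?(ltW x0)// -[leRHS]expR0 ler_expR; lra.
have t3 : expR (- r) * (pr * (K * (e * m))) <= expR (- r * h) * (pr * (x * expR ((r - delta) * h) * expR m - K)).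
  apply: ler_pM; [exact: expR_ge0|exact: mulr_ge0 pr0 (mulr_ge0 (ltW K_gt0) em0)| |].
    by rewrite ler_expR mulNr lerN2 ler_piMr// ltW.
  exact: ler_wpM2l.
have hE : h `^ ((1 - e) * (1 - alpha^-1)) * h `^ alpha^-1 = h * h `^ (- p).
  rewrite powR_mul_base// -powRD ?(gt_eqF h0) ?implybT//; congr (_ `^ _).
  by rewrite /p; ring.
have hp0 : 0 < h `^ p by exact: powR_gt0.
have t4 : K * (C * (h * h `^ (- p))) <= expR (- r) * (pr * (K * (e * m))).
  rewrite -hE.
  have h3 : q * h `^ ((1 - e) * (1 - alpha^-1)) * h `^ alpha^-1 <= pr * V.
    by apply: ler_pM => //; rewrite ?mulr_ge0 ?powR_ge0// ltW.
  have k0 : 0 <= K * (expR (- r) * (e * ((1 - e) ^+ 2 * fc))).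
    exact: mulr_ge0 (ltW K_gt0) (mulr_ge0 (expR_ge0 _) (mulr_ge0 (ltW e0) (mulr_ge0 (ltW E2) (ltW fc0)))).
  have := ler_wpM2l k0 h3.
  have -> : K * (expR (- r) * (e * ((1 - e) ^+ 2 * fc))) * (pr * V) =
     expR (- r) * (pr * (K * (e * m))) by rewrite /m; ring.
  by apply: le_trans; rewrite le_eqVlt /C; apply/orP; left; apply/eqP; ring.
have t5 : r * h < C * (h * h `^ (- p)).
  rewrite mulrCA mulrC ltr_pM2l// powRN ltr_pdivlMr//.
  have : r * h `^ p <= C / 2.
    by move: hp; rewrite ler_pdivlMr ?mulr_gt0//; lra.
  lra.
have t6 : K * (r * h) < K * (C * (h * h `^ (- p))) by rewrite ltr_pM2l.
rewrite mulrDr mulrBr; exact: arith2 t1 t2 (le_trans t4 t3) (lexx _) t6.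
Qed.

Lemma critical_price_upper (e : R) : 0 < e < 1 -> \forall h \near 0^'+,
  forall T t, T - t = h ->
  critical_price P X r delta K T t <=
    K * expR (- ((1 - e) ^+ 3 * front_const alpha c * front alpha h)).
Proof.
move=> /continuation_point; apply: filterS => h H T t /H Hx.
by apply: ge_inf; [exists 0 => y []|].
Qed.

End EuropeanBound.

(** * Supersolutions *)

Section Glue.
Context {R : realType}.
Implicit Types (f g : R -> R) (x y : R).

Definition glue f g x : R := if x <= 0 then f x else g x.

Lemma glue_neg f g x : x <= 0 -> glue f g x = f x.
Proof. by rewrite /glue => ->. Qed.

Lemma glue_pos f g x : f 0 = g 0 -> 0 <= x -> glue f g x = g x.
Proof.
rewrite /glue => e x0; case: ifPn => // xn.
by have -> : x = 0 by apply/eqP; rewrite eq_le xn x0.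
Qed.

(** At the joint the glued function is [f] plus a function that is 0 on the left and [g - f] on the
    right; its difference quotients are bounded by those of [g - f], which tend to 0. *)
Lemma derives_glue f g f1 g1 : derives f f1 -> derives g g1 ->
  f 0 = g 0 -> f1 0 = g1 0 -> derives (glue f g) (glue f1 g1).
Proof.
move=> df dg e0 e1 y; have [y0|y0|->] := ltgtP y 0.
- rewrite /glue (ltW y0); apply: near_eq_is_derive (df y).
  by apply: filterS (lt_nbhsl y0) => z /ltW ->.
- rewrite {2}/glue leNgt y0/=; apply: near_eq_is_derive (dg y).
  by apply: filterS (lt_nbhsr y0) => z z0; rewrite /glue leNgt z0.
rewrite /glue lexx.
pose k z := g z - f z; pose k1 z := if z <= 0 then 0 else k z.
have dk : is_derive (0 : R) (1 : R) k 0.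
  by apply: is_derive_eq (is_deriveB (dg 0) (df 0)) _; rewrite e1 subrr.
have k0 : k 0 = 0 by rewrite /k e0 subrr.
have dk1 : is_derive (0 : R) (1 : R) k1 0.
  have [dv lim] := dk.
  have cv : h^-1 *: (k (h *: 1 + 0) - k 0) @[h --> (0 : R)^'] --> (0 : R).
    by rewrite -[X in _ --> X]lim /derive; exact: dv.
  have cv1 : h^-1 *: (k1 (h *: 1 + 0) - k1 0) @[h --> (0 : R)^'] --> (0 : R).
    apply/cvgrPdist_le => e e0'; move/cvgrPdist_le : cv => /(_ _ e0').
    apply: filterS => h; rewrite !sub0r !normrN; apply: le_trans.
    rewrite /k1 lexx k0 !subr0; case: ifPn => // _.
    by rewrite scaler0 normr0.
  by apply: DeriveDef; [apply/cvg_ex; exists 0|exact: cvg_lim].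
have -> : (fun z => if z <= 0 then f z else g z) = (fun z => f z + k1 z).
  by apply/funext => z; rewrite /k1 /k; case: ifP => _; ring.
by apply: is_derive_eq (is_deriveD (df 0) dk1) _; rewrite addr0.
Qed.

Lemma lipschitz_glue f g g1 C : 0 <= C -> derives g g1 ->
  (forall x, x <= 0 -> f x = g 0) -> (forall x, 0 <= x -> `|g1 x| <= C) ->
  forall x y, `|glue f g x - glue f g y| <= C * `|x - y|.
Proof.
move=> C0 dg f0 g1C.
have pos x y : 0 <= x -> x <= y -> `|g y - g x| <= C * `|y - x|.
  move=> x0 xy; have [s /andP[s0 s1] ->] := mean_value x y dg.
  rewrite normrM ler_wpM2r//; apply: g1C.
  by rewrite addr_ge0// mulr_ge0// subr_ge0.
move=> x y; wlog xy : x y / x <= y.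
  move=> h; have [/h//|/ltW/h] := leP x y.
  by rewrite distrC [`|y - x|]distrC.
rewrite distrC [`|x - y|]distrC.
have e00 : f 0 = g 0 by exact: f0.
have [x0|x0] := leP 0 x.
  by rewrite !glue_pos//; [exact: pos|exact: le_trans xy].
rewrite (glue_neg _ _ (ltW x0)) (f0 x (ltW x0)).
have [y0|y0] := leP 0 y.
  rewrite glue_pos//; apply: le_trans (pos 0 y (lexx 0) y0) _.
  rewrite ler_wpM2l// subr0 !ger0_norm//; [|rewrite subr_ge0; exact: ltW (lt_le_trans x0 y0)]; lra.
by rewrite (glue_neg _ _ (ltW y0)) (f0 y (ltW y0)) subrr normr0 mulr_ge0.
Qed.

Lemma derives_cst (c : R) : derives (fun=> c) (fun=> 0).
Proof. by move=> y; exact: is_derive_cst. Qed.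

Lemma derives_id : derives (fun x : R => x) (fun=> 1).
Proof. by apply: derives_ext (@derives_scale R 1) _ _ => x //; rewrite mul1r. Qed.

End Glue.

Section Exp3.
Context {R : realType}.

Definition exp3_pos (x : R) : R := expR x - 1 - x - x ^+ 2 / 2.
Definition exp3 : R -> R := glue (fun=> 0) exp3_pos.
Definition exp3' : R -> R := glue (fun=> 0) (@exp2 R).
Definition exp3'' : R -> R := glue (fun=> 0) (fun x => expR x - 1).

Lemma derives_exp3_pos : derives exp3_pos (@exp2 R).
Proof.
have d2 := derivesZ 2^-1 (derivesM (@derives_id R) (@derives_id R)).
apply: derives_ext (derivesB (@derives_exp2 R) d2) _ _ => x.
  by rewrite /exp2 /exp3_pos expr2; ring.
by rewrite /exp2 mulr1 mul1r; field.
Qed.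

Lemma exp3_00 : exp3_pos 0 = 0.
Proof. by rewrite /exp3_pos expR0; ring. Qed.

Lemma derives_exp3 : derives exp3 exp3'.
Proof.
apply: derives_glue; [exact: derives_cst|exact: derives_exp3_pos| |].
  by rewrite exp3_00.
by rewrite /exp2 expR0; ring.
Qed.

Lemma derives_exp3' : derives exp3' exp3''.
Proof.
apply: derives_glue; [exact: derives_cst|exact: derives_exp2| |].
  by rewrite /exp2 expR0; ring.
by rewrite expR0; ring.
Qed.

Lemma exp3'_ge0 x : 0 <= exp3' x.
Proof. by rewrite /exp3' /glue; case: ifPn => // _; exact: exp2_ge0. Qed.

Lemma exp3_mono : {homo exp3 : x y / x <= y}.
Proof.
move=> x y xy; rewrite -subr_ge0; have [s _ ->] := mean_value x y derives_exp3.
by rewrite mulr_ge0 ?exp3'_ge0// subr_ge0.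
Qed.

Lemma exp3_ge0 x : 0 <= exp3 x.
Proof.
have [x0|x0] := leP x 0; first by rewrite /exp3 glue_neg.
by apply: le_trans (exp3_mono (ltW x0)); rewrite /exp3 glue_neg.
Qed.

Lemma exp3'_le_exp x : exp3' x <= expR x.
Proof.
rewrite /exp3' /glue; case: ifPn => [_|]; first exact: expR_ge0.
by rewrite -ltNge /exp2 => x0; lra.
Qed.

Lemma exp3_le_exp x : exp3 x <= expR x.
Proof.
rewrite /exp3 /glue; case: ifPn => [_|]; first exact: expR_ge0.
by rewrite -ltNge /exp3_pos => x0; have := sqr_ge0 x; lra.
Qed.

(* [expR - exp3] is convex, so its Taylor remainder is nonnegative. *)
Lemma exp3_remainder x s : s <= 0 -> exp3 (x + s) - exp3 x - s * exp3' x <= expR x * exp2 s.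
Proof.
move=> s0; pose q x := expR x - exp3 x; pose q1 x := expR x - exp3' x.
have dq : derives q q1 by apply: derivesB; [exact: derives_expR|exact: derives_exp3].
have dq1 : derives q1 (fun x => expR x - exp3'' x).
  by apply: derivesB; [exact: derives_expR|exact: derives_exp3'].
have q2 t : 0 <= expR t - exp3'' t.
  rewrite /exp3'' /glue; case: ifPn => _; [by rewrite subr0 expR_ge0|lra].
have [u /andP[u0 u1] e] := mean_value x (x + s) dq.
have [t _ e1] := mean_value (x + u * (x + s - x)) x dq1.
have h : 0 <= q1 x - q1 (x + u * (x + s - x)).
  rewrite e1 mulr_ge0// subr_ge0 addrAC subrr add0r gerDl.
  by rewrite mulr_ge0_le0.
have : q1 x * s <= q (x + s) - q x.
  have E : x + s - x = s by ring.
  by rewrite e E ler_wnM2r// -subr_ge0; move: h; rewrite E.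
rewrite /q /q1 expRD /exp2; lra.
Qed.

(** Lets [exp3] control the full exponential for positive arguments. After e^x >= 1 + x^3 / 6 the
    claim is a cubic inequality, proved by completing squares; 19 is large enough for it. *)
Lemma exp_le_exp3 x : 0 <= x -> expR x <= 2 * exp3 x + 19.
Proof.
move=> x0; rewrite /exp3 glue_pos ?exp3_00// /exp3_pos.
have := @expR_ge1Dxn R x 2 x0; rewrite (_ : 3`! = 6)// => h.
have -> : 2 * (expR x - 1 - x - x ^+ 2 / 2) + 19 = 2 * expR x + (17 - 2 * x - x ^+ 2) by field.
have : 0 <= 18 + x ^+ 3 / 6 - 2 * x - x ^+ 2.
  have -> : 18 + x ^+ 3 / 6 - 2 * x - x ^+ 2 = x * (x - 5) ^+ 2 / 6 + (2 / 3 * (x - 37/8) ^+ 2 + (18 - 2 / 3 * (37 / 8) ^+ 2)) by field.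
  have h1 : 0 <= x * (x - 5) ^+ 2 / 6 by rewrite mulr_ge0// mulr_ge0// sqr_ge0.
  have h2 := sqr_ge0 (x - 37/8).
  lra.
lra.
Qed.

Variable A : R.
Hypothesis A_gt0 : 0 < A.

(* [exp3] replaces [expR] because it vanishes to third order at 0: the function is
   then [C^2] and starts from 0, at the same exponential rate. *)
Definition hit x := 1 - expR (- (A * exp3 x)).
Definition hit1 x := expR (- (A * exp3 x)) * (A * exp3' x).
Definition hit2 x := expR (- (A * exp3 x)) * (A * exp3'' x) + - (expR (- (A * exp3 x)) * (A * exp3' x)) * (A * exp3' x).

Lemma derives_hit_exp (p p1 : R -> R) : derives p p1 ->
  derives (fun x => expR (- (A * p x))) (fun x => - (expR (- (A * p x)) * (A * p1 x))).
Proof.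
move=> dp; have h := derives_comp (@derives_expR R) (derivesZ (- A) dp).
by apply: derives_ext h _ _ => x; rewrite !mulNr// mulrN.
Qed.

Lemma derives_hit : derives hit hit1.
Proof.
have := derivesB (@derives_cst R 1) (derives_hit_exp derives_exp3).
by move=> h; apply: derives_eq h _ => x; rewrite sub0r opprK.
Qed.

Lemma derives_hit1 : derives hit1 hit2.
Proof. exact: derivesM (derives_hit_exp derives_exp3) (derivesZ A derives_exp3'). Qed.

Let hit3_pos x := expR (- (A * exp3_pos x)) *
  (A * expR x - 3 * (A * exp2 x) * (A * (expR x - 1)) + (A * exp2 x) ^+ 3).

Let hit2_pos x := expR (- (A * exp3_pos x)) * (A * (expR x - 1)) +
  - (expR (- (A * exp3_pos x)) * (A * exp2 x)) * (A * exp2 x).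

Lemma derives_hit2_pos : derives hit2_pos hit3_pos.
Proof.
have dE := derives_hit_exp derives_exp3_pos.
have d2 := derivesZ A (@derives_exp2 R).
have d1 := derivesZ A (derivesB (@derives_expR R) (@derives_cst R 1)).
have dN := derivesZ (- 1) (derivesM dE d2).
have h := derivesD (derivesM dE d1) (derivesM dN d2).
apply: derives_ext h _ _ => x; rewrite /hit2_pos /hit3_pos; ring.
Qed.

Let c0 := Num.min 1 (A / 3).

(** By the choice of [c0], c0 (1 + p) <= 1 + A p / 3 <= e^(A p / 3), and the cube of this is the
    claim. Three powers suffice because the third derivative of [hit] is the highest in use. *)
Lemma hit_decay x : 0 <= x -> expR (- (A * exp3 x)) * (1 + exp3 x) ^+ 3 <= c0 ^- 3.
Proof.
move=> x0; have p0 := exp3_ge0 x; move: (exp3 x) p0 => p p0.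
have c00 : 0 < c0 by rewrite lt_min ltr01 divr_gt0.
rewrite expRN mulrC ler_pdivrMr ?expR_gt0// mulrC ler_pdivlMr ?exprn_gt0//.
have -> : expR (A * p) = expR (A * p / 3) ^+ 3 by rewrite -expRM_natl; congr expR; field.
rewrite -exprMn lerXn2r ?nnegrE ?expR_ge0//.
  by rewrite mulr_ge0 ?(ltW c00)//; lra.
apply: le_trans (expR_ge1Dx _).
rewrite mulrDl mul1r; apply: lerD; first by rewrite ge_min lexx.
have -> : A * p / 3 = A / 3 * p by ring.
by rewrite [p * c0]mulrC ler_wpM2r// ge_min lexx orbT.
Qed.

Lemma hit_bound (x k : R) : 0 <= x -> 0 <= k -> forall n, (n <= 3)%N ->
  expR (- (A * exp3 x)) * (k * (1 + exp3 x) ^+ n) <= k * c0 ^- 3.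
Proof.
move=> x0 k0 n n3; have p0 := exp3_ge0 x; rewrite mulrCA.
apply: ler_wpM2l => //; apply: le_trans (hit_decay x0).
by rewrite ler_wpM2l ?expR_ge0// ler_weXn2l//; lra.
Qed.

Definition hit_const : R := 1 + (20 * A + 3 * (20 * A) ^+ 2 + (20 * A) ^+ 3) * c0 ^- 3.

Lemma exp2_le_exp3 x : 0 <= x ->
  [/\ 0 <= A * exp2 x, A * exp2 x <= 20 * A * (1 + exp3 x),
      0 <= A * (expR x - 1) & A * expR x <= 20 * A * (1 + exp3 x)].
Proof.
move=> x0; have h1 := exp_le_exp3 x0; have h2 := exp3_ge0 x; have h3 := exp2_ge0 x.
have h4 := expR_ge1Dx x; have A0 := ltW A_gt0.
rewrite [20 * A]mulrC -mulrA; split; rewrite ?ler_wpM2l ?mulr_ge0//; move: h3; rewrite /exp2; lra.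
Qed.

Lemma hit_moments (a x : R) : 0 <= a -> 0 <= x ->
  A * exp2 x <= a * (1 + exp3 x) -> A * expR x <= a * (1 + exp3 x) ->
  let E := expR (- (A * exp3 x)) in
  [/\ E * (A * expR x) <= a * c0 ^- 3, E * ((A * exp2 x) * (A * expR x)) <= a ^+ 2 * c0 ^- 3,
      E * (A * exp2 x) ^+ 2 <= a ^+ 2 * c0 ^- 3 & E * (A * exp2 x) ^+ 3 <= a ^+ 3 * c0 ^- 3].
Proof.
move=> a0 x0 Ae Ae' E.
have [Ae0 _ _ _] := exp2_le_exp3 x0.
have Ae'0 : 0 <= A * expR x by rewrite mulr_ge0 ?expR_ge0// ltW.
have p0 := exp3_ge0 x.
have q0 : 0 <= a * (1 + exp3 x) by rewrite mulr_ge0//; lra.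
have b (k : R) n (t : R) : 0 <= k -> (n <= 3)%N -> t <= k * (1 + exp3 x) ^+ n -> E * t <= k * c0 ^- 3.
  by move=> hk hn ht; apply: le_trans (hit_bound x0 hk hn); rewrite ler_wpM2l// expR_ge0.
split.
- by apply: (b _ 1%N) => //; rewrite expr1.
- apply: (b _ 2%N) => //; first by rewrite exprn_ge0.
  by rewrite -exprMn [leRHS]expr2 ler_pM.
- apply: (b _ 2%N) => //; first by rewrite exprn_ge0.
  by rewrite -exprMn lerXn2r ?nnegrE.
- apply: (b _ 3%N) => //; first by rewrite exprn_ge0.
  by rewrite -exprMn lerXn2r ?nnegrE.
Qed.

(** Every derivative is [expR (- (A * exp3 x))] times a polynomial of degree at most 3 in quantities
    bounded by [20 * A * (1 + exp3 x)]. The second derivative vanishes at the joint, so it is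
    Lipschitz with the bound on the third derivative to the right. *)
Lemma C2_lip_hit : C2_lip hit_const hit hit1 hit2.
Proof.
have c00 : 0 < c0 by rewrite lt_min ltr01 divr_gt0.
have k0 : 0 <= c0 ^- 3 by rewrite invr_ge0 exprn_ge0// ltW.
have A0 := ltW A_gt0.
have hc : hit_const = 1 + (20 * A + 3 * (20 * A) ^+ 2 + (20 * A) ^+ 3) * c0 ^- 3 by [].
have pos := exp2_le_exp3; have dom := hit_moments.
have a0 : 0 <= 20 * A by rewrite mulr_ge0.
move: (20 * A) a0 hc pos dom => a a0 hc pos dom.
have m1 : 0 <= a * c0 ^- 3 by rewrite mulr_ge0.
have m2 : 0 <= a ^+ 2 * c0 ^- 3 by rewrite mulr_ge0// exprn_ge0.
have m3 : 0 <= a ^+ 3 * c0 ^- 3 by rewrite mulr_ge0// exprn_ge0.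
have {}hc : 1 + a * c0 ^- 3 + 3 * (a ^+ 2 * c0 ^- 3) + a ^+ 3 * c0 ^- 3 = hit_const.
  by rewrite hc; ring.
move: (a * c0 ^- 3) (a ^+ 2 * c0 ^- 3) (a ^+ 3 * c0 ^- 3) m1 m2 m3 hc (dom a) => M1 M2 M3 m1 m2 m3 hc {}dom.
have e200 : exp2 (0 : R) = 0 by rewrite /exp2 expR0; ring.
have hit2E x : hit2 x = glue (fun=> 0) hit2_pos x.
  rewrite /glue /hit2 /hit2_pos; case: ifPn => x0.
    by rewrite /exp3' /exp3'' !glue_neg// !mulr0 addr0.
  by rewrite -ltNge in x0; rewrite /exp3 /exp3' /exp3'' !glue_pos ?(ltW x0) ?exp3_00 ?e200 ?expR0 ?subrr.
split; [exact: derives_hit|exact: derives_hit1| |].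
  move=> x; have E0 := expR_ge0 (- (A * exp3 x)); split.
  - have E1 : expR (- (A * exp3 x)) <= 1.
      by rewrite -[leRHS]expR0 ler_expR oppr_le0 mulr_ge0// exp3_ge0.
    by rewrite /hit ger0_norm -?hc; lra.
  - rewrite ger0_norm; last by rewrite mulr_ge0// mulr_ge0// exp3'_ge0.
    rewrite /hit1 /exp3' /glue; case: ifPn => x0; first by rewrite !mulr0 -hc; lra.
    rewrite -ltNge in x0; have [q1 q2 q3 q4] := pos x (ltW x0).
    have [d1 _ _ _] := dom x a0 (ltW x0) q2 q4.
    apply: (@le_trans _ _ M1); last by rewrite -hc; lra.
    apply: le_trans d1; rewrite ler_wpM2l// ler_wpM2l// /exp2; lra.
  rewrite hit2E /glue; case: ifPn => x0; first by rewrite normr0 -hc; lra.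
  rewrite -ltNge in x0; have [q1 q2 q3 q4] := pos x (ltW x0).
  have [d1 _ d2 _] := dom x a0 (ltW x0) q2 q4; move: d1 d2 E0.
  rewrite /exp3 glue_pos ?exp3_00 ?(ltW x0)// /hit2_pos => d1 d2 E0.
  have t1 : 0 <= expR (- (A * exp3_pos x)) * (A * (expR x - 1)) by rewrite mulr_ge0.
  have t2 : 0 <= expR (- (A * exp3_pos x)) * (A * exp2 x) ^+ 2 by rewrite mulr_ge0// sqr_ge0.
  have t3 : 0 <= expR (- (A * exp3_pos x)) * A by rewrite mulr_ge0.
  move: t1 t2 t3 d1 d2; have -> : A * (expR x - 1) = A * expR x - A by ring.
  rewrite mulrBr mulNr -mulrA -expr2.
  move: (_ * (A * expR x)) (_ * (_ ^+ 2)) (_ * A) => T1 T2 T3 *.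
  by rewrite -hc ler_norml; apply/andP; split; lra.
move=> x y; rewrite !hit2E; apply: (lipschitz_glue _ derives_hit2_pos).
- by rewrite -hc; lra.
- by move=> z _; rewrite /hit2_pos e200 expR0 subrr !mulr0 addr0.
move=> z z0; have [q1 q2 q3 q4] := pos z z0.
have [d1 d2 _ d3] := dom z a0 z0 q2 q4; move: d1 d2 d3.
rewrite /exp3 glue_pos ?exp3_00// /hit3_pos => d1 d2 d3.
have E0 := expR_ge0 (- (A * exp3_pos z)).
have t1 : 0 <= expR (- (A * exp3_pos z)) * (A * expR z) by rewrite mulr_ge0// mulr_ge0// expR_ge0.
have t2 : 0 <= expR (- (A * exp3_pos z)) * (A * exp2 z) ^+ 3 by rewrite mulr_ge0// exprn_ge0.
have t3 : 0 <= expR (- (A * exp3_pos z)) * ((A * exp2 z) * (A * (expR z - 1))).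
  by rewrite mulr_ge0// mulr_ge0.
have t4 : 0 <= expR (- (A * exp3_pos z)) * ((A * exp2 z) * A) by rewrite mulr_ge0// mulr_ge0.
have t5 : expR (- (A * exp3_pos z)) * ((A * exp2 z) * (A * (expR z - 1))) =
  expR (- (A * exp3_pos z)) * ((A * exp2 z) * (A * expR z)) - expR (- (A * exp3_pos z)) * ((A * exp2 z) * A) by ring.
have -> : expR (- (A * exp3_pos z)) * (A * expR z - 3 * (A * exp2 z) * (A * (expR z - 1)) + (A * exp2 z) ^+ 3) =
  expR (- (A * exp3_pos z)) * (A * expR z) - 3 * (expR (- (A * exp3_pos z)) * ((A * exp2 z) * (A * (expR z - 1)))) +
  expR (- (A * exp3_pos z)) * (A * exp2 z) ^+ 3 by ring.
move: t1 t2 t3 t4 t5 d1 d2 d3.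
move: (_ * (A * expR z)) (_ * (_ ^+ 3)) => T1 T2.
move: (_ * (A * exp2 z * (A * expR z))) (_ * (_ * (A * (expR z - 1)))) (_ * (A * exp2 z * A)) => T3 T4 T5 *.
by rewrite -hc ler_norml; apply/andP; split; lra.
Qed.

End Exp3.

Section HitGenerator.
Context {R : realType}.

Lemma C2_lip_dilate C (F f1 f2 : R -> R) (b : R) : 1 <= b -> C2_lip C F f1 f2 ->
  C2_lip (C * b ^+ 3) (fun y => F (b * y)) (fun y => b * f1 (b * y)) (fun y => b ^+ 2 * f2 (b * y)).
Proof.
move=> b1 lF; have C0 := C2_bd_ge0 (C2_lip_bd lF); case: lF => d1 d2 bd lip.
have b0 : 0 <= b by lra.
have b2 : b <= b ^+ 2 by rewrite expr2 ler_peMl.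
have b3 : b ^+ 2 <= b ^+ 3 by rewrite [leRHS]exprS ler_peMl ?sqr_ge0.
have bn0 n : 0 <= b ^+ n by rewrite exprn_ge0.
split.
- by apply: derives_eq (derives_comp d1 (@derives_scale R b)) _ => y; rewrite mulrC.
- by apply: derives_eq (derivesZ b (derives_comp d2 (@derives_scale R b))) _ => y; rewrite expr2; ring.
- move=> y; have [q0 q1 q2] := bd (b * y); split.
  + by apply: le_trans q0 _; rewrite ler_peMr//; lra.
  + by rewrite normrM (ger0_norm b0) mulrC; apply: ler_pM => //; lra.
  + by rewrite normrM (ger0_norm (bn0 2%N)) mulrC; apply: ler_pM.
- move=> x y; rewrite -mulrBr normrM (ger0_norm (bn0 2%N)).
  apply: le_trans (ler_wpM2l (bn0 2%N) (lip _ _)) _.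
  rewrite -mulrBr normrM (ger0_norm b0) le_eqVlt; apply/orP; left; apply/eqP; ring.
Qed.

Variables (nu : {measure set R -> \bar R}).
Hypothesis hW : summ nu (@jump_weight R).
Variable a0 : R.
Hypothesis a0_lt0 : a0 < 0.
Variables (A b : R).
Hypotheses (A_gt0 : 0 < A) (b_ge1 : 1 <= b).

Let F y := hit A (b * y).
Let f1 y := b * hit1 A (b * y).
(** The factor in front of [kappa nu a0 b] in the bound on the generator; unlike the derivative
    [hit1] it keeps the full exponential. *)
Definition hit_mass (x : R) : R := expR (- (A * exp3 x)) * (A * glue (fun=> 0) expR x).

Lemma hit_mass_ge0 x : 0 <= hit_mass x.
Proof.
rewrite mulr_ge0 ?expR_ge0// mulr_ge0 ?(ltW A_gt0)//.
by rewrite /glue; case: ifPn => // _; exact: expR_ge0.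
Qed.

Lemma hit_increment (x s : R) :
  hit A (x + s) - hit A x <= expR (- (A * exp3 x)) * (A * (exp3 (x + s) - exp3 x)).
Proof.
have -> : hit A (x + s) - hit A x =
   expR (- (A * exp3 x)) * (1 - expR (- (A * (exp3 (x + s) - exp3 x)))).
  rewrite /hit mulrBr mulr1 -expRD.
  have -> : - (A * exp3 x) - A * (exp3 (x + s) - exp3 x) = - (A * exp3 (x + s)) by ring.
  by ring.
rewrite ler_wpM2l ?expR_ge0//.
by have := expR_ge1Dx (- (A * (exp3 (x + s) - exp3 x))); lra.
Qed.

Lemma hit_mono : {homo hit A : x y / x <= y}.
Proof.
by move=> x y xy; rewrite /hit lerD2l lerN2 ler_expR lerN2 ler_pM2l// exp3_mono.
Qed.

Lemma hit_01 x : 0 <= hit A x <= 1.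
Proof.
rewrite /hit; have E0 := expR_ge0 (- (A * exp3 x)).
have E1 : expR (- (A * exp3 x)) <= 1.
  by rewrite -[leRHS]expR0 ler_expR oppr_le0 mulr_ge0 ?exp3_ge0// ltW.
by apply/andP; split; lra.
Qed.

Lemma hit1_le x : 0 <= hit1 A x <= hit_mass x.
Proof.
rewrite /hit1 /hit_mass mulr_ge0 ?expR_ge0 ?mulr_ge0 ?exp3'_ge0 ?(ltW A_gt0)//=.
rewrite ler_wpM2l ?expR_ge0// ler_wpM2l ?(ltW A_gt0)//.
rewrite /exp3' /glue; case: ifPn => //; rewrite -ltNge /exp2 => x0; lra.
Qed.

(** Downward jumps above [a0] produce the [kappa] term through the remainder of [exp3], deeper ones
    cost only the compensator. Upward jumps shorter than [s] are linearised; for longer ones the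
    function is at most 1 while the weight is at least [s]. *)
Lemma hit_jump (s y z : R) : 0 < s ->
  F (y + z) - F y - f1 y * (expR z - 1) <=
  hit_mass (b * y) * (\1_(`]a0, 0[%classic) z * exp2 (b * z)) +
  (hit_mass (b * y) * b * (Num.min 1 (a0 ^+ 2))^-1 + A * expR (b * y) * b * expR (b * s) + s^-1)
    * jump_weight z.
Proof.
move=> s0; rewrite /F /f1; set x := b * y; rewrite mulrDr -/x.
have b0 : 0 <= b by move: (b_ge1); lra.
have U0 := hit_mass_ge0 x; have A0 := ltW A_gt0.
have W0 := jump_weight_ge0 z.
have m0 : 0 < (Num.min 1 (a0 ^+ 2))^-1 by rewrite invr_gt0 min1_sqr_gt0.
have t1 : 0 <= hit_mass x * b * (Num.min 1 (a0 ^+ 2))^-1 * jump_weight z.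
  exact: mulr_ge0 (mulr_ge0 (mulr_ge0 U0 b0) (ltW m0)) W0.
have t2 : 0 <= A * expR x * b * expR (b * s) * jump_weight z by rewrite !mulr_ge0 ?expR_ge0.
have t3 : 0 <= s^-1 * jump_weight z by rewrite mulr_ge0// invr_ge0 ltW.
rewrite !mulrDl.
have /andP[h0 h1] := hit1_le x.
have [z0|z0] := ltP z 0; last first.
  have -> : \1_(`]a0, 0[%classic) z = 0 :> R.
    by rewrite indicE memNset//= in_itv/= => /andP[_ h]; lra.
  rewrite mul0r mulr0 add0r.
  have g0 : 0 <= b * hit1 A x * (expR z - 1).
    by apply: mulr_ge0; [exact: mulr_ge0|have := expR_ge1Dx z; lra].
  have inc : hit A (x + b * z) - hit A x <=
      A * expR x * b * expR (b * s) * jump_weight z + s^-1 * jump_weight z.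
    have Wz : z <= jump_weight z by have := jump_weight_ge_exp z; have := expR_ge1Dx z; lra.
    have [zs|zs] := ltP z s; last first.
      have : 1 <= s^-1 * jump_weight z.
        by rewrite mulrC ler_pdivlMr// mul1r; lra.
      by have /andP[_ k1] := hit_01 (x + b * z); have /andP[k2 _] := hit_01 x; lra.
    have bz : 0 <= b * z by rewrite mulr_ge0.
    have p1 : exp3 (x + b * z) - exp3 x <= b * z * expR (x + b * s).
      have [u /andP[u0 u1] ->] := mean_value x (x + b * z) derives_exp3.
      have -> : x + b * z - x = b * z by ring.
      rewrite mulrC ler_wpM2l//; apply: le_trans (exp3'_le_exp _) _.
      rewrite ler_expR lerD2l; apply: le_trans (_ : b * z <= _).
        by rewrite ler_piMl.
      by rewrite ler_wpM2l// ltW.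
    apply: le_trans (hit_increment x (b * z)) _.
    have E1 : expR (- (A * exp3 x)) <= 1.
      by rewrite -[leRHS]expR0 ler_expR oppr_le0 mulr_ge0 ?exp3_ge0.
    have p0 : 0 <= exp3 (x + b * z) - exp3 x by rewrite subr_ge0 exp3_mono// lerDl.
    apply: le_trans (_ : A * (b * z * expR (x + b * s)) <= _).
      apply: le_trans (_ : A * (exp3 (x + b * z) - exp3 x) <= _).
        by rewrite ler_piMl// mulr_ge0.
      by rewrite ler_wpM2l.
    have -> : A * (b * z * expR (x + b * s)) = A * expR x * b * expR (b * s) * z.
      by rewrite expRD; ring.
    have : A * expR x * b * expR (b * s) * z <= A * expR x * b * expR (b * s) * jump_weight z.
      by rewrite ler_wpM2l// !mulr_ge0 ?expR_ge0.
    lra.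
  lra.
have ez : 0 <= 1 - expR z <= 1.
  by have := expR_gt0 z; have : expR z <= 1 by [rewrite -expR0 ler_expR ltW]; lra.
have bz : b * z <= 0 by rewrite mulr_ge0_le0// ltW.
have [za|za] := ltP a0 z; last first.
  have -> : \1_(`]a0, 0[%classic) z = 0 :> R.
    by rewrite indicE memNset//= in_itv/= => /andP[h _]; lra.
  rewrite mul0r mulr0 add0r.
  have mono : hit A (x + b * z) <= hit A x by apply: hit_mono; lra.
  have g1 : b * hit1 A x * (1 - expR z) <= b * hit_mass x.
    apply: le_trans (_ : b * hit1 A x <= _); last by rewrite ler_wpM2l.
    by apply: ler_piMr; [exact: mulr_ge0|lra].
  have := jump_weight_away a0_lt0 za.
  move/(ler_wpM2l (mulr_ge0 U0 b0)); rewrite mulr1 mulrA => g2.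
  have -> : b * hit1 A x * (expR z - 1) = - (b * hit1 A x * (1 - expR z)) by ring.
  lra.
have -> : \1_(`]a0, 0[%classic) z = 1 :> R.
  by rewrite indicE mem_set//= in_itv/= za z0.
rewrite mul1r.
have main : hit A (x + b * z) - hit A x - b * hit1 A x * (expR z - 1) <= hit_mass x * exp2 (b * z).
  have E0 := expR_ge0 (- (A * exp3 x)).
  have zz : b * hit1 A x * z <= b * hit1 A x * (expR z - 1).
    by apply: ler_wpM2l; [exact: mulr_ge0|have := expR_ge1Dx z; lra].
  apply: le_trans (_ : expR (- (A * exp3 x)) * (A * (exp3 (x + b * z) - exp3 x - b * z * exp3' x)) <= _).
    have := hit_increment x (b * z).
    have -> : expR (- (A * exp3 x)) * (A * (exp3 (x + b * z) - exp3 x - b * z * exp3' x)) =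
      expR (- (A * exp3 x)) * (A * (exp3 (x + b * z) - exp3 x)) - b * hit1 A x * z by rewrite /hit1; ring.
    lra.
  rewrite /hit_mass -!mulrA ler_wpM2l// ler_wpM2l//.
  have [x0|x0] := leP x 0.
    rewrite /exp3 /exp3' !glue_neg//; last lra.
    by rewrite mul0r !mulr0 !subr0.
  have -> : glue (fun=> 0) expR x = expR x by rewrite /glue leNgt x0.
  by have := exp3_remainder x bz; rewrite -[b * z * _]mulrA.
lra.
Qed.

Lemma hit_summ y : summ nu (fun z => F (y + z) - F y - f1 y * (expR z - 1)).
Proof.
exact: (@summ_gen R nu hW _ _ _ _ y (C2_lip_bd (C2_lip_dilate b_ge1 (C2_lip_hit A_gt0)))).
Qed.

(** The drift [- v] beats the growth rate, since [v * b] exceeds the bound on [kappa] and the error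
    terms by [e * D]. What remains is the gap between [hit_mass] and [hit1], which matters only for
    moderate [x]. *)
Lemma hit_gen (s e D v y : R) : 0 < s -> 0 < e <= 1 -> 0 < D ->
  v * b = (1 + 2 * e) * D ->
  kappa nu a0 b + (b * (Num.min 1 (a0 ^+ 2))^-1 + expR 1 * (b * expR (b * s))) * jump_mass nu <= (1 + e) * D ->
  A * expR (b * y) <= 1 ->
  gen nu F f1 y - v * f1 y <=
  s^-1 * jump_mass nu + A * (b * expR (b * s)) * jump_mass nu + A * D * (3 + 9 / (2 * e)).
Proof.
move=> s0 /andP[e0 e1] D0 vb kD Ay.
have b0 : 0 <= b by move: (b_ge1); lra.
have J0 := @jump_mass_ge0 R nu; have A0 := ltW A_gt0.
set k1 := (Num.min 1 (a0 ^+ 2))^-1 in kD.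
set x := b * y in Ay.
have mD : measurable (`]a0, 0[%classic : set R) by exact: measurable_itv.
have sk := @summ_exp2 R nu a0 hW a0_lt0 _ b mD (fun x h => h) b0.
have gb : gen nu F f1 y <= hit_mass x * kappa nu a0 b +
   (hit_mass x * b * k1 + A * expR x * b * expR (b * s) + s^-1) * jump_mass nu.
  rewrite /kappa /jump_mass -!RintZ// -RintD; [|exact: summZ|exact: summZ].
  apply: Rint_le; [exact: hit_summ|by apply: summD; exact: summZ|].
  by move=> z; exact: hit_jump.
have E0 := expR_gt0 (- (A * exp3 x)).
have E1 : expR (- (A * exp3 x)) <= 1.
  by rewrite -[leRHS]expR0 ler_expR oppr_le0 mulr_ge0 ?exp3_ge0.
have ebs := expR_ge0 (b * s).
have c1 : 0 <= 9 / (2 * e) by rewrite divr_ge0// mulr_ge0// ltW.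
have t0 : 0 <= A * D * (3 + 9 / (2 * e)).
  by rewrite mulr_ge0 ?mulr_ge0 ?(ltW D0)//; lra.
have t1 : 0 <= A * (b * expR (b * s)) * jump_mass nu by rewrite !mulr_ge0.
have vf : v * f1 y = (1 + 2 * e) * D * hit1 A x by rewrite -vb /f1; ring.
rewrite vf.
have [x0|x0] := leP x 0.
  move: gb; rewrite /hit_mass /hit1 /exp3' !glue_neg// !(mulr0, mul0r) !add0r => gb.
  have : A * expR x * b * expR (b * s) * jump_mass nu <= A * (b * expR (b * s)) * jump_mass nu.
    rewrite ler_wpM2r// -[leLHS]mulrA -mulrA; apply: ler_wpM2l => //.
    by rewrite ler_piMl ?mulr_ge0// -[leRHS]expR0 ler_expR.
  by move: gb; rewrite mulrDl; lra.
have UE : hit_mass x = expR (- (A * exp3 x)) * (A * expR x).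
  by rewrite /hit_mass /glue leNgt x0.
have HE : hit1 A x = expR (- (A * exp3 x)) * (A * (expR x - 1 - x)).
  by rewrite /hit1 /exp3' /glue leNgt x0.
(* Below the barrier the factor [expR (- (A * exp3 x))] is at least e^(-1); this is the origin of
   [expR 1] in the hypothesis on [kappa]. *)
have Eu : A * expR x <= expR 1 * hit_mass x.
  rewrite UE mulrA -expRD ler_peMl ?mulr_ge0 ?expR_ge0//.
  rewrite -[leLHS]expR0 ler_expR subr_ge0; apply: le_trans Ay.
  by rewrite ler_wpM2l// exp3_le_exp.
have U0 := hit_mass_ge0 x.
have g1 : A * expR x * b * expR (b * s) * jump_mass nu <=
    expR 1 * hit_mass x * (b * expR (b * s)) * jump_mass nu.
  by rewrite ler_wpM2r// -mulrA ler_wpM2r// mulr_ge0.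
have g2 := ler_wpM2l U0 kD.
(* The exponential is at least 1 + x^2 / 2, and the maximum of 3 x - e x^2 / 2 is 9 / (2 e). *)
have br : (1 + 2 * e) * (1 + x) - e * expR x <= 3 + 9 / (2 * e).
  have := @expR_ge1Dxn R x 1 (ltW x0); rewrite (_ : 2`! = 2)// => h.
  have := ler_wpM2l (ltW e0) h.
  have : 3 * x - e * (x ^+ 2 / 2) <= 9 / (2 * e).
    rewrite ler_pdivlMr ?mulr_gt0//; have := sqr_ge0 (e * x - 3); rewrite !expr2; lra.
  have : 0 <= (1 - e) * x by rewrite mulr_ge0//; lra.
  rewrite mulrDr mulr1; lra.
have g3 : expR (- (A * exp3 x)) * (A * D) * ((1 + 2 * e) * (1 + x) - e * expR x) <=
   A * D * (3 + 9 / (2 * e)).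
  have AD : 0 <= expR (- (A * exp3 x)) * (A * D) by rewrite !mulr_ge0// ltW.
  apply: le_trans (ler_wpM2l AD br) _; rewrite ler_wpM2r; [by []|lra|].
  by rewrite ler_piMl// mulr_ge0// ltW.
have g4 : hit_mass x * ((1 + e) * D) - (1 + 2 * e) * D * hit1 A x =
   expR (- (A * exp3 x)) * (A * D) * ((1 + 2 * e) * (1 + x) - e * expR x).
  by rewrite UE HE; ring.
move: gb g1 g2 g3 t1; rewrite -g4.
move: (gen nu F f1 y) (hit_mass x) (hit1 A x) (A * expR x) (expR 1) (expR (b * s)) (A * D * _) (jump_mass nu)
  (kappa nu a0 b) s^-1 => G U H Ax E Eb Q J kp si gb g1 g2 g3 t1.
have {}g2 : U * kp + U * b * k1 * J + E * U * (b * Eb) * J <= U * ((1 + e) * D) by move: g2; lra.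
have {}gb : G <= U * kp + U * b * k1 * J + Ax * b * Eb * J + si * J by move: gb; lra.
by lra.
Qed.

End HitGenerator.

(** * A smoothed put payoff *)

Section Ramp.
Context {R : realType}.

Lemma lipschitz_glue0 (g : R -> R) C : 0 <= C -> g 0 = 0 ->
  (forall x y, `|g x - g y| <= C * `|x - y|) ->
  forall x y, `|glue (fun=> 0) g x - glue (fun=> 0) g y| <= C * `|x - y|.
Proof.
move=> C0 g0 lip x y; wlog xy : x y / x <= y.
  move=> h; have [/h//|/ltW/h] := leP x y.
  by rewrite distrC [`|y - x|]distrC.
have [x0|x0] := leP 0 x.
  by rewrite !glue_pos//; exact: le_trans xy.
rewrite (glue_neg _ _ (ltW x0)).
have [y0|y0] := leP 0 y; last by rewrite (glue_neg _ _ (ltW y0)) subrr normr0 mulr_ge0.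
rewrite glue_pos// -{1}g0; apply: le_trans (lip 0 y) _.
rewrite ler_wpM2l// distrC subr0 distrC !ger0_norm ?subr_ge0//; lra.
Qed.

Lemma C2_lip_shift C (F f1 f2 : R -> R) (c : R) : C2_lip C F f1 f2 ->
  C2_lip C (fun y => F (c + y)) (fun y => f1 (c + y)) (fun y => f2 (c + y)).
Proof.
case=> d1 d2 b lip; split; [exact: derives_shift|exact: derives_shift|by move=> y; exact: b|].
by move=> x y; apply: le_trans (lip _ _) _; rewrite opprD addrACA subrr add0r.
Qed.

(** The identity on the left and a saturation below 2 on the right. At 0 the logistic branch has
    value 0, slope 1 and second derivative 0, so the junction is twice continuously
    differentiable. *)
Definition ramp : R -> R := glue (fun x => x) (fun x => 4 * logistic x - 2).
Definition ramp' : R -> R := glue (fun=> 1) (fun x => 4 * (logistic x * (1 - logistic x))).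
Definition ramp'' : R -> R :=
  glue (fun=> 0) (fun x => 4 * (logistic x * (1 - logistic x) * (1 - 2 * logistic x))).

Lemma logistic0 : logistic (0 : R) = 2^-1.
Proof. by rewrite /logistic oppr0 expR0. Qed.

Lemma derives_ramp : derives ramp ramp'.
Proof.
apply: derives_glue; [exact: derives_id| |by rewrite logistic0; field|by rewrite logistic0; field].
have h := derivesB (derivesZ 4 (@derives_logistic R)) (@derives_cst R 2).
by apply: derives_eq h _ => x; rewrite subr0.
Qed.

Lemma derives_ramp' : derives ramp' ramp''.
Proof.
have [_ d2 _ _] := @C2_lip_logistic R.
apply: derives_glue; [exact: derives_cst|exact: derivesZ d2|by rewrite logistic0; field|by rewrite logistic0; field].
Qed.

Lemma ramp'_01 x : 0 <= ramp' x <= 1.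
Proof.
rewrite /ramp' /glue; case: ifPn => _; first by rewrite ler01 lexx.
have /andP[p0 p1] := logistic01 x; move: (logistic x) p0 p1 => p p0 p1.
have h : 0 <= p * (1 - p) by apply: mulr_ge0; lra.
have := sqr_ge0 (2 * p - 1); rewrite expr2 => h2.
by apply/andP; split; lra.
Qed.

Lemma ramp''_bound x : `|ramp'' x| <= 4.
Proof.
rewrite /ramp'' /glue; case: ifPn => _; first by rewrite normr0.
have [_ _ b _] := @C2_lip_logistic R; have [_ _ h] := b x.
by rewrite normrM ger0_norm// -[leRHS]mulr1 ler_wpM2l.
Qed.

Lemma ramp''_lip x y : `|ramp'' x - ramp'' y| <= 4 * `|x - y|.
Proof.
apply: lipschitz_glue0 => //; first by rewrite logistic0; field.
move=> u v; have [_ _ _ lip] := @C2_lip_logistic R.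
by rewrite -mulrBr normrM ger0_norm// ler_wpM2l//; have := lip u v; rewrite mul1r.
Qed.

Lemma ramp_le2 x : ramp x <= 2.
Proof.
rewrite /ramp /glue; case: ifPn => x0; first lra.
by have /andP[_ h] := logistic01 x; lra.
Qed.

Lemma ramp_le x : ramp x <= x.
Proof.
have [x0|x0] := leP x 0; first by rewrite /ramp glue_neg.
have [s _ h] := mean_value 0 x derives_ramp.
have e : ramp 0 = 0 by rewrite /ramp glue_neg.
move: h; rewrite e !subr0 => ->.
by rewrite ler_piMl ?(ltW x0)//; have /andP[] := ramp'_01 (0 + s * x).
Qed.

Variable a : R.
Hypotheses (a_gt0 : 0 < a) (a_le1 : a <= 1).

(** The profile at unit scale. Since [ramp] stays below 2 the exponential stays below 1, so the
    function is nonnegative and can dominate a positive part. *)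
Definition payoff_sup0 (t : R) : R := 1 - expR (a * (ramp t - 2)).
Definition payoff_sup1 (t : R) : R := - (a * (expR (a * (ramp t - 2)) * ramp' t)).
Definition payoff_sup2 (t : R) : R := - (a * (expR (a * (ramp t - 2)) * (a * (ramp' t * ramp' t) + ramp'' t))).

Let E t := expR (a * (ramp t - 2)).

Let E01 t : 0 <= E t <= 1.
Proof.
rewrite expR_ge0/= -[X in _ <= X]expR0 ler_expR mulr_ge0_le0 ?(ltW a_gt0)//.
by have := ramp_le2 t; lra.
Qed.

Lemma derives_ramp_exp : derives E (fun t => a * (E t * ramp' t)).
Proof.
have h := derivesZ a (derivesB derives_ramp (@derives_cst R 2)).
by apply: derives_eq (derives_comp (@derives_expR R) h) _ => t; rewrite /E subr0; ring.
Qed.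

Lemma C2_lip_payoff_sup0 : C2_lip (17 : R) payoff_sup0 payoff_sup1 payoff_sup2.
Proof.
have dE := derives_ramp_exp; have a0 := ltW a_gt0; have a1 := a_le1.
have E0 t : 0 <= E t by case/andP: (E01 t).
have E1 t : E t <= 1 by case/andP: (E01 t).
have m0 t : 0 <= ramp' t by case/andP: (ramp'_01 t).
have m1 t : ramp' t <= 1 by case/andP: (ramp'_01 t).
have nE t : `|E t| <= 1 by rewrite ger0_norm.
have nm t : `|ramp' t| <= 1 by rewrite ger0_norm.
have Em t : 0 <= E t * ramp' t <= 1 by rewrite mulr_ge0//= mulr_ile1.
have mm t : 0 <= ramp' t * ramp' t <= 1 by rewrite mulr_ge0//= mulr_ile1.
have amm t : `|a * (ramp' t * ramp' t) + ramp'' t| <= 5.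
  have h : 0 <= a * (ramp' t * ramp' t) <= 1.
    by have /andP[h1 h2] := mm t; rewrite mulr_ge0//= mulr_ile1.
  have := ramp''_bound t; rewrite !ler_norml => /andP[h1 h2].
  by move: h => /andP[h3 h4]; apply/andP; split; lra.
split.
- by apply: derives_eq (derivesB (@derives_cst R 1) dE) _ => t; rewrite sub0r.
- have h := derivesZ (- a) (derivesM dE derives_ramp').
  by apply: derives_ext h _ _ => t; rewrite /payoff_sup1 /payoff_sup2 -/(E t); ring.
- move=> t; split.
  + rewrite /payoff_sup0 -/(E t) ler_norml; have := E0 t; have := E1 t.
    by move=> *; apply/andP; split; lra.
  + rewrite /payoff_sup1 -/(E t) normrN normrM (ger0_norm a0).
    have /andP[h1 h2] := Em t; rewrite ger0_norm//.
    by apply: le_trans (mulr_ile1 a0 h1 a1 h2) _; lra.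
  + rewrite /payoff_sup2 -/(E t) normrN normrM (ger0_norm a0) normrM.
    have h : `|E t| * `|a * (ramp' t * ramp' t) + ramp'' t| <= 1 * 5 by apply: ler_pM.
    have := ler_pM a0 (mulr_ge0 (normr_ge0 _) (normr_ge0 _)) a1 h; lra.
move=> x y; set g := fun t => a * (ramp' t * ramp' t) + ramp'' t.
have -> : payoff_sup2 x - payoff_sup2 y = - (a * (E x * g x - E y * g y)).
  rewrite /payoff_sup2 -!/(E _) -!/(g _); move: (E x) (E y) (g x) (g y) => *; ring.
rewrite normrN normrM (ger0_norm a0).
have xy := normr_ge0 (x - y).
have lE : `|E x - E y| <= 1 * `|x - y|.
  apply: lipschitz_of_derive dE _ => t; have /andP[h1 h2] := Em t.
  by rewrite ger0_norm ?mulr_ge0// mulr_ile1.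
have lm : `|ramp' x - ramp' y| <= 4 * `|x - y|.
  by apply: lipschitz_of_derive derives_ramp' _ => t; exact: ramp''_bound.
have lmm := lipschitzM (nm y) (nm x) xy lm lm.
have lam : `|g x - g y| <= 12 * `|x - y|.
  have -> : g x - g y =
     a * (ramp' x * ramp' x - ramp' y * ramp' y) + (ramp'' x - ramp'' y) by rewrite /g; ring.
  rewrite (le_trans (ler_normD _ _))// normrM (ger0_norm a0).
  have h : a * `|ramp' x * ramp' x - ramp' y * ramp' y| <= `|ramp' x * ramp' x - ramp' y * ramp' y|.
    by rewrite ler_piMl.
  have := ramp''_lip x y; lra.
have := lipschitzM (nE y) (amm x) xy lE lam => h.
apply: le_trans (ler_piMl (normr_ge0 _) a1) _.
apply: le_trans h _; rewrite ler_wpM2r//; lra.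
Qed.

End Ramp.

Section PayoffSupersolution.
Context {R : realType}.

(** The converse of the upper bounds on [exp2]: Taylor remainders at scale [a] become multiples of
    [exp2 (a^-1 * z)] and are thus measured by [kappa nu a0 a^-1]. *)
Lemma exp2_ge_min (u : R) : 0 <= u -> Num.min u (u ^+ 2) <= 4 * exp2 (- u).
Proof.
move=> u0; rewrite /exp2 opprK.
have [u2|u2] := leP u 2; last first.
  by rewrite ge_min; apply/orP; left; have := expR_ge0 (- u); lra.
rewrite ge_min; apply/orP; right.
have h : (1 - u / 2) ^+ 2 <= expR (- u).
  have -> : - u = - (u / 2) + - (u / 2) by field.
  rewrite expRD -expr2 lerXn2r ?nnegrE ?expR_ge0//; first lra.
  exact: expR_ge1Dx.
by move: h; rewrite !expr2; lra.
Qed.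

Variable a : R.
Hypotheses (a_gt0 : 0 < a) (a_le1 : a <= 1).

(* Equal to the payoff [1 - expR y] for [y <= - (2 * a)], and smoothed on the scale [a]. *)
Definition payoff_sup (y : R) : R := payoff_sup0 a (2 + a^-1 * y).
Definition payoff_sup' (y : R) : R := a^-1 * payoff_sup1 a (2 + a^-1 * y).
Definition payoff_sup'' (y : R) : R := a^-1 ^+ 2 * payoff_sup2 a (2 + a^-1 * y).

Let ainv : 1 <= a^-1.
Proof. by rewrite invf_ge1. Qed.

Lemma C2_lip_payoff_sup : C2_lip (17 * a^-1 ^+ 3) payoff_sup payoff_sup' payoff_sup''.
Proof.
exact: (C2_lip_dilate ainv (C2_lip_shift 2 (C2_lip_payoff_sup0 a_gt0 a_le1))).
Qed.

Let ramp_exp01 t : 0 <= expR (a * (ramp t - 2)) <= 1.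
Proof.
rewrite expR_ge0/= -[X in _ <= X]expR0 ler_expR mulr_ge0_le0 ?(ltW a_gt0)//.
by have := ramp_le2 t; lra.
Qed.

Lemma payoff_sup_01 y : 0 <= payoff_sup y <= 1.
Proof.
rewrite /payoff_sup /payoff_sup0; have /andP[h1 h2] := ramp_exp01 (2 + a^-1 * y).
by apply/andP; split; lra.
Qed.

Lemma payoff_sup'_01 y : - 1 <= payoff_sup' y <= 0.
Proof.
rewrite /payoff_sup' /payoff_sup1 mulrN mulKf ?gt_eqF//.
have /andP[h1 h2] := ramp_exp01 (2 + a^-1 * y).
have /andP[h3 h4] := ramp'_01 (2 + a^-1 * y).
have := mulr_ge0 h1 h3; have := mulr_ile1 h1 h3 h2 h4; lra.
Qed.

Lemma payoff_sup''_bound y : `|payoff_sup'' y| <= 5 * a^-1.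
Proof.
set t := 2 + a^-1 * y; have an : a != 0 by rewrite gt_eqF.
have -> : payoff_sup'' y = - (a^-1 * (expR (a * (ramp t - 2)) * (a * (ramp' t * ramp' t) + ramp'' t))).
  by rewrite /payoff_sup'' /payoff_sup2 -/t; field.
have a10 : 0 <= a^-1 by rewrite invr_ge0 ltW.
rewrite normrN normrM (ger0_norm a10) mulrC ler_wpM2r// normrM.
have /andP[h1 h2] := ramp_exp01 t; rewrite (ger0_norm h1).
apply: le_trans (ler_piMl (normr_ge0 _) h2) _.
have /andP[h3 h4] := ramp'_01 t.
have h5 : 0 <= a * (ramp' t * ramp' t) <= 1.
  rewrite mulr_ge0 ?(ltW a_gt0) ?mulr_ge0//= mulr_ile1 ?mulr_ge0 ?(ltW a_gt0)//.
  exact: mulr_ile1.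
have := ramp''_bound t; rewrite !ler_norml => /andP[h6 h7].
by move: h5 => /andP[h8 h9]; apply/andP; split; lra.
Qed.

Lemma payoff_sup_low y : y <= - (2 * a) -> payoff_sup y = 1 - expR y /\ payoff_sup' y = - expR y.
Proof.
move=> ya; have an : a != 0 by rewrite gt_eqF.
have t0 : 2 + a^-1 * y <= 0.
  have : a^-1 * y <= a^-1 * (- (2 * a)) by rewrite ler_wpM2l// invr_ge0 ltW.
  by have -> : a^-1 * (- (2 * a)) = - 2 by [field]; lra.
have E : a * (ramp (2 + a^-1 * y) - 2) = y by rewrite /ramp glue_neg//; field.
by rewrite /payoff_sup /payoff_sup' /payoff_sup0 /payoff_sup1 E /ramp' glue_neg// mulr1 mulrN mulKf.
Qed.

Lemma payoff_sup_ge y : 1 - expR y <= payoff_sup y.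
Proof.
have an : a != 0 by rewrite gt_eqF.
rewrite /payoff_sup /payoff_sup0 lerD2l lerN2 ler_expR.
have -> : y = a * (2 + a^-1 * y - 2) by field.
rewrite ler_pM2l// lerD2r; have -> : a * (2 + a^-1 * y - 2) = y by field.
exact: ramp_le.
Qed.

Lemma payoff_sup_anti : {homo payoff_sup : x y / x <= y >-> y <= x}.
Proof.
move=> x y xy; have [d1 _ _ _] := C2_lip_payoff_sup.
have [s _ h] := mean_value x y d1.
rewrite -subr_le0 h mulr_le0_ge0 ?subr_ge0//.
by have /andP[] := payoff_sup'_01 (x + s * (y - x)).
Qed.

Variables (nu : {measure set R -> \bar R}).
Hypothesis hW : summ nu (@jump_weight R).
Variable a0 : R.
Hypothesis a0_lt0 : a0 < 0.

Let G := payoff_sup.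
Let G' := payoff_sup'.

Lemma payoff_sup_summ y : summ nu (fun z => G (y + z) - G y - G' y * (expR z - 1)).
Proof.
exact: (@summ_gen R nu hW _ _ _ _ y (C2_lip_bd C2_lip_payoff_sup)).
Qed.

Lemma summ_up_jump : summ nu (fun z : R => Num.max (expR z - 1) 0).
Proof.
apply: summ_le hW; first by apply: measurable_maxr => //; exact: measurable_funB.
move=> z; rewrite /jump_weight ger0_norm ?le_max ?lexx ?orbT// lerDr.
by rewrite le_min ler01 sqr_ge0.
Qed.

(** Where the function is exactly 1 - e^y, downward jumps contribute nothing, by the martingale
    compensator. An upward jump can only lower the function, so it contributes at most e^y (e^z -
    1), and e^y <= 1. *)
Lemma payoff_sup_gen_low y : y <= - (2 * a) ->
  gen nu G G' y <= \int[nu]_z (Num.max (expR z - 1) 0).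
Proof.
move=> ya; apply: Rint_le; [exact: payoff_sup_summ|exact: summ_up_jump|move=> z].
rewrite /G /G'; have [-> ->] := payoff_sup_low ya.
have E : - expR y * (expR z - 1) = expR y - expR (y + z) by rewrite expRD; ring.
have y0 : expR y <= 1 by rewrite -[leRHS]expR0 ler_expR; move: (a_gt0); lra.
have [z0|z0] := leP z 0.
  have [-> _] : payoff_sup (y + z) = 1 - expR (y + z) /\ payoff_sup' (y + z) = - expR (y + z).
    by apply: payoff_sup_low; lra.
  by rewrite le_max; apply/orP; right; rewrite E; lra.
rewrite le_max; apply/orP; left.
have yz : y <= y + z by lra.
have := payoff_sup_anti yz; rewrite (payoff_sup_low ya).1 => mono.
have z1 : 1 <= expR z by rewrite -[leLHS]expR0 ler_expR ltW.
have : expR y * (expR z - 1) <= expR z - 1 by rewrite ler_piMl// subr_ge0.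
lra.
Qed.

Definition payoff_sup_slack : R :=
  expR 1 * (1 + a0 ^+ 2) + (Num.min 1 (a0 ^+ 2))^-1 + 1.

(** For [a0 < z < 0] the remainder is at most both 5 z^2 / a and 2 |z|, hence at most 5 a times the
    minimum of |z| / a and its square; the factor 4 from [exp2_ge_min] gives 20. *)
Lemma payoff_sup_jump (y z : R) :
  payoff_sup (y + z) - payoff_sup y - payoff_sup' y * (expR z - 1) <=
  20 * a * (\1_(`]a0, 0[%classic) z * exp2 (a^-1 * z)) +
  (expR 1 * (1 + a0 ^+ 2) * jump_weight z +
   (Num.min 1 (a0 ^+ 2))^-1 * jump_weight z + jump_weight z).
Proof.
have arith1 (Gz Gy g e W T1 T2 k x : R) : 0 <= T1 -> 0 <= T2 -> 0 <= (1 + g) * e -> Gz <= Gy ->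
  e <= W -> Gz - Gy - g * e <= k * (0 * x) + (T1 + T2 + W).
  by rewrite mul0r mulr0 add0r mulrDl mul1r; lra.
have arith2 (Gz Gy g e W T1 T2 k x : R) : 0 <= T1 -> 1 <= T2 -> 0 <= W -> 0 <= - g * (1 - e) ->
  Gz <= 1 -> 0 <= Gy -> Gz - Gy - g * (e - 1) <= k * (0 * x) + (T1 + T2 + W).
  by rewrite mul0r mulr0 add0r; lra.
have arith3 (D g e k T1 T2 W : R) : 0 <= T2 -> 0 <= W -> D <= k -> e <= T1 -> - g * e <= e ->
  D - g * e <= k + (T1 + T2 + W).
  by lra.
have arith4 (g : R) : -1 <= g -> 0 <= 1 + g by lra.
have arith5 (g : R) : g <= 0 -> 0 <= - g by lra.
have arith6 (g : R) : -1 <= g -> g <= 0 -> `|g| <= 1.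
  by move=> h1 h2; rewrite ler_norml h1/=; lra.
have arith7 (g : R) : -1 <= g -> - g <= 1 by lra.
have arith8 (u v w : R) : u <= 1 * v -> w <= v -> u + w <= 2 * v by lra.
have arith9 (u v w : R) : 0 <= v -> u <= 2 * v -> 5 * v <= 5 * a * (4 * w) -> u <= 20 * a * w.
  by move=> v0; rewrite [5 * a * (4 * w)](_ : _ = 20 * a * w); [lra|ring].
have an : a != 0 by rewrite gt_eqF.
have a10 : 0 <= a^-1 by rewrite invr_ge0 ltW.
have W0 := jump_weight_ge0 z.
have m0 : 0 < (Num.min 1 (a0 ^+ 2))^-1 by rewrite invr_gt0 min1_sqr_gt0.
have t1 : 0 <= expR 1 * (1 + a0 ^+ 2) * jump_weight z.
  by rewrite mulr_ge0// mulr_ge0 ?expR_ge0// addr_ge0// sqr_ge0.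
have t2 : 0 <= (Num.min 1 (a0 ^+ 2))^-1 * jump_weight z by rewrite mulr_ge0// ltW.
have /andP[g1 g2] := payoff_sup'_01 y.
have [z0|z0] := ltP z 0; last first.
  have -> : \1_(`]a0, 0[%classic) z = 0 :> R.
    by rewrite indicE memNset//= in_itv/= => /andP[_]; rewrite ltNge z0.
  apply: (arith1 _ _ _ _ _ _ _ _ _ t1 t2).
  - apply: mulr_ge0; first exact: arith4.
    by rewrite subr_ge0 -[leLHS]expR0 ler_expR.
  - by apply: payoff_sup_anti; rewrite lerDl.
  - exact: jump_weight_ge_exp.
have ez : 0 <= 1 - expR z by rewrite subr_ge0 -[leRHS]expR0 ler_expR ltW.
have [za|za] := ltP a0 z; last first.
  have -> : \1_(`]a0, 0[%classic) z = 0 :> R.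
    by rewrite indicE memNset//= in_itv/= => /andP[h _]; move: za; rewrite leNgt h.
  apply: arith2 => //.
  - by have := jump_weight_away a0_lt0 za.
  - by apply: mulr_ge0 => //; exact: arith5.
  - by have /andP[] := payoff_sup_01 (y + z).
  - by have /andP[] := payoff_sup_01 y.
have -> : \1_(`]a0, 0[%classic) z = 1 :> R.
  by rewrite indicE mem_set//= in_itv/= za z0.
rewrite mul1r.
have [d1 d2 _ _] := C2_lip_payoff_sup.
have q1 := taylor1 y z d1 d2 payoff_sup''_bound.
have q2 : `|payoff_sup (y + z) - payoff_sup y - payoff_sup' y * z| <= 2 * - z.
  have l1 : `|payoff_sup (y + z) - payoff_sup y| <= 1 * `|y + z - y|.
    apply: lipschitz_of_derive d1 _ => t; have /andP[h1 h2] := payoff_sup'_01 t.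
    exact: arith6.
  apply: le_trans (ler_normB _ _) _; apply: arith8.
    by move: l1; have -> : y + z - y = z by [ring]; rewrite (ltr0_norm z0).
  rewrite normrM (ltr0_norm z0) ler_piMl//; last exact: arith6.
  by rewrite oppr_ge0 ltW.
have u0 : 0 <= a^-1 * - z by rewrite mulr_ge0// oppr_ge0 ltW.
have q3 : `|payoff_sup (y + z) - payoff_sup y - payoff_sup' y * z| <= 20 * a * exp2 (a^-1 * z).
  have -> : a^-1 * z = - (a^-1 * - z) by ring.
  have := exp2_ge_min u0; rewrite ge_min => h.
  have a5 : 0 <= 5 * a by rewrite mulr_ge0// ltW.
  case/orP: h => h; have := ler_wpM2l a5 h.
    have -> : 5 * a * (a^-1 * - z) = 5 * - z by field.
    by apply: arith9 => //; rewrite oppr_ge0 ltW.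
  have -> : 5 * a * (a^-1 * - z) ^+ 2 = 5 * a^-1 * z ^+ 2 by field.
  move=> h2; apply: le_trans q1 (le_trans h2 _).
  by rewrite le_eqVlt; apply/orP; left; apply/eqP; ring.
have -> : payoff_sup (y + z) - payoff_sup y - payoff_sup' y * (expR z - 1) =
  payoff_sup (y + z) - payoff_sup y - payoff_sup' y * z - payoff_sup' y * exp2 z.
  by rewrite /exp2; move: (payoff_sup (y + z)) (payoff_sup y) (payoff_sup' y) (expR z) => *; ring.
apply: arith3 => //.
- exact: le_trans (ler_norm _) q3.
- by have := exp2_le_jump_weight a0_lt0 za z0.
- by rewrite ler_piMl ?exp2_ge0//; exact: arith7.
Qed.

Lemma payoff_sup_gen_high y :
  gen nu G G' y <= 20 * a * kappa nu a0 a^-1 + payoff_sup_slack * jump_mass nu.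
Proof.
have a10 : 0 <= a^-1 by rewrite invr_ge0 ltW.
have mD : measurable (`]a0, 0[%classic : set R) by exact: measurable_itv.
have sk := @summ_exp2 R nu a0 hW a0_lt0 _ a^-1 mD (fun x h => h) a10.
rewrite /kappa /jump_mass -!RintZ// -RintD; [|exact: summZ|exact: summZ].
apply: Rint_le; [exact: payoff_sup_summ|by apply: summD; exact: summZ|move=> z].
rewrite /payoff_sup_slack.
have -> u v : (u + v + 1) * jump_weight z = u * jump_weight z + v * jump_weight z + jump_weight z by ring.
exact: payoff_sup_jump.
Qed.

Lemma payoff_sup_generator (r q y : R) : 0 <= r -> 0 <= q <= r ->
  gen nu G G' y + q * G' y - r * G y <=
  - (q - \int[nu]_z (Num.max (expR z - 1) 0)) +
  (- (2 * a) < y)%R%:R * (20 * a * kappa nu a0 a^-1 + payoff_sup_slack * jump_mass nu + q).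
Proof.
move=> r0 /andP[q0 qr].
have Ip : 0 <= \int[nu]_z (Num.max (expR z - 1) 0).
  by apply: Rintegral_ge0 => z _; rewrite le_max lexx orbT.
have [ya|ya] := ltP; rewrite ?mul1r ?mul0r.
  have := payoff_sup_gen_high y.
  have /andP[g1 g2] := payoff_sup'_01 y; have /andP[p3 p4] := payoff_sup_01 y.
  have gn : 0 <= - payoff_sup' y by lra.
  have := mulr_ge0 q0 gn.
  have := mulr_ge0 r0 p3; rewrite /G /G'; lra.
have := payoff_sup_gen_low ya; rewrite /G /G'; have [-> ->] := payoff_sup_low ya.
have y0 : expR y <= 1 by rewrite -[leRHS]expR0 ler_expR; move: (a_gt0); lra.
have : 0 <= (r - q) * (1 - expR y) by rewrite mulr_ge0//; lra.
lra.
Qed.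

End PayoffSupersolution.

(** * Stopped payoffs *)

Section StoppedSum.
Context {R : realType}.

(** With a decreasing condition the sum telescopes to [M] at the first index where the condition
    fails, or at [n] if there is none. *)
Lemma stopped_sum (M : nat -> R) (a : nat -> bool) n :
  (forall i j, (i <= j)%N -> a j -> a i) ->
  ((forall k, (k < n)%N -> a k) /\
     M 0%N + \sum_(k < n) (a k)%:R * (M k.+1 - M k) = M n) \/
  (exists2 j, (j < n)%N & [/\ ~~ a j, (forall i, (i < j)%N -> a i) &
     M 0%N + \sum_(k < n) (a k)%:R * (M k.+1 - M k) = M j]).
Proof.
move=> anti; elim: n => [|n [[an IH]|[j jn [aj ai IH]]]].
- by left; split=> //; rewrite big_ord0 addr0.
- rewrite big_ord_recr/= addrA IH.
  case: (boolP (a n)) => aN; [left|right].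
    split; last by rewrite mul1r addrC subrK.
    by move=> k; rewrite ltnS leq_eqVlt => /predU1P[->//|/an].
  by exists n => //; split => //; rewrite mul0r addr0.
- right; exists j; first exact: leqW.
  split=> //; rewrite big_ord_recr/= addrA IH.
  case: (boolP (a n)) => aN; last by rewrite mul0r addr0.
  by move: aj; rewrite (anti j n)// ltnW.
Qed.

(** If [g] has failed by time [k] while [b] still holds there, the sum is frozen at an index at most
    [k]; there [b] holds, so [g] must be what failed. *)
Lemma stopped_sum_exit (M : nat -> R) (g b : nat -> bool) n k :
  (forall i j, (i <= j)%N -> b j -> b i) -> (k < n)%N -> b k ->
  ~~ [forall j : 'I_k.+1, g j] ->
  exists2 j, ~~ g j &
    M 0%N + \sum_(i < n) (b i && [forall j : 'I_i.+1, g j])%:R * (M i.+1 - M i) = M j.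
Proof.
move=> antib kn bk nk; set a := fun i => b i && [forall j : 'I_i.+1, g j].
have antia i j : (i <= j)%N -> a j -> a i.
  move=> ij /andP[bj /forallP gj]; apply/andP; split; first exact: antib bj.
  by apply/forallP => l; have := gj (widen_ord (ij : (i.+1 <= j.+1)%N) l).
case: (stopped_sum M n antia) => [[ak _]|[j jn [aj ai E]]].
  by have := ak _ kn; rewrite /a (negbTE nk) andbF.
exists j => //.
have jk : (j <= k)%N.
  by rewrite leqNgt; apply/negP => /ai; rewrite /a (negbTE nk) andbF.
have bj := antib _ _ jk bk.
apply: contra aj => gj; rewrite /a bj/=; apply/forallP => -[l /=]; rewrite ltnS leq_eqVlt.
by case/predU1P => [->//|/ai /andP[_ /forallP /(_ (Ordinal (ltnSn l)))]].
Qed.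

Lemma stopped_sum_ge0 (M : nat -> R) (a : nat -> bool) n :
  (forall i j, (i <= j)%N -> a j -> a i) -> (forall j, 0 <= M j) ->
  0 <= M 0%N + \sum_(k < n) (a k)%:R * (M k.+1 - M k).
Proof.
move=> anti M0; case: (stopped_sum M n anti) => [[_ ->//]|[j _ [_ _ ->//]]].
Qed.

End StoppedSum.

Section BarrierCrossing.
Context {R : realType} {d : measure_display} {Omega : measurableType d}.
Variable P : probability Omega R.
Variable X : R -> Omega -> R.
Hypothesis hX : levy_process P X.
Hypothesis hc : measure_is_complete P.
Variable tau : Omega -> R.
Hypothesis st : stopping_time P X tau.
Hypothesis tau0 : forall w, 0 <= tau w.
Variables (h v b : R) (n : nat).
Hypothesis h_gt0 : 0 < h.

Definition running k : set Omega := [set w | h * k%:R <= tau w].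

Definition below k : set Omega :=
  [set w | [forall j : 'I_k.+1, grid_pos X h (- v) 0 j w < b]].

(** Discrete counterpart of the mean of [tau]. Both the carrying cost and the crossing probability
    are measured against it. *)
Definition occupation : R := h * \sum_(k < n) \int[P]_w \1_(running k) w.

Definition crossing : set Omega := [set w | [exists k : 'I_n, (h * k%:R <= tau w)%R &&
  ~~ [forall j : 'I_k.+1, grid_pos X h (- v) 0 j w < b]]].

Lemma aug_sigma_running k : aug_sigma P X (h * k%:R) (running k).
Proof. exact: stopping_time_aug. Qed.

Lemma aug_sigma_below k : aug_sigma P X (h * k%:R) (below k).
Proof.
have level j : aug_sigma P X (h * j%:R) [set w | grid_pos X h (- v) 0 j w < b].
  have -> : [set w | grid_pos X h (- v) 0 j w < b] = X (h * j%:R) @^-1` `]-oo, b - (0 + - v * (h * j%:R))[%classic.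
    by apply/seteqP; split => w /=; rewrite /grid_pos in_itv/= ltrBrDl.
  apply: aug_sigma_preimage => //.
  by rewrite mulr_ge0 ?(ltW h_gt0)/=.
elim: k => [|k IH].
  have -> : below 0 = [set w | grid_pos X h (- v) 0 0 w < b].
    apply/seteqP; split => w /= => [/forallP /(_ ord0)//|gw].
    by apply/forallP => j; rewrite ord1.
  exact: level.
have -> : below k.+1 = below k `&` [set w | grid_pos X h (- v) 0 k.+1 w < b].
  apply/seteqP; split => w /=.
    move=> /forallP gw; split; last exact: gw ord_max.
    by apply/forallP => j; exact: gw (widen_ord (leqnSn _) j).
  move=> [/forallP gw g1]; apply/forallP => -[j /= jk].
  by move: jk; rewrite ltnS leq_eqVlt => /predU1P[->//|jk]; exact: gw (Ordinal jk).
apply: aug_sigma_setI => //; apply: aug_sigma_mono IH.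
by rewrite ler_pM2l// ler_nat.
Qed.

Lemma measurable_running k : measurable (running k).
Proof.
apply: (aug_sigma_measurable hX hc _ (aug_sigma_running k)); by rewrite mulr_ge0// ltW.
Qed.

Lemma measurable_below k : measurable (below k).
Proof.
apply: (aug_sigma_measurable hX hc _ (aug_sigma_below k)); by rewrite mulr_ge0// ltW.
Qed.

Lemma measurable_crossing : measurable crossing.
Proof.
have -> : crossing = \big[setU/set0]_(k < n) (running k `\` below k).
  rewrite -(bigcup_mkord n (fun k => running k `\` below k)); apply/seteqP; split => w /=.
    by move=> /existsP[k /andP[h1 /negP h2]]; exists k => /=.
  by move=> [k kn [h1 h2]]; apply/existsP; exists (Ordinal kn); apply/andP; split=> //; exact/negP.
apply: bigsetU_measurable => k _; apply: measurableD.
- exact: measurable_running.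
- exact: measurable_below.
Qed.

Lemma running_anti w i j : (i <= j)%N -> (h * j%:R <= tau w)%R -> (h * i%:R <= tau w)%R.
Proof. by move=> ij; apply: le_trans; rewrite ler_pM2l// ler_nat. Qed.

Lemma occupation_ge0 : 0 <= occupation.
Proof.
rewrite mulr_ge0 ?(ltW h_gt0)// sumr_ge0// => k _.
by apply: Rintegral_ge0 => w _; exact: indic_ge0.
Qed.

Lemma summ_indicator (A : set Omega) : measurable A -> summ P (fun w => \1_A w : R).
Proof.
move=> mA; apply: (@summ_bounded _ _ _ P _ 1); first exact: measurable_indic.
by move=> w; rewrite indicE; case: (_ \in _); rewrite ?normr1 ?normr0.
Qed.

Lemma summ_stopped_mart C (F f1 f2 : R -> R) u rho y0 (A : nat -> set Omega) :
  C2_lip C F f1 f2 -> (forall k, measurable (A k)) ->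
  summ P (fun w => grid_mart X F h u rho y0 0 w +
    \sum_(k < n) \1_(A k) w * (grid_mart X F h u rho y0 k.+1 w - grid_mart X F h u rho y0 k w)).
Proof.
move=> lF mA; apply: summD; first exact: (summ_grid_mart hX _ _ _ _ lF).
apply: summ_sum => k.
apply: (@summ_indic _ _ _ P _ _ (expR (- rho * (h * k.+1%:R)) * C + expR (- rho * (h * k%:R)) * C)) => //.
  by apply: measurable_funB; exact: (measurable_grid_mart hX _ _ _ _ lF).
by move=> w; rewrite (le_trans (ler_normB _ _))// lerD//; exact: (grid_mart_bound _ _ _ _ _ lF).
Qed.

Variables (C : R) (F f1 f2 : R -> R) (c Q m : R).
Hypothesis lF : C2_lip C F f1 f2.
Hypotheses (F_ge0 : forall y, 0 <= F y) (F_b : forall y, b <= y -> m <= F y).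
Hypotheses (F_0 : F 0 = 0) (c_ge0 : 0 <= c).
Hypothesis one_step : forall y,
  \int[P]_w F (y - v * h + X h w) <= F y + h * (if y < b then c else Q).

(** Optional stopping at the first passage over [b] or once [tau] is passed. The function starts at
    0 and is at least [m] past the barrier. [Q] only makes the one-step bound hold everywhere:
    before the passage the position is below [b], so just [c] is counted. *)
Lemma crossing_prob : m * \int[P]_w \1_crossing w <= c * occupation.
Proof.
pose q y := if y < b then c else Q.
have mq : measurable_fun setT q.
  apply: measurable_fun_ifT => //.
  by apply: measurable_fun_ltr.
have bq y : `|q y| <= `|c| + `|Q|.
  by rewrite /q; case: ifP => _; rewrite ?lerDl ?lerDr.
pose A k := running k `&` below k.
have sA k : aug_sigma P X (h * k%:R) (A k).
  by apply: aug_sigma_setI; [exact: aug_sigma_running|exact: aug_sigma_below].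
have one y : expR (- 0 * h) * \int[P]_w F (y + - v * h + X h w) <= F y + h * q y.
  by rewrite oppr0 mul0r expR0 mul1r mulNr; exact: one_step.
have := @dynkin_sum _ _ _ P X hX hc C F f1 f2 h (- v) 0 0 q _ lF h_gt0 mq bq one n A sA.
rewrite F_0 add0r => D1.
have EA k w : \1_(A k) w =
    ((h * k%:R <= tau w)%R && [forall j : 'I_k.+1, grid_pos X h (- v) 0 j w < b])%:R :> R.
  rewrite indicE; congr (nat_of_bool _)%:R; rewrite /A /running /below.
  by apply/idP/idP; [rewrite inE/= => -[-> ->]|move=> /andP[h1 h2]; rewrite inE].
have mA k : measurable (A k).
  by apply: measurableI; [exact: measurable_running|exact: measurable_below].
have sM : summ P (fun w => grid_mart X F h (- v) 0 0 0 w +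
   \sum_(k < n) \1_(A k) w * (grid_mart X F h (- v) 0 0 k.+1 w - grid_mart X F h (- v) 0 0 k w)).
  exact: summ_stopped_mart lF mA.
rewrite /occupation mulrCA mulr_sumr.
apply: le_trans (le_trans D1 _).
  rewrite -RintZ; last by apply: summ_indicator; exact: measurable_crossing.
  apply: Rint_le => //.
    by apply: summZ; apply: summ_indicator; exact: measurable_crossing.
  move=> w; pose M k := grid_mart X F h (- v) 0 0 k w.
  have ME k : M k = F (grid_pos X h (- v) 0 k w).
    by rewrite /M /grid_mart oppr0 mul0r expR0 mul1r.
  rewrite [leRHS](_ : _ = M 0%N + \sum_(k < n)
     ((h * k%:R <= tau w)%R && [forall j : 'I_k.+1, grid_pos X h (- v) 0 j w < b])%:R * (M k.+1 - M k)); last first.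
    by congr (_ + _); apply: eq_bigr => k _; rewrite EA.
  rewrite indicE; case: (boolP (w \in crossing)) => hw; last first.
    rewrite mulr0; apply: (@stopped_sum_ge0 _ M (fun k =>
      (h * k%:R <= tau w)%R && [forall j : 'I_k.+1, grid_pos X h (- v) 0 j w < b])) => [i j ij|j]; last by rewrite ME.
    move=> /andP[h1 /forallP h2]; apply/andP; split; first exact: running_anti h1.
    by apply/forallP => l; exact: h2 (widen_ord (ij : (i.+1 <= j.+1)%N) l).
  move: hw; rewrite inE => /existsP[k /andP[h1 h2]]; rewrite mulr1.
  have [j gj ->] := @stopped_sum_exit _ M (fun j => grid_pos X h (- v) 0 j w < b)
    (fun j => (h * j%:R <= tau w)%R) n k (@running_anti w) (ltn_ord k) h1 h2.
  by rewrite ME; apply: F_b; rewrite leNgt.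
rewrite ler_pM2l//; apply: ler_sum => k _.
rewrite oppr0 mul0r expR0 mul1r -RintZ; last by apply: summ_indicator; exact: measurable_running.
apply: Rint_le => [||w].
- apply: (@summ_indic _ _ _ P _ _ (`|c| + `|Q|)) => //.
  by apply: measurableT_comp mq _; exact: (measurable_grid_pos hX).
- by apply: summZ; apply: summ_indicator; exact: measurable_running.
rewrite EA indicE.
have -> : (w \in running k) = (h * k%:R <= tau w)%R by apply/idP/idP; rewrite inE.
case: (h * k%:R <= tau w)%R => /=; last by rewrite mul0r mulr0.
case: forallP => gw; last by rewrite mul0r mulr1.
by rewrite mul1r mulr1 /q (gw ord_max).
Qed.

End BarrierCrossing.

Section GridPayoffBound.
Context {R : realType} {d : measure_display} {Omega : measurableType d}.
Variable P : probability Omega R.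
Variable X : R -> Omega -> R.
Hypothesis hX : levy_process P X.
Hypothesis hc : measure_is_complete P.
Variables (tau : Omega -> R) (T : R).
Hypothesis st : stopping_time P X tau.
Hypothesis tau_bd : forall w, 0 <= tau w <= T.
Variables (h v b : R) (N : nat).
Hypotheses (h_gt0 : 0 < h) (hT : h * N.+1%:R = T).
Variables (r delta K y0 a c D m qb : R).
Hypotheses (r_gt0 : 0 < r) (K_ge0 : 0 <= K) (c_ge0 : 0 <= c) (D_ge0 : 0 <= D).
Hypotheses (qv_ge0 : 0 <= r - delta + v) (far : y0 + b + (r - delta + v) * T <= - (2 * a)).
Variables (C : R) (G G1 G2 : R -> R).
Hypothesis lG : C2_lip C G G1 G2.
Hypotheses (G_ge0 : forall y, 0 <= G y) (G_ge : forall y, 1 - expR y <= G y).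
Hypothesis one_step : forall y,
  expR (- r * h) * \int[P]_w G (y + (r - delta) * h + X h w) <=
  G y + h * (- c + (- (2 * a) < y)%R%:R * D).
Let H := crossing X tau h v b N.+2.
Let S := occupation P tau h N.+2.

Let tau0 w : 0 <= tau w.
Proof. by case/andP: (tau_bd w). Qed.

(** The smoothed payoff loses [c] per unit of time and regains at most [D], only at grid points
    above - 2 a. By [far], such a point before [tau] forces the path with drift [- v] over the
    barrier, so the gain is charged to the crossing event. *)
Lemma grid_payoff_le :
  \int[P]_w grid_payoff X tau r delta K (K * expR y0) h w <=
  K * (G y0 - c * expR (- r * (T + h)) * S + D * (T + h) * \int[P]_w \1_H w).
Proof.
pose q y := - c + (- (2 * a) < y)%R%:R * D.
have mq : measurable_fun setT q.
  apply: measurable_funD => //; apply: measurable_funM => //.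
  have -> : (fun y : R => (- (2 * a) < y)%R%:R : R) = \1_(`]- (2 * a), +oo[%classic).
    apply/funext => y; rewrite indicE; congr (nat_of_bool _)%:R.
    by apply/idP/idP; rewrite mem_setE in_itv/= andbT.
  by apply: measurable_indic.
have bq y : `|q y| <= c + D.
  rewrite /q (le_trans (ler_normD _ _))// normrN (ger0_norm c_ge0) lerD2l.
  by case: (_ < _); rewrite ?mul1r ?mul0r ?normr0// ger0_norm.
have D1 := @dynkin_sum _ _ _ P X hX hc C G G1 G2 h (r - delta) r y0 q _ lG h_gt0 mq bq one_step
  N.+2 (running tau h) (aug_sigma_running st tau0 h).
have mB := measurable_running hX hc st tau0 h_gt0.
have mH : measurable H by exact: (measurable_crossing hX hc st tau0 v b N.+2 h_gt0).
have sM := summ_stopped_mart hX h N.+2 (r - delta) r y0 lG mB.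
have iB k w : \1_(running tau h k) w = (h * k%:R <= tau w)%R%:R :> R by exact: indic_tau_ge.
have T0 : 0 < T by rewrite -hT mulr_gt0.
have s1 A : measurable A -> summ P (fun w => \1_A w : R) by exact: summ_indicator.
have sq k : summ P (fun w => \1_(running tau h k) w * q (grid_pos X h (r - delta) y0 k w)).
  apply: (@summ_indic _ _ _ P _ _ (c + D)) => //.
  by apply: measurableT_comp mq _; exact: (measurable_grid_pos hX).
have step1 : \int[P]_w grid_payoff X tau r delta K (K * expR y0) h w <=
    K * \int[P]_w (grid_mart X G h (r - delta) r y0 0 w +
   \sum_(k < N.+2) \1_(running tau h k) w *
     (grid_mart X G h (r - delta) r y0 k.+1 w - grid_mart X G h (r - delta) r y0 k w)).
  rewrite -RintZ//; apply: Rint_le.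
  - apply: (@summ_bounded _ _ _ P _ K).
      exact: (measurable_grid_payoff hX hc st tau_bd _ _ _ _ h_gt0).
    move=> w; apply: put_payoff_bound => // [|w'].
      by rewrite mulr_ge0 ?expR_ge0.
    have /andP[h1 _] := grid_time_bounds h_gt0 (tau0 w'); exact: ltW (le_lt_trans (tau0 w') h1).
  - exact: summZ.
  move=> w; rewrite (eq_bigr (fun k : 'I_N.+2 => (h * k%:R <= tau w)%R%:R * (grid_mart X G h (r - delta) r y0 k.+1 w - grid_mart X G h (r - delta) r y0 k w))); last first.
    by move=> k _; rewrite iB.
  rewrite -(@grid_time_sum _ (fun k => grid_mart X G h (r - delta) r y0 k w) h (tau w) N.+1 h_gt0); last by rewrite hT.
  set k := (Num.truncn (tau w / h)).+1.
  have -> : grid_payoff X tau r delta K (K * expR y0) h w = expR (- r * (h * k%:R)) *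
    Num.max (K - K * expR y0 * expR ((r - delta) * (h * k%:R) + X (h * k%:R) w)) 0 by [].
  rewrite /grid_mart [leRHS]mulrCA; apply: ler_wpM2l; first exact: expR_ge0.
  rewrite ge_max mulr_ge0 ?G_ge0// andbT.
  apply: le_trans (ler_wpM2l K_ge0 (G_ge _)).
  by rewrite mulrBr mulr1 lerD2l lerN2 -mulrA -expRD /grid_pos addrA.
apply: le_trans step1 _; rewrite ler_wpM2l//; apply: le_trans D1 _.
rewrite -addrA lerD2l.
have h0 := ltW h_gt0; have r0 := ltW r_gt0.
have IH0 : 0 <= \int[P]_w \1_H w by apply: Rintegral_ge0 => w _; exact: indic_ge0.
(* The sum has [N.+2] terms, of total length [T + h]: rounding up may overshoot the horizon by one
   step. *)
have -> : - (c * expR (- r * (T + h)) * S) + D * (T + h) * \int[P]_w \1_H w =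
   h * \sum_(k < N.+2) (- (c * expR (- r * (T + h))) * \int[P]_w \1_(running tau h k) w + D * \int[P]_w \1_H w).
  rewrite big_split/= -mulr_sumr sumr_const card_ord mulrDr -[_ *+ N.+2]mulr_natr.
  have -> : T + h = h * N.+2%:R by rewrite -hT -[in RHS]natr1; ring.
  by rewrite /S /occupation; ring.
rewrite ler_wpM2l//; apply: ler_sum => k _.
have e0 := expR_ge0 (- r * (h * k%:R)).
have I0 : 0 <= \int[P]_w \1_(running tau h k) w by apply: Rintegral_ge0 => w _; exact: indic_ge0.
apply: le_trans (_ : expR (- r * (h * k%:R)) * (- c * \int[P]_w \1_(running tau h k) w + D * \int[P]_w \1_H w) <= _).
  rewrite ler_wpM2l// -!RintZ; [|exact: s1|exact: s1].
  rewrite -RintD; [|apply: summZ; exact: s1|apply: summZ; exact: s1].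
  apply: Rint_le => [//||w]; first by apply: summD; apply: summZ; exact: s1.
  have H01 : (0 : R) <= \1_H w by exact: indic_ge0.
  rewrite iB; case: (boolP (h * k%:R <= tau w)%R) => hk; last first.
    by rewrite mul0r mulr0 add0r mulr_ge0.
  rewrite mul1r mulr1 /q lerD2l mulrC ler_wpM2l//.
  case: (boolP (- (2 * a) < _)) => [hy|_] //.
  rewrite indicE mem_set//= /H /crossing/=.
  apply/existsP; exists k; rewrite hk/=; apply/negP => /forallP /(_ ord_max)/=.
  move: hy; rewrite /grid_pos !(add0r) => hy hb.
  have hkT : h * k%:R <= T by apply: le_trans hk _; case/andP: (tau_bd w).
  have := ler_wpM2l qv_ge0 hkT; move: (far); lra.
rewrite mulrDr lerD//.
  rewrite mulrA ler_wpM2r// mulrN lerN2 mulrC ler_wpM2r// ler_expR !mulNr lerN2 ler_wpM2l//.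
  rewrite -hT -[X in _ <= _ + X]mulr1 -mulrDr ler_wpM2l//.
  by rewrite natr1 ler_nat ltnW.
rewrite ler_piMl ?mulr_ge0// -[leRHS]expR0 ler_expR mulNr oppr_le0 mulr_ge0// mulr_ge0//.
Qed.

Hypotheses (qb_ge0 : 0 <= qb) (m_gt0 : 0 < m).
Hypothesis cross : m * \int[P]_w \1_H w <= qb * S.
Hypothesis dominated : D * (T + h) * qb <= m * (c * expR (- r * (T + h))).

(** The crossing probability is itself at most a multiple of the occupation, so cost and
    compensation are compared per unit of occupation, whatever the stopping time. *)
Lemma grid_payoff_le_sup :
  \int[P]_w grid_payoff X tau r delta K (K * expR y0) h w <= K * G y0.
Proof.
apply: le_trans grid_payoff_le _; rewrite ler_wpM2l// -addrA gerDl.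
have S0 : 0 <= S by exact: occupation_ge0.
have T0 : 0 < T by rewrite -hT mulr_gt0.
have DT : 0 <= D * (T + h) by rewrite mulr_ge0// addr_ge0// ltW.
rewrite -(pmulr_rle0 _ m_gt0).
have := ler_wpM2l DT cross; have := ler_wpM2r S0 dominated.
move: (c * expR _) (D * (T + h)) (\int[P]_w \1_H w) => A B I; lra.
Qed.

End GridPayoffBound.

Section StoppedPayoffBound.
Context {R : realType} {d : measure_display} {Omega : measurableType d}.
Variable P : probability Omega R.
Variable X : R -> Omega -> R.
Variable nu : {measure set R -> \bar R}.
Hypothesis hX : levy_process P X.
Hypothesis hc : measure_is_complete P.
Hypothesis hchar : levy_char P X nu.
Hypothesis hW : summ nu (@jump_weight R).
Variables (a0 r delta K : R).
Hypotheses (a0_lt0 : a0 < 0) (r_gt0 : 0 < r) (delta_ge0 : 0 <= delta) (K_ge0 : 0 <= K).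

Definition carry : R := r - delta - \int[nu]_z (Num.max (expR z - 1) 0).
Hypothesis carry_gt0 : 0 < carry.
Hypothesis q_ge0 : 0 <= r - delta.

Definition payoff_rate (a : R) : R :=
  20 * a * kappa nu a0 a^-1 + payoff_sup_slack a0 * jump_mass nu + (r - delta).

Definition hit_rate (A beta s e D : R) : R :=
  s^-1 * jump_mass nu + A * (beta * expR (beta * s)) * jump_mass nu + A * D * (3 + 9 / (2 * e)).

(** From e^x <= 2 exp3 x + 19 one gets A exp3 x >= (1 - 19 A) / 2 >= 1/4, and 1 - e^(-1/4) >=
    1/5. *)
Lemma hit_ge (A x : R) : 0 < A -> 38 * A <= 1 -> 1 <= A * expR x -> 5^-1 <= hit A x.
Proof.
move=> A0 A1 Ax.
have x0 : 0 <= x.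
  rewrite leNgt; apply/negP => x0.
  have E1 : expR x <= 1 by rewrite -[leRHS]expR0 ler_expR ltW.
  have := ler_wpM2l (ltW A0) E1; lra.
have e0 := exp_le_exp3 x0.
have h1 : 4^-1 <= A * exp3 x by have := ler_wpM2l (ltW A0) e0; lra.
have h2 : expR (- (A * exp3 x)) <= expR (- 4^-1) by rewrite ler_expR lerN2.
have h3 : expR (- 4^-1) <= (4 / 5 : R).
  rewrite expRN; have h4 := @expR_ge1Dx R 4^-1.
  have h5 : (0 : R) < 1 + 4^-1 by lra.
  have -> : (4 / 5 : R) = (1 + 4^-1)^-1 by field.
  by rewrite lef_pV2 ?posrE ?expR_gt0.
by rewrite /hit; lra.
Qed.

Variables (tau : Omega -> R) (T : R).
Hypothesis T_gt0 : 0 < T.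
Hypothesis st : stopping_time P X tau.
Hypothesis tau_bd : forall w, 0 <= tau w <= T.
Variables (a A beta b v s e D y0 : R).
Hypotheses (a_gt0 : 0 < a) (a_le1 : a <= 1) (A_gt0 : 0 < A) (A_small : 38 * A <= 1).
Hypotheses (beta_ge1 : 1 <= beta) (Ab : A * expR (beta * b) = 1) (b_ge0 : 0 <= b) (v_ge0 : 0 <= v).
Hypotheses (s_gt0 : 0 < s) (e01 : 0 < e <= 1) (D_gt0 : 0 < D) (vD : v * beta = (1 + 2 * e) * D).
Hypothesis kappa_le : kappa nu a0 beta + (beta * (Num.min 1 (a0 ^+ 2))^-1 +
  expR 1 * (beta * expR (beta * s))) * jump_mass nu <= (1 + e) * D.
Hypothesis far : y0 + b + (r - delta + v) * T <= - (2 * a).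
Hypothesis dominated : payoff_rate a * (2 * T) * (2 * hit_rate A beta s e D) <=
  5^-1 * (carry / 2 * expR (- r * (2 * T))).

(** Proved for the grid payoffs with small mesh and passed to the limit. At [y0] the smoothed payoff
    is the true one, because [far] puts [y0] below - 2 a. *)
Lemma stopped_payoff_le :
  \int[P]_w put_payoff X r delta K (K * expR y0) tau w <= K * (1 - expR y0).
Proof.
move: (dominated); set qb := hit_rate A beta s e D => dom.
have J0 := @jump_mass_ge0 R nu.
have b0 : 0 <= beta by move: (beta_ge1); lra.
have qb0 : 0 < qb.
  have [h1 h2] : 0 < e /\ e <= 1 by case/andP: e01.
  have : 0 < A * D * (3 + 9 / (2 * e)).
    apply: mulr_gt0; first exact: mulr_gt0.
    by rewrite addr_gt0// divr_gt0// mulr_gt0.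
  have : 0 <= s^-1 * jump_mass nu by rewrite mulr_ge0// invr_ge0 ltW.
  have : 0 <= A * (beta * expR (beta * s)) * jump_mass nu.
    by rewrite !mulr_ge0 ?expR_ge0// ltW.
  rewrite /qb /hit_rate; lra.
(* The one-step errors are absorbed by giving up half of the carry and doubling the rate of [hit];
   hence the factors 2 in [dominated]. *)
pose e1 := Num.min qb (carry / 2).
have e10 : 0 < e1 by rewrite lt_min qb0/= divr_gt0.
have e1q : e1 <= qb by rewrite ge_min lexx.
have e1c : e1 <= carry / 2 by rewrite ge_min lexx orbT.
pose F y := hit A (beta * y); pose F1 y := beta * hit1 A (beta * y).
have lF := C2_lip_dilate beta_ge1 (C2_lip_hit A_gt0).
have lG := C2_lip_payoff_sup a_gt0 a_le1.
have [h1 h10 gF] := generator_drift hX hchar hW (- v) 0 lF e10.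
have [h2 h20 gG] := generator_drift hX hchar hW (r - delta) r lG e10.
set CF := hit_const A * beta ^+ 3 in lF.
pose Q := gen_const * CF * jump_mass nu + v * CF + e1.
have stepF h y : 0 < h <= h1 ->
    \int[P]_w F (y - v * h + X h w) <= F y + h * (if y < b then qb + e1 else Q).
  move=> hh; have := gF h y hh; rewrite oppr0 !mul0r subr0 expR0 mul1r ler_norml => /andP[_].
  rewrite mulNr -/(F _) -/F -/F1 => g.
  have h0 : 0 < h by case/andP: hh.
  suff : gen nu F F1 y + - v * F1 y <= (if y < b then qb else Q - e1).
    move=> gl; have := ler_wpM2l (ltW h0) gl.
    by case: ifP => _; move: g; rewrite -/(F1 y); lra.
  rewrite mulNr; case: ifPn => yb.
    apply: (@hit_gen _ nu hW a0 a0_lt0 A beta A_gt0 beta_ge1 s e D v y s_gt0 e01 D_gt0 vD kappa_le).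
    rewrite -[leRHS]Ab ler_wpM2l ?(ltW A_gt0)// ler_expR ler_wpM2l// ltW//.
  have gb := gen_bound hW y (C2_lip_bd lF).
  have fb : `|F1 y| <= CF by case: lF => _ _ /(_ y) [].
  have vb : `|v * F1 y| <= v * CF by rewrite normrM (ger0_norm v_ge0) ler_wpM2l.
  move: gb vb; rewrite !ler_norml -/F -/F1 => /andP[_ gb] /andP[vb _].
  by rewrite /Q; lra.
have stepG h y : 0 < h <= h2 ->
    expR (- r * h) * \int[P]_w payoff_sup a (y + (r - delta) * h + X h w) <=
    payoff_sup a y + h * (- (carry / 2) + (- (2 * a) < y)%R%:R * payoff_rate a).
  move=> hh; have := gG h y hh; rewrite ler_norml => /andP[_ g].
  have h0 : 0 < h by case/andP: hh.
  have qr : 0 <= r - delta <= r by rewrite q_ge0/=; move: (delta_ge0); lra.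
  have := @payoff_sup_generator _ a a_gt0 a_le1 nu hW a0 a0_lt0 r (r - delta) y (ltW r_gt0) qr.
  rewrite -/(payoff_rate a) -/carry => g2.
  have g3 : gen nu (payoff_sup a) (payoff_sup' a) y + (r - delta) * payoff_sup' a y - r * payoff_sup a y <=
     - (carry / 2) - e1 + (- (2 * a) < y)%R%:R * payoff_rate a by move: e1c; lra.
  have := ler_wpM2l (ltW h0) g3; lra.
have Kx : 0 <= K * expR y0 by rewrite mulr_ge0 ?expR_ge0.
have qv : 0 <= (r - delta + v) * T.
  by apply: mulr_ge0; [exact: addr_ge0|exact: ltW].
have <- : K * payoff_sup a y0 = K * (1 - expR y0).
  have y0a : y0 <= - (2 * a).
    apply: le_trans far; rewrite -addrA lerDl; exact: addr_ge0.
  by have [-> _] := payoff_sup_low a_gt0 y0a.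
have cv := payoff_expectation_cvg hX hc T_gt0 st tau_bd r_gt0 K_ge0 Kx (delta := delta).
apply: (cvgr_to_le cv).
have hn n : 0 < T / n.+1%:R by rewrite divr_gt0.
have h120 : 0 < Num.min h1 h2 by rewrite lt_min h10.
have small : \forall n \near \oo, T / n.+1%:R <= Num.min h1 h2.
  have : (fun n => T * n.+1%:R^-1) @ \oo --> (0 : R).
    by rewrite -(mulr0 T); apply: cvgMr; exact: cvg_harmonic.
  move/cvgrPdist_le => /(_ _ h120); apply: filterS => n.
  by rewrite sub0r normrN ger0_norm// ltW.
apply: filterS small => n; rewrite le_min => /andP[s1 s2].
set h := T / n.+1%:R in s1 s2 *.
have h0 : 0 < h by exact: hn.
have hT : h * n.+1%:R = T by rewrite /h divfK// pnatr_eq0.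
have hT1 : h <= T by rewrite /h ler_pdivrMr// ler_peMr ?(ltW T_gt0)// ler1n.
have tau0 w : 0 <= tau w by case/andP: (tau_bd w).
have Fb y : b <= y -> 5^-1 <= F y.
  move=> yb; apply: hit_ge => //; rewrite -[leLHS]Ab ler_wpM2l ?(ltW A_gt0)//.
  by rewrite ler_expR ler_wpM2l.
have F0 : F 0 = 0.
  by rewrite /F mulr0 /hit /exp3 glue_neg// mulr0 oppr0 expR0 subrr.
have hh1 : 0 < h <= h1 by rewrite h0.
have hh2 : 0 < h <= h2 by rewrite h0.
have qe0 : 0 <= qb + e1 by rewrite addr_ge0 ?ltW.
have cross := @crossing_prob _ _ _ P X hX hc tau st tau0 h v b n.+2 h0 _ _ _ _ (qb + e1) Q 5^-1 lF
  (fun y => (andP (hit_01 A_gt0 (beta * y))).1) Fb F0 qe0 (fun y => stepF h y hh1).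
have c0 : 0 <= carry / 2 by rewrite divr_ge0// ltW.
have G0 y : 0 <= payoff_sup a y by have /andP[] := payoff_sup_01 a_gt0 y.
have D0 : 0 <= payoff_rate a.
  have k0 : 0 <= kappa nu a0 a^-1.
    by apply: Rintegral_ge0 => z _; rewrite mulr_ge0 ?exp2_ge0// indicE ler0n.
  have m0 : 0 < (Num.min 1 (a0 ^+ 2))^-1 by rewrite invr_gt0 min1_sqr_gt0.
  have sl : 0 <= payoff_sup_slack a0.
    rewrite /payoff_sup_slack addr_ge0// addr_ge0 ?(ltW m0)// mulr_ge0 ?expR_ge0//.
    by rewrite addr_ge0// sqr_ge0.
  apply: addr_ge0 => //; apply: addr_ge0; last exact: mulr_ge0.
  by apply: mulr_ge0 => //; rewrite mulr_ge0// ltW.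
have qv0 : 0 <= r - delta + v by exact: addr_ge0.
apply: (@grid_payoff_le_sup _ _ _ P X hX hc tau T st tau_bd h v b n h0 hT r delta K y0 a (carry / 2)
  (payoff_rate a) 5^-1 (qb + e1) r_gt0 K_ge0 c0 D0 qv0 far _ _ _ _ lG G0
  (payoff_sup_ge a_gt0) (fun y => stepG h y hh2) _ cross) => //.
have Th : T + h <= 2 * T by have -> : 2 * T = T + T by [ring]; rewrite lerD2l.
have qe : qb + e1 <= 2 * qb by have -> : 2 * qb = qb + qb by [ring]; rewrite lerD2l.
have Th0 : 0 <= T + h by rewrite addr_ge0// ltW.
apply: le_trans (le_trans dom _).
  apply: ler_pM => //; first exact: mulr_ge0.
  exact: ler_wpM2l.
apply: ler_wpM2l; first by rewrite invr_ge0.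
by apply: ler_wpM2l => //; rewrite ler_expR !mulNr lerN2; apply: ler_wpM2l => //; exact: ltW.
Qed.

End StoppedPayoffBound.

Section UpperParameters.
Context {R : realType}.

(** With l = |ln h| these say that powers of the logarithm below 1 are negligible against l, and
    that l and constants are negligible against powers of h. *)
Lemma log_dominates (p z M : R) : 0 < p -> p < 1 -> 0 < z -> 0 < M ->
  exists2 L, 1 <= L & forall l : R, L <= l ->
  [/\ M * l `^ p <= l, M * l * expR (- (z * l)) <= 1 & M <= expR (p * l)].
Proof.
move=> p0 p1 z0 M0; have q0 : 0 < 1 - p by lra.
have M1 : 0 < M^-1 by rewrite invr_gt0.
have [u0 u01 hu] := @powR_small R (1 - p) M^-1 q0 M1.
have z2 : 0 < z ^+ 2 by rewrite exprn_gt0.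
have t0 : 0 <= 2 * M / z ^+ 2 by rewrite divr_ge0 ?mulr_ge0// ltW.
have t1 : 0 <= M / p by rewrite divr_ge0// ltW.
exists (u0 + 2 * M / z ^+ 2 + M / p); first lra.
move=> l lL; have l1 : 1 <= l by lra.
have l0 : 0 < l by lra.
split.
- have h := hu l _; have {}h : l `^ (- (1 - p)) <= M^-1 by apply: h; lra.
  have -> : l `^ p = l * l `^ (- (1 - p)) by rewrite powR_mul_base//; congr (_ `^ _); ring.
  have := ler_wpM2l (ltW (mulr_gt0 M0 l0)) h.
  have -> : M * l * M^-1 = l by field; rewrite gt_eqF.
  by rewrite mulrA.
- rewrite expRN ler_pdivrMr ?expR_gt0// mul1r.
  have zl : 0 <= z * l by rewrite mulr_ge0// ltW.
  have := @expR_ge1Dxn R (z * l) 1 zl; rewrite (_ : 2`! = 2)// => h.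
  have : 2 * M / z ^+ 2 <= l by lra.
  rewrite ler_pdivrMr// => h2; have := ler_wpM2r (ltW l0) h2.
  have -> : l * z ^+ 2 * l = (z * l) ^+ 2 by ring.
  lra.
- have h := expR_ge1Dx (p * l).
  have : M / p <= l by lra.
  by rewrite ler_pdivrMr//; lra.
Qed.

Lemma common_bound (s : seq R) : exists2 M, 0 < M & all (fun x => x <= M) s.
Proof.
elim: s => [|x s [M M0 IH]]; first by exists 1.
exists (Num.max x M); first by rewrite lt_max M0 orbT.
rewrite /= le_max lexx/=; apply: sub_all IH => y yM.
by rewrite le_max yM orbT.
Qed.

End UpperParameters.

(** * Choice of the parameters for a short horizon *)

Section StoppedPayoffLog.
Context {R : realType} {d : measure_display} {Omega : measurableType d}.
Variable P : probability Omega R.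
Variable X : R -> Omega -> R.
Variable nu : {measure set R -> \bar R}.
Hypothesis hX : levy_process P X.
Hypothesis hc : measure_is_complete P.
Hypothesis hchar : levy_char P X nu.
Hypothesis hW : summ nu (@jump_weight R).
Variables (a0 r delta K : R).
Hypotheses (a0_lt0 : a0 < 0) (r_gt0 : 0 < r) (delta_ge0 : 0 <= delta) (K_ge0 : 0 <= K).
Hypothesis carry_gt0 : 0 < carry nu r delta.
Hypothesis q_ge0 : 0 <= r - delta.
Variables (alpha c : R).
Hypotheses (alpha_gt1 : 1 < alpha) (c_gt0 : 0 < c).
Hypothesis kappa_upper : forall e, 0 < e < 1 -> exists2 u0, 1 <= u0 &
  forall u, u0 <= u -> kappa nu a0 u <= (1 + e) * c * u `^ alpha.

Let J := jump_mass nu.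
Let m1 := (Num.min 1 (a0 ^+ 2))^-1.
Let lam := front_const alpha c.
Let p := alpha^-1.

(** In the variable l = - ln h every power of the horizon is an exponential of a multiple of l, so
    the required inequalities become comparisons of exponents, with a margin proportional to [e]. *)
Lemma stopped_payoff_le_log e : 0 < e < 1 -> exists2 L, 1 <= L & forall l, L <= l ->
  forall tau, stopping_time P X tau -> (forall w, 0 <= tau w <= expR (- l)) ->
  forall y0, y0 <= - ((1 + e) * lam * (expR (- (p * l)) * l `^ (1 - p))) ->
  \int[P]_w put_payoff X r delta K (K * expR y0) tau w <= K * (1 - expR y0).
Proof.
have arith_b (l bv x y w e' : R) : 0 <= l -> bv = (1 + e') * l - x - y - (p + w) * l ->
  x <= e' / 8 * l -> y <= e' / 8 * l -> w <= e' / 8 -> 0 <= e' -> (1 - p + e' / 2) * l <= bv.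
  move=> l0 -> h1 h2 h3 h4; have := ler_wpM2r l0 h3; have := mulr_ge0 h4 l0; lra.
have arith_z (w f : R) : 0 < w -> w <= 1 -> 0 < f -> exists2 z : R, 0 < z &
    [/\ 2 * z <= w, 2 * z <= f / 2, z <= w, z <= 1 & z <= f / 2].
  move=> w0 w1 f0; exists (Num.min (w / 2) (f / 4)); first by rewrite lt_min !divr_gt0.
  have h1 : Num.min (w / 2) (f / 4) <= w / 2 by rewrite ge_min lexx.
  have h2 : Num.min (w / 2) (f / 4) <= f / 4 by rewrite ge_min lexx orbT.
  by split; lra.
have arith_e (x y w : R) : 4 * x * y <= 1 -> 1 + - x * (2 * y) <= w -> 2^-1 <= w by lra.
have arith_w (w z : R) : 2 * z <= w -> 0 <= e -> - (w + e / 2) + z <= - z by lra.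
have arith_k (k1 k2 D e' : R) : k1 <= (1 + e' / 2) * D -> k2 <= e' / 2 * D -> k1 + k2 <= (1 + e') * D by lra.
move=> /andP[e0 e1].
have al0 : 0 < alpha by move: (alpha_gt1); lra.
have p0 : 0 < p by rewrite invr_gt0.
have p1 : p < 1 by rewrite invf_lt1.
have lam0 : 0 < lam by rewrite powR_gt0// mulr_gt0.
have lamE : lam `^ alpha = alpha * c.
  by rewrite /lam /front_const -powRrM mulVf ?gt_eqF// powRr1// mulr_ge0 ?ltW.
have J0 : 0 <= J := @jump_mass_ge0 R nu.
have m10 : 0 < m1 by rewrite invr_gt0 min1_sqr_gt0.
have E10 : 0 < expR 1 :> R := expR_gt0 _.
pose e' := e / 16.
have e'0 : 0 < e' by rewrite divr_gt0.
have e'1 : e' < 1 by rewrite /e'; lra.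
have half01 : 0 < (2^-1 : R) < 1 by apply/andP; split; lra.
have e'2 : 0 < e' / 2 < 1 by apply/andP; split; lra.
have [ua ua1 ha] := kappa_upper half01.
have [ub ub1 hb] := kappa_upper e'2.
set q := r - delta.
pose kJ := payoff_sup_slack a0 * J.
have c40 : 0 < 40 * c + 1 by apply: addr_gt0 => //; exact: mulr_gt0.
(* Fixed by the last inequality: the payoff rate (40 c + 1), the doubled horizon and the doubled hit
   rate 2 * 3 eps multiply to 12 (40 c + 1) eps, which must equal carry / 20. *)
pose eps := carry nu r delta / 20 / 12 / (40 * c + 1).
have eps0 : 0 < eps by apply: divr_gt0 c40; apply: divr_gt0; [exact: divr_gt0|].
have J10 : 0 < J + 1 := ltr_wpDl J0 ltr01.
pose ks := (J + 1) / (eps * lam).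
have ks0 : 0 < ks by rewrite divr_gt0// mulr_gt0.
pose C' := 3 + 9 / (2 * e').
have C'0 : 0 < C' by rewrite addr_gt0// divr_gt0// mulr_gt0.
(* [z] is a spare exponent: e^(z l) is a small negative power of the horizon, and the margin it
   leaves absorbs both [expR (beta * s)] and factors of [l]. *)
have [z z0 [zp ze zp' zl ze2]] : exists2 z, 0 < z & [/\ 2 * z <= 1 - p, 2 * z <= e / 2, z <= 1 - p, z <= 1 & z <= e / 2].
  by apply: arith_z => //; [rewrite subr_gt0|rewrite gerBl ltW].
have [M M0 /= /and5P[M38 Mlam Mq Mks /and5P[Mk MJ MC MkJ /and4P[Mr Mua Mub _]]]] := common_bound
  [:: 38; 16 / (e * lam); 8 * q / (e * lam); ks / z; (m1 + expR 1) * J / (lam * (e' / 2 * p));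
      J / (lam * eps); p * C' / eps; kJ + q; 4 * r; ua; lam * ub].
have [L L1 hL] := log_dominates p0 p1 z0 M0.
exists L => // l lL tau st tau_bd y0 hy0.
have [hg hE hM] := hL l lL.
have l1 : 1 <= l by exact: le_trans lL.
have lp : 0 < l := lt_le_trans ltr01 l1.
have l0 := ltW lp.
have expE (x y : R) : x <= y -> expR (x * l) <= expR (y * l) by move=> xy; rewrite ler_expR ler_wpM2r.
set E := expR (- (z * l)) in hE.
pose Ez := expR (z * l).
pose g := l `^ p.
have g1 : 1 <= g by have := @ler_powR R l l1 0 p (ltW p0); rewrite powRr0.
have g0 : 0 < g := lt_le_trans ltr01 g1.
have gl : g <= l.
  by have := ler1_powR l1 (ltW p1).
pose u := expR (- (p * l)); pose iu := expR (p * l); pose th := expR (- l); pose ith := expR l.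
have u0 : 0 < u := expR_gt0 _.
have iu0 : 0 < iu := expR_gt0 _.
have th0 : 0 < th := expR_gt0 _.
have ith0 : 0 < ith := expR_gt0 _.
have EE : 0 < E := expR_gt0 _.
have Ez0 : 0 < Ez := expR_gt0 _.
have uiu : u * iu = 1 by rewrite /u /iu -expRD addNr expR0.
have thith : th * ith = 1 by rewrite /th /ith -expRD addNr expR0.
have uinv : u^-1 = iu by rewrite /u expRN invrK.
have u1 : u <= 1 by rewrite /u -[leRHS]expR0 ler_expR oppr_le0 mulr_ge0// ltW.
(* [th] is the horizon, [u = th `^ p] the scale of small moves, and [beta] solves
   [c * beta `^ alpha = l / (alpha * th)]. *)
pose beta := g * iu / lam.
have beta0 : 0 < beta by rewrite divr_gt0// mulr_gt0.
pose D := p * l * ith.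
have D0 : 0 < D by rewrite !mulr_gt0.
pose v := (1 + 2 * e') * D / beta.
have e'20 : 0 < 1 + 2 * e' by apply: addr_gt0 => //; exact: mulr_gt0.
have v0 : 0 < v by apply: divr_gt0 beta0; exact: mulr_gt0.
(* What is left of the distance from [y0] up to - 2 u after the drift and the moving barrier have
   used (q + v) th; [A] then makes the barrier the level where [A * expR (beta * b) = 1]. *)
pose b := (1 + e) * lam * (u * l `^ (1 - p)) - 2 * u - (q + v) * th.
pose A := expR (- (beta * b)).
(* Long enough that upward jumps beyond [s] contribute at most [eps * iu] to the hit rate, yet
   [beta * s] is only of order l^(1/alpha). *)
pose s := (J + 1) / eps * u.
have s0 : 0 < s by rewrite mulr_gt0// divr_gt0.
have betau : beta * u = g / lam.
  by rewrite /beta mulrAC -[g * iu * u]mulrA [iu * u]mulrC uiu mulr1.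
have gpow : g `^ alpha = l by rewrite /g -powRrM mulVf ?gt_eqF// powRr1.
have iupow : iu `^ alpha = ith.
  by rewrite /iu -expRM /ith; congr expR; rewrite mulrAC mulVf ?gt_eqF// mul1r.
have betapow : c * beta `^ alpha = D.
  rewrite /beta powRM ?mulr_ge0 ?invr_ge0 ?(ltW g0) ?(ltW iu0) ?(ltW lam0)//.
  rewrite powRM ?(ltW g0) ?(ltW iu0)// gpow iupow -powR_inv1 ?(ltW lam0)//.
  rewrite powRAC lamE powR_inv1 ?mulr_ge0 ?(ltW al0) ?(ltW c_gt0)// /D /p.
  by field; rewrite !gt_eqF.
(* In units of 1 / beta the distance is (1 + e) l. The rise v th of the barrier takes (p + 2 e' p) l
   and the other terms are o(l). Hence [A] is at most the horizon to the power 1 - 1/alpha + e /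
   2. *)
have bb : (1 - p + e / 2) * l <= beta * b.
  apply: (arith_b _ _ (2 * (g / lam)) (q * (beta * th)) (2 * e' * p)) => //.
  - rewrite -betau.
    have bv : beta * v * th = (p + 2 * e' * p) * l.
      rewrite /v; have -> : beta * ((1 + 2 * e') * D / beta) = (1 + 2 * e') * D by field; rewrite gt_eqF.
      have -> : (1 + 2 * e') * D * th = (p + 2 * e' * p) * l * (th * ith) by rewrite /D; ring.
      by rewrite thith mulr1.
    have bl : beta * (lam * (u * l `^ (1 - p))) = l.
      have -> : beta * (lam * (u * l `^ (1 - p))) = (beta * u) * lam * l `^ (1 - p) by ring.
      rewrite betau divfK ?gt_eqF// /g -powRD ?(gt_eqF lp) ?implybT//.
      by rewrite addrC subrK powRr1.
    have -> : beta * b = (1 + e) * (beta * (lam * (u * l `^ (1 - p)))) - 2 * (beta * u)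
       - q * (beta * th) - beta * v * th by rewrite /b; ring.
    by rewrite bl bv.
  - have : 16 / (e * lam) * g <= M * g by rewrite ler_wpM2r// ltW.
    move/le_trans => /(_ _ hg); have -> : 16 / (e * lam) * g = 2 * (g / lam) / (e / 8).
      by field; rewrite !gt_eqF.
    by rewrite ler_pdivrMr ?divr_gt0// [e / 8 * l]mulrC.
  - have : 8 * q / (e * lam) * g <= M * g by rewrite ler_wpM2r// ltW.
    move/le_trans => /(_ _ hg); have -> : 8 * q / (e * lam) * g = q * (g / lam) / (e / 8).
      by field; rewrite !gt_eqF.
    rewrite ler_pdivrMr ?divr_gt0// [e / 8 * l]mulrC; apply: le_trans.
    rewrite ler_wpM2l// -betau ler_wpM2l ?(ltW beta0)// /u /th -mulN1r -mulNr.
    by apply: expE; rewrite lerN2 ltW.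
  - have -> : e / 8 = 2 * e' by rewrite /e'; field.
    by apply: ler_piMr (ltW p1); rewrite mulr_ge0// ltW.
  - exact: ltW.
have [wpos wpos'] : 0 < 1 - p + e / 2 /\ 0 < M * l by split; [apply: addr_gt0; rewrite ?subr_gt0// divr_gt0|exact: mulr_gt0].
have b0 : 0 <= b.
  by rewrite -(pmulr_rge0 _ beta0); apply: le_trans bb; rewrite mulr_ge0// ltW.
have AW : A <= expR (- (1 - p + e / 2) * l) by rewrite /A ler_expR mulNr lerN2.
have A0 : 0 < A := expR_gt0 _.
have AE : A <= E.
  apply: le_trans AW _; rewrite /E -mulNr; apply: expE; rewrite lerN2.
  by apply: le_trans (ler_wpDr _ zp'); rewrite ?divr_ge0// ltW.
have El : E <= l * E by rewrite ler_peMl// ltW.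
(* Each entry in the list defining [M] is the constant of one later estimate; most of these
   estimates have the shape x w <= 1 with w at most l e^(-z l). *)
have le1 (x w : R) : x <= M -> 0 <= w -> w <= l * E -> x * w <= 1.
  move=> xM w0 wl; apply: le_trans hE; rewrite -mulrA.
  by apply: le_trans (ler_wpM2r w0 xM) _; rewrite ler_wpM2l// ltW.
have A38 : 38 * A <= 1 by apply: le1 => //; [exact: ltW|exact: le_trans El].
have ubb : ub <= beta.
  rewrite /beta ler_pdivlMr// mulrC; apply: le_trans Mub (le_trans hM _).
  by rewrite ler_peMl// ltW.
have beta1 : 1 <= beta := le_trans ub1 ubb.
have bsE : beta * s = ks * g.
  have -> : beta * s = (J + 1) / eps * (beta * u) by rewrite /s; ring.
  by rewrite betau /ks; field; rewrite !gt_eqF.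
have bsz : expR (beta * s) <= Ez.
  rewrite ler_expR bsE; have : ks / z * g <= l.
    by apply: le_trans hg; rewrite ler_wpM2r// ltW.
  by rewrite mulrAC ler_pdivrMr// [l * z]mulrC.
have AEz : A * Ez <= E.
  apply: le_trans (_ : expR (- (1 - p + e / 2) * l) * Ez <= _); first by rewrite ler_wpM2r// ltW.
  by rewrite /Ez -expRD -mulrDl /E -mulNr; apply: expE; apply: arith_w => //; exact: ltW.
have Aith : A * ith * u <= E.
  apply: le_trans (_ : expR (- (1 - p + e / 2) * l) * ith * u <= _).
    by apply: ler_wpM2r (ltW u0) _ _ _; exact: ler_wpM2r (ltW ith0) _ _ AW.
  rewrite /ith /u -!expRD /E ler_expR.
  have -> : - (1 - p + e / 2) * l + l + - (p * l) = - (e / 2) * l by ring.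
  by rewrite -[leRHS]mulNr ler_wpM2r// lerN2.
have thiu : th * iu <= E.
  rewrite /th /iu -expRD /E ler_expR.
  have -> : - l + p * l = - (1 - p) * l by ring.
  by rewrite -[leRHS]mulNr ler_wpM2r// lerN2.
have thE : th <= E.
  by rewrite /th /E ler_expR lerN2 ler_piMl.
have term1 : s^-1 * J <= eps * iu.
  have -> : s^-1 * J = eps * iu * (J / (J + 1)).
    by rewrite /s -uinv; field; rewrite !gt_eqF.
  have iu_eps : 0 <= eps * iu by apply: ltW; exact: mulr_gt0.
  by apply: ler_piMr => //; rewrite ler_pdivrMr// mul1r lerDl.
have term2 : A * (beta * expR (beta * s)) * J <= eps * iu.
  apply: le_trans (_ : A * (beta * Ez) * J <= _).
    by rewrite ler_wpM2r// ler_wpM2l ?(ltW A0)// ler_wpM2l// ltW.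
  have h : J / (lam * eps) * (A * Ez * g) <= 1.
    apply: le1 => //; first by rewrite !mulr_ge0 ?(ltW A0) ?(ltW Ez0) ?(ltW g0).
    by rewrite [l * E]mulrC; apply: ler_pM => //; rewrite ?mulr_ge0 ?(ltW A0) ?(ltW Ez0) ?(ltW g0).
  have -> : A * (beta * Ez) * J = J / (lam * eps) * (A * Ez * g) * (eps * iu).
    by rewrite /beta; field; rewrite !gt_eqF.
  by apply: ler_piMl => //; apply: ltW; exact: mulr_gt0.
have term3 : A * D * C' <= eps * iu.
  have h : p * C' / eps * (A * ith * u * l) <= 1.
    apply: le1 => //; first by rewrite !mulr_ge0 ?ltW.
    by rewrite mulrC ler_wpM2l.
  have -> : A * D * C' = p * C' / eps * (A * ith * u * l) * (eps * iu).
    have -> : p * C' / eps * (A * ith * u * l) * (eps * iu) = A * D * C' * (u * iu).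
      by rewrite /D; field; rewrite gt_eqF.
    by rewrite uiu mulr1.
  by apply: ler_piMl => //; apply: ltW; exact: mulr_gt0.
have hit3 : hit_rate nu A beta s e' D <= 3 * (eps * iu).
  rewrite /hit_rate -/J -/C'; apply: le_trans (lerD (lerD term1 term2) term3) _.
  by rewrite le_eqVlt; apply/orP; left; apply/eqP; ring.
have kD : kappa nu a0 beta + (beta * m1 + expR 1 * (beta * expR (beta * s))) * J <= (1 + e') * D.
  apply: arith_k.
    by rewrite -betapow mulrA; exact: hb.
  have Ez1 : 1 <= Ez by rewrite /Ez -[leLHS]expR0 ler_expR mulr_ge0// ltW.
  apply: le_trans (_ : beta * ((m1 + expR 1) * Ez) * J <= _).
    apply: ler_wpM2r => //.
    have -> : beta * m1 + expR 1 * (beta * expR (beta * s)) = beta * (m1 + expR 1 * expR (beta * s)) by ring.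
    rewrite ler_wpM2l ?(ltW beta0)// mulrDl lerD//; first by rewrite ler_peMr// ltW.
    by rewrite ler_wpM2l// ltW.
  have ithE : iu * Ez * th <= E.
    rewrite /iu /Ez /th /E -!expRD ler_expR.
    rewrite -subr_ge0; have -> : - (z * l) - (p * l + z * l + - l) = (1 - p) * l - 2 * z * l by ring.
    by rewrite subr_ge0 ler_wpM2r.
  have h : (m1 + expR 1) * J / (lam * (e' / 2 * p)) * (g * (iu * Ez * th)) <= 1.
    apply: le1 => //; first by rewrite !mulr_ge0 ?ltW.
    by apply: ler_pM; rewrite // ?mulr_ge0 ?ltW.
  have -> : beta * ((m1 + expR 1) * Ez) * J =
    (m1 + expR 1) * J / (lam * (e' / 2 * p)) * (g * (iu * Ez * th)) * (e' / 2 * p * ith).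
    have -> : (m1 + expR 1) * J / (lam * (e' / 2 * p)) * (g * (iu * Ez * th)) * (e' / 2 * p * ith) =
      beta * ((m1 + expR 1) * Ez) * J * (th * ith).
      by rewrite /beta; field; rewrite !gt_eqF.
    by rewrite thith mulr1.
  have k0 : 0 <= e' / 2 * p * ith by rewrite !mulr_ge0 ?ltW.
  apply: le_trans (ler_piMl k0 h) _.
  have -> : e' / 2 * D = e' / 2 * p * ith * l by rewrite /D; ring.
  exact: ler_peMr.
have rate : payoff_rate nu a0 r delta u <= (40 * c + 1) * (u * ith).
  have k1 : kappa nu a0 u^-1 <= (1 + 2^-1) * c * ith.
    by rewrite uinv -iupow; apply: ha; exact: le_trans Mua hM.
  have h : (kJ + q) * (th * iu) <= 1.
    by apply: le1 => //; [rewrite mulr_ge0 ?ltW|exact: le_trans El].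
  have h2 : kJ + q <= u * ith.
    have -> : kJ + q = (kJ + q) * (th * iu) * (u * ith).
      have -> : (kJ + q) * (th * iu) * (u * ith) = (kJ + q) * (u * iu) * (th * ith) by ring.
      by rewrite uiu thith !mulr1.
    by apply: ler_piMl => //; apply: ltW; exact: mulr_gt0.
  have -> : payoff_rate nu a0 r delta u = 20 * u * kappa nu a0 u^-1 + (kJ + q) by rewrite addrA.
  rewrite [leRHS]mulrDl mul1r; apply: lerD h2.
  have u20 : 0 <= 20 * u by rewrite mulr_ge0// ltW.
  apply: le_trans (ler_wpM2l u20 k1) _.
  have -> : 20 * u * ((1 + 2^-1) * c * ith) = 30 * (c * (u * ith)) by field.
  have -> : 40 * c * (u * ith) = 40 * (c * (u * ith)) by ring.
  by apply: ler_wpM2r; [rewrite !mulr_ge0 ?ltW|rewrite ler_nat].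
have E2 : 2^-1 <= expR (- r * (2 * th)).
  have h : 4 * r * th <= 1 by apply: le1 => //; [exact: ltW|exact: le_trans El].
  exact: arith_e h (expR_ge1Dx _).
apply: (@stopped_payoff_le _ _ _ P X nu hX hc hchar hW a0 r delta K a0_lt0 r_gt0 delta_ge0 K_ge0
  carry_gt0 q_ge0 tau th th0 st tau_bd u A beta b v s e' D y0) => //.
- by rewrite /A -expRD addNr expR0.
- exact: ltW.
- by rewrite e'0/= ltW.
- by rewrite /v divfK ?gt_eqF.
- have -> : - (2 * u) = - ((1 + e) * lam * (u * l `^ (1 - p))) + b + (q + v) * th by rewrite /b; ring.
  by rewrite lerD2r lerD2r.
apply: le_trans (_ : (40 * c + 1) * (u * ith) * (2 * th) * (2 * (3 * (eps * iu))) <= _).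
  have hr0 : 0 <= 2 * hit_rate nu A beta s e' D.
    rewrite mulr_ge0// /hit_rate -/J; apply: addr_ge0; last by rewrite !mulr_ge0 ?ltW.
    by apply: addr_ge0; rewrite !mulr_ge0 ?invr_ge0 ?expR_ge0// ltW.
  have th2 : 0 <= 2 * th by rewrite mulr_ge0// ltW.
  apply: le_trans (_ : (40 * c + 1) * (u * ith) * (2 * th) * (2 * hit_rate nu A beta s e' D) <= _).
    by apply: ler_wpM2r => //; exact: ler_wpM2r.
  have c0 : 0 <= (40 * c + 1) * (u * ith) * (2 * th) by rewrite !mulr_ge0 ?ltW.
  by apply: ler_wpM2l => //; exact: ler_wpM2l.
have -> : (40 * c + 1) * (u * ith) * (2 * th) * (2 * (3 * (eps * iu))) =
  carry nu r delta / 20 * (u * iu) * (th * ith) by rewrite /eps; field; rewrite gt_eqF.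
rewrite uiu thith !mulr1.
have -> : carry nu r delta / 20 = 5^-1 * (carry nu r delta / 2 * 2^-1) by field.
by rewrite ler_wpM2l// ler_wpM2l// divr_ge0// ltW.
Qed.

End StoppedPayoffLog.

(** * Critical price *)

Section FrontAsymptotics.
Context {R : realType}.
Variable alpha : R.
Hypothesis alpha_gt1 : 1 < alpha.

Lemma near_log (L : R) : \forall h \near (0 : R)^'+, 0 < h /\ L <= - ln h.
Proof.
have n2 : \forall h \near (0 : R)^'+, h <= expR (- L) by exact: nbhs_right_le (expR_gt0 _).
have n3 : \forall h \near (0 : R)^'+, (0 : R) < h by exact: nbhs_right_gt.
apply: filterS (filterI n2 n3) => h [hL h0]; split => //.
by rewrite lerNr -[leRHS]expRK ler_ln ?posrE ?expR_gt0.
Qed.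

Lemma front_log (h : R) : 0 < h -> 0 <= - ln h ->
  front alpha h = expR (- (alpha^-1 * - ln h)) * (- ln h) `^ (1 - alpha^-1).
Proof.
move=> h0 l0; rewrite /front; congr (_ * _ `^ _).
  by rewrite -{1}[h]lnK ?posrE// -expRM; congr expR; ring.
by rewrite ler0_norm// -oppr_ge0.
Qed.

Lemma front_small (e : R) : 0 < e -> \forall h \near (0 : R)^'+, 0 < front alpha h <= e.
Proof.
move=> e0; have al0 : 0 < alpha := lt_trans ltr01 alpha_gt1.
have p0 : 0 < alpha^-1 by rewrite invr_gt0.
have p1 : alpha^-1 < 1 by rewrite invf_lt1.
have ei : 0 < e^-1 by rewrite invr_gt0.
have [L L1 hL] := log_dominates p0 p1 p0 ei.
apply: filterS (near_log L) => h [h0 Lh].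
have l1 : 1 <= - ln h := le_trans L1 Lh; have lp : 0 < - ln h := lt_le_trans ltr01 l1.
rewrite front_log ?(ltW lp)//; apply/andP; split.
  by rewrite mulr_gt0 ?expR_gt0// powR_gt0.
have [_ h2 _] := hL _ Lh; set l := - ln h in l1 lp h2 *.
have : l `^ (1 - alpha^-1) <= l by apply: ler1_powR => //; rewrite gerBl ltW.
have E0 := expR_gt0 (- (alpha^-1 * l)).
move=> /(ler_wpM2l (ltW E0)) h3; apply: le_trans h3 _.
by move: h2; rewrite -mulrA mulrC ler_pdivrMr// mul1r mulrC.
Qed.

Lemma near_left_shift (T : R) (Q : R -> Prop) :
  (\forall h \near (0 : R)^'+, Q h) -> \forall t \near T^'-, Q (T - t).
Proof.
move=> [e /= e0 hQ]; exists e => // t /= te tT; apply: hQ; last by rewrite subr_gt0.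
by rewrite /= sub0r normrN.
Qed.

(** Returns from log-prices to prices: near 0, 1 - e^(-x) is x up to a relative error [e]. *)
Lemma one_sub_exp_ge (x e : R) : 0 <= x -> x <= e -> (1 - e) * x <= 1 - expR (- x).
Proof.
move=> x0 xe; have h := expR_ge1Dx x.
have h2 : expR (- x) <= (1 + x)^-1.
  by rewrite expRN lef_pV2 ?posrE ?expR_gt0//; lra.
have h3 : (1 + x)^-1 <= 1 - (1 - x) * x.
  rewrite -[leLHS]mul1r ler_pdivrMr; last lra.
  have : 0 <= x * (x * x) by rewrite !mulr_ge0.
  lra.
have : 0 <= (e - x) * x by rewrite mulr_ge0// subr_ge0.
lra.
Qed.

End FrontAsymptotics.

Section LowerBound.
Context {R : realType} {d : measure_display} {Omega : measurableType d}.
Variable P : probability Omega R.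
Variable X : R -> Omega -> R.
Variables (r delta K : R).

Lemma american_put_le (T t x B : R) : t < T ->
  (forall tau, stopping_time P X tau -> (forall w, 0 <= tau w <= T - t) ->
    \int[P]_w put_payoff X r delta K x tau w <= B) ->
  american_put P X r delta K T t x <= B.
Proof.
move=> tT hB; apply: ge_sup; last by move=> _ [tau [st bd ->]]; exact: hB.
exists (\int[P]_w put_payoff X r delta K x (fun=> 0) w); exists (fun=> 0); split => //.
- exact: stopping_time_cst.
- by move=> _; rewrite lexx/= subr_ge0 ltW.
Qed.

End LowerBound.

Section CriticalPrice.
Context {R : realType} {d : measure_display} {Omega : measurableType d}.
Variable P : probability Omega R.
Variable X : R -> Omega -> R.
Variable nu : {measure set R -> \bar R}.
Hypothesis hX : levy_process P X.
Hypothesis hc : measure_is_complete P.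
Hypothesis hchar : levy_char P X nu.
Hypothesis hW : summ nu (@jump_weight R).
Variables (a0 r delta K : R).
Hypotheses (a0_lt0 : a0 < 0) (r_gt0 : 0 < r) (delta_ge0 : 0 <= delta) (K_gt0 : 0 < K).
Hypothesis carry_gt0 : 0 < carry nu r delta.
Variables (alpha c : R).
Hypotheses (alpha_gt1 : 1 < alpha) (alpha_lt2 : alpha < 2) (c_gt0 : 0 < c).
Hypothesis kappa_equiv : forall e, 0 < e < 1 -> exists2 u0, 1 <= u0 &
  forall u, u0 <= u -> (1 - e) * c * u `^ alpha <= kappa nu a0 u <= (1 + e) * c * u `^ alpha.

Let rd_gt0 : 0 < r - delta.
Proof.
apply: lt_le_trans carry_gt0 _; rewrite /carry gerBl.
by apply: Rintegral_ge0 => z _; rewrite le_max lexx orbT.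
Qed.

Let large : forall e, 0 < e < 1 -> exists2 q, 0 < q &
  \forall t \near 0^'+, ((q * t `^ ((1 - e) * (1 - alpha^-1)))%:E <=
    P [set w | ((1 - e) ^+ 2 * front_const alpha c * front alpha t <= X t w)%R])%E.
Proof.
apply: (large_move_lower hX alpha_gt1 alpha_lt2 c_gt0).
exact: (small_time_tail hX hc hchar hW a0_lt0 alpha_gt1 alpha_lt2 c_gt0 kappa_equiv).
Qed.

(** At any smaller price no stopping time beats immediate exercise, so such a price cannot belong to
    the set whose infimum is the critical price. *)
Lemma critical_price_lower e : 0 < e < 1 -> \forall h \near 0^'+, forall T t, T - t = h ->
  K * expR (- ((1 + e) * front_const alpha c * front alpha h)) <=
  critical_price P X r delta K T t.
Proof.
move=> e01.
have kup e' : 0 < e' < 1 -> exists2 u0, 1 <= u0 & forall u, u0 <= u -> kappa nu a0 u <= (1 + e') * c * u `^ alpha.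
  by move=> /kappa_equiv [u0 u1 hu]; exists u0 => // u /hu /andP[].
have [L L1 hL] := stopped_payoff_le_log hX hc hchar hW a0_lt0 r_gt0 delta_ge0 (ltW K_gt0)
  carry_gt0 (ltW rd_gt0) alpha_gt1 c_gt0 kup e01.
have half01 : 0 < (2^-1 : R) < 1 by apply/andP; split; lra.
have cont := continuation_point hX hc hchar hW r_gt0 delta_ge0 rd_gt0 K_gt0 alpha_gt1 c_gt0 large half01.
apply: filterS (filterI cont (near_log L)) => h [hcont [h0 Lh]] T t Tt.
have tT : t < T by rewrite -subr_gt0 Tt.
(* A lower bound of a set bounds its infimum only if the set is nonempty; the continuation point
   from the European bound is the witness. *)
apply: lb_le_inf; first by eexists; exact: hcont Tt.
move=> x [x0 hx]; rewrite leNgt; apply/negP => xs; move: hx; apply/negP; rewrite -leNgt.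
have st0 : 0 <= - ln h := le_trans ler01 (le_trans L1 Lh).
have hE : expR (- - ln h) = h by rewrite opprK lnK.
(* The price 0 has no log-price; there the payoff bound [K] is enough. *)
have [x00|xp] := eqVneq x 0.
  rewrite x00 subr0 max_l ?(ltW K_gt0)//; apply: (american_put_le tT) => tau st bd.
  have T0 : 0 < T - t by rewrite subr_gt0.
  by apply: (payoff_expectation_le hX hc T0 st bd) => //; exact: ltW.
have {}xp : 0 < x by rewrite lt_neqAle eq_sym xp.
have xE : x = K * expR (ln (x / K)) by rewrite lnK ?posrE ?divr_gt0// mulrC divfK// gt_eqF.
apply: le_trans (_ : K - x <= _); last by rewrite le_max lexx.
apply: (american_put_le tT) => tau st bd.
have -> : K - x = K * (1 - expR (ln (x / K))) by rewrite {1}xE; ring.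
rewrite {1}xE; apply: (hL _ Lh tau st); first by move=> w; rewrite hE -Tt; exact: bd.
rewrite -(front_log _ h0 st0) -[leRHS]expRK ler_ln ?posrE ?expR_gt0 ?divr_gt0//.
by rewrite ler_pdivrMr// mulrC ltW.
Qed.

Lemma critical_price_equiv (T : R) :
  (K - critical_price P X r delta K T t) / front alpha (T - t) @[t --> T^'-] -->
  K * front_const alpha c.
Proof.
have arith1 (B e cp V lo up : R) : 0 <= B -> 0 < e -> e < 1 -> 0 < V ->
    cp <= K - K * lo -> K - K * up <= cp -> B * (1 - e) ^+ 4 * V <= K * lo -> K * up <= B * (1 + e) * V ->
    `|B - (K - cp) / V| <= 4 * e * B.
  move=> B0 e0 e1 V0 h1 h2 h3 h4.
  have q1 : (K - cp) / V <= B * (1 + e) by rewrite ler_pdivrMr//; lra.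
  have q2 : B * (1 - e) ^+ 4 <= (K - cp) / V by rewrite ler_pdivlMr//; lra.
  have q3 : 1 - 4 * e <= (1 - e) ^+ 4.
    have -> : (1 - e) ^+ 4 = 1 - 4 * e + e ^+ 2 * (2 * (1 - e) ^+ 2 + (1 - e ^+ 2) + 3) by ring.
    have : 0 <= e ^+ 2 * (2 * (1 - e) ^+ 2 + (1 - e ^+ 2) + 3).
      apply: mulr_ge0; first exact: sqr_ge0.
      have := sqr_ge0 (1 - e); have : e ^+ 2 <= 1 by apply: exprn_ile1; exact: ltW.
      lra.
    lra.
  have := ler_wpM2l B0 q3; have := mulr_ge0 B0 (ltW e0).
  by rewrite ler_norml => *; apply/andP; split; lra.
set lam := front_const alpha c.
have lam0 : 0 < lam by rewrite powR_gt0// mulr_gt0//; exact: lt_trans ltr01 alpha_gt1.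
have B0 : 0 < K * lam by exact: mulr_gt0.
apply/cvgrPdist_le => eps eps0.
(* The upper bound on the critical price loses (1 - e)^3, and passing from log-price to price one
   more factor 1 - e; by (1 - e)^4 >= 1 - 4 e the relative error is at most 4 e. *)
pose e := Num.min 2^-1 (eps / (4 * (K * lam))).
have B4 : 0 < 4 * (K * lam) by exact: mulr_gt0.
have e0 : 0 < e by rewrite lt_min invr_gt0 ltr0n/= divr_gt0.
have e1 : e < 1.
  apply: le_lt_trans (_ : 2^-1 < 1); first by rewrite ge_min lexx.
  by rewrite invf_lt1// ltr1n.
have e01 : 0 < e < 1 by rewrite e0.
have ee : 4 * e * (K * lam) <= eps.
  have : e <= eps / (4 * (K * lam)) by rewrite ge_min lexx orbT.
  by rewrite ler_pdivlMr//; congr (_ <= _); ring.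
have low := critical_price_lower e01.
have up := critical_price_upper hX hc hchar hW r_gt0 delta_ge0 rd_gt0 K_gt0 alpha_gt1 c_gt0 large e01.
have el : 0 < e / lam by exact: divr_gt0.
have sm := front_small alpha_gt1 el.
apply: filterS (near_left_shift T (filterI low (filterI up sm))) => t [lo [hi /andP[V0 Ve]]].
have {}lo := lo _ _ erefl; have {}hi := hi _ _ erefl.
set V := front alpha (T - t) in lo hi V0 Ve *.
set cp := critical_price P X r delta K T t in lo hi *.
apply: le_trans ee.
have lV : lam * V <= e by move: Ve; rewrite ler_pdivlMr// mulrC.
have lV0 : 0 < lam * V by exact: mulr_gt0.
pose xl := (1 - e) ^+ 3 * lam * V; pose xu := (1 + e) * lam * V.
have e1' : 0 <= 1 - e by rewrite subr_ge0 ltW.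
have xl0 : 0 <= xl.
  by rewrite /xl -mulrA mulr_ge0 ?exprn_ge0// ltW.
have xle : xl <= e.
  apply: le_trans lV; rewrite /xl -mulrA ler_piMl ?(ltW lV0)// exprn_ile1//.
  by rewrite gerBl ltW.
have el1 := one_sub_exp_ge xl0 xle.
have eu1 : 1 - expR (- xu) <= xu by have := expR_ge1Dx (- xu); rewrite -/xu; lra.
apply: (arith1 _ _ _ _ (1 - expR (- xl)) (1 - expR (- xu)) (ltW B0) e0 e1 V0).
- by rewrite mulrBr mulr1 subKr.
- by rewrite mulrBr mulr1 subKr.
- have -> : K * lam * (1 - e) ^+ 4 * V = K * ((1 - e) * xl) by rewrite /xl; ring.
  by rewrite ler_wpM2l// ltW.
- have -> : K * lam * (1 + e) * V = K * xu by rewrite /xu; ring.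
  by rewrite ler_wpM2l// ltW.
Qed.

End CriticalPrice.

Section Setup.
Context {R : realType}.
Variable nu : {measure set R -> \bar R}.

Lemma summ_ge0 (f : R -> R) : measurable_fun setT f -> (forall y, 0 <= f y) ->
  (\int[nu]_y (f y)%:E < +oo)%E -> summ nu f.
Proof.
move=> mf f0 fi; apply/integrableP; split; first exact/measurable_EFinP.
by under eq_integral do rewrite gee0_abs ?lee_fin//.
Qed.

Lemma summ_jump_weight (M : R) : levy_measure nu ->
  (\int[nu]_y (Num.max (expR y - 1) 0)%:E < M%:E)%E -> summ nu (@jump_weight R).
Proof.
move=> [_ h1] h2; apply: summD.
  apply: summ_ge0 h1; last by move=> y; rewrite le_min ler01 sqr_ge0.
  by apply: measurable_minr => //; exact: exprn_measurable.
apply: summ_ge0 (lt_trans h2 (ltry _)); last by move=> y; rewrite le_max lexx orbT.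
by apply: measurable_maxr => //; exact: measurable_funB.
Qed.

End Setup.

Theorem theorem7p1 (R : realType) (d : measure_display)
  (Omega : measurableType d) (P : probability Omega R)
  (X : R -> Omega -> R) (nu : {measure set R -> \bar R}) (eta : R -> R)
  (T K r delta a0 alpha eta0 : R) :
  0 < T -> 0 < K -> 0 < r -> 0 <= delta ->
  measure_is_complete P ->
  levy_process P X ->
  levy_measure nu ->
  levy_char P X nu ->
  (\int[nu]_y (Num.max (expR y - 1) 0)%:E < (r - delta)%:E)%E ->
  a0 < 0 -> 1 < alpha -> alpha < 2 ->
  measurable_fun `[a0, 0[%classic eta ->
  (forall y, a0 <= y -> y < 0 -> 0 < eta y) ->
  (exists M : R, forall y, a0 <= y -> y < 0 -> eta y <= M) ->
  eta y @[y --> 0^'-] --> eta0 ->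
  0 < eta0 ->
  (forall A : set R, measurable A -> A `<=` `]a0, 0[%classic ->
     (nu A = \int[lebesgue_measure]_(y in A) (eta y / `|y| `^ (1 + alpha))%:E)%E) ->
  (K - critical_price P X r delta K T t) /
    ((T - t) `^ alpha^-1 * `|ln (T - t)| `^ (1 - alpha^-1))
    @[t --> T^'-] -->
  K * (eta0 * Gamma (2 - alpha) / (alpha - 1)) `^ alpha^-1.
Proof.
move=> T0 K0 r0 delta0 hc hX hnu hchar Ip_lt a0_lt0 al1 al2 meta eta_pos _ eta_cvg eta00 dens.
(* The bound on upward jumps is used twice: its finiteness makes the jump weight integrable, and its
   strictness makes the carry positive. *)
have hW := summ_jump_weight hnu Ip_lt.
have carry_gt0 : 0 < carry nu r delta.
  rewrite /carry subr_gt0 -lte_fin EFin_Rint//; exact: summ_up_jump.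
have [c0 hk] := kappa_asymp hW a0_lt0 al1 meta eta_pos eta_cvg eta00 dens.
have -> : eta0 * Gamma (2 - alpha) / (alpha - 1) = alpha * kappa_const alpha eta0.
  by rewrite /kappa_const; field; rewrite subr_eq0 !gt_eqF//; exact: lt_trans al1.
exact: (critical_price_equiv hX hc hchar hW a0_lt0 r0 delta0 K0 carry_gt0 al1 al2 c0 hk).
Qed.
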